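(* Let $\alpha$ be a nowhere vanishing function of class $C^{2}$ on a rectangle $\Pi=\{|x|\le a_1,\ |y|\le a_2,\ z=0\}$ in $\mathbb R^3$ with cartesian coordinates $(x,y,z)$, and let $\gamma=\{|x|\le a_1,\ y=z=0\}$. Then there are $\Delta,K>0$ such that for all functions $\bar k_1,\bar k_2$ of class $C^1$ on $\gamma$ with $\|\bar k_i\|_\gamma<\Delta$ $(i=1,2)$ the following holds. For some $\varepsilon\in(0,a_2]$ there exists a function $f$ of class $C^3$ on $$\Pi_{K,\varepsilon}=\{|x|+Ky\le a_1,\ 0\le y\le\varepsilon,\ z=0\}$$ with the properties: (1) the principal curvatures $k_1,k_2$ of the graph $M^2:\ z=f(x,y)$ in $\mathbb R^3$ satisfy $k_i(x,0)=\bar k_i(x)$ $(i=1,2)$; (2) the vector field $\alpha\,\partial_x+\partial_y$ is tangent to the projections onto $\Pi_{K,\varepsilon}$ of the $k_1$-curvature lines of $M^2$; (3) $f(0,0)=0$ and $df(0,0)=0$. Moreover, there is $r>0$ such that the solution $f$ is unique in the class of $C^3$-regular functions on $\Pi_{K,\varepsilon}$ satisfying $\|(f,f_x,f_y)\|_{\Pi_{K,\varepsilon}}\le r$ (that is, $f$ is the only function in this class having properties (1)--(3)).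
   Context: For a bounded continuous vector-valued function $u$ on a set $D$, $\|u\|_D=\sup_{x\in D}\max_i|u_i(x)|$. The projection onto the $xy$-plane is the orthogonal one, $(x,y,z)\mapsto(x,y,0)$. Graphs $z=f(x,y)$ are oriented by the upward unit normal $n=(-f_x,-f_y,1)/\sqrt{1+f_x^2+f_y^2}$, with second fundamental form coefficients $f_{xx},f_{xy},f_{yy}$ divided by $\sqrt{1+f_x^2+f_y^2}$. The statement that $k_1,k_2$ are the principal curvatures and $l=\alpha\partial_x+\partial_y$ is tangent to the projections of the $k_1$-curvature lines means: at each point, the tangent vector of $M^2$ projecting to $l$ is an eigenvector of the shape operator with eigenvalue $k_1$, and $k_2$ is the other eigenvalue. $k_i(x,y)$ denotes the value of $k_i$ at the point $(x,y,f(x,y))$. *)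

(* Defs.v *)
From Stdlib Require Import Reals List ClassicalEpsilon.
From Coquelicot Require Import Coquelicot.
Import ListNotations.
Open Scope R_scope.

(* The plane z = 0 is identified with R * R, the segment y = z = 0 with a subset
   of R. *)

Definition rect (a1 a2 : R) (p : R * R) : Prop :=
  Rabs (fst p) <= a1 /\ Rabs (snd p) <= a2.

Definition segment (a1 : R) (x : R) : Prop := Rabs x <= a1.

Definition trapezoid (a1 K eps : R) (p : R * R) : Prop :=
  Rabs (fst p) + K * snd p <= a1 /\ 0 <= snd p <= eps.

(* Differentiability on a closed set D is differentiability relative to D: the
   first order expansion at p is only required along points of D.  The sets used
   here are convex with nonempty interior, so v is determined by f and p at every
   p of D, boundary points and corners included. *)

Definition is_grad (D : R * R -> Prop) (f : R * R -> R) (p v : R * R) : Prop :=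
  filterdiff f (within D (locally p))
    (fun h : R * R => fst h * fst v + snd h * snd v).

Definition grad (D : R * R -> Prop) (f : R * R -> R) (p : R * R) : R * R :=
  epsilon (inhabits (0, 0)) (is_grad D f p).

Definition Dx (D : R * R -> Prop) (f : R * R -> R) (p : R * R) : R :=
  fst (grad D f p).

Definition Dy (D : R * R -> Prop) (f : R * R -> R) (p : R * R) : R :=
  snd (grad D f p).

Fixpoint class_C (n : nat) (D : R * R -> Prop) (f : R * R -> R) : Prop :=
  match n with
  | O => continuous_on D f
  | S m => (forall p, D p -> exists v, is_grad D f p v)
           /\ class_C m D (Dx D f) /\ class_C m D (Dy D f)
  end.

Definition class_C1_1d (I : R -> Prop) (k : R -> R) : Prop :=
  exists k' : R -> R,
    (forall x, I x ->
       filterdiff k (within I (locally x)) (fun h : R => scal h (k' x)))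
    /\ continuous_on I k'.

(* Vector-valued functions are given by the list of their components. *)

Definition max_norm (v : list R) : R := fold_right Rmax 0 (map Rabs v).

Definition sup_norm {T : Type} (D : T -> Prop) (u : T -> list R) : Rbar :=
  Lub_Rbar (fun s => exists x, D x /\ s = max_norm (u x)).

(* Tangent vectors of the graph z = f(x,y) are represented by their projections
   to the xy-plane: (v1, v2) stands for v1 (1, 0, f_x) + v2 (0, 1, f_y). *)

Definition first_form (D : R * R -> Prop) (f : R * R -> R) (p u v : R * R) : R :=
  (1 + Dx D f p ^ 2) * fst u * fst v
  + Dx D f p * Dy D f p * (fst u * snd v + snd u * fst v)
  + (1 + Dy D f p ^ 2) * snd u * snd v.

(* With respect to the upward unit normal. *)

Definition second_form (D : R * R -> Prop) (f : R * R -> R) (p u v : R * R) : R :=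
  (Dx D (Dx D f) p * fst u * fst v
   + Dy D (Dx D f) p * (fst u * snd v + snd u * fst v)
   + Dy D (Dy D f) p * snd u * snd v)
  / sqrt (1 + Dx D f p ^ 2 + Dy D f p ^ 2).

(* The inverse of the Gram matrix of the first form times the matrix of the
   second form. *)

Definition shape_operator (D : R * R -> Prop) (f : R * R -> R) (p u : R * R)
  : R * R :=
  let e1 := (1, 0) in
  let e2 := (0, 1) in
  let E := first_form D f p e1 e1 in
  let F := first_form D f p e1 e2 in
  let G := first_form D f p e2 e2 in
  let L := second_form D f p e1 u in
  let N := second_form D f p e2 u in
  ((G * L - F * N) / (E * G - F ^ 2), (E * N - F * L) / (E * G - F ^ 2)).

Definition char_poly2 (A : R * R -> R * R) (t : R) : R :=
  (t - fst (A (1, 0))) * (t - snd (A (0, 1)))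
  - fst (A (0, 1)) * snd (A (1, 0)).

(* k1 and k2 are the two eigenvalues of A, counted with multiplicity. *)

Definition eigenvalues2 (A : R * R -> R * R) (k1 k2 : R) : Prop :=
  forall t, char_poly2 A t = (t - k1) * (t - k2).

Definition eigenvector2 (A : R * R -> R * R) (k : R) (l : R * R) : Prop :=
  l <> (0, 0) /\ A l = (k * fst l, k * snd l).

(* The labelling of the principal curvatures k1, k2 is the one fixed by the
   direction field alpha d/dx + d/dy, so they are quantified jointly over the
   first two properties. *)

Definition is_solution (a1 : R) (alpha : R * R -> R) (kb1 kb2 : R -> R)
    (D : R * R -> Prop) (f : R * R -> R) : Prop :=
  (exists k1 k2 : R * R -> R,
     (forall p, D p -> eigenvalues2 (shape_operator D f p) (k1 p) (k2 p))
     /\ (forall x, segment a1 x -> k1 (x, 0) = kb1 x /\ k2 (x, 0) = kb2 x)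
     /\ (forall p, D p ->
           eigenvector2 (shape_operator D f p) (k1 p) (alpha p, 1)))
  /\ f (0, 0) = 0 /\ grad D f (0, 0) = (0, 0).

Definition jet1 (D : R * R -> Prop) (f : R * R -> R) (p : R * R) : list R :=
  [f p; Dx D f p; Dy D f p].

(* Main.v *)
(* A graph z = f(x, y) has the curvature direction (alpha, 1) iff this direction is
   orthogonal, for both fundamental forms, to (beta, 1), where
   beta = - (p q alpha + 1 + q^2) / ((1 + p^2) alpha + p q), p = f_x, q = f_y. This is the
   quasilinear equation alpha beta f_xx + (alpha + beta) f_xy + f_yy = 0, hyperbolic for small
   p and q since alpha and beta then have opposite signs; call them l > 0 > m. Prescribing
   k_1 and k_2 on y = 0 gives f_xx and f_xy there as functions of (x, p, q), small with the
   data, hence an ordinary differential equation for the Cauchy data, solvable on the whole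
   segment once Delta is small.

   In characteristic coordinates (u, v) with u = v = x on the initial line the equation reads
   x_u = l y_u, x_v = m y_v, q_u = - m p_u, q_v = - l p_v. Cross differentiation yields
   y_uv and p_uv, so that x, y, p, q, f, y_u, y_v, p_u, p_v satisfy integral equations along
   the two coordinate directions, without loss of derivatives, solved by contraction near the
   diagonal. The derivatives of the solution are found from the linearized integral system,
   and (u, v) -> (x, y) is inverted on the trapezoid, which makes f_xx, f_xy, f_yy of class C^1.

   For uniqueness, the differences of p, q, l f_xx + f_xy and m f_xx + f_xy for two solutions
   have derivatives along the characteristic directions bounded by the differences themselves;
   they vanish on y = 0, and the backward characteristics stay in the trapezoid. *)

From Stdlib Require Import Reals Lra Lia List FunctionalExtensionality ClassicalEpsilon.
From Coquelicot Require Import Coquelicot.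
Require Import Defs.
Import ListNotations.
Open Scope R_scope.

(** The regularity budget is exact: [alpha] is C^2, the curvatures on the segment are C^1, and f
    must be C^3. The first partials of l and m are therefore only C^1, and nothing may be
    differentiated twice. With y_u, y_v, p_u, p_v among the unknowns, all right-hand sides are C^1
    functions of the unknowns and all data are C^1, so C^1 regularity of the abstract integral
    system is enough: the second derivatives of f are rational in C^1 functions of (u, v). The price
    is that x, y, p, q, f are integrated along u only; that x_v = m y_v, q_v = - l p_v and f_v = p
    x_v + q y_v has to be proved afterwards. All domains are closed and have corners, so expansions
    hold relative to the domain with uniform moduli, and the coordinates are inverted by a
    contraction that respects the boundary. Gronwall's inequality is replaced by repeated halving of
    a bound. Order of the constants: [rho] bounds p and q and fixes the signs of l and m; [Delta]
    and [K] depend on [alpha] and the rectangle alone; [eps] depends on the data too; the radius of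
    uniqueness is [rho]. *)

(** * Elementary estimates *)

Lemma le_of_le_eps (a b : R) : (forall e, 0 < e -> a <= b + e) -> a <= b.
Proof.
  intros H. destruct (Rle_dec a b) as [h|h]; [easy|].
  specialize (H ((a - b) / 2)). lra.
Qed.

Lemma Rabs_eq_0_of_eps (a : R) : (forall e, 0 < e -> Rabs a <= e) -> a = 0.
Proof.
  intros H. assert (Rabs a <= 0).
  { apply le_of_le_eps. intros e he. specialize (H e he). lra. }
  pose proof (Rabs_pos a). assert (h : Rabs a = 0) by lra.
  now apply Rabs_eq_0 in h.
Qed.

(** Iterating b -> e + b / 2 from any finite a priori bound [b0] gives 2 e + |b0| / 2^n. This stands
    in for Gronwall's inequality wherever the length of integration times the Lipschitz constant is
    at most 1 / 2. *)
Lemma bound_of_halving (I : Type) (P : I -> Prop) (f : I -> R) (e b0 : R) :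
  0 <= e ->
  (forall i, P i -> Rabs (f i) <= b0) ->
  (forall b, 0 <= b -> (forall i, P i -> Rabs (f i) <= b) ->
     forall i, P i -> Rabs (f i) <= e + b / 2) ->
  forall i, P i -> Rabs (f i) <= 2 * e.
Proof.
  intros he H0 H.
  assert (Hn : forall n i, P i -> Rabs (f i) <= 2 * e + Rabs b0 / 2 ^ n).
  { induction n as [|n IH]; intros i hi.
    - simpl. specialize (H0 i hi). pose proof (Rle_abs b0). lra.
    - assert (hp : 0 < 2 ^ n) by (apply pow_lt; lra).
      apply Rle_trans with (e + (2 * e + Rabs b0 / 2 ^ n) / 2).
      + apply H; auto. pose proof (Rabs_pos b0).
        assert (0 <= Rabs b0 / 2 ^ n) by (apply Rdiv_le_0_compat; lra). lra.
      + simpl. right. field. lra. }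
  intros i hi. apply le_of_le_eps. intros d hd.
  destruct (pow_lt_1_zero (1/2)) with (y := d / (Rabs b0 + 1)) as [N HN].
  { rewrite Rabs_pos_eq; lra. }
  { pose proof (Rabs_pos b0). apply Rdiv_lt_0_compat; lra. }
  specialize (Hn N i hi). specialize (HN N (le_n N)).
  pose proof (Rabs_pos b0).
  assert (hp : 0 < 2 ^ N) by (apply pow_lt; lra).
  assert (hq : (1/2)^N = / 2 ^ N).
  { unfold Rdiv. rewrite Rmult_1_l. now rewrite pow_inv. }
  rewrite hq, Rabs_pos_eq in HN; [|left; now apply Rinv_0_lt_compat].
  assert (Rabs b0 / 2 ^ N <= d).
  { apply Rmult_lt_compat_r with (r := Rabs b0 + 1) in HN; [|lra].
    replace (d / (Rabs b0 + 1) * (Rabs b0 + 1)) with d in HN by (field; lra).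
    assert (0 < / 2 ^ N) by now apply Rinv_0_lt_compat.
    unfold Rdiv. nra. }
  lra.
Qed.

Lemma zero_of_halving (I : Type) (P : I -> Prop) (f : I -> R) (b0 : R) :
  (forall i, P i -> Rabs (f i) <= b0) ->
  (forall b, 0 <= b -> (forall i, P i -> Rabs (f i) <= b) ->
     forall i, P i -> Rabs (f i) <= b / 2) ->
  forall i, P i -> f i = 0.
Proof.
  intros H0 H i hi.
  assert (Rabs (f i) <= 2 * 0).
  { apply (bound_of_halving I P f 0 b0); auto; try lra.
    intros b hb hB j hj. specialize (H b hb hB j hj). lra. }
  apply Rabs_eq_0_of_eps. intros; lra.
Qed.

(** A mean value inequality in which no derivative occurs: at each point a local Lipschitz estimate
    with constant B + e is enough, and it is needed only within [c, d]. This suits functions that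
    are differentiable relative to a closed set. *)
Lemma increment_bound (f : R -> R) (c d B : R) :
  c <= d ->
  (forall t, c <= t <= d -> forall e, 0 < e -> exists r, 0 < r /\
     forall s, c <= s <= d -> Rabs (s - t) <= r ->
       Rabs (f s - f t) <= (B + e) * Rabs (s - t)) ->
  Rabs (f d - f c) <= B * (d - c).
Proof.
  intros hcd H.
  cut (forall e, 0 < e -> Rabs (f d - f c) <= (B + e) * (d - c)).
  { intros K. apply le_of_le_eps. intros e he.
    specialize (K (e / (d - c + 1))).
    assert (0 < e / (d - c + 1)) by (apply Rdiv_lt_0_compat; lra).
    specialize (K H0).
    assert (e / (d - c + 1) * (d - c + 1) = e) by (field; lra). nra. }
  intros e he.
  (* The supremum m of [E] belongs to [E] by the local estimate to the left of m, and m < d is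
     excluded by the one to its right. *)
  set (E := fun t => c <= t <= d /\ Rabs (f t - f c) <= (B + e) * (t - c)).
  assert (Ec : E c).
  { split; [lra|]. rewrite Rminus_diag, Rabs_R0. lra. }
  destruct (completeness E) as [m [Hub Hlub]].
  { exists d. intros t [h _]. lra. }
  { now exists c. }
  assert (hcm : c <= m) by now apply Hub.
  assert (hmd : m <= d). { apply Hlub. intros t [h _]. lra. }
  destruct (H m (conj hcm hmd) e he) as [r [hr Hr]].
  assert (Em : E m).
  { split; [lra|].
    destruct (Rle_dec (Rabs (f m - f c)) ((B + e) * (m - c))) as [|hn]; [easy|].
    exfalso.
    assert (hex : exists t, E t /\ m - r < t).
    { apply Classical_Prop.NNPP. intros hno. assert (m <= m - r); [|lra].
      apply Hlub. intros t ht. apply Rnot_lt_le. intros hlt. apply hno.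
      now exists t. }
    destruct hex as [t [[ht1 ht2] ht3]].
    assert (htm : t <= m) by (apply Hub; split; auto).
    specialize (Hr t ht1). rewrite Rabs_left1 in Hr by lra.
    specialize (Hr ltac:(lra)).
    apply hn.
    replace (f m - f c) with ((f t - f c) - (f t - f m)) by ring.
    eapply Rle_trans; [apply Rabs_triang|]. rewrite Rabs_Ropp. nra. }
  destruct (Req_dec m d) as [->|hne]; [apply Em|].
  exfalso.
  set (s := Rmin d (m + r)).
  assert (hs : m < s <= d /\ s <= m + r).
  { unfold s. split; [split|].
    - apply Rmin_glb_lt; lra.
    - apply Rmin_l.
    - apply Rmin_r. }
  specialize (Hr s ltac:(lra)). rewrite Rabs_pos_eq in Hr by lra.
  specialize (Hr ltac:(lra)).
  assert (s <= m); [|lra].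
  apply Hub. split; [lra|].
  replace (f s - f c) with ((f s - f m) + (f m - f c)) by ring.
  eapply Rle_trans; [apply Rabs_triang|]. destruct Em as [_ Em]. nra.
Qed.

(** * The contraction principle *)

(** A bound on the sup norm instead of the norm itself, so that functions on an arbitrary index
    type, possibly at infinite distance, need no special treatment. *)
Definition nb {I : Type} (h : I -> R) (b : R) : Prop :=
  0 <= b /\ forall j, Rabs (h j) <= b.

Definition dlt {I : Type} (X Y : I -> R) : I -> R := fun j => Y j - X j.

(** The contraction factor is fixed at 1 / 2. The distance between two points of [C] may be
    infinite, so one finite bound [b0] on the first step is required, and [C] is closed only under
    uniform limits. *)
Lemma banach_fixed_point (J : Type) (C : (J -> R) -> Prop)
    (Phi : (J -> R) -> J -> R) (X0 : J -> R) (b0 : R) :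
  (forall X, C X -> C (Phi X)) ->
  (forall (Xn : nat -> J -> R) X, (forall n, C (Xn n)) ->
     (forall e, 0 < e -> exists n, forall j, Rabs (X j - Xn n j) <= e) -> C X) ->
  (forall X Y b, C X -> C Y -> nb (dlt X Y) b -> nb (dlt (Phi X) (Phi Y)) (b / 2)) ->
  C X0 -> nb (dlt X0 (Phi X0)) b0 ->
  exists X, C X /\ forall j, Phi X j = X j.
Proof.
  intros Cinv Ccl Hc C0 Hb0.
  set (Xn := fun n => Nat.iter n Phi X0).
  assert (CX : forall n, C (Xn n)).
  { induction n; simpl; auto. }
  assert (Hstep : forall n, nb (dlt (Xn n) (Xn (S n))) (b0 / 2 ^ n)).
  { induction n as [|n IH].
    - simpl. unfold Rdiv. rewrite Rinv_1, Rmult_1_r. exact Hb0.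
    - apply Hc in IH; auto.
      replace (b0 / 2 ^ S n) with (b0 / 2 ^ n / 2); [exact IH|].
      simpl. field. apply pow_nonzero. lra. }
  assert (hb0 : 0 <= b0) by apply Hb0.
  assert (hpow : forall n, 0 < 2 ^ n) by (intros; apply pow_lt; lra).
  assert (hbn : forall n, 0 <= b0 / 2 ^ n).
  { intros n. apply Rdiv_le_0_compat; auto. }
  (* The geometric sum is kept with its exact tail, so that the induction on k closes. *)
  assert (Hdist : forall n k j, Rabs (Xn (n + k)%nat j - Xn n j)
      <= 2 * (b0 / 2 ^ n) - 2 * (b0 / 2 ^ (n + k))).
  { intros n k j. induction k as [|k IH].
    - rewrite Nat.add_0_r, Rminus_diag, Rabs_R0. lra.
    - rewrite Nat.add_succ_r.
      destruct (Hstep (n + k)%nat) as [_ hs]. specialize (hs j). unfold dlt in hs.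
      replace (Xn (S (n + k)) j - Xn n j)
        with ((Xn (S (n + k)) j - Xn (n + k)%nat j) + (Xn (n + k)%nat j - Xn n j))
        by ring.
      eapply Rle_trans; [apply Rabs_triang|].
      replace (b0 / 2 ^ S (n + k)) with (b0 / 2 ^ (n + k) / 2).
      2:{ simpl. field. apply pow_nonzero. lra. }
      lra. }
  assert (Hsmall : forall e, 0 < e -> exists n, 2 * (b0 / 2 ^ n) <= e).
  { intros e he.
    destruct (pow_lt_1_zero (1/2)) with (y := e / (2 * b0 + 1)) as [N HN].
    { rewrite Rabs_pos_eq; lra. }
    { apply Rdiv_lt_0_compat; lra. }
    exists N. specialize (HN N (le_n N)).
    assert (hq : (1/2)^N = / 2 ^ N).
    { unfold Rdiv. rewrite Rmult_1_l. now rewrite pow_inv. }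
    assert (hi : 0 < / 2 ^ N) by now apply Rinv_0_lt_compat.
    rewrite hq, Rabs_pos_eq in HN by lra.
    apply Rmult_lt_compat_r with (r := 2 * b0 + 1) in HN; [|lra].
    replace (e / (2 * b0 + 1) * (2 * b0 + 1)) with e in HN by (field; lra).
    unfold Rdiv. nra. }
  set (X := fun j => real (Lim_seq (fun n => Xn n j))).
  assert (HX : forall j, is_lim_seq (fun n => Xn n j) (Finite (X j))).
  { intros j. apply Lim_seq_correct'.
    assert (hcau : ex_finite_lim_seq (fun n => Xn n j)).
    { apply ex_lim_seq_cauchy_corr. intros eps.
      destruct (Hsmall (eps / 4)) as [N HN].
      { destruct eps; simpl; lra. }
      exists N. intros n m hn hm.
      pose proof (Hdist N (n - N)%nat j) as h1.
      pose proof (Hdist N (m - N)%nat j) as h2.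
      replace (N + (n - N))%nat with n in h1 by lia.
      replace (N + (m - N))%nat with m in h2 by lia.
      pose proof (hbn n). pose proof (hbn m).
      replace (Xn n j - Xn m j) with ((Xn n j - Xn N j) - (Xn m j - Xn N j)) by ring.
      eapply Rle_lt_trans; [apply Rabs_triang|]. rewrite Rabs_Ropp.
      destruct eps as [eps heps]; simpl in *. lra. }
    exact hcau. }
  assert (HXn : forall n j, Rabs (X j - Xn n j) <= 2 * (b0 / 2 ^ n)).
  { intros n j.
    assert (hl : is_lim_seq (fun k => Rabs (Xn k j - Xn n j)) (Rabs (X j - Xn n j))).
    { apply (is_lim_seq_abs _ (Finite (X j - Xn n j))).
      apply is_lim_seq_minus'; auto. apply is_lim_seq_const. }
    assert (hle : Rbar_le (Rabs (X j - Xn n j)) (2 * (b0 / 2 ^ n))).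
    { eapply is_lim_seq_le_loc; [|exact hl|apply is_lim_seq_const].
      exists n. intros m hm. pose proof (Hdist n (m - n)%nat j) as h1.
      replace (n + (m - n))%nat with m in h1 by lia. pose proof (hbn m). lra. }
    exact hle. }
  assert (CXX : C X).
  { apply (Ccl Xn); auto. intros e he. destruct (Hsmall e he) as [n hn].
    exists n. intros j. specialize (HXn n j). lra. }
  exists X. split; auto. intros j.
  apply Rminus_diag_uniq, Rabs_eq_0_of_eps. intros e he.
  destruct (Hsmall (e / 2)) as [n hn]; [lra|].
  assert (h1 : nb (dlt (Xn n) X) (2 * (b0 / 2 ^ n))).
  { split; [pose proof (hbn n); lra|]. intros i. apply HXn. }
  apply Hc in h1; auto. destruct h1 as [_ h1]. specialize (h1 j). unfold dlt in h1.
  specialize (HXn (S n) j).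
  assert (b0 / 2 ^ S n <= b0 / 2 ^ n).
  { simpl. replace (b0 / (2 * 2 ^ n)) with (b0 / 2 ^ n / 2).
    - specialize (hbn n). lra.
    - field. apply pow_nonzero. lra. }
  change (Xn (S n) j) with (Phi (Xn n) j) in HXn.
  replace (Phi X j - X j) with ((Phi X j - Phi (Xn n) j) - (X j - Phi (Xn n) j)) by ring.
  eapply Rle_trans; [apply Rabs_triang|]. rewrite Rabs_Ropp.
  pose proof (hbn n). lra.
Qed.

(** * Uniformly C^1 functions *)

Definition lin {I : Type} (L : (I -> R) -> R) : Prop :=
  (forall h k, L (fun j => h j + k j) = L h + L k)
  /\ forall c h, L (fun j => c * h j) = c * L h.

(* Bounded C^1 functions with moduli uniform over O and over the index. This stands for C^1 on
   a compact set, and needs no topology on [I -> R]. *)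
Definition UC1f {K I : Type} (O : (I -> R) -> Prop)
    (F : K -> (I -> R) -> R) (G : K -> (I -> R) -> (I -> R) -> R) : Prop :=
  (exists M, 0 < M /\ forall i X, O X ->
     lin (G i X) /\ Rabs (F i X) <= M
     /\ forall h b, nb h b -> Rabs (G i X h) <= M * b)
  /\ forall e, 0 < e -> exists r, 0 < r /\ forall i X Y, O X -> O Y ->
     forall b, b <= r -> nb (dlt X Y) b ->
     Rabs (F i Y - F i X - G i X (dlt X Y)) <= e * b
     /\ forall h c, nb h c -> Rabs (G i Y h - G i X h) <= e * c.

Definition UC1 {I : Type} (O : (I -> R) -> Prop)
    (F : (I -> R) -> R) (G : (I -> R) -> (I -> R) -> R) : Prop :=
  UC1f O (fun _ : unit => F) (fun _ => G).

Definition C1on {I : Type} (O : (I -> R) -> Prop) (F : (I -> R) -> R) : Prop :=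
  exists G, UC1 O F G.

Lemma finite_upper (K : Type) (l : list K) (P : K -> R -> Prop) :
  (forall i, In i l) ->
  (forall i M M', M <= M' -> P i M -> P i M') ->
  (forall i, exists M, 0 < M /\ P i M) ->
  exists M, 0 < M /\ forall i, P i M.
Proof.
  intros Hl Hm H.
  assert (h : forall l', exists M, 0 < M /\ forall i, In i l' -> P i M).
  { induction l' as [|a l' [M [hM HM]]].
    - exists 1. split; [lra|]. intros i [].
    - destruct (H a) as [Ma [hMa HMa]]. exists (Rmax M Ma). split.
      + eapply Rlt_le_trans; [exact hM|apply Rmax_l].
      + intros i [<-|hi].
        * eapply Hm; [apply Rmax_r|auto].
        * eapply Hm; [apply Rmax_l|auto]. }
  destruct (h l) as [M [hM HM]]. exists M. auto.
Qed.

Lemma finite_lower (K : Type) (l : list K) (P : K -> R -> Prop) :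
  (forall i, In i l) ->
  (forall i M M', M' <= M -> P i M -> P i M') ->
  (forall i, exists M, 0 < M /\ P i M) ->
  exists M, 0 < M /\ forall i, P i M.
Proof.
  intros Hl Hm H.
  assert (h : forall l', exists M, 0 < M /\ forall i, In i l' -> P i M).
  { induction l' as [|a l' [M [hM HM]]].
    - exists 1. split; [lra|]. intros i [].
    - destruct (H a) as [Ma [hMa HMa]]. exists (Rmin M Ma). split.
      + apply Rmin_glb_lt; auto.
      + intros i [<-|hi].
        * eapply Hm; [apply Rmin_r|auto].
        * eapply Hm; [apply Rmin_l|auto]. }
  destruct (h l) as [M [hM HM]]. exists M. auto.
Qed.

Section calculus.
Context {I : Type}.
Variable O : (I -> R) -> Prop.

Lemma UC1_intro F (G : (I -> R) -> (I -> R) -> R) M :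
  (forall X, O X -> lin (G X)) ->
  (forall X, O X -> Rabs (F X) <= M) ->
  (forall X, O X -> forall h b, nb h b -> Rabs (G X h) <= M * b) ->
  (forall e, 0 < e -> exists r, 0 < r /\ forall X Y, O X -> O Y ->
     forall b, b <= r -> nb (dlt X Y) b ->
     Rabs (F Y - F X - G X (dlt X Y)) <= e * b
     /\ forall h c, nb h c -> Rabs (G Y h - G X h) <= e * c) ->
  UC1 O F G.
Proof.
  intros H1 H2 H3 H4. split.
  - exists (Rmax M 1). split; [eapply Rlt_le_trans; [|apply Rmax_r]; lra|].
    intros _ X hX. split; [auto|split].
    + eapply Rle_trans; [now apply H2|apply Rmax_l].
    + intros h b hb. eapply Rle_trans; [apply (H3 X hX h b hb)|].
      apply Rmult_le_compat_r; [apply hb|apply Rmax_l].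
  - intros e he. destruct (H4 e he) as [r [hr Hr]]. exists r. split; auto.
Qed.

Lemma UC1_bound F (G : (I -> R) -> (I -> R) -> R) : UC1 O F G ->
  exists M, 0 < M /\ forall X, O X -> lin (G X) /\ Rabs (F X) <= M
     /\ forall h b, nb h b -> Rabs (G X h) <= M * b.
Proof.
  intros [[M [hM HM]] _]. exists M. split; auto. intros X hX. exact (HM tt X hX).
Qed.

Lemma UC1_modulus F (G : (I -> R) -> (I -> R) -> R) : UC1 O F G ->
  forall e, 0 < e -> exists r, 0 < r /\ forall X Y, O X -> O Y ->
     forall b, b <= r -> nb (dlt X Y) b ->
     Rabs (F Y - F X - G X (dlt X Y)) <= e * b
     /\ forall h c, nb h c -> Rabs (G Y h - G X h) <= e * c.
Proof.
  intros [_ H] e he. destruct (H e he) as [r [hr Hr]]. exists r. split; auto.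
  intros X Y hX hY b. apply (Hr tt); auto.
Qed.

Lemma UC1_finite (K : Type) (l : list K) (F : K -> (I -> R) -> R) G :
  (forall i, In i l) -> (forall i, UC1 O (F i) (G i)) -> UC1f O F G.
Proof.
  intros Hl H. split.
  - destruct (finite_upper K l (fun i M => 0 < M /\ forall X, O X ->
      lin (G i X) /\ Rabs (F i X) <= M
      /\ forall h b, nb h b -> Rabs (G i X h) <= M * b)) as [M [hM HM]]; auto.
    + intros i M M' hMM [hM HM]. split; [lra|]. intros X hX.
      destruct (HM X hX) as [h1 [h2 h3]]. split; [auto|split; [lra|]].
      intros h b hb. specialize (h3 h b hb). destruct hb as [hb _]. nra.
    + intros i. destruct (UC1_bound _ _ (H i)) as [M [hM HM]]. exists M. auto.
    + exists M. split; auto. intros i X hX. apply HM; auto.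
  - intros e he.
    destruct (finite_lower K l (fun i r => forall X Y, O X -> O Y ->
      forall b, b <= r -> nb (dlt X Y) b ->
      Rabs (F i Y - F i X - G i X (dlt X Y)) <= e * b
      /\ forall h c, nb h c -> Rabs (G i Y h - G i X h) <= e * c)) as [r [hr Hr]]; auto.
    + intros i M M' hMM HM X Y hX hY b hb hn. apply HM; auto. lra.
    + intros i. exact (UC1_modulus _ _ (H i) e he).
    + exists r. auto.
Qed.

(** [O] need not be convex, so no segment joins X to Y. Close pairs are compared through the
    derivative; for pairs further apart than r the bound on F itself gives 2 M <= (2 M / r) b. *)
Lemma UC1f_lipschitz (K : Type) (F : K -> (I -> R) -> R) G : UC1f O F G ->
  exists L, 0 < L /\ forall i X Y, O X -> O Y -> forall b, nb (dlt X Y) b ->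
    Rabs (F i Y - F i X) <= L * b.
Proof.
  intros [[M [hM HM]] H]. destruct (H 1) as [r [hr Hr]]; [lra|].
  exists (M + 1 + 2 * M / r).
  assert (hq : 0 < 2 * M / r) by (apply Rdiv_lt_0_compat; lra).
  split; [lra|]. intros i X Y hX hY b hb.
  assert (b0 : 0 <= b) by apply hb.
  destruct (Rle_dec b r) as [h|h].
  - destruct (Hr i X Y hX hY b h hb) as [h1 _].
    destruct (HM i X hX) as [_ [_ h2]]. specialize (h2 _ _ hb).
    replace (F i Y - F i X)
      with ((F i Y - F i X - G i X (dlt X Y)) + G i X (dlt X Y)) by ring.
    eapply Rle_trans; [apply Rabs_triang|]. nra.
  - destruct (HM i X hX) as [_ [h1 _]]. destruct (HM i Y hY) as [_ [h2 _]].
    assert (Rabs (F i Y - F i X) <= 2 * M).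
    { unfold Rminus. eapply Rle_trans; [apply Rabs_triang|]. rewrite Rabs_Ropp. lra. }
    assert (2 * M / r * b >= 2 * M).
    { apply Rle_ge. apply Rle_trans with (2 * M / r * r); [right; field; lra|].
      apply Rmult_le_compat_l; lra. }
    nra.
Qed.

Lemma UC1_lipschitz F G : UC1 O F G ->
  exists L, 0 < L /\ forall X Y, O X -> O Y -> forall b, nb (dlt X Y) b ->
    Rabs (F Y - F X) <= L * b.
Proof.
  intros H. destruct (UC1f_lipschitz _ _ _ H) as [L [hL HL]].
  exists L. split; auto. intros X Y hX hY. exact (HL tt X Y hX hY).
Qed.

Lemma UC1_ext F G F' G' : UC1 O F G -> (forall X, O X -> F' X = F X) ->
  (forall X h, O X -> G' X h = G X h) -> UC1 O F' G'.
Proof.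
  intros H hF hG. destruct (UC1_bound _ _ H) as [M [hM HM]].
  apply (UC1_intro _ _ M).
  - intros X hX. destruct (HM X hX) as [[h1 h2] _]. split; intros; rewrite !hG; auto.
  - intros X hX. rewrite hF; auto. apply HM; auto.
  - intros X hX h b hb. rewrite hG; auto. apply HM; auto.
  - intros e he. destruct (UC1_modulus _ _ H e he) as [r [hr Hr]].
    exists r. split; auto. intros X Y hX hY b hb hn.
    destruct (Hr X Y hX hY b hb hn) as [h1 h2].
    split; intros; rewrite ?hF, ?hG; auto.
Qed.

Lemma UC1_const c : UC1 O (fun _ => c) (fun _ _ => 0).
Proof.
  apply (UC1_intro _ _ (Rabs c)).
  - intros X hX. split; intros; ring.
  - intros. lra.
  - intros X hX h b hb. rewrite Rabs_R0. destruct hb.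
    apply Rmult_le_pos; auto. apply Rabs_pos.
  - intros e he. exists 1. split; [lra|]. intros X Y hX hY b h1 hb. split.
    + rewrite !Rminus_0_r, Rminus_diag, Rabs_R0. destruct hb; nra.
    + intros h d hd. rewrite Rminus_diag, Rabs_R0. destruct hd. nra.
Qed.

Lemma UC1_coord i M : (forall X, O X -> Rabs (X i) <= M) ->
  UC1 O (fun X => X i) (fun _ h => h i).
Proof.
  intros HM. apply (UC1_intro _ _ (Rmax M 1)).
  - intros X hX. split; intros; ring.
  - intros. eapply Rle_trans; [now apply HM|apply Rmax_l].
  - intros X hX h b [hb1 hb2]. eapply Rle_trans; [apply hb2|].
    pose proof (Rmax_r M 1). nra.
  - intros e he. exists 1. split; [lra|]. intros X Y hX hY b h1 hb. split.
    + unfold dlt. rewrite Rminus_diag, Rabs_R0. destruct hb; nra.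
    + intros h d hd. rewrite Rminus_diag, Rabs_R0. destruct hd. nra.
Qed.

Lemma UC1_plus F1 G1 F2 G2 : UC1 O F1 G1 -> UC1 O F2 G2 ->
  UC1 O (fun X => F1 X + F2 X) (fun X h => G1 X h + G2 X h).
Proof.
  intros H1 H2.
  destruct (UC1_bound _ _ H1) as [M1 [hM1 HM1]].
  destruct (UC1_bound _ _ H2) as [M2 [hM2 HM2]].
  apply (UC1_intro _ _ (M1 + M2)).
  - intros X hX. destruct (HM1 X hX) as [[a1 a2] _]. destruct (HM2 X hX) as [[b1 b2] _].
    split; intros; rewrite ?a1, ?a2, ?b1, ?b2; ring.
  - intros X hX. eapply Rle_trans; [apply Rabs_triang|].
    destruct (HM1 X hX) as [_ [h1 _]]. destruct (HM2 X hX) as [_ [h2 _]]. lra.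
  - intros X hX h b hb. eapply Rle_trans; [apply Rabs_triang|].
    destruct (HM1 X hX) as [_ [_ h1]]. destruct (HM2 X hX) as [_ [_ h2]].
    specialize (h1 h b hb). specialize (h2 h b hb). lra.
  - intros e he.
    destruct (UC1_modulus _ _ H1 (e / 2)) as [r1 [hr1 Hr1]]; [lra|].
    destruct (UC1_modulus _ _ H2 (e / 2)) as [r2 [hr2 Hr2]]; [lra|].
    exists (Rmin r1 r2). split; [now apply Rmin_glb_lt|].
    intros X Y hX hY b hb hn.
    pose proof (Rmin_l r1 r2). pose proof (Rmin_r r1 r2).
    destruct (Hr1 X Y hX hY b ltac:(lra) hn) as [a1 a2].
    destruct (Hr2 X Y hX hY b ltac:(lra) hn) as [b1 b2]. split.
    + match goal with |- Rabs ?t <= _ => replace t with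
       ((F1 Y - F1 X - G1 X (dlt X Y)) + (F2 Y - F2 X - G2 X (dlt X Y))) by ring end.
      eapply Rle_trans; [apply Rabs_triang|]. lra.
    + intros h c hc. specialize (a2 h c hc). specialize (b2 h c hc).
      match goal with |- Rabs ?t <= _ => replace t with
       ((G1 Y h - G1 X h) + (G2 Y h - G2 X h)) by ring end.
      eapply Rle_trans; [apply Rabs_triang|]. lra.
Qed.

Lemma UC1_mult F1 G1 F2 G2 : UC1 O F1 G1 -> UC1 O F2 G2 ->
  UC1 O (fun X => F1 X * F2 X) (fun X h => F1 X * G2 X h + F2 X * G1 X h).
Proof.
  intros H1 H2.
  destruct (UC1_bound _ _ H1) as [M1 [hM1 HM1]].
  destruct (UC1_bound _ _ H2) as [M2 [hM2 HM2]].
  destruct (UC1_lipschitz _ _ H1) as [L1 [hL1 HL1]].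
  destruct (UC1_lipschitz _ _ H2) as [L2 [hL2 HL2]].
  assert (hprod : forall a b A B, Rabs a <= A -> Rabs b <= B -> Rabs (a * b) <= A * B).
  { intros. rewrite Rabs_mult. apply Rmult_le_compat; auto using Rabs_pos. }
  apply (UC1_intro _ _ (2 * (M1 * M2))).
  - intros X hX. destruct (HM1 X hX) as [[a1 a2] _]. destruct (HM2 X hX) as [[b1 b2] _].
    split; intros; rewrite ?a1, ?a2, ?b1, ?b2; ring.
  - intros X hX.
    destruct (HM1 X hX) as [_ [h1 _]]. destruct (HM2 X hX) as [_ [h2 _]].
    pose proof (hprod _ _ _ _ h1 h2). pose proof (Rmult_lt_0_compat _ _ hM1 hM2). lra.
  - intros X hX h b hb. eapply Rle_trans; [apply Rabs_triang|].
    destruct (HM1 X hX) as [_ [h1 h1']]. destruct (HM2 X hX) as [_ [h2 h2']].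
    pose proof (hprod _ _ _ _ h1 (h2' h b hb)).
    pose proof (hprod _ _ _ _ h2 (h1' h b hb)). lra.
  - intros e he.
    set (e1 := e / (4 * (M1 + M2 + 1))).
    assert (he1 : 0 < e1) by (apply Rdiv_lt_0_compat; lra).
    assert (hee : 4 * (M1 + M2 + 1) * e1 = e) by (unfold e1; field; lra).
    destruct (UC1_modulus _ _ H1 e1 he1) as [r1 [hr1 Hr1]].
    destruct (UC1_modulus _ _ H2 e1 he1) as [r2 [hr2 Hr2]].
    set (r3 := e1 / (L1 + L2)).
    assert (hr3 : 0 < r3) by (apply Rdiv_lt_0_compat; lra).
    exists (Rmin (Rmin r1 r2) r3). split; [repeat apply Rmin_glb_lt; auto|].
    intros X Y hX hY b hb hn.
    assert (hb1 : b <= r1 /\ b <= r2 /\ b <= r3).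
    { pose proof (Rmin_l (Rmin r1 r2) r3). pose proof (Rmin_r (Rmin r1 r2) r3).
      pose proof (Rmin_l r1 r2). pose proof (Rmin_r r1 r2). lra. }
    destruct hb1 as [hb1 [hb2 hb3]].
    assert (b0 : 0 <= b) by apply hn.
    assert (hLb : (L1 + L2) * b <= e1).
    { apply Rle_trans with ((L1 + L2) * r3); [apply Rmult_le_compat_l; lra|].
      unfold r3. right. field. lra. }
    destruct (Hr1 X Y hX hY b hb1 hn) as [a1 a2].
    destruct (Hr2 X Y hX hY b hb2 hn) as [b1 b2].
    pose proof (HL1 X Y hX hY b hn) as l1. pose proof (HL2 X Y hX hY b hn) as l2.
    destruct (HM1 X hX) as [_ [m1 m1']]. destruct (HM2 X hX) as [_ [m2 m2']].
    destruct (HM1 Y hY) as [_ [n1 n1']]. destruct (HM2 Y hY) as [_ [n2 n2']].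
    assert (l1' : Rabs (F1 Y - F1 X) <= e1) by nra.
    assert (l2' : Rabs (F2 Y - F2 X) <= e1) by nra.
    split.
    + match goal with |- Rabs ?t <= _ => replace t with
       ((F1 Y - F1 X - G1 X (dlt X Y)) * F2 Y + (F2 Y - F2 X) * G1 X (dlt X Y)
        + F1 X * (F2 Y - F2 X - G2 X (dlt X Y))) by ring end.
      pose proof (hprod _ _ _ _ a1 n2).
      pose proof (hprod _ _ _ _ l2' (m1' _ _ hn)).
      pose proof (hprod _ _ _ _ m1 b1).
      eapply Rle_trans; [apply Rabs_triang|].
      eapply Rle_trans; [apply Rplus_le_compat_r, Rabs_triang|].
      rewrite <- hee. pose proof (Rmult_le_pos _ _ (Rlt_le _ _ he1) b0). nra.
    + intros h c hc. specialize (a2 h c hc). specialize (b2 h c hc).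
      match goal with |- Rabs ?t <= _ => replace t with
       (F1 Y * (G2 Y h - G2 X h) + (F1 Y - F1 X) * G2 X h
        + (F2 Y * (G1 Y h - G1 X h) + (F2 Y - F2 X) * G1 X h)) by ring end.
      pose proof (hprod _ _ _ _ n1 b2). pose proof (hprod _ _ _ _ l1' (m2' _ _ hc)).
      pose proof (hprod _ _ _ _ n2 a2). pose proof (hprod _ _ _ _ l2' (m1' _ _ hc)).
      eapply Rle_trans; [apply Rabs_triang|].
      eapply Rle_trans; [apply Rplus_le_compat; apply Rabs_triang|].
      rewrite <- hee. destruct hc as [hc _].
      pose proof (Rmult_le_pos _ _ (Rlt_le _ _ he1) hc). nra.
Qed.

End calculus.

Lemma UC1f_subset {K I : Type} (O O' : (I -> R) -> Prop) (F : K -> (I -> R) -> R) G :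
  (forall X, O' X -> O X) -> UC1f O F G -> UC1f O' F G.
Proof.
  intros Hs [[M [hM HM]] H]. split.
  - exists M. split; auto.
  - intros e he. destruct (H e he) as [r [hr Hr]]. exists r. split; auto.
Qed.

(** The intermediate variables are indexed by a finite type, so that one bound and one modulus serve
    all inner functions at once. *)
Lemma UC1_comp {I J : Type} (l : list I) (OI : (I -> R) -> Prop) (OJ : (J -> R) -> Prop)
    (F : (I -> R) -> R) G (P : I -> (J -> R) -> R) DP :
  (forall i, In i l) -> UC1 OI F G -> (forall i, UC1 OJ (P i) (DP i)) ->
  (forall Y, OJ Y -> OI (fun i => P i Y)) ->
  UC1 OJ (fun Y => F (fun i => P i Y)) (fun Y h => G (fun i => P i Y) (fun i => DP i Y h)).
Proof.
  intros Hl HF HP0 Hmap.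
  pose proof (UC1_finite OJ I l P DP Hl HP0) as HP.
  destruct (UC1_bound _ _ _ HF) as [M [hM HM]].
  pose proof HP as [[N [hN HN]] HPm].
  destruct (UC1f_lipschitz _ _ _ _ HP) as [L [hL HL]].
  assert (hnb : forall Y h b, OJ Y -> nb h b -> nb (fun i => DP i Y h) (N * b)).
  { intros Y h b hY hb. split; [destruct hb; nra|]. intros i. apply HN; auto. }
  apply (UC1_intro _ _ _ (M + M * N)).
  - intros Y hY. destruct (HM _ (Hmap Y hY)) as [[h1 h2] _].
    assert (h3 : forall i, lin (DP i Y)) by (intros; apply HN; auto).
    split; intros.
    + rewrite <- h1. f_equal. apply functional_extensionality. intros i. apply h3.
    + rewrite <- h2. f_equal. apply functional_extensionality. intros i. apply h3.
  - intros Y hY. destruct (HM _ (Hmap Y hY)) as [_ [h1 _]].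
    pose proof (Rmult_lt_0_compat _ _ hM hN). lra.
  - intros Y hY h b hb. destruct (HM _ (Hmap Y hY)) as [_ [_ h1]].
    specialize (h1 _ _ (hnb Y h b hY hb)). destruct hb as [hb _]. nra.
  - intros e he.
    set (e1 := e / (2 * (M + N + L))).
    assert (he1 : 0 < e1) by (apply Rdiv_lt_0_compat; lra).
    assert (hee : 2 * (M + N + L) * e1 = e) by (unfold e1; field; lra).
    destruct (UC1_modulus _ _ _ HF e1 he1) as [r1 [hr1 Hr1]].
    destruct (HPm e1 he1) as [r2 [hr2 Hr2]].
    exists (Rmin r2 (r1 / L)). split.
    { apply Rmin_glb_lt; auto. now apply Rdiv_lt_0_compat. }
    intros X Y hX hY b hb hn.
    assert (hb1 : b <= r2 /\ b <= r1 / L).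
    { pose proof (Rmin_l r2 (r1 / L)). pose proof (Rmin_r r2 (r1 / L)). lra. }
    destruct hb1 as [hb1 hb2].
    assert (b0 : 0 <= b) by apply hn.
    assert (hLb : L * b <= r1).
    { apply Rle_trans with (L * (r1 / L)); [apply Rmult_le_compat_l; lra|].
      right. field. lra. }
    assert (hd : nb (dlt (fun i => P i X) (fun i => P i Y)) (L * b)).
    { split; [nra|]. intros i. apply HL; auto. }
    destruct (Hr1 _ _ (Hmap X hX) (Hmap Y hY) _ hLb hd) as [a1 a2].
    destruct (HM _ (Hmap X hX)) as [[lp lm] [_ m1]].
    split.
    + set (u := fun i => DP i X (dlt X Y)).
      set (w := fun i => P i Y - P i X - DP i X (dlt X Y)).
      assert (hw : nb w (e1 * b)).
      { split; [nra|]. intros i. apply (Hr2 i X Y hX hY b hb1 hn). }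
      assert (hs : G (fun i => P i X) (dlt (fun i => P i X) (fun i => P i Y))
                   = G (fun i => P i X) u + G (fun i => P i X) w).
      { rewrite <- lp. f_equal. apply functional_extensionality. intros i.
        unfold dlt, u, w, dlt. ring. }
      rewrite hs in a1. specialize (m1 _ _ hw).
      match goal with |- Rabs ?t <= _ => replace t with
       ((F (fun i => P i Y) - F (fun i => P i X)
          - (G (fun i => P i X) u + G (fun i => P i X) w))
        + G (fun i => P i X) w) by ring end.
      eapply Rle_trans; [apply Rabs_triang|]. rewrite <- hee.
      assert (0 <= N * (e1 * b)) by (apply Rmult_le_pos; nra).
      assert (0 <= e1 * b) by nra. nra.
    + intros h c hc.
      set (u := fun i => DP i X h). set (w := fun i => DP i Y h - DP i X h).
      assert (hw : nb w (e1 * c)).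
      { split; [destruct hc; nra|]. intros i. apply (Hr2 i X Y hX hY b hb1 hn). auto. }
      destruct (HM _ (Hmap Y hY)) as [[lpY lmY] [_ m1Y]].
      assert (hs : G (fun i => P i Y) (fun i => DP i Y h)
                   = G (fun i => P i Y) u + G (fun i => P i Y) w).
      { rewrite <- lpY. f_equal. apply functional_extensionality. intros i.
        unfold u, w. ring. }
      rewrite hs. fold u.
      specialize (m1Y _ _ hw).
      specialize (a2 u (N * c) (hnb X h c hX hc)).
      match goal with |- Rabs ?t <= _ => replace t with
       ((G (fun i => P i Y) u - G (fun i => P i X) u) + G (fun i => P i Y) w) by ring end.
      eapply Rle_trans; [apply Rabs_triang|]. rewrite <- hee.
      destruct hc as [hc _].
      assert (0 <= e1 * c) by nra. nra.
Qed.

(** A function of one real variable is a function on [unit -> R]; composition with it is then a case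
    of the general chain rule. *)
Definition D1 (S : R -> Prop) (phi dphi : R -> R) : Prop :=
  UC1 (fun X : unit -> R => S (X tt)) (fun X => phi (X tt))
    (fun X h => dphi (X tt) * h tt).

Lemma D1_intro S phi dphi M :
  (forall x, S x -> Rabs (phi x) <= M /\ Rabs (dphi x) <= M) ->
  (forall e, 0 < e -> exists r, 0 < r /\ forall x y, S x -> S y -> Rabs (y - x) <= r ->
     Rabs (phi y - phi x - dphi x * (y - x)) <= e * Rabs (y - x)
     /\ Rabs (dphi y - dphi x) <= e) ->
  D1 S phi dphi.
Proof.
  intros HM H. apply (UC1_intro _ _ _ M).
  - intros X hX. split; intros; ring.
  - intros X hX. now apply HM.
  - intros X hX h b [hb1 hb2]. rewrite Rabs_mult.
    apply Rmult_le_compat; auto using Rabs_pos. now apply HM.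
  - intros e he. destruct (H e he) as [r [hr Hr]]. exists r. split; auto.
    intros X Y hX hY b hb [hn1 hn2]. specialize (hn2 tt). unfold dlt in *.
    destruct (Hr (X tt) (Y tt) hX hY) as [h1 h2]; [lra|]. split.
    + eapply Rle_trans; [apply h1|]. nra.
    + intros h c [hc1 hc2]. rewrite <- Rmult_minus_distr_r, Rabs_mult.
      apply Rmult_le_compat; auto using Rabs_pos.
Qed.

Lemma D1_elim S phi dphi : D1 S phi dphi ->
  (exists M, 0 < M /\ forall x, S x -> Rabs (phi x) <= M /\ Rabs (dphi x) <= M) /\
  (forall e, 0 < e -> exists r, 0 < r /\ forall x y, S x -> S y -> Rabs (y - x) <= r ->
     Rabs (phi y - phi x - dphi x * (y - x)) <= e * Rabs (y - x)
     /\ Rabs (dphi y - dphi x) <= e).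
Proof.
  intros H. split.
  - destruct (UC1_bound _ _ _ H) as [M [hM HM]]. exists M. split; auto.
    intros x hx. destruct (HM (fun _ => x) hx) as [_ [h1 h2]]. split; auto.
    specialize (h2 (fun _ => 1) 1). rewrite !Rmult_1_r in h2. apply h2.
    split; [lra|]. intros _. rewrite Rabs_R1. lra.
  - intros e he. destruct (UC1_modulus _ _ _ H e he) as [r [hr Hr]].
    exists r. split; auto. intros x y hx hy hxy.
    destruct (Hr (fun _ => x) (fun _ => y) hx hy (Rabs (y - x)) hxy) as [h1 h2].
    { split; [apply Rabs_pos|]. intros j. unfold dlt. lra. }
    split; [exact h1|]. specialize (h2 (fun _ => 1) 1). rewrite !Rmult_1_r in h2.
    apply h2. split; [lra|]. intros _. rewrite Rabs_R1. lra.
Qed.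

Lemma UC1_comp1 {I : Type} (O : (I -> R) -> Prop) (S : R -> Prop) phi dphi F G :
  D1 S phi dphi -> UC1 O F G -> (forall X, O X -> S (F X)) ->
  UC1 O (fun X => phi (F X)) (fun X h => dphi (F X) * G X h).
Proof.
  intros H1 H2 H3.
  apply (UC1_comp [tt] (fun X : unit -> R => S (X tt)) O _ _ (fun _ => F) (fun _ => G)) in H1; auto.
  intros []. now left.
Qed.

Lemma D1_inv c M : 0 < c ->
  D1 (fun x => c <= Rabs x <= M) Rinv (fun x => - / (x * x)).
Proof.
  intros hc.
  assert (hx0 : forall x, c <= Rabs x <= M -> x <> 0).
  { intros x hx h0. rewrite h0, Rabs_R0 in hx. lra. }
  assert (hi : forall x, c <= Rabs x <= M -> Rabs (/ x) <= / c).
  { intros x hx. rewrite Rabs_inv. apply Rinv_le_contravar; lra. }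
  assert (hic : 0 < / c) by now apply Rinv_0_lt_compat.
  apply (D1_intro _ _ _ (/ c + / c * / c)).
  - intros x hx. specialize (hi x hx). split; [nra|].
    rewrite Rabs_Ropp, Rinv_mult, Rabs_mult. pose proof (Rabs_pos (/ x)). nra.
  - intros e he.
    exists (e * (c * c * c) / 2). split; [repeat apply Rmult_lt_0_compat; lra|].
    intros x y hx hy hxy.
    pose proof (hx0 x hx). pose proof (hx0 y hy).
    pose proof (hi x hx) as ix. pose proof (hi y hy) as iy.
    pose proof (Rabs_pos (/x)). pose proof (Rabs_pos (/y)). pose proof (Rabs_pos (y - x)).
    assert (hp : Rabs (/ x) * Rabs (/ x) <= / c * / c) by nra.
    assert (hp2 : Rabs (/ x) * Rabs (/ y) <= / c * / c) by nra.
    assert (hp3 : Rabs (/ x) * Rabs (/ x) * Rabs (/ y) <= / c * / c * / c).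
    { apply Rmult_le_compat; nra. }
    assert (hp4 : Rabs (/ y) * Rabs (/ x) * Rabs (/ y) <= / c * / c * / c).
    { apply Rmult_le_compat; nra. }
    assert (hk : / c * / c * / c * Rabs (y - x) <= e / 2).
    { apply Rle_trans with (/ c * / c * / c * (e * (c * c * c) / 2)).
      - apply Rmult_le_compat_l; auto. repeat apply Rmult_le_pos; lra.
      - right. field. lra. }
    split.
    + replace (/ y - / x - - / (x * x) * (y - x))
        with ((/ x * / x * / y) * (y - x) * (y - x)) by (field; auto).
      rewrite !Rabs_mult.
      apply Rmult_le_compat_r; auto.
      apply Rle_trans with (/ c * / c * / c * Rabs (y - x)); [|lra].
      apply Rmult_le_compat_r; auto.
    + replace (- / (y * y) - - / (x * x))
        with ((/ y * / x * / y) * (y - x) + (/ x * / x * / y) * (y - x)) by (field; auto).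
      eapply Rle_trans; [apply Rabs_triang|]. rewrite !Rabs_mult.
      pose proof (Rmult_le_compat_r _ _ _ H3 hp3).
      pose proof (Rmult_le_compat_r _ _ _ H3 hp4). lra.
Qed.

Lemma D1_sqrt M : D1 (fun x => 1 <= x <= M) sqrt (fun x => / (2 * sqrt x)).
Proof.
  assert (hs : forall x, 1 <= x <= M -> 1 <= sqrt x <= M /\ sqrt x * sqrt x = x).
  { intros x hx. assert (h : sqrt x * sqrt x = x) by (apply sqrt_sqrt; lra).
    assert (1 <= sqrt x). { rewrite <- sqrt_1. apply sqrt_le_1; lra. }
    repeat split; auto. nra. }
  apply (D1_intro _ _ _ (Rabs M + 1)).
  - intros x hx. destruct (hs x hx) as [h1 h2].
    pose proof (Rle_abs M). split.
    + rewrite Rabs_pos_eq; lra.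
    + rewrite Rabs_pos_eq; [|left; apply Rinv_0_lt_compat; lra].
      apply Rle_trans with (/ 1); [apply Rinv_le_contravar; lra|].
      rewrite Rinv_1. pose proof (Rabs_pos M). lra.
  - intros e he. exists e. split; auto. intros x y hx hy hxy.
    destruct (hs x hx) as [[h1 _] h2]. destruct (hs y hy) as [[h3 _] h4].
    clear hx hy. revert h1 h2 h3 h4 hxy.
    (* In terms of the roots a and b the first order remainder is - (b - a)^2 / (2 a), and a, b >= 1
       controls every denominator. *)
    generalize (sqrt x) as a. generalize (sqrt y) as b. intros b a h1 h2 h3 h4 hxy.
    subst x y.
    pose proof (Rabs_pos (b - a)).
    assert (hba : Rabs (b * b - a * a) = Rabs (b - a) * (a + b)).
    { replace (b * b - a * a) with ((b - a) * (a + b)) by ring.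
      rewrite Rabs_mult, (Rabs_pos_eq (a + b)); lra. }
    split.
    + replace (b - a - / (2 * a) * (b * b - a * a))
        with (- (/ (2 * a) * ((b - a) * (b - a)))) by (field; lra).
      assert (hh : 0 < / (2 * a) <= 1).
      { split; [apply Rinv_0_lt_compat; lra|]. rewrite <- Rinv_1.
        apply Rinv_le_contravar; lra. }
      rewrite Rabs_Ropp, !Rabs_mult, (Rabs_pos_eq (/ (2 * a))) by lra.
      rewrite hba in *.
      apply Rle_trans with (1 * (Rabs (b - a) * Rabs (b - a))).
      * apply Rmult_le_compat_r; nra.
      * assert (Rabs (b - a) <= e) by nra.
        assert (Rabs (b-a) <= Rabs (b-a) * (a + b)) by nra. nra.
    + replace (/ (2 * b) - / (2 * a)) with (- (/ (2 * a * b) * (b - a))) by (field; lra).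
      assert (hh : 0 < / (2 * a * b) <= 1).
      { split; [apply Rinv_0_lt_compat; nra|]. rewrite <- Rinv_1.
        apply Rinv_le_contravar; nra. }
      rewrite Rabs_Ropp, Rabs_mult, (Rabs_pos_eq (/ (2 * a * b))) by lra. nra.
Qed.

(** * Closure properties of uniformly C^1 functions *)

Section C1_closure.
Context {I : Type}.
Variable O : (I -> R) -> Prop.

Lemma UC1_inv F G c : 0 < c -> (forall X, O X -> c <= Rabs (F X)) -> UC1 O F G ->
  UC1 O (fun X => / F X) (fun X h => - / (F X * F X) * G X h).
Proof.
  intros hc h H. destruct (UC1_bound _ _ _ H) as [M [hM HM]].
  apply (UC1_comp1 O _ _ _ F G (D1_inv c M hc)); auto.
  intros X hX. split; auto. apply HM; auto.
Qed.

Lemma C1_const c : C1on O (fun _ => c).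
Proof. eexists. apply UC1_const. Qed.

Lemma C1_coord i M : (forall X, O X -> Rabs (X i) <= M) -> C1on O (fun X => X i).
Proof. eexists. eapply UC1_coord. eassumption. Qed.

Lemma C1_plus F1 F2 : C1on O F1 -> C1on O F2 -> C1on O (fun X => F1 X + F2 X).
Proof. intros [G1 H1] [G2 H2]. eexists. apply UC1_plus; eassumption. Qed.

Lemma C1_mult F1 F2 : C1on O F1 -> C1on O F2 -> C1on O (fun X => F1 X * F2 X).
Proof. intros [G1 H1] [G2 H2]. eexists. apply UC1_mult; eassumption. Qed.

Lemma C1_ext F F' : C1on O F -> (forall X, O X -> F' X = F X) -> C1on O F'.
Proof. intros [G H] hF. exists G. eapply UC1_ext; eauto. Qed.

Lemma C1_opp F : C1on O F -> C1on O (fun X => - F X).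
Proof.
  intros H. apply (C1_ext (fun X => -1 * F X)).
  - apply C1_mult; auto. apply C1_const.
  - intros. ring.
Qed.

Lemma C1_minus F1 F2 : C1on O F1 -> C1on O F2 -> C1on O (fun X => F1 X - F2 X).
Proof. intros. apply C1_plus; auto. now apply C1_opp. Qed.

Lemma C1_pow F n : C1on O F -> C1on O (fun X => F X ^ n).
Proof.
  intros H. induction n as [|n IH]; simpl; [apply C1_const|now apply C1_mult].
Qed.

Lemma C1_inv F c : 0 < c -> (forall X, O X -> c <= Rabs (F X)) -> C1on O F ->
  C1on O (fun X => / F X).
Proof. intros hc h [G H]. eexists. eapply UC1_inv; eassumption. Qed.

Lemma C1_div F1 F2 c : 0 < c -> (forall X, O X -> c <= Rabs (F2 X)) ->
  C1on O F1 -> C1on O F2 -> C1on O (fun X => F1 X / F2 X).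
Proof. intros. apply C1_mult; auto. eapply C1_inv; eauto. Qed.

Lemma C1_sqrt F : (forall X, O X -> 1 <= F X) -> C1on O F -> C1on O (fun X => sqrt (F X)).
Proof.
  intros h [G H]. destruct (UC1_bound _ _ _ H) as [M [hM HM]].
  eexists. apply (UC1_comp1 O _ _ _ F G (D1_sqrt M)); auto.
  intros X hX. split; auto. destruct (HM X hX) as [_ [h1 _]].
  eapply Rle_trans; [apply Rle_abs|auto].
Qed.

Lemma C1_subset (O' : (I -> R) -> Prop) F : (forall X, O' X -> O X) -> C1on O F -> C1on O' F.
Proof. intros h [G H]. exists G. eapply UC1f_subset; eauto. Qed.

Lemma C1_bounded F : C1on O F -> exists M, 0 < M /\ forall X, O X -> Rabs (F X) <= M.
Proof.
  intros [G H]. destruct (UC1_bound _ _ _ H) as [M [hM HM]].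
  exists M. split; auto. intros X hX. apply HM; auto.
Qed.

Lemma C1_lipschitz F : C1on O F ->
  exists L, 0 < L /\ forall X Y, O X -> O Y -> forall b, nb (dlt X Y) b ->
    Rabs (F Y - F X) <= L * b.
Proof. intros [G H]. eapply UC1_lipschitz; eauto. Qed.

End C1_closure.

(** * Integral equations along two directions *)

Lemma continuous_of_modulus (h : R -> R) :
  (forall e, 0 < e -> exists r, 0 < r /\ forall x y, Rabs (y - x) <= r ->
     Rabs (h y - h x) <= e) -> forall x, continuous h x.
Proof.
  intros H x. apply continuity_pt_filterlim. intros e he.
  destruct (H (e / 2)) as [r [hr Hr]]; [lra|].
  exists r. split; auto. intros y [_ hy]. simpl in *. unfold R_dist in *.
  specialize (Hr x y). lra.
Qed.

Definition RI (h : R -> R) (a b : R) : R := RInt h a b.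

Section integrals.
Variables (h k : R -> R).
Hypothesis hc : forall x, continuous h x.
Hypothesis kc : forall x, continuous k x.

Lemma RI_ex a b : ex_RInt h a b.
Proof. apply (ex_RInt_continuous h). auto. Qed.

Lemma RI_chasles a b c : RI h a b + RI h b c = RI h a c.
Proof.
  apply (RInt_Chasles h a b c); apply (ex_RInt_continuous h); auto.
Qed.

Lemma RI_swap a b : RI h b a = - RI h a b.
Proof.
  pose proof (RI_chasles a b a) as H. unfold RI in *. rewrite RInt_point in H.
  unfold zero in H; simpl in H. lra.
Qed.

Lemma RI_bound a b M : (forall x, Rmin a b <= x <= Rmax a b -> Rabs (h x) <= M) ->
  Rabs (RI h a b) <= M * Rabs (b - a).
Proof.
  intros H. destruct (Rle_dec a b) as [hab|hab].
  - rewrite Rmin_left, Rmax_right in H by lra. rewrite (Rabs_pos_eq (b - a)) by lra.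
    rewrite Rmult_comm. apply abs_RInt_le_const; auto. apply RI_ex.
  - rewrite Rmin_right, Rmax_left in H by lra. rewrite (Rabs_left1 (b - a)) by lra.
    rewrite RI_swap, Rabs_Ropp. replace (- (b - a)) with (a - b) by ring.
    rewrite Rmult_comm. apply abs_RInt_le_const; auto; [lra|apply RI_ex].
Qed.

Lemma RI_minus a b : RI h a b - RI k a b = RI (fun x => h x - k x) a b.
Proof.
  unfold RI. symmetry. apply (RInt_minus h k a b);
  [apply (ex_RInt_continuous h)|apply (ex_RInt_continuous k)]; auto.
Qed.
End integrals.

Lemma RI_const c a b : RI (fun _ => c) a b = (b - a) * c.
Proof. unfold RI. rewrite RInt_const. reflexivity. Qed.

Lemma RI_diff_bound h k a b M :
  (forall x, continuous h x) -> (forall x, continuous k x) ->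
  (forall x, Rmin a b <= x <= Rmax a b -> Rabs (h x - k x) <= M) ->
  Rabs (RI h a b - RI k a b) <= M * Rabs (b - a).
Proof.
  intros hc kc H. rewrite RI_minus; auto. apply RI_bound; auto.
  intros x. apply (continuous_minus h k); auto.
Qed.

Lemma RI_lin_bound h c a b M :
  (forall x, continuous h x) ->
  (forall x, Rmin a b <= x <= Rmax a b -> Rabs (h x - c) <= M) ->
  Rabs (RI h a b - (b - a) * c) <= M * Rabs (b - a).
Proof.
  intros hc H. rewrite <- RI_const. apply RI_diff_bound; auto.
  intros x. apply continuous_const.
Qed.

Definition clamp (lo hi x : R) : R := Rmax lo (Rmin hi x).

Lemma Rmax_close a b a' b' e : Rabs (a' - a) <= e -> Rabs (b' - b) <= e ->
  Rabs (Rmax a' b' - Rmax a b) <= e.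
Proof.
  intros h1 h2. apply Rabs_le_between in h1. apply Rabs_le_between in h2.
  apply Rabs_le_between. unfold Rmax. repeat destruct (Rle_dec _ _); lra.
Qed.

Lemma Rmin_close a b a' b' e : Rabs (a' - a) <= e -> Rabs (b' - b) <= e ->
  Rabs (Rmin a' b' - Rmin a b) <= e.
Proof.
  intros h1 h2. apply Rabs_le_between in h1. apply Rabs_le_between in h2.
  apply Rabs_le_between. unfold Rmin. repeat destruct (Rle_dec _ _); lra.
Qed.

Lemma clamp_close lo hi x lo' hi' x' e :
  Rabs (lo' - lo) <= e -> Rabs (hi' - hi) <= e -> Rabs (x' - x) <= e ->
  Rabs (clamp lo' hi' x' - clamp lo hi x) <= e.
Proof. intros. apply Rmax_close; auto. apply Rmin_close; auto. Qed.

Lemma clamp_lip lo hi x x' : Rabs (clamp lo hi x' - clamp lo hi x) <= Rabs (x' - x).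
Proof.
  apply clamp_close; rewrite ?Rminus_diag, ?Rabs_R0; auto using Rabs_pos; lra.
Qed.

Lemma clamp_range lo hi x : lo <= hi -> lo <= clamp lo hi x <= hi.
Proof.
  intros. unfold clamp. split; [apply Rmax_l|].
  apply Rmax_lub; auto. apply Rmin_l.
Qed.

Lemma clamp_id lo hi x : lo <= x <= hi -> clamp lo hi x = x.
Proof. intros. unfold clamp. rewrite Rmin_right, Rmax_right; lra. Qed.

Definition strip (a d u v : R) : Prop :=
  Rabs u <= a /\ Rabs v <= a /\ Rabs (u - v) <= d.

(** Together with [ret2] this retracts the plane onto the strip: u is clamped to [- a, a], then v to
    the slice of the strip over the clamped u. Iterates can so be defined on the whole plane. *)
Definition ret1 (a u : R) : R := clamp (- a) a u.
Definition ret2 (a d u v : R) : R :=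
  clamp (Rmax (- a) (ret1 a u - d)) (Rmin a (ret1 a u + d)) v.

Lemma ret_strip a d u v : 0 < a -> 0 < d -> strip a d (ret1 a u) (ret2 a d u v).
Proof.
  intros ha hd. pose proof (clamp_range (-a) a u ltac:(lra)) as h1. fold (ret1 a u) in h1.
  assert (h2 : Rmax (- a) (ret1 a u - d) <= Rmin a (ret1 a u + d)).
  { apply Rmax_lub; apply Rmin_glb; lra. }
  pose proof (clamp_range _ _ v h2) as h3. fold (ret2 a d u v) in h3.
  pose proof (Rmax_l (- a) (ret1 a u - d)). pose proof (Rmax_r (- a) (ret1 a u - d)).
  pose proof (Rmin_l a (ret1 a u + d)). pose proof (Rmin_r a (ret1 a u + d)).
  repeat split; apply Rabs_le_between; lra.
Qed.

Lemma ret_id a d u v : strip a d u v -> ret1 a u = u /\ ret2 a d u v = v.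
Proof.
  intros [h1 [h2 h3]]. apply Rabs_le_between in h1.
  apply Rabs_le_between in h2. apply Rabs_le_between in h3.
  assert (e : ret1 a u = u) by (apply clamp_id; lra).
  split; auto. unfold ret2. rewrite e. apply clamp_id. split.
  - apply Rmax_lub; lra.
  - apply Rmin_glb; lra.
Qed.

Lemma ret_close a d u v u' v' e : Rabs (u' - u) <= e -> Rabs (v' - v) <= e ->
  Rabs (ret1 a u' - ret1 a u) <= e /\ Rabs (ret2 a d u' v' - ret2 a d u v) <= e.
Proof.
  intros h1 h2. assert (h3 : Rabs (ret1 a u' - ret1 a u) <= e).
  { eapply Rle_trans; [apply clamp_lip|auto]. }
  split; auto. assert (he : 0 <= e).
  { eapply Rle_trans; [apply Rabs_pos|exact h1]. }
  apply clamp_close; auto.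
  - apply Rmax_close; [rewrite Rminus_diag, Rabs_R0; auto|].
    replace (ret1 a u' - d - (ret1 a u - d)) with (ret1 a u' - ret1 a u) by ring. auto.
  - apply Rmin_close; [rewrite Rminus_diag, Rabs_R0; auto|].
    replace (ret1 a u' + d - (ret1 a u + d)) with (ret1 a u' - ret1 a u) by ring. auto.
Qed.

(** Bounded and uniformly continuous on the plane, with constants common to all indices: a class
    stable under uniform limits, hence suited to the fixed point argument. *)
Definition BUC {K : Type} (h : K -> R -> R -> R) : Prop :=
  (exists M, 0 < M /\ forall i u v, Rabs (h i u v) <= M)
  /\ forall e, 0 < e -> exists r, 0 < r /\ forall i u v u' v',
     Rabs (u' - u) <= r -> Rabs (v' - v) <= r -> Rabs (h i u' v' - h i u v) <= e.

Lemma BUC_continuous_u {K} (h : K -> R -> R -> R) i v : BUC h ->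
  forall u, continuous (fun s : R => h i s v) u.
Proof.
  intros [_ H]. apply continuous_of_modulus. intros e he.
  destruct (H e he) as [r [hr Hr]]. exists r. split; auto. intros x y hxy.
  apply Hr; auto. rewrite Rminus_diag, Rabs_R0. lra.
Qed.

Lemma BUC_continuous_v {K} (h : K -> R -> R -> R) i u : BUC h ->
  forall v, continuous (fun t : R => h i u t) v.
Proof.
  intros [_ H]. apply continuous_of_modulus. intros e he.
  destruct (H e he) as [r [hr Hr]]. exists r. split; auto. intros x y hxy.
  apply Hr; auto. rewrite Rminus_diag, Rabs_R0. lra.
Qed.

Section picard.
Context {I : Type}.
Variable (dir : I -> bool) (F : I -> R -> R -> (I -> R) -> R) (g : I -> R -> R).
Variables (a d L : R).
Hypotheses (ha : 0 < a) (hd : 0 < d) (hL : 0 <= L) (hdL : d * L <= 1 / 2).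
Hypothesis F_lip : forall i u v X Y b, nb (dlt X Y) b ->
  Rabs (F i u v Y - F i u v X) <= L * b.
Hypothesis F_bound : exists M, 0 < M /\ forall i u v, Rabs (F i u v (fun _ => 0)) <= M.
Hypothesis F_uc : forall N e, 0 < e -> exists r, 0 < r /\
  forall i u v u' v' X, nb X N -> Rabs (u' - u) <= r -> Rabs (v' - v) <= r ->
  Rabs (F i u' v' X - F i u v X) <= e.
Hypothesis g_bound : exists M, 0 < M /\ forall i u, Rabs (g i u) <= M.
Hypothesis g_uc : forall e, 0 < e -> exists r, 0 < r /\
  forall i u u', Rabs (u' - u) <= r -> Rabs (g i u' - g i u) <= e.

Definition nemytskii (U : I -> R -> R -> R) : I -> R -> R -> R :=
  fun i u v => F i u v (fun j => U j u v).

Lemma nemytskii_BUC U : BUC U -> BUC (nemytskii U).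
Proof.
  intros [[M [hM HM]] HU]. destruct F_bound as [N [hN HN]]. split.
  - exists (N + L * M). split; [nra|]. intros i u v. unfold nemytskii.
    replace (F i u v (fun j => U j u v)) with
      (F i u v (fun _ => 0) + (F i u v (fun j => U j u v) - F i u v (fun _ => 0))) by ring.
    eapply Rle_trans; [apply Rabs_triang|]. apply Rplus_le_compat; auto.
    apply F_lip. split; [lra|]. intros j. unfold dlt. rewrite Rminus_0_r. auto.
  - intros e he. destruct (F_uc M (e / 2)) as [r1 [hr1 Hr1]]; [lra|].
    destruct (HU (e / (2 * (L + 1)))) as [r2 [hr2 Hr2]].
    { apply Rdiv_lt_0_compat; lra. }
    exists (Rmin r1 r2). split; [now apply Rmin_glb_lt|].
    intros i u v u' v' hu hv. pose proof (Rmin_l r1 r2). pose proof (Rmin_r r1 r2).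
    unfold nemytskii.
    replace (F i u' v' (fun j => U j u' v') - F i u v (fun j => U j u v)) with
      ((F i u' v' (fun j => U j u' v') - F i u' v' (fun j => U j u v))
       + (F i u' v' (fun j => U j u v) - F i u v (fun j => U j u v))) by ring.
    eapply Rle_trans; [apply Rabs_triang|].
    assert (h1 : Rabs (F i u' v' (fun j => U j u v) - F i u v (fun j => U j u v)) <= e / 2).
    { apply Hr1; try lra. split; [lra|auto]. }
    assert (h2 : Rabs (F i u' v' (fun j => U j u' v') - F i u' v' (fun j => U j u v))
                 <= L * (e / (2 * (L + 1)))).
    { apply F_lip. split.
      - left. apply Rdiv_lt_0_compat; lra.
      - intros j. unfold dlt. apply Hr2; lra. }
    assert (L * (e / (2 * (L + 1))) <= e / 2).
    { assert (0 < e / (2 * (L + 1))) by (apply Rdiv_lt_0_compat; lra).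
      apply Rle_trans with ((L + 1) * (e / (2 * (L + 1)))); [nra|].
      right. field. lra. }
    lra.
Qed.

(** The equation is evaluated at the retracted point. The path of integration joins the diagonal to
    that point parallel to an axis, stays in the strip and has length at most [d]. *)
Definition picard_op (U : I -> R -> R -> R) (i : I) (u v : R) : R :=
  let u' := ret1 a u in let v' := ret2 a d u v in
  if dir i then g i v' + RI (fun s => nemytskii U i s v') v' u'
  else g i u' + RI (fun t => nemytskii U i u' t) u' v'.

Lemma picard_op_BUC U : BUC U -> BUC (picard_op U).
Proof.
  intros HU. pose proof (nemytskii_BUC U HU) as HN.
  set (N := nemytskii U) in *.
  pose proof (fun i v => BUC_continuous_u N i v HN) as cu.
  pose proof (fun i u => BUC_continuous_v N i u HN) as cv.
  destruct HN as [[M [hM HM]] HNm]. destruct g_bound as [Mg [hMg HMg]].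
  unfold picard_op. fold N. split.
  - exists (Mg + M * d). split; [nra|]. intros i u v.
    destruct (ret_strip a d u v ha hd) as [_ [_ h]].
    assert (h' : Rabs (ret2 a d u v - ret1 a u) <= d) by (rewrite Rabs_minus_sym; auto).
    cbv zeta. destruct (dir i).
    + eapply Rle_trans; [apply Rabs_triang|]. apply Rplus_le_compat; auto.
      eapply Rle_trans; [apply (RI_bound _ (cu i _) _ _ M); auto|].
      apply Rmult_le_compat_l; lra.
    + eapply Rle_trans; [apply Rabs_triang|]. apply Rplus_le_compat; auto.
      eapply Rle_trans; [apply (RI_bound _ (cv i _) _ _ M); auto|].
      apply Rmult_le_compat_l; lra.
  - intros e he. destruct (g_uc (e / 4)) as [r1 [hr1 Hr1]]; [lra|].
    destruct (HNm (e / (4 * d))) as [r2 [hr2 Hr2]]; [apply Rdiv_lt_0_compat; lra|].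
    set (r3 := e / (4 * M)).
    assert (hr3 : 0 < r3) by (apply Rdiv_lt_0_compat; lra).
    exists (Rmin (Rmin r1 r2) r3). split; [repeat apply Rmin_glb_lt; auto|].
    intros i u v u1 v1 hu hv.
    destruct (ret_close a d u v u1 v1 _ hu hv) as [ku kv].
    pose proof (Rmin_l (Rmin r1 r2) r3). pose proof (Rmin_r (Rmin r1 r2) r3).
    pose proof (Rmin_l r1 r2). pose proof (Rmin_r r1 r2).
    destruct (ret_strip a d u v ha hd) as [_ [_ h]].
    cbv zeta. set (x := ret1 a u) in *. set (y := ret2 a d u v) in *.
    set (x1 := ret1 a u1) in *. set (y1 := ret2 a d u1 v1) in *.
    clearbody x y x1 y1.
    assert (hM3 : M * r3 = e / 4) by (unfold r3; field; lra).
    assert (hde : e / (4 * d) * d = e / 4) by (field; lra).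
    assert (hz : forall z : R, Rabs (z - z) <= r2)
      by (intros; rewrite Rminus_diag, Rabs_R0; lra).
    assert (hed : 0 < e / (4 * d)) by (apply Rdiv_lt_0_compat; lra).
    destruct (dir i).
    + assert (E : RI (fun s => N i s y1) y1 x1 - RI (fun s => N i s y) y x
         = RI (fun s => N i s y1) y1 y + RI (fun s => N i s y1) x x1
           + (RI (fun s => N i s y1) y x - RI (fun s => N i s y) y x)).
      { rewrite <- (RI_chasles _ (cu i y1) y1 y x1), <- (RI_chasles _ (cu i y1) y x x1). ring. }
      replace (g i y1 + RI (fun s => N i s y1) y1 x1
               - (g i y + RI (fun s => N i s y) y x)) with
        ((g i y1 - g i y) + (RI (fun s => N i s y1) y1 x1 - RI (fun s => N i s y) y x)) by ring.
      rewrite E.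
      assert (b1 := RI_bound _ (cu i y1) y1 y M (fun s _ => HM i s y1)).
      assert (b2 := RI_bound _ (cu i y1) x x1 M (fun s _ => HM i s y1)).
      assert (b3 : Rabs (RI (fun s => N i s y1) y x - RI (fun s => N i s y) y x)
                   <= e / (4 * d) * Rabs (x - y)).
      { apply RI_diff_bound; auto. intros z _. apply Hr2; auto; lra. }
      assert (b4 : Rabs (g i y1 - g i y) <= e / 4) by (apply Hr1; lra).
      rewrite (Rabs_minus_sym y y1) in b1.
      eapply Rle_trans; [apply Rabs_triang|].
      eapply Rle_trans; [apply Rplus_le_compat_l, Rabs_triang|].
      eapply Rle_trans; [apply Rplus_le_compat_l, Rplus_le_compat_r, Rabs_triang|].
      assert (M * Rabs (y1 - y) <= M * r3) by (apply Rmult_le_compat_l; lra).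
      assert (M * Rabs (x1 - x) <= M * r3) by (apply Rmult_le_compat_l; lra).
      assert (e / (4 * d) * Rabs (x - y) <= e / (4 * d) * d)
        by (apply Rmult_le_compat_l; lra).
      lra.
    + assert (E : RI (fun s => N i x1 s) x1 y1 - RI (fun s => N i x s) x y
         = RI (fun s => N i x1 s) x1 x + RI (fun s => N i x1 s) y y1
           + (RI (fun s => N i x1 s) x y - RI (fun s => N i x s) x y)).
      { rewrite <- (RI_chasles _ (cv i x1) x1 x y1), <- (RI_chasles _ (cv i x1) x y y1). ring. }
      replace (g i x1 + RI (fun s => N i x1 s) x1 y1
               - (g i x + RI (fun s => N i x s) x y)) with
        ((g i x1 - g i x) + (RI (fun s => N i x1 s) x1 y1 - RI (fun s => N i x s) x y)) by ring.
      rewrite E.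
      assert (b1 := RI_bound _ (cv i x1) x1 x M (fun s _ => HM i x1 s)).
      assert (b2 := RI_bound _ (cv i x1) y y1 M (fun s _ => HM i x1 s)).
      assert (b3 : Rabs (RI (fun s => N i x1 s) x y - RI (fun s => N i x s) x y)
                   <= e / (4 * d) * Rabs (y - x)).
      { apply RI_diff_bound; auto. intros z _. apply Hr2; auto; lra. }
      assert (b4 : Rabs (g i x1 - g i x) <= e / 4) by (apply Hr1; lra).
      rewrite (Rabs_minus_sym x x1) in b1. rewrite (Rabs_minus_sym y x) in b3.
      eapply Rle_trans; [apply Rabs_triang|].
      eapply Rle_trans; [apply Rplus_le_compat_l, Rabs_triang|].
      eapply Rle_trans; [apply Rplus_le_compat_l, Rplus_le_compat_r, Rabs_triang|].
      assert (M * Rabs (y1 - y) <= M * r3) by (apply Rmult_le_compat_l; lra).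
      assert (M * Rabs (x1 - x) <= M * r3) by (apply Rmult_le_compat_l; lra).
      assert (e / (4 * d) * Rabs (x - y) <= e / (4 * d) * d)
        by (apply Rmult_le_compat_l; lra).
      lra.
Qed.

Lemma picard_op_contraction U V b : BUC U -> BUC V -> 0 <= b ->
  (forall i u v, Rabs (V i u v - U i u v) <= b) ->
  forall i u v, Rabs (picard_op V i u v - picard_op U i u v) <= b / 2.
Proof.
  intros HU HV hb H i u v.
  pose proof (nemytskii_BUC U HU) as NU. pose proof (nemytskii_BUC V HV) as NV.
  assert (hN : forall u v, Rabs (nemytskii V i u v - nemytskii U i u v) <= L * b).
  { intros. apply F_lip. split; auto. intros j. apply H. }
  unfold picard_op. cbv zeta.
  destruct (ret_strip a d u v ha hd) as [_ [_ h]].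
  set (x := ret1 a u) in *. set (y := ret2 a d u v) in *.
  assert (h' : L * b * Rabs (x - y) <= b / 2).
  { apply Rle_trans with (L * b * d); [|nra].
    apply Rmult_le_compat_l; auto. now apply Rmult_le_pos. }
  destruct (dir i).
  - replace (g i y + RI (fun s => nemytskii V i s y) y x
      - (g i y + RI (fun s => nemytskii U i s y) y x))
      with (RI (fun s => nemytskii V i s y) y x - RI (fun s => nemytskii U i s y) y x) by ring.
    eapply Rle_trans; [apply RI_diff_bound; eauto using BUC_continuous_u|auto].
  - replace (g i x + RI (fun s => nemytskii V i x s) x y
      - (g i x + RI (fun s => nemytskii U i x s) x y))
      with (RI (fun s => nemytskii V i x s) x y - RI (fun s => nemytskii U i x s) x y) by ring.
    rewrite Rabs_minus_sym in h'.
    eapply Rle_trans; [apply RI_diff_bound; eauto using BUC_continuous_v|auto].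
Qed.

(** Existence needs only a thin strip: the path has length at most [d], so [d * L <= 1 / 2] makes
    [picard_op] halve distances. *)
Theorem picard : exists U : I -> R -> R -> R, BUC U /\
  forall i u v, strip a d u v ->
    U i u v = if dir i then g i v + RI (fun s => F i s v (fun j => U j s v)) v u
              else g i u + RI (fun t => F i u t (fun j => U j u t)) u v.
Proof.
  (* The whole family becomes one scalar function on I * (R * R), the form required by the fixed
     point theorem. *)
  set (cur := fun (X : I * (R * R) -> R) (i : I) (u v : R) => X (i, (u, v))).
  set (Phi := fun (X : I * (R * R) -> R) (p : I * (R * R)) =>
                picard_op (cur X) (fst p) (fst (snd p)) (snd (snd p))).
  set (C := fun X : I * (R * R) -> R => BUC (cur X)).
  assert (C0 : C (fun _ => 0)).
  { split.
    - exists 1. split; [lra|]. intros. unfold cur. rewrite Rabs_R0. lra.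
    - intros e he. exists 1. split; [lra|]. intros. unfold cur.
      rewrite Rminus_diag, Rabs_R0. lra. }
  destruct (picard_op_BUC _ C0) as [[M0 [hM0 HM0]] _].
  destruct (banach_fixed_point (I * (R * R)) C Phi (fun _ => 0) M0) as [X [CX HX]]; auto.
  - intros X. apply picard_op_BUC.
  - intros Xn X HC Hlim. split.
    + destruct (Hlim 1) as [n Hn]; [lra|]. destruct (HC n) as [[M [hM HM]] _].
      exists (1 + M). split; [lra|]. intros i u v. unfold cur.
      specialize (Hn (i, (u, v))). specialize (HM i u v). unfold cur in HM.
      replace (X (i, (u, v))) with ((X (i, (u, v)) - Xn n (i, (u, v))) + Xn n (i, (u, v))) by ring.
      eapply Rle_trans; [apply Rabs_triang|]. lra.
    + intros e he. destruct (Hlim (e / 3)) as [n Hn]; [lra|].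
      destruct (HC n) as [_ Hm]. destruct (Hm (e / 3)) as [r [hr Hr]]; [lra|].
      exists r. split; auto. intros i u v u' v' hu hv. specialize (Hr i u v u' v' hu hv).
      unfold cur in *. pose proof (Hn (i, (u, v))) as h1.
      pose proof (Hn (i, (u', v'))) as h2.
      apply Rabs_le_between in h1. apply Rabs_le_between in h2.
      apply Rabs_le_between in Hr. apply Rabs_le_between. lra.
  - intros X Y b CX CY [hb Hb]. split; [lra|]. intros [i [u v]].
    unfold dlt, Phi; simpl. apply picard_op_contraction; auto.
    intros j s t. apply (Hb (j, (s, t))).
  - split; [lra|]. intros [i [u v]]. unfold dlt, Phi; simpl. rewrite Rminus_0_r. apply HM0.
  - exists (cur X). split; auto. intros i u v hs.
    specialize (HX (i, (u, v))). unfold Phi in HX; simpl in HX.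
    unfold picard_op in HX; cbv zeta in HX.
    destruct (ret_id a d u v hs) as [-> E2] in HX. rewrite E2 in HX.
    unfold cur at 1. rewrite <- HX. reflexivity.
Qed.

End picard.

(** * Differentiability of the solution *)

Lemma lin_minus {I : Type} (L : (I -> R) -> R) h k : lin L ->
  L h - L k = L (fun j => h j - k j).
Proof.
  intros [h1 h2].
  replace (fun j => h j - k j) with (fun j => h j + (-1) * k j).
  - rewrite (h1 h (fun j => -1 * k j)), h2. ring.
  - apply functional_extensionality. intros; ring.
Qed.

Lemma RI_reflect (h : R -> R) a b : (forall x, continuous h x) ->
  RI h (- a) (- b) = - RI (fun t => h (- t)) a b.
Proof.
  intros hc.
  assert (hex : ex_RInt h (-1 * a + 0) (-1 * b + 0)) by now apply RI_ex.
  unfold RI. pose proof (RInt_comp_lin h (-1) 0 a b hex) as H.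
  replace (-1 * a + 0) with (- a) in H by ring.
  replace (-1 * b + 0) with (- b) in H by ring. rewrite <- H.
  assert (hcn : forall x, continuous (fun t => h (- t)) x).
  { intros x. apply (continuous_comp Ropp h); auto.
    apply (continuous_opp (fun t : R => t) x). apply continuous_id. }
  pose proof (RInt_opp (fun t => h (- t)) a b (RI_ex _ hcn a b)) as H'.
  unfold opp at 2 in H'; simpl in H'. rewrite <- H'.
  apply RInt_ext. intros x _. change (-1 * h (-1 * x + 0) = - h (- x)).
  replace (-1 * x + 0) with (- x) by ring. ring.
Qed.

(** The half u >= v of the strip. It corresponds to the side y >= 0 of the initial line, on which
    the solution is sought. *)
Definition tri (a d u v : R) : Prop := Rabs u <= a /\ Rabs v <= a /\ 0 <= u - v <= d.

Lemma tri_strip a d u v : tri a d u v -> strip a d u v.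
Proof.
  intros [h1 [h2 h3]]. repeat split; auto. rewrite Rabs_pos_eq; lra.
Qed.

Definition pi_box {I : Type} (lo hi : I -> R) (X : I -> R) : I -> R :=
  fun i => clamp (lo i) (hi i) (X i).

Definition in_box {I : Type} (lo hi : I -> R) (X : I -> R) : Prop :=
  forall i, lo i <= X i <= hi i.

Lemma pi_box_in {I : Type} (lo hi X : I -> R) :
  (forall i, lo i <= hi i) -> in_box lo hi (pi_box lo hi X).
Proof. intros h i. now apply clamp_range. Qed.

Lemma pi_box_id {I : Type} (lo hi X : I -> R) : in_box lo hi X -> pi_box lo hi X = X.
Proof. intros h. apply functional_extensionality. intros i. now apply clamp_id. Qed.

Lemma pi_box_lip {I : Type} (lo hi X Y : I -> R) b :
  nb (dlt X Y) b -> nb (dlt (pi_box lo hi X) (pi_box lo hi Y)) b.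
Proof.
  intros [h1 h2]. split; auto. intros j. eapply Rle_trans; [apply clamp_lip|apply h2].
Qed.

(** The right-hand sides are controlled only on a box of values. Clamping makes them bounded and
    Lipschitz everywhere, and it has no effect once the solution is known to remain in the box. *)
Definition on_box {I : Type} (lo hi : I -> R) (F : I -> (I -> R) -> R)
    (U : I -> R -> R -> R) (i : I) (u v : R) : R :=
  F i (pi_box lo hi (fun j => U j u v)).

(* The data are prescribed on the diagonal u = v. *)
Definition solves {I : Type} (dir : I -> bool) (N U : I -> R -> R -> R) (g : I -> R -> R)
    (u v : R) : Prop :=
  forall i, U i u v = if dir i then g i v + RI (fun s => N i s v) v u
                      else g i u + RI (fun t => N i u t) u v.

(** One constant [M] bounds values, derivatives and Lipschitz constants alike, so that the width of
    the strip has to satisfy the single condition [d * M <= 1 / 2]. *)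
Record system_data {I : Type} (lo hi : I -> R) (F : I -> (I -> R) -> R)
    (G : I -> (I -> R) -> (I -> R) -> R) (g gp : I -> R -> R) (a M : R) : Prop := {
  sd_pos : 0 < M;
  sd_box : forall i, lo i <= hi i;
  sd_lin : forall i X, in_box lo hi X -> lin (G i X);
  sd_F : forall i X, in_box lo hi X -> Rabs (F i X) <= M;
  sd_G : forall i X, in_box lo hi X -> forall h b, nb h b -> Rabs (G i X h) <= M * b;
  sd_lip : forall i X Y, in_box lo hi X -> in_box lo hi Y ->
    forall b, nb (dlt X Y) b -> Rabs (F i Y - F i X) <= M * b;
  sd_mod : forall e, 0 < e -> exists r, 0 < r /\ forall i X Y,
    in_box lo hi X -> in_box lo hi Y -> forall b, b <= r -> nb (dlt X Y) b ->
    Rabs (F i Y - F i X - G i X (dlt X Y)) <= e * b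
    /\ forall h c, nb h c -> Rabs (G i Y h - G i X h) <= e * c;
  sd_g : forall i w, Rabs w <= a -> Rabs (g i w) <= M /\ Rabs (gp i w) <= M;
  sd_glip : forall i w w', Rabs w <= a -> Rabs w' <= a ->
    Rabs (g i w' - g i w) <= M * Rabs (w' - w);
  sd_gmod : forall e, 0 < e -> exists r, 0 < r /\ forall i w w',
    Rabs w <= a -> Rabs w' <= a -> Rabs (w' - w) <= r ->
    Rabs (g i w' - g i w - gp i w * (w' - w)) <= e * Rabs (w' - w)
    /\ Rabs (gp i w' - gp i w) <= e }.

Lemma system_data_intro {I : Type} (l : list I) (lo hi : I -> R) (F : I -> (I -> R) -> R) G
    (g gp : I -> R -> R) (a : R) :
  (forall i : I, In i l) -> (forall i, lo i <= hi i) ->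
  (forall i, UC1 (in_box lo hi) (F i) (G i)) ->
  (forall i, D1 (fun w => Rabs w <= a) (g i) (gp i)) ->
  exists M, system_data lo hi F G g gp a M.
Proof.
  intros Hl Hb HF Hg.
  pose proof (UC1_finite _ I l F G Hl HF) as HF'.
  pose proof HF' as [[M1 [hM1 HM1]] Hmod].
  destruct (UC1f_lipschitz _ _ _ _ HF') as [L1 [hL1 HL1]].
  assert (Hg' : UC1f (fun X : unit -> R => Rabs (X tt) <= a) (fun i X => g i (X tt))
     (fun i X h => gp i (X tt) * h tt)) by (apply (UC1_finite _ I l); auto).
  pose proof Hg' as [[M2 [hM2 HM2]] Hgmod].
  destruct (UC1f_lipschitz _ _ _ _ Hg') as [L2 [hL2 HL2]].
  assert (one : forall c, nb (fun _ : unit => c) (Rabs c)).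
  { intros c. split; [apply Rabs_pos|]. intros; lra. }
  exists (M1 + L1 + M2 + L2). constructor; auto.
  - lra.
  - intros i X hX. now apply HM1.
  - intros i X hX. destruct (HM1 i X hX) as [_ [h _]]. lra.
  - intros i X hX h b hb. destruct (HM1 i X hX) as [_ [_ h']]. specialize (h' h b hb).
    destruct hb. nra.
  - intros i X Y hX hY b hb. specialize (HL1 i X Y hX hY b hb). destruct hb. nra.
  - intros i w hw. destruct (HM2 i (fun _ => w) hw) as [_ [h1 h2]].
    specialize (h2 _ _ (one 1)). rewrite Rabs_R1, !Rmult_1_r in h2. split; lra.
  - intros i w w' hw hw'.
    specialize (HL2 i (fun _ => w) (fun _ => w') hw hw' _ (one (w' - w))).
    simpl in HL2. pose proof (Rabs_pos (w' - w)). nra.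
  - intros e he. destruct (Hgmod e he) as [r [hr Hr]]. exists r. split; auto.
    intros i w w' hw hw' h.
    destruct (Hr i (fun _ => w) (fun _ => w') hw hw' _ h (one (w' - w))) as [h1 h2].
    split; [exact h1|]. specialize (h2 _ _ (one 1)).
    rewrite Rabs_R1, !Rmult_1_r in h2. exact h2.
Qed.

Section regularity.
Context {I : Type}.
Variables (dir : I -> bool) (lo hi : I -> R) (F : I -> (I -> R) -> R)
  (G : I -> (I -> R) -> (I -> R) -> R) (g gp : I -> R -> R) (a d M : R).
Hypotheses (ha : 0 < a) (hd : 0 < d) (hdM : d * M <= 1 / 2).
Hypothesis S : system_data lo hi F G g gp a M.

Lemma on_box_BUC U : BUC U -> BUC (on_box lo hi F U).
Proof.
  intros [[Mu [hMu HMu]] HU]. pose proof (sd_pos _ _ _ _ _ _ _ _ S) as hM. split.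
  - exists M. split; auto. intros i u v.
    apply (sd_F _ _ _ _ _ _ _ _ S). apply pi_box_in, S.
  - intros e he. destruct (HU (e / M)) as [r [hr Hr]]; [now apply Rdiv_lt_0_compat|].
    exists r. split; auto. intros i u v u' v' hu hv.
    replace e with (M * (e / M)) by (field; lra).
    apply (sd_lip _ _ _ _ _ _ _ _ S); try (apply pi_box_in, S).
    apply pi_box_lip. split; [left; now apply Rdiv_lt_0_compat|].
    intros j. unfold dlt. auto.
Qed.

Lemma box_solution : exists U, BUC U
  /\ (forall u v, strip a d u v -> solves dir (on_box lo hi F U) U g u v)
  /\ forall i u v, strip a d u v ->
       Rabs (U i u v - g i (if dir i then v else u)) <= M * Rabs (u - v).
Proof.
  pose proof (sd_pos _ _ _ _ _ _ _ _ S) as hM.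
  (* Values are clamped to the box and the data are continued by constants beyond |w| = a, so that
     the hypotheses of [picard] hold on the whole plane. *)
  destruct (picard dir (fun i _ _ X => F i (pi_box lo hi X))
    (fun i w => g i (ret1 a w)) a d M) as [U [HU Heq]]; auto; try lra.
  - intros i u v X Y b hb. apply (sd_lip _ _ _ _ _ _ _ _ S); try (apply pi_box_in, S).
    now apply pi_box_lip.
  - exists M. split; auto. intros. apply (sd_F _ _ _ _ _ _ _ _ S). apply pi_box_in, S.
  - intros N e he. exists 1. split; [lra|]. intros. rewrite Rminus_diag, Rabs_R0. lra.
  - exists M. split; auto. intros. apply (sd_g _ _ _ _ _ _ _ _ S).
    destruct (ret_strip a d u 0 ha hd) as [h _]. exact h.
  - intros e he. exists (e / M). split; [now apply Rdiv_lt_0_compat|].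
    intros i u u' hu. eapply Rle_trans.
    + apply (sd_glip _ _ _ _ _ _ _ _ S).
      * destruct (ret_strip a d u 0 ha hd) as [h _]. exact h.
      * destruct (ret_strip a d u' 0 ha hd) as [h _]. exact h.
    + replace e with (M * (e / M)) by (field; lra). apply Rmult_le_compat_l; [lra|].
      eapply Rle_trans; [apply clamp_lip|exact hu].
  - pose proof (on_box_BUC U HU) as HN.
    assert (hid : forall w, Rabs w <= a -> ret1 a w = w).
    { intros w hw. apply clamp_id. apply Rabs_le_between in hw. lra. }
    assert (Hs : forall u v, strip a d u v -> solves dir (on_box lo hi F U) U g u v).
    { intros u v hs i. rewrite Heq; auto. destruct hs as [h1 [h2 _]].
      rewrite (hid u), (hid v); auto. }
    exists U. split; auto. split; auto.
    intros i u v hs. rewrite (Hs u v hs i). destruct (dir i).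
    + rewrite Rplus_minus_l.
      apply RI_bound; [now apply (BUC_continuous_u (on_box lo hi F U))|].
      intros. apply (sd_F _ _ _ _ _ _ _ _ S). apply pi_box_in, S.
    + rewrite Rplus_minus_l.
      rewrite Rabs_minus_sym.
      apply RI_bound; [now apply (BUC_continuous_v (on_box lo hi F U))|].
      intros. apply (sd_F _ _ _ _ _ _ _ _ S). apply pi_box_in, S.
Qed.

Variable U : I -> R -> R -> R.
Hypothesis HU : BUC U.
Hypothesis Usol : forall u v, tri a d u v -> solves dir (on_box lo hi F U) U g u v.
Hypothesis Uin : forall u v, tri a d u v -> in_box lo hi (fun j => U j u v).

Let N := on_box lo hi F U.

Definition on_box_deriv (W : I -> R -> R -> R) (i : I) (u v : R) : R :=
  G i (pi_box lo hi (fun j => U j u v)) (fun j => W j u v).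

Lemma tri_sub u u' v t : tri a d u v -> tri a d u' v -> u <= u' -> v <= t <= u ->
  tri a d u t /\ tri a d u' t.
Proof.
  intros [h1 [h2 h3]] [h4 [h5 h6]] h7 h8.
  pose proof (proj1 (Rabs_le_between _ _) h1). pose proof (proj1 (Rabs_le_between _ _) h2).
  assert (Rabs t <= a) by (apply Rabs_le_between; lra).
  unfold tri. repeat split; auto; lra.
Qed.

(** Components integrated along u change by at most M (u' - u). For the others the datum and the
    moved end point give 2 M (u' - u), and the integral of the difference is at most half of any
    known bound; halving turns 2 M into 4 M. *)
Lemma U_lipschitz_u u u' v i : tri a d u v -> tri a d u' v -> u <= u' ->
  Rabs (U i u' v - U i u v) <= 4 * M * (u' - u).
Proof.
  intros h1 h2 huu.
  pose proof (sd_pos _ _ _ _ _ _ _ _ S) as hM.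
  pose proof (on_box_BUC U HU) as HN. fold N in HN.
  pose proof (fun i v => BUC_continuous_u N i v HN) as cu.
  pose proof (fun i u => BUC_continuous_v N i u HN) as cv.
  assert (hNM : forall i u v, Rabs (N i u v) <= M).
  { intros. apply (sd_F _ _ _ _ _ _ _ _ S). apply pi_box_in, S. }
  destruct HU as [[Mu [hMu HMu]] _].
  set (P := fun p : I * R => tri a d u (snd p) /\ tri a d u' (snd p)).
  set (f := fun p : I * R => U (fst p) u' (snd p) - U (fst p) u (snd p)).
  replace (4 * M * (u' - u)) with (2 * (2 * M * (u' - u))) by ring.
  change (Rabs (f (i, v)) <= 2 * (2 * M * (u' - u))).
  assert (hP : P (i, v)) by (split; auto).
  revert hP. generalize (i, v). clear i v h1 h2.
  apply (bound_of_halving (I * R) P f (2 * M * (u' - u)) (2 * Mu)).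
  - assert (0 <= M * (u' - u)) by (apply Rmult_le_pos; lra). lra.
  - intros [i v] _. unfold f; simpl. unfold Rminus.
    eapply Rle_trans; [apply Rabs_triang|]. rewrite Rabs_Ropp.
    pose proof (HMu i u' v). pose proof (HMu i u v). lra.
  - intros b hb Hb [i v] [t1 t2]. unfold f; simpl in *.
    rewrite (Usol u' v t2 i), (Usol u v t1 i). fold N.
    pose proof t1 as [q1 [q2 q3]]. pose proof t2 as [q4 [q5 q6]].
    assert (hMh : 0 <= M * (u' - u)) by (apply Rmult_le_pos; lra).
    destruct (dir i).
    + rewrite <- (RI_chasles _ (cu i v) v u u').
      match goal with |- Rabs ?t <= _ =>
        replace t with (RI (fun s => N i s v) u u') by ring end.
      eapply Rle_trans; [apply (RI_bound _ (cu i v) _ _ M); auto|].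
      rewrite Rabs_pos_eq by lra. lra.
    + rewrite <- (RI_chasles _ (cv i u') u' u v).
      match goal with |- Rabs ?t <= _ => replace t with
        ((g i u' - g i u) + (RI (fun s => N i u' s) u' u
         + (RI (fun s => N i u' s) u v - RI (fun s => N i u s) u v))) by ring end.
      assert (b1 := sd_glip _ _ _ _ _ _ _ _ S i u u' q1 q4).
      rewrite (Rabs_pos_eq (u' - u)) in b1 by lra.
      assert (b2 : Rabs (RI (fun s => N i u' s) u' u) <= M * (u' - u)).
      { replace (u' - u) with (Rabs (u - u')) by (rewrite Rabs_left1; lra).
        apply (RI_bound _ (cv i u')); auto. }
      assert (b3 : Rabs (RI (fun s => N i u' s) u v - RI (fun s => N i u s) u v)
                   <= M * b * Rabs (v - u)).
      { apply RI_diff_bound; auto. intros t ht.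
        rewrite Rmin_right, Rmax_left in ht by lra.
        destruct (tri_sub u u' v t t1 t2 huu ht) as [w1 w2].
        unfold N, on_box. rewrite !pi_box_id by (apply Uin; auto).
        apply (sd_lip _ _ _ _ _ _ _ _ S); try (apply Uin; assumption).
        split; auto. intros j. apply (Hb (j, t)). now split. }
      rewrite (Rabs_left1 (v - u)) in b3 by lra.
      assert (M * b * - (v - u) <= b / 2).
      { apply Rle_trans with (M * b * d); [|nra].
        apply Rmult_le_compat_l; [|lra]. apply Rmult_le_pos; lra. }
      eapply Rle_trans; [apply Rabs_triang|].
      eapply Rle_trans; [apply Rplus_le_compat_l, Rabs_triang|]. lra.
Qed.

(* The candidate W for the u-derivative: the components integrated along u have
   u-derivative N, and substituting this into the differentiated integral equations of
   the others leaves a linear system for them, solved by a second use of [picard]. *)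
Lemma linearized_system : exists W, BUC W
  /\ (forall i u v, dir i = true -> W i u v = N i u v)
  /\ (forall i u, dir i = false -> forall v, continuous (fun t : R => on_box_deriv W i u t) v)
  /\ (forall i u v, dir i = false -> strip a d u v ->
        W i u v = gp i u - N i u u + RI (fun t => on_box_deriv W i u t) u v).
Proof.
  pose proof (sd_pos _ _ _ _ _ _ _ _ S) as hM.
  pose proof (on_box_BUC U HU) as HN. fold N in HN.
  pose proof HN as [[MN [hMN HMN]] HNm].
  pose proof HU as [_ HUm].
  assert (hpin : forall u v, in_box lo hi (pi_box lo hi (fun j => U j u v))).
  { intros. apply pi_box_in, S. }
  set (mix := fun u v (X : I -> R) (j : I) => if dir j then N j u v else X j).
  set (F2 := fun i u v X => if dir i then 0
        else G i (pi_box lo hi (fun j => U j u v)) (mix u v X)).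
  (* The term - N(u, u) comes from the lower limit of the integral from u to v when the equation is
     differentiated in u. *)
  set (g2 := fun i u => if dir i then 0
        else gp i (ret1 a u) - N i (ret1 a u) (ret1 a u)).
  assert (hr1 : forall u, Rabs (ret1 a u) <= a).
  { intros u. destruct (ret_strip a d u 0 ha hd) as [h _]. exact h. }
  assert (F2_lip : forall i u v X Y b, nb (dlt X Y) b ->
    Rabs (F2 i u v Y - F2 i u v X) <= M * b).
  { intros i u v X Y b [hb1 hb2]. unfold F2. destruct (dir i).
    - rewrite Rminus_diag, Rabs_R0. apply Rmult_le_pos; lra.
    - rewrite lin_minus; [|apply (sd_lin _ _ _ _ _ _ _ _ S); auto].
      apply (sd_G _ _ _ _ _ _ _ _ S); auto. split; auto. intros j. unfold mix.
      destruct (dir j); [rewrite Rminus_diag, Rabs_R0; auto|]. apply hb2. }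
  assert (F2_bound : exists M, 0 < M /\ forall i u v, Rabs (F2 i u v (fun _ => 0)) <= M).
  { exists (M * MN). split; [now apply Rmult_lt_0_compat|]. intros i u v. unfold F2.
    destruct (dir i).
    - rewrite Rabs_R0. apply Rmult_le_pos; lra.
    - apply (sd_G _ _ _ _ _ _ _ _ S); auto. split; [lra|]. intros j. unfold mix.
      destruct (dir j); auto. rewrite Rabs_R0. lra. }
  assert (F2_uc : forall K e, 0 < e -> exists r, 0 < r /\
    forall i u v u' v' X, nb X K -> Rabs (u' - u) <= r -> Rabs (v' - v) <= r ->
    Rabs (F2 i u' v' X - F2 i u v X) <= e).
  { intros K e he.
    set (c := MN + Rabs K). assert (hc : 0 < c) by (pose proof (Rabs_pos K); unfold c; lra).
    destruct (sd_mod _ _ _ _ _ _ _ _ S (e / (2 * c))) as [r0 [hr0 Hr0]].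
    { apply Rdiv_lt_0_compat; lra. }
    destruct (HUm r0 hr0) as [r3 [hr3 Hr3]].
    destruct (HNm (e / (2 * M))) as [r4 [hr4 Hr4]]; [apply Rdiv_lt_0_compat; lra|].
    exists (Rmin r3 r4). split; [now apply Rmin_glb_lt|].
    intros i u v u' v' X [hK HX] hu hv.
    pose proof (Rmin_l r3 r4). pose proof (Rmin_r r3 r4).
    unfold F2. destruct (dir i); [rewrite Rminus_diag, Rabs_R0; lra|].
    set (A := pi_box lo hi (fun j => U j u v)). set (A' := pi_box lo hi (fun j => U j u' v')).
    assert (hA : in_box lo hi A) by apply hpin.
    assert (hA' : in_box lo hi A') by apply hpin.
    assert (hmc : nb (mix u v X) c).
    { split; [lra|]. intros j. unfold mix, c. pose proof (Rabs_pos K).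
      pose proof (Rle_abs K). specialize (HX j).
      destruct (dir j); [|lra]. specialize (HMN j u v). lra. }
    destruct (Hr0 i A A' hA hA' r0) as [_ h1]; [lra| |].
    { apply pi_box_lip. split; [lra|]. intros j. apply Hr3; lra. }
    specialize (h1 _ _ hmc).
    assert (h2 : Rabs (G i A' (mix u' v' X) - G i A' (mix u v X)) <= M * (e / (2 * M))).
    { rewrite lin_minus; [|apply (sd_lin _ _ _ _ _ _ _ _ S); auto].
      apply (sd_G _ _ _ _ _ _ _ _ S); auto.
      assert (0 < e / (2 * M)) by (apply Rdiv_lt_0_compat; lra).
      split; [lra|]. intros j. unfold mix.
      destruct (dir j); [apply Hr4; lra|]. rewrite Rminus_diag, Rabs_R0; lra. }
    replace (e / (2 * c) * c) with (e / 2) in h1 by (field; lra).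
    replace (M * (e / (2 * M))) with (e / 2) in h2 by (field; lra).
    match goal with |- Rabs ?t <= _ => replace t with
      ((G i A' (mix u' v' X) - G i A' (mix u v X))
       + (G i A' (mix u v X) - G i A (mix u v X))) by ring end.
    eapply Rle_trans; [apply Rabs_triang|]. lra. }
  assert (g2_bound : exists M, 0 < M /\ forall i u, Rabs (g2 i u) <= M).
  { exists (M + MN). split; [lra|]. intros i u. unfold g2.
    destruct (dir i); [rewrite Rabs_R0; lra|].
    destruct (sd_g _ _ _ _ _ _ _ _ S i _ (hr1 u)) as [_ h].
    unfold Rminus. eapply Rle_trans; [apply Rabs_triang|]. rewrite Rabs_Ropp.
    specialize (HMN i (ret1 a u) (ret1 a u)). lra. }
  assert (g2_uc : forall e, 0 < e -> exists r, 0 < r /\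
    forall i u u', Rabs (u' - u) <= r -> Rabs (g2 i u' - g2 i u) <= e).
  { intros e he. destruct (sd_gmod _ _ _ _ _ _ _ _ S (e / 2)) as [r3 [hr3 Hr3]]; [lra|].
    destruct (HNm (e / 2)) as [r4 [hr4 Hr4]]; [lra|].
    exists (Rmin r3 r4). split; [now apply Rmin_glb_lt|]. intros i u u' hu.
    pose proof (Rmin_l r3 r4). pose proof (Rmin_r r3 r4).
    pose proof (clamp_lip (-a) a u u') as hl. fold (ret1 a u) in hl. fold (ret1 a u') in hl.
    unfold g2. destruct (dir i); [rewrite Rminus_diag, Rabs_R0; lra|].
    destruct (Hr3 i (ret1 a u) (ret1 a u')) as [_ k1]; auto; [lra|].
    assert (k2 : Rabs (N i (ret1 a u') (ret1 a u') - N i (ret1 a u) (ret1 a u)) <= e / 2)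
      by (apply Hr4; lra).
    apply Rabs_le_between in k1. apply Rabs_le_between in k2. apply Rabs_le_between. lra. }
  destruct (picard dir F2 g2 a d M ha hd (Rlt_le _ _ hM) hdM F2_lip F2_bound F2_uc
              g2_bound g2_uc) as [W0 [HW0 Heq]].
  set (W := fun i u v => if dir i then N i u v else W0 i u v).
  pose proof (nemytskii_BUC F2 M (Rlt_le _ _ hM) F2_lip F2_bound F2_uc W0 HW0) as HF2.
  assert (hder : forall i u v, dir i = false ->
            nemytskii F2 W0 i u v = on_box_deriv W i u v).
  { intros i u v hi'. unfold nemytskii, F2, on_box_deriv. rewrite hi'. reflexivity. }
  exists W. repeat split.
  - destruct HW0 as [[M0 [hM0 HM0]] _]. exists (MN + M0). split; [lra|].
    intros i u v. unfold W. specialize (HMN i u v). specialize (HM0 i u v).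
    destruct (dir i); lra.
  - intros e he. destruct HW0 as [_ H0]. destruct (H0 e he) as [r3 [hr3 Hr3]].
    destruct (HNm e he) as [r4 [hr4 Hr4]].
    exists (Rmin r3 r4). split; [now apply Rmin_glb_lt|].
    pose proof (Rmin_l r3 r4). pose proof (Rmin_r r3 r4).
    intros i u v u' v' hu hv. unfold W. destruct (dir i).
    + apply Hr4; lra.
    + apply Hr3; lra.
  - intros i u v hi'. unfold W. now rewrite hi'.
  - intros i u hi' v. apply (continuous_ext (fun t => nemytskii F2 W0 i u t)).
    + intros t. now apply hder.
    + apply (BUC_continuous_v (nemytskii F2 W0)); auto.
  - intros i u v hi' hs. unfold W at 1. rewrite hi', Heq; auto. rewrite hi'.
    unfold g2. rewrite hi'. destruct (ret_id a d u v hs) as [-> _]. f_equal.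
    apply RInt_ext. intros t _. now rewrite <- (hder i u t hi').
Qed.

(** The remainder U(u') - U(u) - (u' - u) W obeys the integral inequality of the linearized system
    with a source of order e (u' - u), and vanishes to first order on the diagonal; halving then
    bounds it. *)
Lemma U_derivative_u W :
  BUC W -> (forall i u v, dir i = true -> W i u v = N i u v) ->
  (forall i u, dir i = false -> forall v, continuous (fun t : R => on_box_deriv W i u t) v) ->
  (forall i u v, dir i = false -> strip a d u v ->
        W i u v = gp i u - N i u u + RI (fun t => on_box_deriv W i u t) u v) ->
  forall e, 0 < e -> exists r, 0 < r /\ forall i u u' v,
    tri a d u v -> tri a d u' v -> Rabs (u' - u) <= r ->
    Rabs (U i u' v - U i u v - (u' - u) * W i u v) <= e * Rabs (u' - u).
Proof.
  intros HW W1 Wc W2.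
  pose proof (sd_pos _ _ _ _ _ _ _ _ S) as hM.
  pose proof (on_box_BUC U HU) as HN. fold N in HN.
  pose proof (fun i v => BUC_continuous_u N i v HN) as cu.
  pose proof (fun i u => BUC_continuous_v N i u HN) as cv.
  destruct HN as [_ HNm]. pose proof HW as [[Mw [hMw HMw]] HWm].
  assert (right : forall e, 0 < e -> exists r, 0 < r /\ forall i u u' v,
    tri a d u v -> tri a d u' v -> 0 <= u' - u <= r ->
    Rabs (U i u' v - U i u v - (u' - u) * W i u v) <= e * (u' - u)).
  { intros e he.
    (* Halving doubles the source, which consists of e1 h from the datum, e1 h from the moved end
       point, and 4 M d e1 h from linearizing F over increments of size 4 M h. *)
    set (c := 2 * (2 + 4 * M * d)).
    assert (hc : 0 < c) by (unfold c; nra).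
    set (e1 := e / c). assert (he1 : 0 < e1) by now apply Rdiv_lt_0_compat.
    destruct (sd_mod _ _ _ _ _ _ _ _ S e1 he1) as [r1 [hr1 Hr1]].
    destruct (sd_gmod _ _ _ _ _ _ _ _ S e1 he1) as [r2 [hr2 Hr2]].
    destruct (HNm e1 he1) as [r3 [hr3 Hr3]].
    set (r4 := r1 / (4 * M)). assert (hr4 : 0 < r4) by (apply Rdiv_lt_0_compat; lra).
    exists (Rmin (Rmin r2 r3) r4). split; [repeat apply Rmin_glb_lt; auto|].
    intros i u u' v t1 t2 hh.
    pose proof (Rmin_l (Rmin r2 r3) r4). pose proof (Rmin_r (Rmin r2 r3) r4).
    pose proof (Rmin_l r2 r3). pose proof (Rmin_r r2 r3).
    set (h := u' - u) in *.
    assert (hMh : 4 * M * h <= r1).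
    { apply Rle_trans with (4 * M * r4); [apply Rmult_le_compat_l; lra|].
      unfold r4. right. field. lra. }
    set (P := fun p : I * R => tri a d u (snd p) /\ tri a d u' (snd p)).
    set (f := fun p : I * R => U (fst p) u' (snd p) - U (fst p) u (snd p)
                               - h * W (fst p) u (snd p)).
    replace (e * h) with (2 * (e1 * h * (2 + 4 * M * d))) by (unfold e1, c; field; nra).
    change (Rabs (f (i, v)) <= 2 * (e1 * h * (2 + 4 * M * d))).
    assert (hP : P (i, v)) by (split; auto).
    revert hP. generalize (i, v). clear i v t1 t2.
    apply (bound_of_halving (I * R) P f _ (4 * M * h + h * Mw)).
    - apply Rmult_le_pos; nra.
    - intros [i v] [q1 q2]. unfold f; simpl in *. unfold Rminus at 1.
      eapply Rle_trans; [apply Rabs_triang|]. rewrite Rabs_Ropp, Rabs_mult.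
      rewrite (Rabs_pos_eq h) by lra. apply Rplus_le_compat.
      + apply U_lipschitz_u; auto. unfold h in hh. lra.
      + apply Rmult_le_compat_l; [lra|auto].
    - intros b hb Hb [i v] [t1 t2]. unfold f; simpl in *.
      rewrite (Usol u' v t2 i), (Usol u v t1 i). fold N.
      pose proof t1 as [q1 [q2 q3]]. pose proof t2 as [q4 [q5 q6]].
      assert (huu : u <= u') by (unfold h in hh; lra).
      assert (habs : Rabs (u' - u) = h) by (rewrite Rabs_pos_eq; auto; unfold h in hh; lra).
      assert (heh : 0 <= e1 * h) by nra.
      assert (h0 : 0 <= 4 * M * d) by nra.
      destruct (dir i) eqn:Edir.
      + rewrite <- (RI_chasles _ (cu i v) v u u'), W1; auto.
        match goal with |- Rabs ?t <= _ =>
          replace t with (RI (fun s => N i s v) u u' - (u' - u) * N i u v)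
            by (unfold h; ring) end.
        eapply Rle_trans; [apply (RI_lin_bound _ _ _ _ e1 (cu i v))|].
        * intros s hs. rewrite Rmin_left, Rmax_right in hs by lra.
          apply Hr3; [rewrite Rabs_pos_eq; unfold h in hh; lra|].
          rewrite Rminus_diag, Rabs_R0; lra.
        * rewrite habs. nra.
      + rewrite <- (RI_chasles _ (cv i u') u' u v), W2; auto; [|now apply tri_strip].
        rewrite (RI_swap _ (cv i u') u u').
        match goal with |- Rabs ?t <= _ => replace t with
          ((g i u' - g i u - gp i u * (u' - u))
           + (- (RI (fun s => N i u' s) u u' - (u' - u) * N i u u)
           + ((RI (fun s => N i u' s) u v - RI (fun s => N i u s) u v)
           - h * RI (fun t0 => on_box_deriv W i u t0) u v))) by (unfold h; ring) end.
        assert (b1 : Rabs (g i u' - g i u - gp i u * (u' - u)) <= e1 * h).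
        { rewrite <- habs. apply Hr2; auto. rewrite habs. lra. }
        assert (b2 : Rabs (RI (fun s => N i u' s) u u' - (u' - u) * N i u u) <= e1 * h).
        { rewrite <- habs. apply RI_lin_bound; auto. intros s hs.
          rewrite Rmin_left, Rmax_right in hs by lra.
          apply Hr3; [rewrite habs; lra|]. rewrite Rabs_pos_eq; unfold h in hh; lra. }
        assert (b3 : Rabs ((RI (fun s => N i u' s) u v - RI (fun s => N i u s) u v)
           - h * RI (fun t0 => on_box_deriv W i u t0) u v)
           <= (e1 * (4 * M * h) + M * b) * Rabs (v - u)).
        { rewrite RI_minus; auto.
          assert (Escal : h * RI (fun t0 => on_box_deriv W i u t0) u v
                 = RI (fun t0 => h * on_box_deriv W i u t0) u v).
          { symmetry. apply (RInt_scal (fun t0 => on_box_deriv W i u t0) u v h).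
            apply RI_ex. auto. }
          rewrite Escal. apply RI_diff_bound.
          - intros x. apply (continuous_minus (fun s => N i u' s) (fun s => N i u s)); auto.
          - intros x. apply (continuous_scal_r h (fun t0 => on_box_deriv W i u t0)); auto.
          - intros t ht. rewrite Rmin_right, Rmax_left in ht by lra.
            destruct (tri_sub u u' v t t1 t2 huu ht) as [w1 w2].
            unfold N, on_box, on_box_deriv. rewrite !pi_box_id by (apply Uin; auto).
            set (X := fun j => U j u t). set (Y := fun j => U j u' t).
            assert (hX : in_box lo hi X) by now apply Uin.
            assert (hY : in_box lo hi Y) by now apply Uin.
            assert (hXY : nb (dlt X Y) (4 * M * h)).
            { split; [nra|]. intros j. apply U_lipschitz_u; auto. }
            destruct (Hr1 i X Y hX hY _ hMh hXY) as [k1 _].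
            destruct (sd_lin _ _ _ _ _ _ _ _ S i X hX) as [_ lsc].
            rewrite <- lsc.
            replace (F i Y - F i X - G i X (fun j => h * W j u t)) with
              ((F i Y - F i X - G i X (dlt X Y))
               + (G i X (dlt X Y) - G i X (fun j => h * W j u t))) by ring.
            eapply Rle_trans; [apply Rabs_triang|]. apply Rplus_le_compat; auto.
            rewrite lin_minus; [|apply (sd_lin _ _ _ _ _ _ _ _ S); auto].
            apply (sd_G _ _ _ _ _ _ _ _ S); auto. split; auto.
            intros j. apply (Hb (j, t)). now split. }
        assert (hvu : Rabs (v - u) <= d) by (rewrite Rabs_left1; lra).
        assert (b4 : (e1 * (4 * M * h) + M * b) * Rabs (v - u) <= e1 * h * (4 * M * d) + b / 2).
        { apply Rle_trans with ((e1 * (4 * M * h) + M * b) * d).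
          - apply Rmult_le_compat_l; auto.
            assert (0 <= e1 * (4 * M * h)) by nra. nra.
          - nra. }
        eapply Rle_trans; [apply Rabs_triang|].
        eapply Rle_trans; [apply Rplus_le_compat_l, Rabs_triang|]. rewrite Rabs_Ropp. lra. }
  (* For u' < u the expansion based at u' is rebased at u by the uniform continuity of W. *)
  intros e he. destruct (right (e / 2)) as [r1 [hr1 Hr1]]; [lra|].
  destruct (HWm (e / 2)) as [r2 [hr2 Hr2]]; [lra|].
  exists (Rmin r1 r2). split; [now apply Rmin_glb_lt|].
  pose proof (Rmin_l r1 r2). pose proof (Rmin_r r1 r2).
  intros i u u' v t1 t2 hh. destruct (Rle_dec u u') as [h|h].
  - rewrite (Rabs_pos_eq (u' - u)) in * by lra.
    eapply Rle_trans; [apply Hr1; auto; lra|]. nra.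
  - pose proof hh as hh'. rewrite (Rabs_left (u' - u)) in hh' by lra.
    specialize (Hr1 i u' u v t2 t1 ltac:(lra)).
    specialize (Hr2 i u v u' v). rewrite Rminus_diag, Rabs_R0 in Hr2.
    specialize (Hr2 ltac:(lra) ltac:(lra)).
    replace (U i u' v - U i u v - (u' - u) * W i u v) with
      (- (U i u v - U i u' v - (u - u') * W i u' v) + (u' - u) * (W i u' v - W i u v)) by ring.
    eapply Rle_trans; [apply Rabs_triang|]. rewrite Rabs_Ropp, Rabs_mult.
    pose proof (Rabs_pos (u' - u)).
    assert (Rabs (u' - u) * Rabs (W i u' v - W i u v) <= Rabs (u' - u) * (e / 2))
      by (apply Rmult_le_compat_l; auto).
    rewrite (Rabs_left (u' - u)) in * by lra. lra.
Qed.

End regularity.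

Lemma RI_opp (h : R -> R) a b : (forall x, continuous h x) ->
  RI (fun t => - h t) a b = - RI h a b.
Proof. intros hc. exact (RInt_opp h a b (RI_ex h hc a b)). Qed.

(* The reflection (u, v) -> (-v, -u) preserves the triangle and exchanges the two
   directions of integration. *)
Definition reflect {I : Type} (U : I -> R -> R -> R) (i : I) (u v : R) : R :=
  U i (- v) (- u).

Lemma tri_reflect a d u v : tri a d u v -> tri a d (- v) (- u).
Proof.
  intros [h1 [h2 h3]]. unfold tri. rewrite !Rabs_Ropp. repeat split; auto; lra.
Qed.

Lemma strip_reflect a d u v : strip a d u v -> strip a d (- v) (- u).
Proof.
  intros [h1 [h2 h3]]. unfold strip. rewrite !Rabs_Ropp. repeat split; auto.
  replace (- v - - u) with (u - v) by ring. auto.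
Qed.

Lemma BUC_reflect {I : Type} (U : I -> R -> R -> R) : BUC U -> BUC (reflect U).
Proof.
  intros [[M [hM HM]] H]. split.
  - exists M. split; auto. intros; apply HM.
  - intros e he. destruct (H e he) as [r [hr Hr]]. exists r. split; auto.
    intros i u v u' v' hu hv. apply Hr.
    + replace (- v' - - v) with (- (v' - v)) by ring. now rewrite Rabs_Ropp.
    + replace (- u' - - u) with (- (u' - u)) by ring. now rewrite Rabs_Ropp.
Qed.

Lemma BUC_opp {I : Type} (U : I -> R -> R -> R) : BUC U -> BUC (fun i u v => - U i u v).
Proof.
  intros [[M [hM HM]] H]. split.
  - exists M. split; auto. intros. rewrite Rabs_Ropp; apply HM.
  - intros e he. destruct (H e he) as [r [hr Hr]]. exists r. split; auto.
    intros i u v u' v' hu hv.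
    replace (- U i u' v' - - U i u v) with (- (U i u' v' - U i u v)) by ring.
    rewrite Rabs_Ropp. auto.
Qed.

(** The reflection reverses the orientation of the paths of integration, whence the sign of F and G,
    and it maps the diagonal point w to - w. *)
Lemma system_data_reflect {I : Type} (lo hi : I -> R) F G g gp a M :
  system_data lo hi F G g gp a M ->
  system_data lo hi (fun i X => - F i X) (fun i X h => - G i X h)
    (fun i w => g i (- w)) (fun i w => - gp i (- w)) a M.
Proof.
  intros S. constructor; try apply S.
  - intros i X hX. destruct (sd_lin _ _ _ _ _ _ _ _ S i X hX) as [h1 h2].
    split; intros; rewrite ?h1, ?h2; ring.
  - intros. rewrite Rabs_Ropp. now apply (sd_F _ _ _ _ _ _ _ _ S).
  - intros. rewrite Rabs_Ropp. now apply (sd_G _ _ _ _ _ _ _ _ S).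
  - intros i X Y hX hY b hb. replace (- F i Y - - F i X) with (- (F i Y - F i X)) by ring.
    rewrite Rabs_Ropp. now apply (sd_lip _ _ _ _ _ _ _ _ S).
  - intros e he. destruct (sd_mod _ _ _ _ _ _ _ _ S e he) as [r [hr Hr]].
    exists r. split; auto. intros i X Y hX hY b hb hn.
    destruct (Hr i X Y hX hY b hb hn) as [h1 h2]. split.
    + match goal with |- Rabs ?t <= _ =>
        replace t with (- (F i Y - F i X - G i X (dlt X Y))) by ring end.
      now rewrite Rabs_Ropp.
    + intros h c hc.
      replace (- G i Y h - - G i X h) with (- (G i Y h - G i X h)) by ring.
      rewrite Rabs_Ropp. auto.
  - intros i w hw. rewrite Rabs_Ropp. apply (sd_g _ _ _ _ _ _ _ _ S). now rewrite Rabs_Ropp.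
  - intros i w w' hw hw'. replace (w' - w) with (- (- w' - - w)) by ring.
    rewrite Rabs_Ropp. apply (sd_glip _ _ _ _ _ _ _ _ S); now rewrite Rabs_Ropp.
  - intros e he. destruct (sd_gmod _ _ _ _ _ _ _ _ S e he) as [r [hr Hr]].
    exists r. split; auto. intros i w w' hw hw' h.
    assert (E : Rabs (- w' - - w) = Rabs (w' - w)).
    { replace (- w' - - w) with (- (w' - w)) by ring. apply Rabs_Ropp. }
    destruct (Hr i (- w) (- w')) as [h1 h2]; rewrite ?Rabs_Ropp, ?E; auto.
    rewrite E in h1. split.
    + replace (g i (- w') - g i (- w) - - gp i (- w) * (w' - w))
        with (g i (- w') - g i (- w) - gp i (- w) * (- w' - - w)) by ring. auto.
    + replace (- gp i (- w') - - gp i (- w)) with (- (gp i (- w') - gp i (- w))) by ring.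
      now rewrite Rabs_Ropp.
Qed.

Section full_regularity.
Context {I : Type}.
Variables (dir : I -> bool) (lo hi : I -> R) (F : I -> (I -> R) -> R)
  (G : I -> (I -> R) -> (I -> R) -> R) (g gp : I -> R -> R) (a d M : R).
Hypotheses (ha : 0 < a) (hd : 0 < d) (hdM : d * M <= 1 / 2).
Hypothesis S : system_data lo hi F G g gp a M.
Variable U : I -> R -> R -> R.
Hypothesis HU : BUC U.
Hypothesis Usol : forall u v, tri a d u v -> solves dir (on_box lo hi F U) U g u v.
Hypothesis Uin : forall u v, tri a d u v -> in_box lo hi (fun j => U j u v).
Let N := on_box lo hi F U.

(** The reflected system turns v-derivatives into u-derivatives. The integral equation for [W] is
    kept in the conclusion because the v-derivatives are identified through it later. *)
Lemma U_derivative_v : exists W, BUC W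
  /\ (forall i u v, dir i = false -> W i u v = N i u v)
  /\ (forall i v, dir i = true -> forall u,
        continuous (fun s : R => on_box_deriv lo hi G U W i s v) u)
  /\ (forall i u v, dir i = true -> strip a d u v ->
        W i u v = gp i v - N i v v + RI (fun s => on_box_deriv lo hi G U W i s v) v u)
  /\ forall e, 0 < e -> exists r, 0 < r /\ forall i u v v',
       tri a d u v -> tri a d u v' -> Rabs (v' - v) <= r ->
       Rabs (U i u v' - U i u v - (v' - v) * W i u v) <= e * Rabs (v' - v).
Proof.
  pose proof (on_box_BUC _ _ _ _ _ _ _ _ S U HU) as HN. fold N in HN.
  pose proof (system_data_reflect _ _ _ _ _ _ _ _ S) as S'.
  set (dir' := fun i => negb (dir i)).
  set (F' := fun i X => - F i X) in *. set (G' := fun i X h => - G i X h) in *.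
  set (g' := fun i w => g i (- w)) in *. set (gp' := fun i w => - gp i (- w)) in *.
  set (U' := reflect U).
  assert (HU' : BUC U') by now apply BUC_reflect.
  assert (EN : forall i u v, on_box lo hi F' U' i u v = - N i (- v) (- u)) by reflexivity.
  assert (Usol' : forall u v, tri a d u v -> solves dir' (on_box lo hi F' U') U' g' u v).
  { intros u v ht i. unfold U', reflect, dir', g'.
    rewrite (Usol _ _ (tri_reflect _ _ _ _ ht) i). destruct (dir i); simpl; f_equal.
    - rewrite RI_reflect; [|apply (BUC_continuous_u N); auto].
      symmetry. apply (RI_opp (fun t => N i (- t) (- u))).
      intros x. apply (BUC_continuous_v (reflect N) i u (BUC_reflect _ HN) x).
    - rewrite RI_reflect; [|apply (BUC_continuous_v N); auto].
      symmetry. apply (RI_opp (fun t => N i (- v) (- t))).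
      intros x. apply (BUC_continuous_u (reflect N) i v (BUC_reflect _ HN) x). }
  assert (Uin' : forall u v, tri a d u v -> in_box lo hi (fun j => U' j u v)).
  { intros u v ht. apply (Uin _ _ (tri_reflect _ _ _ _ ht)). }
  destruct (linearized_system dir' lo hi F' G' g' gp' a d M ha hd hdM S' U' HU')
    as [W' [HW' [W1 [Wc W2]]]].
  pose proof (U_derivative_u dir' lo hi F' G' g' gp' a d M hd hdM S' U' HU' Usol' Uin'
    W' HW' W1 Wc W2) as Hder.
  set (W := fun i u v => - W' i (- v) (- u)).
  assert (ED : forall i u v, on_box_deriv lo hi G' U' W' i u v
                             = on_box_deriv lo hi G U W i (- v) (- u)).
  { intros i u v. unfold on_box_deriv, G', U', reflect, W.
    set (X := pi_box lo hi _).
    assert (hX : in_box lo hi X) by apply pi_box_in, S.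
    destruct (sd_lin _ _ _ _ _ _ _ _ S i X hX) as [_ l2].
    specialize (l2 (-1) (fun j => W' j u v)).
    replace (- G i X (fun j => W' j u v)) with (-1 * G i X (fun j => W' j u v)) by ring.
    rewrite <- l2. f_equal. apply functional_extensionality. intros j.
    rewrite !Ropp_involutive. ring. }
  assert (Ebox : forall i s v, on_box_deriv lo hi G U W i s v
                  = on_box_deriv lo hi G' U' W' i (- v) (- s)).
  { intros. rewrite ED, !Ropp_involutive. reflexivity. }
  assert (Wc' : forall i v, dir i = true -> forall u,
        continuous (fun s : R => on_box_deriv lo hi G U W i s v) u).
  { intros i v hi' u.
    apply (continuous_ext (fun s => on_box_deriv lo hi G' U' W' i (- v) (- s))).
    { intros s. now rewrite Ebox. }
    apply (continuous_comp Ropp (fun t => on_box_deriv lo hi G' U' W' i (- v) t)).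
    - apply (continuous_opp (fun t : R => t) u). apply continuous_id.
    - apply Wc. unfold dir'. now rewrite hi'. }
  exists W. split; [|split; [|split; [exact Wc'|split]]].
  - apply (BUC_opp (reflect W')). now apply BUC_reflect.
  - intros i u v hi'. unfold W. rewrite W1; [|unfold dir'; now rewrite hi'].
    rewrite EN, !Ropp_involutive. reflexivity.
  - intros i u v hi' hs. unfold W at 1.
    rewrite W2; [|unfold dir'; now rewrite hi'|now apply strip_reflect].
    rewrite EN, !Ropp_involutive. unfold gp'. rewrite Ropp_involutive.
    rewrite (RI_reflect _ v u); [|apply Wc; unfold dir'; now rewrite hi'].
    assert (E : RI (fun t => on_box_deriv lo hi G' U' W' i (- v) (- t)) v u
                = RI (fun s => on_box_deriv lo hi G U W i s v) v u).
    { apply RInt_ext. intros t _. now rewrite Ebox. }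
    rewrite E. ring.
  - intros e he. destruct (Hder e he) as [r [hr Hr]]. exists r. split; auto.
    intros i u v v' t1 t2 hv.
    assert (E : Rabs (- v' - - v) = Rabs (v' - v)).
    { replace (- v' - - v) with (- (v' - v)) by ring. apply Rabs_Ropp. }
    specialize (Hr i (- v) (- v') (- u) (tri_reflect _ _ _ _ t1) (tri_reflect _ _ _ _ t2)).
    rewrite E in Hr. specialize (Hr hv).
    unfold U', reflect in Hr. rewrite !Ropp_involutive in Hr. unfold W.
    replace (U i u v' - U i u v - (v' - v) * - W' i (- v) (- u))
      with (U i u v' - U i u v - (- v' - - v) * W' i (- v) (- u)) by ring. exact Hr.
Qed.

Theorem solution_regular : exists Wu Wv, BUC Wu /\ BUC Wv
  /\ (forall i u v, dir i = true -> Wu i u v = N i u v)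
  /\ (forall i u v, dir i = false -> Wv i u v = N i u v)
  /\ (forall i v, dir i = true -> forall u,
        continuous (fun s : R => on_box_deriv lo hi G U Wv i s v) u)
  /\ (forall i u v, dir i = true -> strip a d u v ->
        Wv i u v = gp i v - N i v v + RI (fun s => on_box_deriv lo hi G U Wv i s v) v u)
  /\ forall e, 0 < e -> exists r, 0 < r /\ forall i u v u' v' b,
       tri a d u v -> tri a d u' v' -> b <= r -> Rabs (u' - u) <= b -> Rabs (v' - v) <= b ->
       Rabs (U i u' v' - U i u v - ((u' - u) * Wu i u v + (v' - v) * Wv i u v)) <= e * b.
Proof.
  destruct (linearized_system dir lo hi F G g gp a d M ha hd hdM S U HU)
    as [Wu [HWu [W1 [Wc W2]]]].
  pose proof (U_derivative_u dir lo hi F G g gp a d M hd hdM S U HU Usol Uin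
    Wu HWu W1 Wc W2) as Hu.
  destruct U_derivative_v as [Wv [HWv [V1 [Vc [V2 Hv]]]]].
  exists Wu, Wv. repeat (split; auto).
  intros e he.
  destruct (Hu (e / 4)) as [r1 [hr1 Hr1]]; [lra|].
  destruct (Hv (e / 4)) as [r2 [hr2 Hr2]]; [lra|].
  destruct HWu as [_ Hum]. destruct HWv as [_ Hvm].
  destruct (Hum (e / 4)) as [r3 [hr3 Hr3]]; [lra|].
  destruct (Hvm (e / 4)) as [r4 [hr4 Hr4]]; [lra|].
  exists (Rmin (Rmin (Rmin r1 r2) (Rmin r3 r4)) (d / 2)).
  split; [repeat apply Rmin_glb_lt; auto; lra|].
  intros i u v u' v' b t1 t2 hb hu hv.
  pose proof (Rmin_l (Rmin (Rmin r1 r2) (Rmin r3 r4)) (d / 2)).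
  pose proof (Rmin_r (Rmin (Rmin r1 r2) (Rmin r3 r4)) (d / 2)).
  pose proof (Rmin_l (Rmin r1 r2) (Rmin r3 r4)). pose proof (Rmin_r (Rmin r1 r2) (Rmin r3 r4)).
  pose proof (Rmin_l r1 r2). pose proof (Rmin_r r1 r2).
  pose proof (Rmin_l r3 r4). pose proof (Rmin_r r3 r4).
  assert (hb0 : 0 <= b) by (eapply Rle_trans; [apply Rabs_pos|exact hu]).
  assert (z : forall x : R, Rabs (x - x) <= 0).
  { intros. rewrite Rminus_diag, Rabs_R0. lra. }
  (* The expansion follows the two sides of a rectangle. The triangle has a slanted edge, but for
     increments of at most d / 2 one of the two corners lies in it. *)
  assert (corner : tri a d u' v \/ tri a d u v').
  { pose proof (proj1 (Rabs_le_between _ _) hu). pose proof (proj1 (Rabs_le_between _ _) hv).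
    destruct t1 as [p1 [p2 p3]]. destruct t2 as [p4 [p5 p6]]. unfold tri.
    destruct (Rle_dec 0 (u' - v)); destruct (Rle_dec (u' - v) d);
    destruct (Rle_dec 0 (u - v')); destruct (Rle_dec (u - v') d);
    try (left; repeat split; auto; lra); try (right; repeat split; auto; lra); lra. }
  pose proof (Rabs_pos (u' - u)). pose proof (Rabs_pos (v' - v)).
  destruct corner as [c|c].
  - specialize (Hr1 i u u' v t1 c ltac:(lra)).
    specialize (Hr2 i u' v v' c t2 ltac:(lra)).
    assert (k : Rabs (Wv i u' v - Wv i u v) <= e / 4)
      by (apply Hr4; [lra|eapply Rle_trans; [apply z|lra]]).
    replace (U i u' v' - U i u v - ((u' - u) * Wu i u v + (v' - v) * Wv i u v)) with
      ((U i u' v - U i u v - (u' - u) * Wu i u v)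
       + ((U i u' v' - U i u' v - (v' - v) * Wv i u' v)
          + (v' - v) * (Wv i u' v - Wv i u v))) by ring.
    eapply Rle_trans; [apply Rabs_triang|].
    eapply Rle_trans; [apply Rplus_le_compat_l, Rabs_triang|]. rewrite Rabs_mult.
    pose proof (Rabs_pos (Wv i u' v - Wv i u v)). nra.
  - specialize (Hr1 i u u' v' c t2 ltac:(lra)).
    specialize (Hr2 i u v v' t1 c ltac:(lra)).
    assert (k : Rabs (Wu i u v' - Wu i u v) <= e / 4)
      by (apply Hr3; [eapply Rle_trans; [apply z|lra]|lra]).
    replace (U i u' v' - U i u v - ((u' - u) * Wu i u v + (v' - v) * Wv i u v)) with
      ((U i u v' - U i u v - (v' - v) * Wv i u v)
       + ((U i u' v' - U i u v' - (u' - u) * Wu i u v')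
          + (u' - u) * (Wu i u v' - Wu i u v))) by ring.
    eapply Rle_trans; [apply Rabs_triang|].
    eapply Rle_trans; [apply Rplus_le_compat_l, Rabs_triang|]. rewrite Rabs_mult.
    pose proof (Rabs_pos (Wu i u v' - Wu i u v)). nra.
Qed.

End full_regularity.

(** * Gradients on convex sets *)

Definition near (r : R) (p q : R * R) : Prop :=
  Rabs (fst q - fst p) <= r /\ Rabs (snd q - snd p) <= r.

Definition pair_dot (h v : R * R) : R := fst h * fst v + snd h * snd v.

Lemma pair_dot_bound h v b c : Rabs (fst h) <= b -> Rabs (snd h) <= b ->
  Rabs (fst v) <= c -> Rabs (snd v) <= c -> Rabs (pair_dot h v) <= 2 * (c * b).
Proof.
  intros. unfold pair_dot. eapply Rle_trans; [apply Rabs_triang|]. rewrite !Rabs_mult.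
  pose proof (Rabs_pos (fst h)). pose proof (Rabs_pos (snd h)).
  pose proof (Rabs_pos (fst v)). pose proof (Rabs_pos (snd v)).
  assert (Rabs (fst h) * Rabs (fst v) <= b * c) by (apply Rmult_le_compat; auto).
  assert (Rabs (snd h) * Rabs (snd v) <= b * c) by (apply Rmult_le_compat; auto). lra.
Qed.

Lemma within_near (D : R * R -> Prop) p (P : R * R -> Prop) :
  within D (locally p) P <-> exists r, 0 < r /\ forall q, D q -> near r p q -> P q.
Proof.
  split.
  - intros [eps H]. exists (eps / 2). destruct eps as [eps heps]; simpl in *.
    split; [lra|]. intros q hq [h1 h2]. apply H; auto.
    split; unfold ball; simpl; unfold AbsRing_ball, abs, minus, plus, opp; simpl;
    unfold Rminus in *; lra.
  - intros [r [hr H]]. exists (mkposreal r hr). intros q [h1 h2] hq.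
    apply H; auto. unfold ball in *; simpl in *. unfold AbsRing_ball, abs, minus, plus, opp in *.
    simpl in *. split; unfold Rminus; lra.
Qed.

Lemma is_grad_intro (D : R * R -> Prop) f p v : D p ->
  (forall e, 0 < e -> exists r, 0 < r /\ forall q b, D q -> b <= r -> near b p q ->
     Rabs (f q - f p - pair_dot (fst q - fst p, snd q - snd p) v) <= e * b) ->
  is_grad D f p v.
Proof.
  intros Hp H. split.
  - split.
    + intros x y. unfold plus; simpl. unfold plus; simpl. ring.
    + intros k x. unfold scal; simpl. unfold scal; simpl. unfold mult; simpl. ring.
    + exists (Rabs (fst v) + Rabs (snd v) + 1). split.
      * pose proof (Rabs_pos (fst v)). pose proof (Rabs_pos (snd v)). lra.
      * intros x. pose proof (norm_le_prod_norm_1 x) as h1. pose proof (norm_le_prod_norm_2 x) as h2.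
        change (Rabs (fst x) <= norm x) in h1. change (Rabs (snd x) <= norm x) in h2.
        change (Rabs (fst x * fst v + snd x * snd v)
                <= (Rabs (fst v) + Rabs (snd v) + 1) * norm x).
        eapply Rle_trans; [apply Rabs_triang|]. rewrite !Rabs_mult.
        pose proof (Rabs_pos (fst v)). pose proof (Rabs_pos (snd v)).
        pose proof (Rabs_pos (fst x)). pose proof (Rabs_pos (snd x)). nra.
  - intros x hx.
    (* [filterdiff] quantifies over all limits of the filter; since p belongs to D, the filter has p
       as its only limit. *)
    assert (E : x = p).
    { assert (h : forall e, 0 < e -> Rabs (fst p - fst x) <= e /\ Rabs (snd p - snd x) <= e).
      { intros e he. specialize (hx (ball x (mkposreal e he)) (locally_ball _ _)).
        apply within_near in hx. destruct hx as [r [hr Hr]].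
        destruct (Hr p Hp) as [h1 h2].
        - unfold near. rewrite !Rminus_diag, Rabs_R0. lra.
        - unfold ball in *; simpl in *. unfold AbsRing_ball, abs, minus, plus, opp in *.
          simpl in *. split; unfold Rminus; lra. }
      assert (h1 : fst p - fst x = 0) by (apply Rabs_eq_0_of_eps; apply h).
      assert (h2 : snd p - snd x = 0) by (apply Rabs_eq_0_of_eps; apply h).
      destruct p, x; simpl in *. f_equal; lra. }
    subst x. intros eps. apply within_near.
    destruct (H eps) as [r [hr Hr]]; [apply eps|].
    exists r. split; auto. intros q hq [n1 n2].
    set (b := Rmax (Rabs (fst q - fst p)) (Rabs (snd q - snd p))).
    specialize (Hr q b hq).
    assert (hb : b <= r) by now apply Rmax_lub.
    specialize (Hr hb (conj (Rmax_l _ _) (Rmax_r _ _))).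
    eapply Rle_trans; [exact Hr|]. apply Rmult_le_compat_l; [left; apply eps|].
    pose proof (norm_le_prod_norm_1 (minus q p)) as h1.
    pose proof (norm_le_prod_norm_2 (minus q p)) as h2.
    apply Rmax_lub; [exact h1|exact h2].
Qed.

Lemma is_grad_elim (D : R * R -> Prop) f p v : is_grad D f p v ->
  forall e, 0 < e -> exists r, 0 < r /\ forall q b, D q -> b <= r -> near b p q ->
     Rabs (f q - f p - pair_dot (fst q - fst p, snd q - snd p) v) <= e * b.
Proof.
  intros [_ H] e he.
  assert (hl : is_filter_lim (within D (locally p)) p).
  { intros P hP. unfold within. eapply filter_imp; [|exact hP]. auto. }
  specialize (H p hl). assert (he2 : 0 < e / 2) by lra.
  specialize (H (mkposreal _ he2)). apply within_near in H.
  destruct H as [r [hr Hr]]. exists r. split; auto.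
  intros q b hq hb [n1 n2].
  specialize (Hr q hq (conj (Rle_trans _ _ _ n1 hb) (Rle_trans _ _ _ n2 hb))).
  eapply Rle_trans; [exact Hr|]. simpl.
  assert (hn : norm (minus q p) <= 2 * b).
  { unfold norm; simpl. unfold prod_norm. simpl.
    replace (2 * b) with (sqrt ((2 * b) * (2 * b))) by (apply sqrt_square; pose proof (Rabs_pos (fst q - fst p)); lra).
    unfold norm; simpl. unfold abs, minus, plus, opp; simpl.
    pose proof (Rabs_pos (fst q - fst p)). pose proof (Rabs_pos (snd q - snd p)).
    unfold Rminus in *. apply sqrt_le_1_alt. nra. }
  change (e / 2 * norm (minus q p) <= e * b). nra.
Qed.

Lemma continuous_on_elim (D : R * R -> Prop) (f : R * R -> R) : continuous_on D f ->
  forall p, D p -> forall e, 0 < e -> exists r, 0 < r /\ forall q, D q -> near r p q ->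
    Rabs (f q - f p) <= e.
Proof.
  intros H p hp e he.
  specialize (H p hp (ball (f p) (mkposreal e he)) (locally_ball _ _)).
  apply within_near in H. destruct H as [r [hr Hr]]. exists r. split; auto.
  intros q hq hn. specialize (Hr q hq hn). left. exact Hr.
Qed.

Lemma continuous_on_intro (D : R * R -> Prop) (f : R * R -> R) :
  (forall p, D p -> forall e, 0 < e -> exists r, 0 < r /\ forall q, D q -> near r p q ->
    Rabs (f q - f p) <= e) -> continuous_on D f.
Proof.
  intros H p hp P [eps HP]. destruct (H p hp (eps / 2)) as [r [hr Hr]].
  { destruct eps; simpl; lra. }
  apply within_near. exists r. split; auto. intros q hq hn. apply HP.
  specialize (Hr q hq hn). unfold ball; simpl.
  unfold AbsRing_ball, abs, minus, plus, opp; simpl. unfold Rminus in *.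
  destruct eps; simpl in *; lra.
Qed.

Lemma is_grad_near_continuous (D : R * R -> Prop) f p v : is_grad D f p v ->
  forall e, 0 < e -> exists r, 0 < r /\ forall q, D q -> near r p q ->
    Rabs (f q - f p) <= e.
Proof.
  intros H e he. destruct (is_grad_elim _ _ _ _ H 1) as [r [hr Hr]]; [lra|].
  set (c := Rabs (fst v) + Rabs (snd v)).
  assert (hc : 0 <= c) by (pose proof (Rabs_pos (fst v)); pose proof (Rabs_pos (snd v)); unfold c; lra).
  set (b := Rmin r (e / (2 * c + 1))).
  assert (hb : 0 < b) by (apply Rmin_glb_lt; auto; apply Rdiv_lt_0_compat; lra).
  exists b. split; auto. intros q hq hn.
  specialize (Hr q b hq (Rmin_l _ _) hn). destruct hn as [n1 n2].
  assert (hd : Rabs (pair_dot (fst q - fst p, snd q - snd p) v) <= 2 * (c * b)).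
  { apply pair_dot_bound; auto; unfold c;
    pose proof (Rabs_pos (fst v)); pose proof (Rabs_pos (snd v)); lra. }
  replace (f q - f p) with ((f q - f p - pair_dot (fst q - fst p, snd q - snd p) v)
     + pair_dot (fst q - fst p, snd q - snd p) v) by ring.
  eapply Rle_trans; [apply Rabs_triang|].
  assert ((2 * c + 1) * b <= e).
  { apply Rle_trans with ((2 * c + 1) * (e / (2 * c + 1))).
    - apply Rmult_le_compat_l; [lra|apply Rmin_r].
    - right. field. lra. }
  lra.
Qed.

Definition segment_pt (p q : R * R) (t : R) : R * R :=
  (fst p + t * (fst q - fst p), snd p + t * (snd q - snd p)).

(** The interior is witnessed by a square with sides parallel to the axes: its corners determine
    gradients, and second differences are formed over shrunken copies of it. *)
Definition convex_body (D : R * R -> Prop) : Prop :=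
  (forall p q t, D p -> D q -> 0 <= t <= 1 -> D (segment_pt p q t))
  /\ exists x y h, 0 < h /\ forall s t, 0 <= s <= h -> 0 <= t <= h -> D (x + s, y + t).

Section convex.
Variable D : R * R -> Prop.
Hypothesis HD : convex_body D.

(** By convexity each q in D can be contracted towards p, so the difference of two gradients at p
    annihilates every q - p. Three corners of the square in D then force it to vanish, even when p
    is a corner of D. *)
Lemma grad_unique f p v w : D p -> is_grad D f p v -> is_grad D f p w -> v = w.
Proof.
  intros hp hv hw. destruct HD as [Hc [x [y [h [hh Hsq]]]]].
  set (z := (fst v - fst w, snd v - snd w)).
  assert (Hz : forall q, D q -> pair_dot (fst q - fst p, snd q - snd p) z = 0).
  { intros q hq. apply Rabs_eq_0_of_eps. intros e he.
    set (B := Rabs (fst q - fst p) + Rabs (snd q - snd p) + 1).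
    assert (hB : 0 < B) by (unfold B; pose proof (Rabs_pos (fst q - fst p));
      pose proof (Rabs_pos (snd q - snd p)); lra).
    assert (he' : 0 < e / (2 * B)) by (apply Rdiv_lt_0_compat; lra).
    destruct (is_grad_elim _ _ _ _ hv _ he') as [r1 [hr1 H1]].
    destruct (is_grad_elim _ _ _ _ hw _ he') as [r2 [hr2 H2]].
    set (t := Rmin 1 (Rmin r1 r2 / B)).
    assert (ht : 0 < t).
    { apply Rmin_glb_lt; [lra|]. apply Rdiv_lt_0_compat; auto. now apply Rmin_glb_lt. }
    assert (ht1 : t <= 1) by apply Rmin_l.
    assert (htB : t * B <= Rmin r1 r2).
    { apply Rle_trans with (Rmin r1 r2 / B * B).
      - apply Rmult_le_compat_r; [lra|apply Rmin_r].
      - right. field. lra. }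
    pose proof (Rmin_l r1 r2). pose proof (Rmin_r r1 r2).
    set (qt := segment_pt p q t).
    assert (hqt : D qt) by (apply Hc; auto; lra).
    assert (hn : near (t * B) p qt).
    { unfold near, qt, segment_pt; simpl.
      replace (fst p + t * (fst q - fst p) - fst p) with (t * (fst q - fst p)) by ring.
      replace (snd p + t * (snd q - snd p) - snd p) with (t * (snd q - snd p)) by ring.
      rewrite !Rabs_mult, (Rabs_pos_eq t) by lra.
      split; apply Rmult_le_compat_l; try lra; unfold B;
      pose proof (Rabs_pos (fst q - fst p)); pose proof (Rabs_pos (snd q - snd p)); lra. }
    specialize (H1 qt (t * B) hqt ltac:(lra) hn). specialize (H2 qt (t * B) hqt ltac:(lra) hn).
    assert (E : t * pair_dot (fst q - fst p, snd q - snd p) z =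
      (f qt - f p - pair_dot (fst qt - fst p, snd qt - snd p) w)
      - (f qt - f p - pair_dot (fst qt - fst p, snd qt - snd p) v)).
    { unfold pair_dot, z, qt, segment_pt; simpl. ring. }
    apply Rmult_le_reg_l with t; auto.
    rewrite <- (Rabs_pos_eq t) at 1 by lra. rewrite <- Rabs_mult, E.
    unfold Rminus at 1. eapply Rle_trans; [apply Rabs_triang|]. rewrite Rabs_Ropp.
    replace (t * e) with (e / (2 * B) * (t * B) + e / (2 * B) * (t * B)) by (field; lra).
    lra. }
  pose proof (Hz _ (Hsq 0 0 ltac:(lra) ltac:(lra))) as k1.
  pose proof (Hz _ (Hsq h 0 ltac:(lra) ltac:(lra))) as k2.
  pose proof (Hz _ (Hsq 0 h ltac:(lra) ltac:(lra))) as k3.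
  unfold pair_dot, z in *; simpl in *.
  assert (h * (fst v - fst w) = 0) by lra. assert (h * (snd v - snd w) = 0) by lra.
  destruct v as [v1 v2], w as [w1 w2]; simpl in *.
  apply Rmult_integral in H. apply Rmult_integral in H0. f_equal; lra.
Qed.

Lemma grad_eq f p v : D p -> is_grad D f p v -> grad D f p = v.
Proof.
  intros hp hv. apply (grad_unique f p); auto.
  unfold grad. apply epsilon_spec. now exists v.
Qed.

Lemma Dx_eq f p v : D p -> is_grad D f p v -> Dx D f p = fst v.
Proof. intros. unfold Dx. erewrite grad_eq; eauto. Qed.

Lemma Dy_eq f p v : D p -> is_grad D f p v -> Dy D f p = snd v.
Proof. intros. unfold Dy. erewrite grad_eq; eauto. Qed.

Lemma is_grad_ext f f' p v : D p -> (forall q, D q -> f' q = f q) ->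
  is_grad D f p v -> is_grad D f' p v.
Proof.
  intros hp he H. apply is_grad_intro; auto. intros e h.
  destruct (is_grad_elim _ _ _ _ H e h) as [r [hr Hr]].
  exists r. split; auto. intros. rewrite !he; auto.
Qed.

Lemma class_C_ext n : forall f f', (forall q, D q -> f' q = f q) ->
  class_C n D f -> class_C n D f'.
Proof.
  induction n as [|n IH]; intros f f' he.
  - intros H. apply continuous_on_intro. intros p hp e h.
    destruct (continuous_on_elim _ _ H p hp e h) as [r [hr Hr]].
    exists r. split; auto. intros. rewrite !he; auto.
  - intros [H1 [H2 H3]].
    assert (hg : forall p, D p -> grad D f' p = grad D f p).
    { intros p hp. destruct (H1 p hp) as [v hv]. rewrite (grad_eq f p v); auto.
      apply grad_eq; auto. apply is_grad_ext with f; auto. }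
    split; [|split].
    + intros p hp. destruct (H1 p hp) as [v hv]. exists v. apply is_grad_ext with f; auto.
    + apply (IH (Dx D f)); auto. intros q hq. unfold Dx. now rewrite hg.
    + apply (IH (Dy D f)); auto. intros q hq. unfold Dy. now rewrite hg.
Qed.

Lemma class_C_S_intro n f fx fy :
  (forall p, D p -> is_grad D f p (fx p, fy p)) -> class_C n D fx -> class_C n D fy ->
  class_C (S n) D f.
Proof.
  intros H hx hy. split; [|split].
  - intros p hp. eexists. eauto.
  - apply (class_C_ext n fx); auto. intros q hq. now rewrite (Dx_eq f q _ hq (H q hq)).
  - apply (class_C_ext n fy); auto. intros q hq. now rewrite (Dy_eq f q _ hq (H q hq)).
Qed.

Lemma class_C_S_elim n f : class_C (S n) D f ->
  (forall p, D p -> is_grad D f p (Dx D f p, Dy D f p))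
  /\ class_C n D (Dx D f) /\ class_C n D (Dy D f).
Proof.
  intros [H1 [H2 H3]]. split; auto. intros p hp. destruct (H1 p hp) as [v hv].
  rewrite (Dx_eq f p v), (Dy_eq f p v); auto.
Qed.

Lemma class_C_continuous n f : class_C n D f -> continuous_on D f.
Proof.
  destruct n; [auto|]. intros [H _]. apply continuous_on_intro.
  intros p hp. destruct (H p hp) as [v hv]. exact (is_grad_near_continuous _ _ _ _ hv).
Qed.

Lemma class_C_pred n : forall f, class_C (S n) D f -> class_C n D f.
Proof.
  induction n as [|n IH]; intros f H.
  - exact (class_C_continuous 1 f H).
  - destruct H as [H1 [H2 H3]]. split; [auto|split; apply IH; auto].
Qed.

(** The one-dimensional increment estimate along the segment from p to q, applied to f minus the
    linear function v. The factor 2 comes from measuring both coordinates in the maximum norm. *)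
Lemma is_grad_increment f fx fy p q v B : D p -> D q ->
  (forall z, D z -> is_grad D f z (fx z, fy z)) ->
  (forall t, 0 <= t <= 1 ->
     Rabs (fx (segment_pt p q t) - fst v) <= B /\ Rabs (fy (segment_pt p q t) - snd v) <= B) ->
  forall b, near b p q ->
  Rabs (f q - f p - pair_dot (fst q - fst p, snd q - snd p) v) <= 2 * (B * b).
Proof.
  intros hp hq Hf HB b hn.
  assert (hb : 0 <= b) by (eapply Rle_trans; [apply Rabs_pos|apply hn]).
  set (dq := (fst q - fst p, snd q - snd p)).
  set (phi := fun t => f (segment_pt p q t) - t * pair_dot dq v).
  assert (E0 : segment_pt p q 0 = p).
  { unfold segment_pt. destruct p; simpl. f_equal; ring. }
  assert (E1 : segment_pt p q 1 = q).
  { unfold segment_pt. destruct p, q; simpl. f_equal; ring. }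
  replace (f q - f p - pair_dot dq v) with (phi 1 - phi 0)
    by (unfold phi; rewrite E0, E1; ring).
  replace (2 * (B * b)) with (2 * (B * b) * (1 - 0)) by ring.
  apply increment_bound; [lra|]. intros t ht e he.
  destruct HD as [Hc _].
  assert (hz : D (segment_pt p q t)) by (apply Hc; auto).
  set (z := segment_pt p q t) in *.
  destruct (is_grad_elim _ _ _ _ (Hf z hz) (e / (b + 1))) as [r [hr Hr]].
  { apply Rdiv_lt_0_compat; lra. }
  exists (r / (b + 1)). split; [apply Rdiv_lt_0_compat; lra|].
  intros s hs hst.
  assert (hzs : D (segment_pt p q s)) by (apply Hc; auto).
  pose proof (Rabs_pos (s - t)) as hst0.
  assert (hbr : Rabs (s - t) * b <= r).
  { apply Rle_trans with (r / (b + 1) * (b + 1)); [|right; field; lra].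
    apply Rmult_le_compat; lra. }
  assert (hnn : near (Rabs (s - t) * b) z (segment_pt p q s)).
  { unfold near, z, segment_pt; simpl.
    match goal with |- Rabs ?x <= _ /\ Rabs ?y <= _ =>
      replace x with ((s - t) * (fst q - fst p)) by ring;
      replace y with ((s - t) * (snd q - snd p)) by ring end.
    rewrite !Rabs_mult. destruct hn. split; apply Rmult_le_compat_l; auto. }
  specialize (Hr _ _ hzs hbr hnn).
  assert (Ed : phi s - phi t =
    (f (segment_pt p q s) - f z
      - pair_dot (fst (segment_pt p q s) - fst z, snd (segment_pt p q s) - snd z) (fx z, fy z))
    + (s - t) * pair_dot dq (fx z - fst v, fy z - snd v)).
  { unfold phi, dq, pair_dot, z, segment_pt; simpl. ring. }
  rewrite Ed. eapply Rle_trans; [apply Rabs_triang|]. rewrite Rabs_mult.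
  destruct hn as [n1 n2]. destruct (HB t ht) as [B1 B2].
  assert (hd : Rabs (pair_dot dq (fx z - fst v, fy z - snd v)) <= 2 * (B * b)).
  { apply pair_dot_bound; simpl; auto. }
  assert (e / (b + 1) * (Rabs (s - t) * b) <= e * Rabs (s - t)).
  { replace (e * Rabs (s - t)) with (e / (b + 1) * (Rabs (s - t) * (b + 1))) by (field; lra).
    apply Rmult_le_compat_l; [left; apply Rdiv_lt_0_compat; lra|nra]. }
  nra.
Qed.

(* The second difference of f over a small square is approximated by the square's area
   times either mixed derivative. *)
Lemma mixed_derivatives f fx fy fxx fxy fyx fyy :
  (forall z, D z -> is_grad D f z (fx z, fy z)) ->
  (forall z, D z -> is_grad D fx z (fxx z, fxy z)) ->
  (forall z, D z -> is_grad D fy z (fyx z, fyy z)) ->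
  continuous_on D fxy -> continuous_on D fyx ->
  forall p, D p -> fxy p = fyx p.
Proof.
  intros Hf Hx Hy Cx Cy p hp.
  apply Rminus_diag_uniq. apply Rabs_eq_0_of_eps. intros e0 he0.
  set (e := e0 / 2). assert (he : 0 < e) by (unfold e; lra).
  destruct (continuous_on_elim _ _ Cx p hp e he) as [r1 [hr1 H1]].
  destruct (continuous_on_elim _ _ Cy p hp e he) as [r2 [hr2 H2]].
  set (r := Rmin r1 r2). assert (hr : 0 < r) by now apply Rmin_glb_lt.
  (* The square contained in D is contracted towards p with ratio [t0]: it stays in D by convexity
     and enters the neighbourhood of p, even for p on the boundary. *)
  assert (Hsmall : exists x y h, 0 < h /\ forall s t, 0 <= s <= h -> 0 <= t <= h ->
     D (x + s, y + t) /\ near r p (x + s, y + t)).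
  { pose proof HD as [Hc [x [y [h [hh Hsq]]]]].
    set (B := Rabs (x - fst p) + Rabs (y - snd p) + h).
    pose proof (Rabs_pos (x - fst p)). pose proof (Rabs_pos (y - snd p)).
    assert (hB : 0 < B) by (unfold B; lra).
    set (t0 := Rmin 1 (r / B)).
    assert (ht0 : 0 < t0) by (apply Rmin_glb_lt; [lra|now apply Rdiv_lt_0_compat]).
    assert (ht1 : t0 <= 1) by apply Rmin_l.
    assert (htB : t0 * B <= r).
    { apply Rle_trans with (r / B * B).
      - apply Rmult_le_compat_r; [lra|apply Rmin_r].
      - right. field. lra. }
    exists (fst p + t0 * (x - fst p)), (snd p + t0 * (y - snd p)), (t0 * h).
    split; [now apply Rmult_lt_0_compat|]. intros s t hs ht.
    assert (hs' : 0 <= s / t0 <= h).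
    { split; [apply Rdiv_le_0_compat; lra|]. apply Rmult_le_reg_l with t0; auto.
      replace (t0 * (s / t0)) with s by (field; lra). lra. }
    assert (ht' : 0 <= t / t0 <= h).
    { split; [apply Rdiv_le_0_compat; lra|]. apply Rmult_le_reg_l with t0; auto.
      replace (t0 * (t / t0)) with t by (field; lra). lra. }
    assert (E : (fst p + t0 * (x - fst p) + s, snd p + t0 * (y - snd p) + t)
       = segment_pt p (x + s / t0, y + t / t0) t0).
    { unfold segment_pt; simpl. f_equal; field; lra. }
    rewrite E. split.
    - apply Hc; auto. lra.
    - unfold near, segment_pt; simpl.
      match goal with |- Rabs ?u <= _ /\ Rabs ?v <= _ =>
        replace u with (t0 * (x - fst p + s / t0)) by ring;
        replace v with (t0 * (y - snd p + t / t0)) by ring end.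
      rewrite !Rabs_mult, (Rabs_pos_eq t0) by lra.
      pose proof (Rabs_triang (x - fst p) (s / t0)) as k1.
      pose proof (Rabs_triang (y - snd p) (t / t0)) as k2.
      rewrite (Rabs_pos_eq (s / t0)) in k1 by lra.
      rewrite (Rabs_pos_eq (t / t0)) in k2 by lra.
      split; eapply Rle_trans; try exact htB; apply Rmult_le_compat_l; unfold B; lra. }
  destruct Hsmall as [x [y [h [hh Hsq]]]].
  pose proof (Rmin_l r1 r2) as hm1. pose proof (Rmin_r r1 r2) as hm2.
  assert (Hdx : forall s, 0 <= s <= h ->
    Rabs (fx (x + s, y + h) - fx (x + s, y) - h * fxy p) <= e * h).
  { intros s hs.
    replace (fx (x + s, y + h) - fx (x + s, y) - h * fxy p)
      with ((fun t => fx (x + s, y + t) - t * fxy p) h - (fun t => fx (x + s, y + t) - t * fxy p) 0)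
      by (cbv beta; rewrite Rplus_0_r; ring).
    replace (e * h) with (e * (h - 0)) by ring.
    apply (increment_bound (fun t => fx (x + s, y + t) - t * fxy p)); [lra|].
    intros t ht e' he'.
    destruct (Hsq s t hs ht) as [hD hN].
    destruct (is_grad_elim _ _ _ _ (Hx _ hD) e' he') as [r' [hr' Hr']].
    exists r'. split; auto. intros t' ht' htt.
    destruct (Hsq s t' hs ht') as [hD' _].
    specialize (Hr' (x + s, y + t') (Rabs (t' - t)) hD' htt). simpl in Hr'.
    unfold pair_dot in Hr'; simpl in Hr'.
    assert (hne : near (Rabs (t' - t)) (x + s, y + t) (x + s, y + t')).
    { split; simpl; [rewrite Rminus_diag, Rabs_R0; apply Rabs_pos|].
      right. f_equal. ring. }
    specialize (Hr' hne).
    assert (hk : Rabs (fxy (x + s, y + t) - fxy p) <= e).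
    { apply H1; auto. unfold near in *. unfold r in hN. lra. }
    match goal with |- Rabs ?u <= _ => replace u with
      ((fx (x + s, y + t') - fx (x + s, y + t) - ((x + s - (x + s)) * fxx (x + s, y + t)
        + (y + t' - (y + t)) * fxy (x + s, y + t)))
       + (t' - t) * (fxy (x + s, y + t) - fxy p)) by ring end.
    eapply Rle_trans; [apply Rabs_triang|]. rewrite Rabs_mult.
    pose proof (Rabs_pos (t' - t)). nra. }
  assert (Hdy : forall t, 0 <= t <= h ->
    Rabs (fy (x + h, y + t) - fy (x, y + t) - h * fyx p) <= e * h).
  { intros t ht.
    replace (fy (x + h, y + t) - fy (x, y + t) - h * fyx p)
      with ((fun s => fy (x + s, y + t) - s * fyx p) h - (fun s => fy (x + s, y + t) - s * fyx p) 0)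
      by (cbv beta; rewrite Rplus_0_r; ring).
    replace (e * h) with (e * (h - 0)) by ring.
    apply (increment_bound (fun s => fy (x + s, y + t) - s * fyx p)); [lra|].
    intros s hs e' he'.
    destruct (Hsq s t hs ht) as [hD hN].
    destruct (is_grad_elim _ _ _ _ (Hy _ hD) e' he') as [r' [hr' Hr']].
    exists r'. split; auto. intros s' hs' hss.
    destruct (Hsq s' t hs' ht) as [hD' _].
    specialize (Hr' (x + s', y + t) (Rabs (s' - s)) hD' hss). simpl in Hr'.
    unfold pair_dot in Hr'; simpl in Hr'.
    assert (hne : near (Rabs (s' - s)) (x + s, y + t) (x + s', y + t)).
    { split; simpl; [|rewrite Rminus_diag, Rabs_R0; apply Rabs_pos].
      right. f_equal. ring. }
    specialize (Hr' hne).
    assert (hk : Rabs (fyx (x + s, y + t) - fyx p) <= e).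
    { apply H2; auto. unfold near in *. unfold r in hN. lra. }
    match goal with |- Rabs ?u <= _ => replace u with
      ((fy (x + s', y + t) - fy (x + s, y + t) - ((x + s' - (x + s)) * fyx (x + s, y + t)
        + (y + t - (y + t)) * fyy (x + s, y + t)))
       + (s' - s) * (fyx (x + s, y + t) - fyx p)) by ring end.
    eapply Rle_trans; [apply Rabs_triang|]. rewrite Rabs_mult.
    pose proof (Rabs_pos (s' - s)). nra. }
  set (Delta := f (x + h, y + h) - f (x + h, y) - (f (x, y + h) - f (x, y))).
  assert (K1 : Rabs (Delta - h * h * fxy p) <= e * h * h).
  { replace (Delta - h * h * fxy p) with
      ((fun s => f (x + s, y + h) - f (x + s, y) - s * (h * fxy p)) h
       - (fun s => f (x + s, y + h) - f (x + s, y) - s * (h * fxy p)) 0)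
      by (unfold Delta; cbv beta; rewrite Rplus_0_r; ring).
    replace (e * h * h) with (e * h * (h - 0)) by ring.
    apply (increment_bound (fun s => f (x + s, y + h) - f (x + s, y) - s * (h * fxy p))); [lra|].
    intros s hs e' he'.
    destruct (Hsq s h hs ltac:(lra)) as [hD1 _].
    destruct (Hsq s 0 hs ltac:(lra)) as [hD2 _]. rewrite Rplus_0_r in hD2.
    destruct (is_grad_elim _ _ _ _ (Hf _ hD1) (e' / 2)) as [q1 [hq1 Hq1]]; [lra|].
    destruct (is_grad_elim _ _ _ _ (Hf _ hD2) (e' / 2)) as [q2 [hq2 Hq2]]; [lra|].
    exists (Rmin q1 q2). split; [now apply Rmin_glb_lt|]. intros s' hs' hss.
    pose proof (Rmin_l q1 q2). pose proof (Rmin_r q1 q2).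
    destruct (Hsq s' h hs' ltac:(lra)) as [hD1' _].
    destruct (Hsq s' 0 hs' ltac:(lra)) as [hD2' _]. rewrite Rplus_0_r in hD2'.
    assert (hne : forall w, near (Rabs (s' - s)) (x + s, w) (x + s', w)).
    { intros w. split; simpl; [|rewrite Rminus_diag, Rabs_R0; apply Rabs_pos].
      right. f_equal. ring. }
    specialize (Hq1 _ (Rabs (s' - s)) hD1' ltac:(lra) (hne _)).
    specialize (Hq2 _ (Rabs (s' - s)) hD2' ltac:(lra) (hne _)).
    unfold pair_dot in Hq1, Hq2; simpl in Hq1, Hq2.
    specialize (Hdx s hs).
    match goal with |- Rabs ?u <= _ => replace u with
      ((f (x + s', y + h) - f (x + s, y + h) - ((x + s' - (x + s)) * fx (x + s, y + h)
         + (y + h - (y + h)) * fy (x + s, y + h)))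
       - (f (x + s', y) - f (x + s, y) - ((x + s' - (x + s)) * fx (x + s, y)
         + (y - y) * fy (x + s, y)))
       + (s' - s) * (fx (x + s, y + h) - fx (x + s, y) - h * fxy p)) by ring end.
    eapply Rle_trans; [apply Rabs_triang|]. rewrite Rabs_mult. unfold Rminus at 1.
    eapply Rle_trans; [apply Rplus_le_compat_r, Rabs_triang|]. rewrite Rabs_Ropp.
    pose proof (Rabs_pos (s' - s)).
    assert (Rabs (s' - s) * Rabs (fx (x + s, y + h) - fx (x + s, y) - h * fxy p)
            <= Rabs (s' - s) * (e * h)) by (apply Rmult_le_compat_l; auto).
    lra. }
  assert (K2 : Rabs (Delta - h * h * fyx p) <= e * h * h).
  { replace (Delta - h * h * fyx p) with
      ((fun t => f (x + h, y + t) - f (x, y + t) - t * (h * fyx p)) h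
       - (fun t => f (x + h, y + t) - f (x, y + t) - t * (h * fyx p)) 0)
      by (unfold Delta; cbv beta; rewrite Rplus_0_r; ring).
    replace (e * h * h) with (e * h * (h - 0)) by ring.
    apply (increment_bound (fun t => f (x + h, y + t) - f (x, y + t) - t * (h * fyx p))); [lra|].
    intros t ht e' he'.
    destruct (Hsq h t ltac:(lra) ht) as [hD1 _].
    destruct (Hsq 0 t ltac:(lra) ht) as [hD2 _]. rewrite Rplus_0_r in hD2.
    destruct (is_grad_elim _ _ _ _ (Hf _ hD1) (e' / 2)) as [q1 [hq1 Hq1]]; [lra|].
    destruct (is_grad_elim _ _ _ _ (Hf _ hD2) (e' / 2)) as [q2 [hq2 Hq2]]; [lra|].
    exists (Rmin q1 q2). split; [now apply Rmin_glb_lt|]. intros t' ht' htt.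
    pose proof (Rmin_l q1 q2). pose proof (Rmin_r q1 q2).
    destruct (Hsq h t' ltac:(lra) ht') as [hD1' _].
    destruct (Hsq 0 t' ltac:(lra) ht') as [hD2' _]. rewrite Rplus_0_r in hD2'.
    assert (hne : forall w, near (Rabs (t' - t)) (w, y + t) (w, y + t')).
    { intros w. split; simpl; [rewrite Rminus_diag, Rabs_R0; apply Rabs_pos|].
      right. f_equal. ring. }
    specialize (Hq1 _ (Rabs (t' - t)) hD1' ltac:(lra) (hne _)).
    specialize (Hq2 _ (Rabs (t' - t)) hD2' ltac:(lra) (hne _)).
    unfold pair_dot in Hq1, Hq2; simpl in Hq1, Hq2.
    specialize (Hdy t ht).
    match goal with |- Rabs ?u <= _ => replace u with
      ((f (x + h, y + t') - f (x + h, y + t) - ((x + h - (x + h)) * fx (x + h, y + t)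
         + (y + t' - (y + t)) * fy (x + h, y + t)))
       - (f (x, y + t') - f (x, y + t) - ((x - x) * fx (x, y + t)
         + (y + t' - (y + t)) * fy (x, y + t)))
       + (t' - t) * (fy (x + h, y + t) - fy (x, y + t) - h * fyx p)) by ring end.
    eapply Rle_trans; [apply Rabs_triang|]. rewrite Rabs_mult. unfold Rminus at 1.
    eapply Rle_trans; [apply Rplus_le_compat_r, Rabs_triang|]. rewrite Rabs_Ropp.
    pose proof (Rabs_pos (t' - t)).
    assert (Rabs (t' - t) * Rabs (fy (x + h, y + t) - fy (x, y + t) - h * fyx p)
            <= Rabs (t' - t) * (e * h)) by (apply Rmult_le_compat_l; auto).
    lra. }
  assert (h2 : 0 < h * h) by nra.
  apply Rmult_le_reg_l with (h * h); auto.
  rewrite <- (Rabs_pos_eq (h * h)) at 1 by lra. rewrite <- Rabs_mult.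
  replace (h * h * (fxy p - fyx p))
    with ((Delta - h * h * fyx p) - (Delta - h * h * fxy p)) by ring.
  unfold Rminus at 1. eapply Rle_trans; [apply Rabs_triang|]. rewrite Rabs_Ropp.
  unfold e in *. lra.
Qed.

End convex.

Lemma is_grad_comp {I : Type} (l : list I) (O : (I -> R) -> Prop) F G
    (D : R * R -> Prop) (c : I -> R * R -> R) (p : R * R) (v : I -> R * R) :
  (forall i, In i l) -> UC1 O F G -> D p -> (forall q, D q -> O (fun i => c i q)) ->
  (forall i, is_grad D (c i) p (v i)) ->
  is_grad D (fun q => F (fun i => c i q)) p
    (G (fun i => c i p) (fun i => fst (v i)), G (fun i => c i p) (fun i => snd (v i))).
Proof.
  intros Hl HF hp Hmap Hc. apply is_grad_intro; auto. intros e he.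
  destruct (UC1_bound _ _ _ HF) as [M [hM HM]].
  destruct (finite_upper I l (fun i c => Rabs (fst (v i)) <= c /\ Rabs (snd (v i)) <= c))
    as [V [hV HV]]; auto.
  { intros; lra. }
  { intros i. exists (Rabs (fst (v i)) + Rabs (snd (v i)) + 1).
    pose proof (Rabs_pos (fst (v i))). pose proof (Rabs_pos (snd (v i))). lra. }
  set (L := 2 * V + 1). assert (hL : 0 < L) by (unfold L; lra).
  set (e1 := e / (M + L)). assert (he1 : 0 < e1) by (apply Rdiv_lt_0_compat; lra).
  assert (hee : (M + L) * e1 = e) by (unfold e1; field; lra).
  destruct (UC1_modulus _ _ _ HF e1 he1) as [r1 [hr1 H1]].
  set (e2 := Rmin e1 1). assert (he2 : 0 < e2) by (apply Rmin_glb_lt; lra).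
  assert (he21 : e2 <= e1) by apply Rmin_l. assert (he22 : e2 <= 1) by apply Rmin_r.
  destruct (finite_lower I l (fun i r => forall q b, D q -> b <= r -> near b p q ->
     Rabs (c i q - c i p - pair_dot (fst q - fst p, snd q - snd p) (v i)) <= e2 * b))
    as [r2 [hr2 H2]]; auto.
  { intros i m m' hm H q b hq hb hn. apply H; auto. lra. }
  { intros i. apply (is_grad_elim _ _ _ _ (Hc i) e2 he2). }
  exists (Rmin r2 (r1 / L)). split; [apply Rmin_glb_lt; auto; now apply Rdiv_lt_0_compat|].
  intros q b hq hb hn.
  pose proof (Rmin_l r2 (r1 / L)). pose proof (Rmin_r r2 (r1 / L)).
  assert (hb0 : 0 <= b) by (eapply Rle_trans; [apply Rabs_pos|apply hn]).
  set (X := fun i => c i p). set (Y := fun i => c i q).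
  set (dq := (fst q - fst p, snd q - snd p)).
  assert (hdot : forall i, Rabs (pair_dot dq (v i)) <= 2 * (V * b)).
  { intros i. destruct hn. destruct (HV i). apply pair_dot_bound; simpl; auto. }
  assert (hw : nb (fun i => Y i - X i - pair_dot dq (v i)) (e2 * b)).
  { split; [nra|]. intros i. apply H2; auto. lra. }
  assert (hXY : nb (dlt X Y) (L * b)).
  { split; [nra|]. intros i. unfold dlt.
    replace (Y i - X i) with ((Y i - X i - pair_dot dq (v i)) + pair_dot dq (v i)) by ring.
    eapply Rle_trans; [apply Rabs_triang|]. destruct hw as [_ hw]. specialize (hw i).
    specialize (hdot i). unfold L. nra. }
  assert (hLb : L * b <= r1).
  { apply Rle_trans with (L * (r1 / L)); [apply Rmult_le_compat_l; lra|right; field; lra]. }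
  destruct (H1 X Y (Hmap p hp) (Hmap q hq) _ hLb hXY) as [k1 _].
  destruct (HM X (Hmap p hp)) as [[la lm] [_ m1]].
  specialize (m1 _ _ hw).
  assert (E : G X (dlt X Y) = pair_dot dq (G X (fun i => fst (v i)), G X (fun i => snd (v i)))
              + G X (fun i => Y i - X i - pair_dot dq (v i))).
  { unfold pair_dot at 1. cbn [fst snd].
    rewrite <- (lm (fst dq)), <- (lm (snd dq)), <- la, <- la. f_equal.
    apply functional_extensionality. intros i. unfold dlt, pair_dot. ring. }
  rewrite E in k1.
  match goal with |- Rabs ?t <= _ => replace t with
    ((F Y - F X - (pair_dot dq (G X (fun i => fst (v i)), G X (fun i => snd (v i)))
       + G X (fun i => Y i - X i - pair_dot dq (v i))))
     + G X (fun i => Y i - X i - pair_dot dq (v i))) by (unfold X, Y; ring) end.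
  eapply Rle_trans; [apply Rabs_triang|]. rewrite <- hee.
  assert (0 <= e1 * b) by nra. assert (M * (e2 * b) <= M * (e1 * b)).
  { apply Rmult_le_compat_l; [lra|]. apply Rmult_le_compat_r; auto. }
  nra.
Qed.

(** * The characteristic system *)

Lemma C1on_comp {I J : Type} (l : list I) (OI : (I -> R) -> Prop) (OJ : (J -> R) -> Prop)
    (F : (I -> R) -> R) (P : I -> (J -> R) -> R) :
  (forall i, In i l) -> C1on OI F -> (forall i, C1on OJ (P i)) ->
  (forall Y, OJ Y -> OI (fun i => P i Y)) -> C1on OJ (fun Y => F (fun i => P i Y)).
Proof.
  intros Hl [G HG] HP Hmap.
  set (DP := fun i => epsilon (inhabits (fun _ _ => 0)) (UC1 OJ (P i))).
  eexists. apply (UC1_comp l OI OJ F G P DP); auto.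
  intros i. unfold DP. apply epsilon_spec. apply HP.
Qed.

Lemma C1on_D1 S phi : C1on (fun X : unit -> R => S (X tt)) (fun X => phi (X tt)) ->
  exists dphi, D1 S phi dphi.
Proof.
  intros [G HG]. exists (fun x => G (fun _ => x) (fun _ => 1)).
  apply (UC1_ext _ _ _ _ _ HG); auto.
  intros X h hX. destruct (UC1_bound _ _ _ HG) as [M [hM HM]].
  destruct (HM X hX) as [[_ l2] _].
  replace (G X h) with (G X (fun j => h tt * (fun _ => 1) j)).
  - rewrite l2. replace (fun _ : unit => X tt) with X; [ring|].
    apply functional_extensionality. now intros [].
  - f_equal. apply functional_extensionality. intros []. ring.
Qed.

(* The unknowns of the characteristic system: x, y, p = f_x, q = f_y, z = f, and
   IA = y_u, IB = y_v, IC = p_u, ID = p_v. *)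
Inductive ix := Ix | Iy | Ip | Iq | Iz | IA | IB | IC | ID.

Definition ixs : list ix := [Ix; Iy; Ip; Iq; Iz; IA; IB; IC; ID].

Lemma in_ixs i : In i ixs.
Proof. destruct i; simpl; tauto. Qed.

Definition jet (x y p q : R) (i : ix) : R :=
  match i with Ix => x | Iy => y | Ip => p | Iq => q | _ => 0 end.

Definition jet_box (a1 a2 rho : R) (X : ix -> R) : Prop :=
  Rabs (X Ix) <= a1 /\ 0 <= X Iy <= a2 /\ Rabs (X Ip) <= rho /\ Rabs (X Iq) <= rho.

Definition directional (lx ly lp lq : (ix -> R) -> R) (X h : ix -> R) : R :=
  lx X * h Ix + ly X * h Iy + lp X * h Ip + lq X * h Iq.

(** This makes l a C^2 function of the four variables x, y, p, q: its first partials occur in the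
    mixed derivatives y_uv and p_uv, and these have to be C^1. By [jf_jet] the remaining entries of
    the vector have no influence. *)
Record jet_function (a1 a2 rho : R) (l lx ly lp lq : (ix -> R) -> R) : Prop := {
  jf_diff : UC1 (jet_box a1 a2 rho) l (directional lx ly lp lq);
  jf_x : C1on (jet_box a1 a2 rho) lx;
  jf_y : C1on (jet_box a1 a2 rho) ly;
  jf_p : C1on (jet_box a1 a2 rho) lp;
  jf_q : C1on (jet_box a1 a2 rho) lq;
  jf_jet : forall X, l X = l (jet (X Ix) (X Iy) (X Ip) (X Iq)) }.

Definition plane (a d : R) (X : bool -> R) : Prop := tri a d (X true) (X false).

Section hodograph.
Variables (a1 a2 rho K0 c0 : R) (l lx ly lp lq m mx my mp mq : (ix -> R) -> R).
Variables (p0 q0 z0 r0 s0 rp sp : R -> R).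
Hypotheses (ha1 : 0 < a1) (ha2 : 0 < a2) (hrho : 0 < rho) (hc0 : 0 < c0).
Hypothesis Hl : jet_function a1 a2 rho l lx ly lp lq.
Hypothesis Hm : jet_function a1 a2 rho m mx my mp mq.
Hypothesis l_range : forall X, jet_box a1 a2 rho X -> c0 <= l X <= K0.
Hypothesis m_range : forall X, jet_box a1 a2 rho X -> - K0 <= m X <= - c0.
Hypothesis Dp0 : D1 (fun w => Rabs w <= a1) p0 r0.
Hypothesis Dq0 : D1 (fun w => Rabs w <= a1) q0 s0.
Hypothesis Dz0 : D1 (fun w => Rabs w <= a1) z0 p0.
Hypothesis Dr0 : D1 (fun w => Rabs w <= a1) r0 rp.
Hypothesis Ds0 : D1 (fun w => Rabs w <= a1) s0 sp.
Hypothesis p0_small : forall w, Rabs w <= a1 -> Rabs (p0 w) <= rho / 2.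
Hypothesis q0_small : forall w, Rabs w <= a1 -> Rabs (q0 w) <= rho / 2.
Hypothesis z0_small : forall w, Rabs w <= a1 -> Rabs (z0 w) <= rho / 2.

Let base (w : R) : ix -> R := jet w 0 (p0 w) (q0 w).

Lemma base_box w : Rabs w <= a1 -> jet_box a1 a2 rho (base w).
Proof.
  intros hw. specialize (p0_small w hw). specialize (q0_small w hw).
  unfold jet_box, base; simpl. repeat split; auto; lra.
Qed.

(** On the diagonal x = w and y = 0, so x_u + x_v = 1 and y_u + y_v = 0. With x_u = l y_u and x_v =
    m y_v this gives y_u = 1 / (l - m) = - y_v, and then p_u = (l r0 + s0) y_u and p_v = (m r0 + s0)
    y_v. *)
Definition gdata (i : ix) (w : R) : R :=
  match i with
  | Ix => w | Iy => 0 | Ip => p0 w | Iq => q0 w | Iz => z0 w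
  | IA => / (l (base w) - m (base w))
  | IB => - / (l (base w) - m (base w))
  | IC => (l (base w) * r0 w + s0 w) / (l (base w) - m (base w))
  | ID => - ((m (base w) * r0 w + s0 w) / (l (base w) - m (base w)))
  end.

Lemma Did : D1 (fun w => Rabs w <= a1) (fun w => w) (fun _ => 1).
Proof.
  eapply UC1_ext; [apply (UC1_coord _ tt a1); auto|auto|]. intros. simpl. ring.
Qed.

Lemma Dzero : D1 (fun w => Rabs w <= a1) (fun w => 0) (fun _ => 0).
Proof.
  eapply UC1_ext; [apply (UC1_const _ 0)|auto|]. intros. simpl. ring.
Qed.

Lemma gap_range w : Rabs w <= a1 -> 2 * c0 <= l (base w) - m (base w) <= 2 * K0.
Proof.
  intros hw. pose proof (l_range _ (base_box w hw)). pose proof (m_range _ (base_box w hw)). lra.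
Qed.

Lemma C1_on_base f : C1on (jet_box a1 a2 rho) f ->
  C1on (fun X : unit -> R => Rabs (X tt) <= a1) (fun X => f (base (X tt))).
Proof.
  intros Hf.
  apply (C1on_comp ixs (jet_box a1 a2 rho) _ f (fun i X => base (X tt) i)); auto using in_ixs.
  - intros [| | | | | | | |]; unfold base, jet; try apply C1_const.
    + eexists; apply Did.
    + eexists; apply Dp0.
    + eexists; apply Dq0.
  - intros X hX. now apply base_box.
Qed.

Lemma gdata_D1 : exists gp, (forall i, D1 (fun w => Rabs w <= a1) (gdata i) (gp i))
  /\ (forall w, gp Ix w = 1) /\ (forall w, gp Iy w = 0) /\ (forall w, gp Ip w = r0 w)
  /\ (forall w, gp Iq w = s0 w) /\ (forall w, gp Iz w = p0 w).
Proof.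
  assert (Cl := C1_on_base l (ex_intro _ _ (jf_diff _ _ _ _ _ _ _ _ Hl))).
  assert (Cm := C1_on_base m (ex_intro _ _ (jf_diff _ _ _ _ _ _ _ _ Hm))).
  set (O := fun X : unit -> R => Rabs (X tt) <= a1) in *.
  assert (Cr : C1on O (fun X => r0 (X tt))) by (eexists; apply Dr0).
  assert (Cs : C1on O (fun X => s0 (X tt))) by (eexists; apply Ds0).
  assert (hgap : forall X, O X -> 2 * c0 <= Rabs (l (base (X tt)) - m (base (X tt)))).
  { intros X hX. rewrite Rabs_pos_eq; apply gap_range in hX; lra. }
  assert (h2 : 0 < 2 * c0) by lra.
  destruct (C1on_D1 (fun w => Rabs w <= a1) (gdata IA)) as [gA HA].
  { apply C1_inv with (2 * c0); auto. now apply C1_minus. }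
  destruct (C1on_D1 (fun w => Rabs w <= a1) (gdata IB)) as [gB HB].
  { apply C1_opp. apply C1_inv with (2 * c0); auto. now apply C1_minus. }
  destruct (C1on_D1 (fun w => Rabs w <= a1) (gdata IC)) as [gC HC].
  { apply C1_div with (2 * c0); auto; [|now apply C1_minus].
    apply C1_plus; auto. now apply C1_mult. }
  destruct (C1on_D1 (fun w => Rabs w <= a1) (gdata ID)) as [gD HDD].
  { apply C1_opp. apply C1_div with (2 * c0); auto; [|now apply C1_minus].
    apply C1_plus; auto. now apply C1_mult. }
  exists (fun i => match i with Ix => fun _ => 1 | Iy => fun _ => 0 | Ip => r0 | Iq => s0
     | Iz => p0 | IA => gA | IB => gB | IC => gC | ID => gD end).
  split; [|repeat split; auto].
  intros [| | | | | | | |]; auto; [apply Did|apply Dzero].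
Qed.

(** The derivatives of (x, y, p, q) along u, and in [along_v] along v, as prescribed by the
    characteristic equations. The other entries are 0, since l and m depend on the jet only. *)
Definition along_u (X : ix -> R) (i : ix) : R :=
  match i with Ix => l X * X IA | Iy => X IA | Ip => X IC | Iq => - (m X * X IC) | _ => 0 end.
Definition along_v (X : ix -> R) (i : ix) : R :=
  match i with Ix => m X * X IB | Iy => X IB | Ip => X ID | Iq => - (l X * X ID) | _ => 0 end.

Let Dl := directional lx ly lp lq.
Let Dm := directional mx my mp mq.

(* The mixed derivatives y_uv and p_uv, obtained by equating the two expressions for
   x_uv and for q_uv. *)
Definition y_uv (X : ix -> R) : R :=
  (Dm X (along_u X) * X IB - Dl X (along_v X) * X IA) / (l X - m X).
Definition p_uv (X : ix -> R) : R :=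
  (Dm X (along_v X) * X IC - Dl X (along_u X) * X ID) / (l X - m X).

(** y_u and p_u are integrated along v, because only their v-derivatives are prescribed; for y_v and
    p_v it is the reverse. For x, y, p, q, z both derivatives are expected, and the u-direction is
    chosen. *)
Definition dirs (i : ix) : bool := match i with IA | IC => false | _ => true end.

Definition rhs (i : ix) (X : ix -> R) : R :=
  match i with
  | Ix => l X * X IA | Iy => X IA | Ip => X IC | Iq => - (m X * X IC)
  | Iz => (X Ip * l X + X Iq) * X IA
  | IA | IB => y_uv X
  | IC | ID => p_uv X
  end.

(** Explicit formulas are needed only for x, y, p, q, z, whose v-derivatives are identified later.
    For the mixed derivatives some derivative suffices, and the value 0 is a placeholder. *)
Definition rhs_deriv (i : ix) (X h : ix -> R) : R :=
  match i with
  | Ix => l X * h IA + X IA * Dl X h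
  | Iy => h IA
  | Ip => h IC
  | Iq => - (m X * h IC + X IC * Dm X h)
  | Iz => (X Ip * l X + X Iq) * h IA + X IA * (X Ip * Dl X h + l X * h Ip + h Iq)
  | _ => 0
  end.

Definition box_hi (Mb : R) (i : ix) : R :=
  match i with Ix => a1 | Iy => a2 | Ip | Iq | Iz => rho | _ => Mb end.
Definition box_lo (Mb : R) (i : ix) : R :=
  match i with Iy => 0 | _ => - box_hi Mb i end.

Lemma in_box_jet Mb X : in_box (box_lo Mb) (box_hi Mb) X -> jet_box a1 a2 rho X.
Proof.
  intros H. pose proof (H Ix) as h1. pose proof (H Iy) as h2. pose proof (H Ip) as h3.
  pose proof (H Iq) as h4. unfold jet_box. simpl in *.
  repeat split; try apply Rabs_le; lra.
Qed.

Lemma in_box_bound Mb i : exists B, forall X, in_box (box_lo Mb) (box_hi Mb) X -> Rabs (X i) <= B.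
Proof.
  exists (Rmax (Rabs (box_lo Mb i)) (Rabs (box_hi Mb i))). intros X hX.
  specialize (hX i). apply Rabs_le_between.
  pose proof (Rmax_l (Rabs (box_lo Mb i)) (Rabs (box_hi Mb i))).
  pose proof (Rmax_r (Rabs (box_lo Mb i)) (Rabs (box_hi Mb i))).
  pose proof (Rle_abs (box_hi Mb i)). pose proof (Rle_abs (- box_lo Mb i)).
  rewrite Rabs_Ropp in *. lra.
Qed.

Lemma rhs_UC1 Mb : exists G,
  (forall i, UC1 (in_box (box_lo Mb) (box_hi Mb)) (rhs i) (G i))
  /\ (forall i X h, match i with IA | IB | IC | ID => True | _ => G i X h = rhs_deriv i X h end).
Proof.
  set (O := in_box (box_lo Mb) (box_hi Mb)).
  assert (sub : forall X, O X -> jet_box a1 a2 rho X) by apply in_box_jet.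
  assert (Ul : UC1 O l Dl) by (eapply UC1f_subset; [exact sub|apply Hl]).
  assert (Um : UC1 O m Dm) by (eapply UC1f_subset; [exact sub|apply Hm]).
  assert (Uc : forall i, UC1 O (fun X => X i) (fun _ h => h i)).
  { intros i. destruct (in_box_bound Mb i) as [B HB]. now apply (UC1_coord O i B). }
  assert (Cc : forall i, C1on O (fun X => X i)) by (intros; eexists; apply Uc).
  assert (Cl : C1on O l) by (eexists; apply Ul).
  assert (Cm : C1on O m) by (eexists; apply Um).
  assert (Clx : C1on O lx) by (eapply C1_subset; [exact sub|apply Hl]).
  assert (Cly : C1on O ly) by (eapply C1_subset; [exact sub|apply Hl]).
  assert (Clp : C1on O lp) by (eapply C1_subset; [exact sub|apply Hl]).
  assert (Clq : C1on O lq) by (eapply C1_subset; [exact sub|apply Hl]).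
  assert (Cmx : C1on O mx) by (eapply C1_subset; [exact sub|apply Hm]).
  assert (Cmy : C1on O my) by (eapply C1_subset; [exact sub|apply Hm]).
  assert (Cmp : C1on O mp) by (eapply C1_subset; [exact sub|apply Hm]).
  assert (Cmq : C1on O mq) by (eapply C1_subset; [exact sub|apply Hm]).
  assert (Cu : forall i, C1on O (fun X => along_u X i)).
  { intros [| | | | | | | |]; simpl; auto using C1_const, C1_mult, C1_opp. }
  assert (Cv : forall i, C1on O (fun X => along_v X i)).
  { intros [| | | | | | | |]; simpl; auto using C1_const, C1_mult, C1_opp. }
  assert (hgap : forall X, O X -> 2 * c0 <= Rabs (l X - m X)).
  { intros X hX. pose proof (l_range _ (sub X hX)). pose proof (m_range _ (sub X hX)).
    rewrite Rabs_pos_eq; lra. }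
  assert (h2 : 0 < 2 * c0) by lra.
  assert (C1y : C1on O y_uv).
  { apply C1_div with (2 * c0); auto; [|now apply C1_minus].
    apply C1_minus; apply C1_mult; auto; unfold Dl, Dm, directional;
    repeat apply C1_plus; apply C1_mult; auto. }
  assert (C1p : C1on O p_uv).
  { apply C1_div with (2 * c0); auto; [|now apply C1_minus].
    apply C1_minus; apply C1_mult; auto; unfold Dl, Dm, directional;
    repeat apply C1_plus; apply C1_mult; auto. }
  destruct C1y as [Gy HGy]. destruct C1p as [Gp HGp].
  exists (fun i => match i with IA | IB => Gy | IC | ID => Gp | _ => rhs_deriv i end).
  split.
  - intros [| | | | | | | |]; auto.
    + apply (UC1_mult O l Dl (fun X => X IA) _ Ul (Uc IA)).
    + apply Uc.
    + apply Uc.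
    + apply (UC1_ext O _ _ _ _ (UC1_mult O _ _ _ _ (UC1_const O (-1))
        (UC1_mult O m Dm (fun X => X IC) _ Um (Uc IC)))); intros; unfold rhs, rhs_deriv; ring.
    + apply (UC1_ext O _ _ _ _ (UC1_mult O _ _ _ _
        (UC1_plus O _ _ _ _ (UC1_mult O _ _ _ _ (Uc Ip) Ul) (Uc Iq)) (Uc IA)));
      intros; unfold rhs, rhs_deriv; ring.
  - intros [| | | | | | | |]; auto.
Qed.

Lemma gdata_box : exists Mb, 0 < Mb /\ forall i w, Rabs w <= a1 ->
  match i with IA | IB | IC | ID => Rabs (gdata i w) <= Mb | _ => True end.
Proof.
  destruct gdata_D1 as [gp [Hgp _]].
  destruct (finite_upper ix ixs (fun i M => forall w, Rabs w <= a1 -> Rabs (gdata i w) <= M))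
    as [M [hM HM]].
  - apply in_ixs.
  - intros i M M' h H w hw. specialize (H w hw). lra.
  - intros i. destruct (D1_elim _ _ _ (Hgp i)) as [[M [hM HM]] _]. exists M.
    split; auto. intros w hw. now apply HM.
  - exists M. split; auto. intros [| | | | | | | |] w hw; auto.
Qed.


Lemma continuous_elim (f : R -> R) x : continuous f x ->
  forall e, 0 < e -> exists r, 0 < r /\ forall y, Rabs (y - x) <= r -> Rabs (f y - f x) <= e.
Proof.
  intros H e he. destruct (H (ball (f x) (mkposreal e he)) (locally_ball _ _)) as [r Hr].
  exists (r / 2). destruct r as [r hr]; simpl in *. split; [lra|].
  intros y hy. left. apply (Hr y). unfold ball; simpl. unfold AbsRing_ball, abs, minus, plus, opp.
  simpl. unfold Rminus in hy. lra.
Qed.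

(** * Identification of the v-derivatives of x, y, p, q, z *)

Section regular_solution.
Variables (Mb d M : R) (G : ix -> (ix -> R) -> (ix -> R) -> R) (gp : ix -> R -> R).
Variables (U Wu Wv : ix -> R -> R -> R).
Let O := in_box (box_lo Mb) (box_hi Mb).
Let X u v : ix -> R := fun i => U i u v.
Hypothesis hd : 0 < d.
Hypothesis S : system_data (box_lo Mb) (box_hi Mb) rhs G gdata gp a1 M.
Hypothesis HG : forall i X h,
  match i with IA | IB | IC | ID => True | _ => G i X h = rhs_deriv i X h end.
Hypothesis HU : BUC U.
Let N := on_box (box_lo Mb) (box_hi Mb) rhs U.
Hypothesis Usol : forall u v, tri a1 d u v -> solves dirs N U gdata u v.
Hypothesis Uin : forall u v, tri a1 d u v -> O (X u v).
Hypotheses (HWu : BUC Wu) (HWv : BUC Wv).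
Hypothesis Wu_N : forall i u v, dirs i = true -> Wu i u v = N i u v.
Hypothesis Wv_N : forall i u v, dirs i = false -> Wv i u v = N i u v.
Hypothesis Wv_c : forall i v, dirs i = true -> forall u,
  continuous (fun s : R => on_box_deriv (box_lo Mb) (box_hi Mb) G U Wv i s v) u.
Hypothesis Wv_eq : forall i u v, dirs i = true -> strip a1 d u v ->
  Wv i u v = gp i v - N i v v
    + RI (fun s => on_box_deriv (box_lo Mb) (box_hi Mb) G U Wv i s v) v u.
Hypothesis Uexp : forall e, 0 < e -> exists r, 0 < r /\ forall i u v u' v' b,
  tri a1 d u v -> tri a1 d u' v' -> b <= r -> Rabs (u' - u) <= b -> Rabs (v' - v) <= b ->
  Rabs (U i u' v' - U i u v - ((u' - u) * Wu i u v + (v' - v) * Wv i u v)) <= e * b.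
Hypothesis gp_x : forall w, gp Ix w = 1.
Hypothesis gp_y : forall w, gp Iy w = 0.
Hypothesis gp_p : forall w, gp Ip w = r0 w.
Hypothesis gp_q : forall w, gp Iq w = s0 w.
Hypothesis gp_z : forall w, gp Iz w = p0 w.

Lemma N_rhs i u v : tri a1 d u v -> N i u v = rhs i (X u v).
Proof. intros h. unfold N, on_box. rewrite pi_box_id; auto. now apply Uin. Qed.

Lemma tri_diag u v : tri a1 d u v -> tri a1 d v v.
Proof. intros [h1 [h2 h3]]. unfold tri. repeat split; auto; lra. Qed.

Lemma tri_between u v s : tri a1 d u v -> v <= s <= u -> tri a1 d s v.
Proof.
  intros [h1 [h2 h3]] hs.
  assert (Rabs s <= a1).
  { apply Rabs_le_between in h1. apply Rabs_le_between in h2. apply Rabs_le. lra. }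
  unfold tri. repeat split; auto; lra.
Qed.

Lemma U_diag i w : Rabs w <= a1 -> U i w w = gdata i w.
Proof.
  intros hw. assert (ht : tri a1 d w w) by (unfold tri; repeat split; auto; lra).
  rewrite (Usol w w ht i). destruct (dirs i); unfold RI; rewrite RInt_point;
  unfold zero; simpl; ring.
Qed.

Lemma X_diag w : Rabs w <= a1 -> X w w = fun i => gdata i w.
Proof. intros hw. apply functional_extensionality. intros i. now apply U_diag. Qed.

Lemma l_diag w : Rabs w <= a1 -> l (X w w) = l (base w).
Proof. intros hw. rewrite (jf_jet _ _ _ _ _ _ _ _ Hl), X_diag; auto. Qed.

Lemma m_diag w : Rabs w <= a1 -> m (X w w) = m (base w).
Proof. intros hw. rewrite (jf_jet _ _ _ _ _ _ _ _ Hm), X_diag; auto. Qed.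

Lemma Wv_diag i w : dirs i = true -> tri a1 d w w -> Wv i w w = gp i w - rhs i (X w w).
Proof.
  intros hi ht. rewrite (Wv_eq i w w hi (tri_strip _ _ _ _ ht)), N_rhs; auto.
  unfold RI. rewrite RInt_point. apply Rplus_0_r.
Qed.

Lemma U_UC1 i : UC1 (plane a1 d) (fun Y => U i (Y true) (Y false))
  (fun Y h => Wu i (Y true) (Y false) * h true + Wv i (Y true) (Y false) * h false).
Proof.
  destruct HU as [[M0 [hM0 HM0]] _]. destruct HWu as [[M1 [hM1 HM1]] Hm1].
  destruct HWv as [[M2 [hM2 HM2]] Hm2].
  apply (UC1_intro _ _ _ (M0 + M1 + M2)).
  - intros Y hY. split; intros; ring.
  - intros Y hY. specialize (HM0 i (Y true) (Y false)). lra.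
  - intros Y hY h b [hb1 hb2]. eapply Rle_trans; [apply Rabs_triang|]. rewrite !Rabs_mult.
    pose proof (hb2 true). pose proof (hb2 false).
    assert (Rabs (Wu i (Y true) (Y false)) * Rabs (h true) <= M1 * b)
      by (apply Rmult_le_compat; auto using Rabs_pos).
    assert (Rabs (Wv i (Y true) (Y false)) * Rabs (h false) <= M2 * b)
      by (apply Rmult_le_compat; auto using Rabs_pos).
    nra.
  - intros e he. destruct (Uexp e he) as [r1 [hr1 Hr1]].
    destruct (Hm1 (e / 2)) as [r2 [hr2 Hr2]]; [lra|].
    destruct (Hm2 (e / 2)) as [r3 [hr3 Hr3]]; [lra|].
    exists (Rmin r1 (Rmin r2 r3)). split; [repeat apply Rmin_glb_lt; auto|].
    intros Y Y' hY hY' b hb [hn1 hn2].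
    pose proof (Rmin_l r1 (Rmin r2 r3)). pose proof (Rmin_r r1 (Rmin r2 r3)).
    pose proof (Rmin_l r2 r3). pose proof (Rmin_r r2 r3).
    pose proof (hn2 true) as n1. pose proof (hn2 false) as n2. unfold dlt in *. split.
    + specialize (Hr1 i (Y true) (Y false) (Y' true) (Y' false) b hY hY' ltac:(lra) n1 n2).
      match goal with |- Rabs ?t <= _ => match type of Hr1 with Rabs ?t' <= _ =>
        replace t with t' by ring end end. exact Hr1.
    + intros h c [hc1 hc2].
      specialize (Hr2 i (Y true) (Y false) (Y' true) (Y' false) ltac:(lra) ltac:(lra)).
      specialize (Hr3 i (Y true) (Y false) (Y' true) (Y' false) ltac:(lra) ltac:(lra)).
      match goal with |- Rabs ?t <= _ => replace t with
        ((Wu i (Y' true) (Y' false) - Wu i (Y true) (Y false)) * h true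
         + (Wv i (Y' true) (Y' false) - Wv i (Y true) (Y false)) * h false) by ring end.
      eapply Rle_trans; [apply Rabs_triang|]. rewrite !Rabs_mult.
      replace (e * c) with (e / 2 * c + e / 2 * c) by field.
      apply Rplus_le_compat; apply Rmult_le_compat; auto using Rabs_pos.
Qed.

Lemma compose_UC1 H GH : UC1 O H GH ->
  UC1 (plane a1 d) (fun Y => H (X (Y true) (Y false)))
    (fun Y h => GH (X (Y true) (Y false))
       (fun i => Wu i (Y true) (Y false) * h true + Wv i (Y true) (Y false) * h false)).
Proof.
  intros HH. apply (UC1_comp ixs O (plane a1 d) H GH
    (fun i Y => U i (Y true) (Y false))); auto using in_ixs, U_UC1.
  intros Y hY. apply Uin. exact hY.
Qed.

(* Comparing two candidates for a v-derivative through their derivatives along u. *)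
Lemma Wv_compare i H GH B u v : UC1 O H GH -> dirs i = true -> tri a1 d u v ->
  (forall s, v <= s <= u ->
     Rabs (G i (X s v) (fun j => Wv j s v) - GH (X s v) (fun j => Wu j s v)) <= B) ->
  Wv i v v = H (X v v) ->
  Rabs (Wv i u v - H (X u v)) <= B * (u - v).
Proof.
  intros HH hi ht HB Hdiag.
  set (phi := fun s => Wv i s v - H (X s v)).
  replace (Wv i u v - H (X u v)) with (phi u - phi v) by (unfold phi; rewrite Hdiag; ring).
  apply increment_bound; [destruct ht as [_ [_ ht]]; lra|].
  intros s hs e he.
  assert (hts := tri_between u v s ht hs).
  set (psi := fun s => on_box_deriv (box_lo Mb) (box_hi Mb) G U Wv i s v).
  destruct (continuous_elim psi s (Wv_c i v hi s) (e / 2)) as [r1 [hr1 Hr1]]; [lra|].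
  destruct (UC1_modulus _ _ _ (compose_UC1 H GH HH) (e / 2)) as [r2 [hr2 Hr2]]; [lra|].
  exists (Rmin r1 r2). split; [now apply Rmin_glb_lt|]. intros s' hs' hss.
  pose proof (Rmin_l r1 r2). pose proof (Rmin_r r1 r2).
  assert (hts' := tri_between u v s' ht hs').
  set (Y := fun b : bool => if b then s else v). set (Y' := fun b : bool => if b then s' else v).
  assert (hn : nb (dlt Y Y') (Rabs (s' - s))).
  { split; [apply Rabs_pos|]. intros []; unfold dlt, Y, Y'; [lra|].
    rewrite Rminus_diag, Rabs_R0. apply Rabs_pos. }
  destruct (Hr2 Y Y' hts hts' (Rabs (s' - s)) ltac:(lra) hn) as [k1 _]. unfold Y, Y', dlt in k1. simpl in k1.
  assert (E1 : GH (X s v) (fun i => Wu i s v * (s' - s) + Wv i s v * (v - v))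
               = (s' - s) * GH (X s v) (fun i => Wu i s v)).
  { destruct (UC1_bound _ _ _ HH) as [Mh [_ HMh]].
    destruct (HMh (X s v) (Uin s v hts)) as [[_ lm] _]. rewrite <- lm. f_equal.
    apply functional_extensionality. intros j. ring. }
  rewrite E1 in k1.
  assert (E2 : Wv i s' v - Wv i s v = RI psi s s').
  { rewrite (Wv_eq i s' v hi), (Wv_eq i s v hi); try now apply tri_strip.
    fold psi. rewrite <- (RI_chasles psi (Wv_c i v hi) v s s'). ring. }
  assert (k2 : Rabs (RI psi s s' - (s' - s) * psi s) <= e / 2 * Rabs (s' - s)).
  { apply RI_lin_bound; [exact (Wv_c i v hi)|]. intros t htt. apply Hr1.
    eapply Rle_trans; [|apply Rle_trans with (1 := hss); auto].
    apply Rabs_le. revert htt. unfold Rmin, Rmax, Rabs.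
    destruct (Rle_dec s s'); destruct (Rcase_abs (s' - s)); lra. }
  assert (E3 : psi s = G i (X s v) (fun j => Wv j s v)).
  { unfold psi, on_box_deriv. rewrite pi_box_id; [reflexivity|]. now apply Uin. }
  specialize (HB s hs). rewrite <- E3 in HB.
  unfold phi.
  replace (Wv i s' v - H (X s' v) - (Wv i s v - H (X s v))) with
    ((RI psi s s' - (s' - s) * psi s)
     - (H (X s' v) - H (X s v) - (s' - s) * GH (X s v) (fun i => Wu i s v))
     + (s' - s) * (psi s - GH (X s v) (fun j => Wu j s v))) by (rewrite <- E2; ring).
  eapply Rle_trans; [apply Rabs_triang|]. rewrite Rabs_mult. unfold Rminus at 1.
  eapply Rle_trans; [apply Rplus_le_compat_r, Rabs_triang|]. rewrite Rabs_Ropp.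
  pose proof (Rabs_pos (s' - s)). nra.
Qed.

(** Both sides have the same integral representation along u: the v-derivative of y_u is y_uv, which
    is also the u-derivative of y_v, and the diagonal values agree. The same holds for p. *)
Lemma Wv_yp u v : tri a1 d u v -> Wv Iy u v = U IB u v /\ Wv Ip u v = U ID u v.
Proof.
  intros ht. pose proof (tri_strip _ _ _ _ ht) as hs. pose proof (tri_diag _ _ ht) as hdg.
  assert (hv : Rabs v <= a1) by apply ht.
  assert (hgap := gap_range v hv).
  split; [rewrite (Wv_eq Iy u v eq_refl hs), (Usol u v ht IB)
         |rewrite (Wv_eq Ip u v eq_refl hs), (Usol u v ht ID)];
  rewrite N_rhs; auto; simpl;
  rewrite ?gp_y, ?gp_p; unfold X; rewrite U_diag; auto; f_equal.
  - simpl. lra.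
  - apply RInt_ext. intros s _. unfold on_box_deriv.
    rewrite (HG Iy). simpl. rewrite Wv_N; reflexivity.
  - simpl. field. lra.
  - apply RInt_ext. intros s _. unfold on_box_deriv.
    rewrite (HG Ip). simpl. rewrite Wv_N; reflexivity.
Qed.

Variable Mc : R.
Hypothesis hMb : 0 < Mb.
Hypothesis coef_bound : forall Y, O Y ->
  Rabs (lx Y) <= Mc /\ Rabs (lq Y) <= Mc /\ Rabs (mx Y) <= Mc /\ Rabs (mq Y) <= Mc.
Hypothesis hMc : Mb * (2 * Mc) * d <= 1 / 2.

Lemma O_sub Y : O Y -> jet_box a1 a2 rho Y.
Proof. apply in_box_jet. Qed.

Lemma gap_nz Y : O Y -> l Y - m Y <> 0.
Proof.
  intros hY. pose proof (l_range _ (O_sub Y hY)). pose proof (m_range _ (O_sub Y hY)). lra.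
Qed.

Lemma coord_UC1 i : UC1 O (fun Y => Y i) (fun _ h => h i).
Proof. destruct (in_box_bound Mb i) as [B HB]. now apply (UC1_coord O i B). Qed.

Lemma l_UC1 : UC1 O l Dl.
Proof. eapply UC1f_subset; [exact O_sub|apply Hl]. Qed.

Lemma m_UC1 : UC1 O m Dm.
Proof. eapply UC1f_subset; [exact O_sub|apply Hm]. Qed.

(** Let X and Q be the defects of x_v = m y_v and q_v = - l p_v. They vanish on the diagonal, and
    their u-derivatives are y_u (l_x X + l_q Q) and - p_u (m_x X + m_q Q), since y_uv and p_uv were
    computed as if both defects were zero. With coefficients bounded by [Mb * (2 * Mc)] in total and
    a path of length at most [d], each bound on the defects can be halved. *)
Lemma Wv_xq u v : tri a1 d u v ->
  Wv Ix u v = m (X u v) * U IB u v /\ Wv Iq u v = - (l (X u v) * U ID u v).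
Proof.
  set (Hx := fun Y : ix -> R => m Y * Y IB).
  set (Hq := fun Y : ix -> R => -1 * (l Y * Y ID)).
  set (GHx := fun Y (h : ix -> R) => m Y * h IB + Y IB * Dm Y h).
  set (GHq := fun Y (h : ix -> R) => -1 * (l Y * h ID + Y ID * Dl Y h) + l Y * Y ID * 0).
  assert (Ux : UC1 O Hx GHx) by (apply (UC1_mult O m Dm _ _ m_UC1 (coord_UC1 IB))).
  assert (Uq : UC1 O Hq GHq).
  { apply (UC1_mult O _ _ _ _ (UC1_const O (-1))
      (UC1_mult O l Dl _ _ l_UC1 (coord_UC1 ID))). }
  set (f := fun t : bool * (R * R) => let (b, uv) := t in let (u, v) := uv in
     if b then Wv Ix u v - Hx (X u v) else Wv Iq u v - Hq (X u v)).
  set (P := fun t : bool * (R * R) => tri a1 d (fst (snd t)) (snd (snd t))).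
  destruct HWv as [[M2 [hM2 HM2]] _].
  destruct (UC1_bound _ _ _ Ux) as [Bx [hBx HBx]].
  destruct (UC1_bound _ _ _ Uq) as [Bq [hBq HBq]].
  assert (Hz : forall t, P t -> f t = 0).
  { apply (zero_of_halving _ P f (M2 + Bx + Bq)).
    - intros [[] [s t]] ht; unfold f, P in *; simpl in ht.
      + destruct (HBx (X s t) (Uin s t ht)) as [_ [k _]]. pose proof (HM2 Ix s t).
        unfold Rminus. eapply Rle_trans; [apply Rabs_triang|]. rewrite Rabs_Ropp. lra.
      + destruct (HBq (X s t) (Uin s t ht)) as [_ [k _]]. pose proof (HM2 Iq s t).
        unfold Rminus. eapply Rle_trans; [apply Rabs_triang|]. rewrite Rabs_Ropp. lra.
    - intros b hb Hb.
      assert (step : forall s t, tri a1 d s t ->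
        Rabs (G Ix (X s t) (fun j => Wv j s t) - GHx (X s t) (fun j => Wu j s t))
          <= Mb * (2 * Mc) * b /\
        Rabs (G Iq (X s t) (fun j => Wv j s t) - GHq (X s t) (fun j => Wu j s t))
          <= Mb * (2 * Mc) * b).
      { intros s t ht. pose proof (Uin s t ht) as hO. pose proof (gap_nz _ hO) as hnz.
        pose proof (Hb (true, (s, t)) ht) as bx. pose proof (Hb (false, (s, t)) ht) as bq.
        unfold f in bx, bq.
        destruct (Wv_yp s t ht) as [ey ep].
        destruct (coef_bound _ hO) as [c1 [c2 [c3 c4]]].
        rewrite (HG Ix), (HG Iq). unfold rhs_deriv, GHx, GHq.
        rewrite (Wv_N IA), (Wv_N IC), (Wu_N IB), (Wu_N ID), !N_rhs by auto.
        unfold rhs.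
        assert (EA : Rabs (X s t IA) <= Mb).
        { apply Rabs_le. exact (hO IA). }
        assert (EC : Rabs (X s t IC) <= Mb).
        { apply Rabs_le. exact (hO IC). }
        split.
        - match goal with |- Rabs ?a <= _ => replace a with
            (X s t IA * (lx (X s t) * (Wv Ix s t - Hx (X s t))
                         + lq (X s t) * (Wv Iq s t - Hq (X s t)))) end.
          + rewrite Rabs_mult. replace (Mb * (2 * Mc) * b) with (Mb * (Mc * b + Mc * b)) by ring.
            apply Rmult_le_compat; auto using Rabs_pos.
            eapply Rle_trans; [apply Rabs_triang|]. rewrite !Rabs_mult.
            apply Rplus_le_compat; apply Rmult_le_compat; auto using Rabs_pos.
          + unfold y_uv, Dl, Dm, directional, along_u, along_v, Hx, Hq.
            rewrite ey, ep, (Wu_N Ix), (Wu_N Iy), (Wu_N Ip), (Wu_N Iq), !N_rhs by auto.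
            unfold rhs. change (U IB s t) with (X s t IB). change (U ID s t) with (X s t ID).
            field. auto.
        - match goal with |- Rabs ?a <= _ => replace a with
            (- (X s t IC * (mx (X s t) * (Wv Ix s t - Hx (X s t))
                         + mq (X s t) * (Wv Iq s t - Hq (X s t))))) end.
          + rewrite Rabs_Ropp, Rabs_mult.
            replace (Mb * (2 * Mc) * b) with (Mb * (Mc * b + Mc * b)) by ring.
            apply Rmult_le_compat; auto using Rabs_pos.
            eapply Rle_trans; [apply Rabs_triang|]. rewrite !Rabs_mult.
            apply Rplus_le_compat; apply Rmult_le_compat; auto using Rabs_pos.
          + unfold p_uv, Dl, Dm, directional, along_u, along_v, Hx, Hq.
            rewrite ey, ep, (Wu_N Ix), (Wu_N Iy), (Wu_N Ip), (Wu_N Iq), !N_rhs by auto.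
            unfold rhs. change (U IB s t) with (X s t IB). change (U ID s t) with (X s t ID).
            field. auto. }
      assert (hMcb : forall s t, tri a1 d s t -> Mb * (2 * Mc) * b * (s - t) <= b / 2).
      { intros s t ht. assert (0 <= Mc).
        { destruct (coef_bound _ (Uin s t ht)) as [k _].
          eapply Rle_trans; [apply Rabs_pos|exact k]. }
        destruct ht as [_ [_ h3]].
        apply Rle_trans with (Mb * (2 * Mc) * b * d); [|nra].
        apply Rmult_le_compat_l; [|lra]. repeat apply Rmult_le_pos; lra. }
      intros [[] [s t]] ht; unfold f; unfold P in ht; simpl in ht.
      + eapply Rle_trans; [apply (Wv_compare Ix Hx GHx (Mb * (2 * Mc) * b)); auto|].
        * intros s' hs'. apply step. now apply (tri_between s t).
        * assert (hv : Rabs t <= a1) by apply ht. assert (hgap := gap_range t hv).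
          pose proof (tri_diag _ _ ht) as hdg.
          rewrite (Wv_diag Ix t eq_refl hdg), gp_x. unfold rhs, Hx.
          rewrite l_diag, m_diag, X_diag by auto. simpl. field. lra.
        * now apply hMcb.
      + eapply Rle_trans; [apply (Wv_compare Iq Hq GHq (Mb * (2 * Mc) * b)); auto|].
        * intros s' hs'. apply step. now apply (tri_between s t).
        * assert (hv : Rabs t <= a1) by apply ht. assert (hgap := gap_range t hv).
          pose proof (tri_diag _ _ ht) as hdg.
          rewrite (Wv_diag Iq t eq_refl hdg), gp_q. unfold rhs, Hq.
          rewrite l_diag, m_diag, X_diag by auto. simpl. field. lra.
        * now apply hMcb. }
  intros ht. pose proof (Hz (true, (u, v)) ht) as k1. pose proof (Hz (false, (u, v)) ht) as k2.
  unfold f, Hx, Hq in k1, k2. change (X u v IB) with (U IB u v) in k1.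
  change (X u v ID) with (U ID u v) in k2. lra.
Qed.

(** Both sides have the same u-derivative: l p_v + q_v and m p_u + q_u vanish, and what is left is p
    times the equation that defines y_uv. Hence the comparison holds with constant 0. *)
Lemma Wv_z u v : tri a1 d u v ->
  Wv Iz u v = (U Ip u v * m (X u v) + U Iq u v) * U IB u v.
Proof.
  set (H := fun Y : ix -> R => (Y Ip * m Y + Y Iq) * Y IB).
  set (GH := fun Y (h : ix -> R) => (Y Ip * m Y + Y Iq) * h IB
                + Y IB * ((Y Ip * Dm Y h + m Y * h Ip) + h Iq)).
  assert (UH : UC1 O H GH).
  { apply (UC1_mult O _ _ _ _
      (UC1_plus O _ _ _ _ (UC1_mult O _ _ _ _ (coord_UC1 Ip) m_UC1) (coord_UC1 Iq))
      (coord_UC1 IB)). }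
  intros ht. apply Rminus_diag_uniq. apply Rabs_eq_0_of_eps. intros e he.
  apply Rle_trans with (0 * (u - v)); [|lra].
  apply (Wv_compare Iz H GH 0); auto.
  - intros s hs. assert (hts := tri_between u v s ht hs).
    pose proof (Uin s v hts) as hO. pose proof (gap_nz _ hO) as hnz.
    destruct (Wv_yp s v hts) as [ey ep]. destruct (Wv_xq s v hts) as [ex eq].
    rewrite (HG Iz). unfold rhs_deriv, GH. right.
    match goal with |- Rabs ?a = 0 => replace a with 0; [apply Rabs_R0|] end.
    unfold Dl, Dm, directional.
    rewrite ey, ep, ex, eq, (Wv_N IA), (Wu_N IB), (Wu_N Ix), (Wu_N Iy), (Wu_N Ip),
      (Wu_N Iq), !N_rhs by auto.
    unfold rhs, y_uv, Dl, Dm, directional, along_u, along_v.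
    change (U IB s v) with (X s v IB). change (U ID s v) with (X s v ID).
    field. auto.
  - assert (hv : Rabs v <= a1) by apply ht. assert (hgap := gap_range v hv).
    pose proof (tri_diag _ _ ht) as hdg.
    rewrite (Wv_diag Iz v eq_refl hdg), gp_z. unfold rhs, H.
          rewrite l_diag, m_diag, X_diag by auto. simpl. field. lra.
Qed.

End regular_solution.

Lemma box_order Mb : 0 < Mb -> forall i, box_lo Mb i <= box_hi Mb i.
Proof. intros h [| | | | | | | |]; simpl; lra. Qed.

Lemma gdata_in_box Mb : 0 < Mb ->
  (forall i w, Rabs w <= a1 ->
     match i with IA | IB | IC | ID => Rabs (gdata i w) <= Mb | _ => True end) ->
  forall w, Rabs w <= a1 -> in_box (box_lo Mb) (box_hi Mb) (fun i => gdata i w).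
Proof.
  intros hMb HMb w hw i. pose proof (HMb i w hw) as h.
  specialize (p0_small w hw). specialize (q0_small w hw). specialize (z0_small w hw).
  apply Rabs_le_between in p0_small. apply Rabs_le_between in q0_small.
  apply Rabs_le_between in z0_small. apply Rabs_le_between in hw.
  destruct i; simpl in *; try apply Rabs_le_between in h; lra.
Qed.

Lemma tri_middle d u v s : tri a1 d u v -> v <= s <= u -> tri a1 d s v /\ tri a1 d u s.
Proof.
  intros [h1 [h2 h3]] hs.
  assert (Rabs s <= a1).
  { apply Rabs_le_between in h1. apply Rabs_le_between in h2. apply Rabs_le. lra. }
  unfold tri. repeat split; auto; lra.
Qed.

Lemma RI_between h b c B : (forall x, continuous h x) -> b <= c ->
  (forall x, b <= x <= c -> 0 <= h x <= B) -> 0 <= RI h b c <= B * (c - b).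
Proof.
  intros hc hbc H.
  assert (k : Rabs (RI h b c - (c - b) * (B / 2)) <= B / 2 * Rabs (c - b)).
  { apply RI_lin_bound; auto. intros x hx. rewrite Rmin_left, Rmax_right in hx by lra.
    specialize (H x hx). apply Rabs_le. lra. }
  rewrite (Rabs_pos_eq (c - b)) in k by lra. apply Rabs_le_between in k. lra.
Qed.

Theorem hodograph_solution : exists d kap (U Wu Wv : ix -> R -> R -> R),
  0 < d /\ 0 < kap /\ BUC U /\ BUC Wu /\ BUC Wv
  /\ (forall i w, Rabs w <= a1 -> U i w w = gdata i w)
  /\ (forall i, UC1 (plane a1 d) (fun Y => U i (Y true) (Y false))
       (fun Y h => Wu i (Y true) (Y false) * h true + Wv i (Y true) (Y false) * h false))
  /\ forall u v, tri a1 d u v -> let X := fun i => U i u v in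
     jet_box a1 a2 rho X /\ Rabs (X Iz) <= rho /\ kap <= X IA /\ X IB <= - kap
     /\ Wu Ix u v = l X * X IA /\ Wv Ix u v = m X * X IB
     /\ Wu Iy u v = X IA /\ Wv Iy u v = X IB
     /\ Wu Ip u v = X IC /\ Wv Ip u v = X ID
     /\ Wu Iq u v = - (m X * X IC) /\ Wv Iq u v = - (l X * X ID)
     /\ Wu Iz u v = (X Ip * l X + X Iq) * X IA
     /\ Wv Iz u v = (X Ip * m X + X Iq) * X IB.
Proof.
  destruct gdata_D1 as [gp [Hgp [gpx [gpy [gpp [gpq gpz]]]]]].
  destruct gdata_box as [Mb0 [hMb0 HMb0]].
  (* The extra 1 lets y_u, y_v, p_u, p_v move by 1 away from their diagonal values without leaving
     the box. *)
  set (Mb := Mb0 + 1). assert (hMb : 0 < Mb) by (unfold Mb; lra).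
  assert (HMb : forall i w, Rabs w <= a1 ->
     match i with IA | IB | IC | ID => Rabs (gdata i w) <= Mb | _ => True end).
  { intros i w hw. specialize (HMb0 i w hw). unfold Mb. destruct i; auto; lra. }
  pose proof (gdata_in_box Mb hMb HMb) as Hgbox.
  set (O := in_box (box_lo Mb) (box_hi Mb)) in *.
  destruct (rhs_UC1 Mb) as [G [HG1 HG2]].
  destruct (system_data_intro ixs (box_lo Mb) (box_hi Mb) rhs G gdata gp a1
     in_ixs (box_order Mb hMb) HG1 Hgp) as [M SD].
  pose proof (sd_pos _ _ _ _ _ _ _ _ SD) as hM.
  assert (hz : Rabs 0 <= a1) by (rewrite Rabs_R0; lra).
  assert (hK0 : 0 < K0) by (pose proof (l_range _ (base_box 0 hz)); lra).
  destruct (C1_bounded _ _ (jf_x _ _ _ _ _ _ _ _ Hl)) as [B1 [hB1 HB1]].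
  destruct (C1_bounded _ _ (jf_q _ _ _ _ _ _ _ _ Hl)) as [B2 [hB2 HB2]].
  destruct (C1_bounded _ _ (jf_x _ _ _ _ _ _ _ _ Hm)) as [B3 [hB3 HB3]].
  destruct (C1_bounded _ _ (jf_q _ _ _ _ _ _ _ _ Hm)) as [B4 [hB4 HB4]].
  set (Mc := B1 + B2 + B3 + B4). assert (hMc : 0 < Mc) by (unfold Mc; lra).
  (* [kap] is half the least possible value 1 / (2 K0) of y_u on the diagonal. [kap1] is at most
     that value and at most the distance c0 / (2 K0) that l / (l - m) keeps from 0 and from 1. *)
  set (kap := / (4 * K0)). assert (hkap : 0 < kap) by (apply Rinv_0_lt_compat; lra).
  set (kap1 := Rmin (c0 / (2 * K0)) (/ (2 * K0))).
  assert (hkap1 : 0 < kap1).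
  { apply Rmin_glb_lt; [apply Rdiv_lt_0_compat|apply Rinv_0_lt_compat]; lra. }
  (* The admissible distance from the data: 1 for the derivatives, rho / 2 for p, q, z, a2 for y,
     and [kap] to keep y_u and y_v away from 0. *)
  set (sm := Rmin (Rmin 1 (rho / 2)) (Rmin a2 kap)).
  assert (hsm : 0 < sm) by (repeat apply Rmin_glb_lt; lra).
  (* Four conditions in turn: contraction of the iteration, displacement at most [sm], right-hand
     sides within [kap1] of their diagonal values, and halving of the defects of x_v and q_v. *)
  set (d := Rmin (Rmin (/ (2 * M)) (sm / M)) (Rmin (kap1 / (2 * (M * M))) (/ (4 * (Mb * Mc))))).
  assert (hMM : 0 < M * M) by nra. assert (hMbc : 0 < Mb * Mc) by nra.
  assert (hd : 0 < d).
  { repeat apply Rmin_glb_lt; try apply Rdiv_lt_0_compat; try apply Rinv_0_lt_compat; lra. }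
  assert (hd1 : d * M <= 1 / 2).
  { apply Rle_trans with (/ (2 * M) * M); [|right; field; lra].
    apply Rmult_le_compat_r; [lra|]. unfold d.
    eapply Rle_trans; [apply Rmin_l|apply Rmin_l]. }
  assert (hd2 : M * d <= sm).
  { apply Rle_trans with (M * (sm / M)); [|right; field; lra].
    apply Rmult_le_compat_l; [lra|]. unfold d.
    eapply Rle_trans; [apply Rmin_l|apply Rmin_r]. }
  assert (hd3 : 2 * (M * M) * d <= kap1).
  { apply Rle_trans with (2 * (M * M) * (kap1 / (2 * (M * M)))); [|right; field; lra].
    apply Rmult_le_compat_l; [lra|]. unfold d.
    eapply Rle_trans; [apply Rmin_r|apply Rmin_l]. }
  assert (hd4 : Mb * (2 * Mc) * d <= 1 / 2).
  { apply Rle_trans with (2 * (Mb * Mc) * / (4 * (Mb * Mc))); [|right; field; lra].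
    replace (Mb * (2 * Mc)) with (2 * (Mb * Mc)) by ring.
    apply Rmult_le_compat_l; [lra|]. unfold d.
    eapply Rle_trans; [apply Rmin_r|apply Rmin_r]. }
  clearbody d.
  assert (hsm1 : sm <= 1 /\ sm <= rho / 2 /\ sm <= a2 /\ sm <= kap).
  { pose proof (Rmin_l (Rmin 1 (rho / 2)) (Rmin a2 kap)).
    pose proof (Rmin_r (Rmin 1 (rho / 2)) (Rmin a2 kap)).
    pose proof (Rmin_l 1 (rho / 2)). pose proof (Rmin_r 1 (rho / 2)).
    pose proof (Rmin_l a2 kap). pose proof (Rmin_r a2 kap). fold sm in H, H0. lra. }
  assert (hk1 : kap1 <= c0 / (2 * K0) /\ kap1 <= / (2 * K0))
    by (split; [apply Rmin_l|apply Rmin_r]).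
  destruct (box_solution dirs (box_lo Mb) (box_hi Mb) rhs G gdata gp a1 d M ha1 hd hd1 SD)
    as [U [HU [Hsol Hclose]]].
  assert (Hclose' : forall i u v, tri a1 d u v ->
     Rabs (U i u v - gdata i (if dirs i then v else u)) <= M * (u - v)).
  { intros i u v ht. pose proof ht as [_ [_ h3]].
    rewrite <- (Rabs_pos_eq (u - v)) by lra. apply Hclose. now apply tri_strip. }
  set (N := on_box (box_lo Mb) (box_hi Mb) rhs U) in *.
  assert (hMd : forall u v, tri a1 d u v -> 0 <= M * (u - v) <= M * d).
  { intros u v [_ [_ h3]]. split; [nra|]. apply Rmult_le_compat_l; lra. }
  (* N stays close to its value on the diagonal, where x_u = l/(l-m) lies strictly
     between 0 and 1: this keeps x between v and u. *)
  assert (HN : forall i s v, tri a1 d s v ->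
     Rabs (N i s v - rhs i (fun j => gdata j s)) <= kap1).
  { intros i s v ht. pose proof (hMd s v ht) as hmd. destruct ht as [h1 [h2 h3]].
    apply Rle_trans with (M * (2 * (M * d))); [|lra].
    rewrite <- (pi_box_id (box_lo Mb) (box_hi Mb) (fun j => gdata j s)) by now apply Hgbox.
    apply (sd_lip _ _ _ _ _ _ _ _ SD); try apply pi_box_in, SD.
    apply pi_box_lip. split; [lra|]. intros j. unfold dlt.
    assert (k := Hclose' j s v (conj h1 (conj h2 h3))).
    destruct (dirs j); [|lra].
    assert (k2 := sd_glip _ _ _ _ _ _ _ _ SD j s v h1 h2).
    rewrite (Rabs_left1 (v - s)) in k2 by lra.
    replace (U j s v - gdata j s) with ((U j s v - gdata j v) + (gdata j v - gdata j s)) by ring.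
    eapply Rle_trans; [apply Rabs_triang|]. lra. }
  assert (HNB : BUC N) by now apply (on_box_BUC _ _ _ _ _ _ _ _ SD).
  assert (HNx : forall s v, tri a1 d s v -> 0 <= N Ix s v <= 1).
  { intros s v ht. assert (k := HN Ix s v ht).
    change (rhs Ix (fun j => gdata j s))
      with (l (fun j => gdata j s) * / (l (base s) - m (base s))) in k.
    assert (hs : Rabs s <= a1) by apply ht.
    pose proof (gap_range s hs). pose proof (l_range _ (base_box s hs)).
    pose proof (m_range _ (base_box s hs)).
    assert (El : l (fun j => gdata j s) = l (base s)) by apply (jf_jet _ _ _ _ _ _ _ _ Hl).
    rewrite El in k. set (ll := l (base s)) in *. set (mm := m (base s)) in *.
    assert (e1 : c0 / (2 * K0) <= ll * / (ll - mm)).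
    { apply Rmult_le_compat; try lra. apply Rinv_le_contravar; lra. }
    assert (e2 : ll * / (ll - mm) = 1 - (- mm) * / (ll - mm)) by (field; lra).
    assert (e3 : c0 / (2 * K0) <= (- mm) * / (ll - mm)).
    { apply Rmult_le_compat; try lra. apply Rinv_le_contravar; lra. }
    apply Rabs_le_between in k. lra. }
  assert (HgA : forall s, Rabs s <= a1 -> 2 * kap <= gdata IA s).
  { intros s hs. pose proof (gap_range s hs). simpl. unfold kap.
    replace (2 * / (4 * K0)) with (/ (2 * K0)) by (field; lra).
    apply Rinv_le_contravar; lra. }
  assert (HNy : forall s v, tri a1 d s v -> 0 <= N Iy s v <= M).
  { intros s v ht. assert (k := HN Iy s v ht).
    assert (hs : Rabs s <= a1) by apply ht. specialize (HgA s hs).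
    change (rhs Iy (fun j => gdata j s)) with (gdata IA s) in k.
    assert (k2 : Rabs (N Iy s v) <= M)
      by (apply (sd_F _ _ _ _ _ _ _ _ SD), pi_box_in, SD).
    apply Rabs_le_between in k. apply Rabs_le_between in k2.
    assert (2 * kap = / (2 * K0)) by (unfold kap; field; lra). lra. }
  assert (Usol : forall u v, tri a1 d u v -> solves dirs N U gdata u v).
  { intros u v ht. apply Hsol. now apply tri_strip. }
  assert (Hx : forall u v, tri a1 d u v -> v <= U Ix u v <= u).
  { intros u v ht. rewrite (Usol u v ht Ix).
    change (dirs Ix) with true. cbv iota. change (gdata Ix v) with v.
    assert (k : 0 <= RI (fun s => N Ix s v) v u <= 1 * (u - v)).
    { apply RI_between.
      - now apply (BUC_continuous_u N).
      - destruct ht as [_ [_ h3]]. lra.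
      - intros s hs. apply HNx. now apply (tri_middle d u v s). }
    lra. }
  assert (Hy : forall u v, tri a1 d u v -> 0 <= U Iy u v <= M * (u - v)).
  { intros u v ht. rewrite (Usol u v ht Iy).
    change (dirs Iy) with true. cbv iota. change (gdata Iy v) with 0.
    assert (k : 0 <= RI (fun s => N Iy s v) v u <= M * (u - v)).
    { apply RI_between.
      - now apply (BUC_continuous_u N).
      - destruct ht as [_ [_ h3]]. lra.
      - intros s hs. apply HNy. now apply (tri_middle d u v s). }
    lra. }
  (* Closeness to the data cannot confine x and y, whose data reach the boundary of the box; for
     them the sign of the right-hand sides is used. The other components have room to move. *)
  assert (Uin : forall u v, tri a1 d u v -> O (fun j => U j u v)).
  { intros u v ht i. pose proof (hMd u v ht) as hmd.
    pose proof (Hclose' i u v ht) as k. pose proof (Hx u v ht). pose proof (Hy u v ht).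
    destruct ht as [h1 [h2 h3]].
    pose proof (HMb0 i u h1) as bu. pose proof (HMb0 i v h2) as bv.
    pose proof (p0_small v h2) as pv. pose proof (q0_small v h2) as qv.
    pose proof (z0_small v h2) as zv.
    apply Rabs_le_between in h1. apply Rabs_le_between in h2.
    apply Rabs_le_between in pv. apply Rabs_le_between in qv. apply Rabs_le_between in zv.
    apply Rabs_le_between in k.
    destruct i; simpl in *; try apply Rabs_le_between in bu;
      try apply Rabs_le_between in bv; unfold Mb; lra. }
  destruct (solution_regular dirs (box_lo Mb) (box_hi Mb) rhs G gdata gp a1 d M ha1 hd hd1 SD
     U HU Usol Uin) as [Wu [Wv [HWu [HWv [W1 [W2 [W3 [W4 W5]]]]]]]].
  assert (Hcoef : forall Y, O Y ->
    Rabs (lx Y) <= Mc /\ Rabs (lq Y) <= Mc /\ Rabs (mx Y) <= Mc /\ Rabs (mq Y) <= Mc).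
  { intros Y hY. apply in_box_jet in hY. unfold Mc.
    specialize (HB1 Y hY). specialize (HB2 Y hY). specialize (HB3 Y hY). specialize (HB4 Y hY).
    repeat split; lra. }
  exists d, kap, U, Wu, Wv. repeat (split; [assumption|]).
  split; [|split].
  - intros i w hw. now apply (U_diag Mb d U hd Usol).
  - intros i. now apply (U_UC1 d U Wu Wv).
  - intros u v ht X.
    pose proof (Uin u v ht) as hO.
    pose proof (in_box_jet Mb _ hO) as hJ.
    pose proof (hMd u v ht) as hmd.
    assert (hr : forall i, N i u v = rhs i X).
    { intros i. unfold N, on_box. now rewrite pi_box_id. }
    destruct (Wv_yp Mb d G gp U Wv hd HG2 Usol Uin W2 W4 gpy gpp u v ht) as [ey ep].
    destruct (Wv_xq Mb d G gp U Wu Wv hd HG2 HU Usol Uin HWu HWv W1 W2 W3 W4 W5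
       gpx gpy gpp gpq Mc hMb Hcoef hd4 u v ht) as [ex eq].
    pose proof (Wv_z Mb d G gp U Wu Wv hd HG2 HU Usol Uin HWu HWv W1 W2 W3 W4 W5
       gpx gpy gpp gpq gpz Mc hMb Hcoef hd4 u v ht) as ez.
    split; [exact hJ|]. split; [apply Rabs_le; exact (hO Iz)|].
    assert (k1 := Hclose' IA u v ht). assert (k2 := Hclose' IB u v ht).
    assert (gA := HgA u ltac:(apply ht)). assert (gB := HgA v ltac:(apply ht)).
    cbn [dirs] in k1, k2.
    change (gdata IB v) with (- gdata IA v) in k2.
    apply Rabs_le_between in k1. apply Rabs_le_between in k2.
    unfold X. split; [lra|]. split; [lra|].
    rewrite !W1 by reflexivity. fold N. rewrite !hr. repeat split; auto.
Qed.

End hodograph.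

(** * Inversion of the characteristic coordinates *)

Lemma continuous_on_plus (D : R * R -> Prop) (f g : R * R -> R) :
  continuous_on D f -> continuous_on D g -> continuous_on D (fun z => f z + g z).
Proof.
  intros Hf Hg p hp.
  apply (filterlim_comp_2 f g Rplus (Hf p hp) (Hg p hp)).
  apply (filterlim_plus (K := R_AbsRing) (V := R_NormedModule)).
Qed.

Lemma continuous_on_mult (D : R * R -> Prop) (f g : R * R -> R) :
  continuous_on D f -> continuous_on D g -> continuous_on D (fun z => f z * g z).
Proof.
  intros Hf Hg p hp.
  apply (filterlim_comp_2 f g Rmult (Hf p hp) (Hg p hp)).
  apply (filterlim_mult (K := R_AbsRing)).
Qed.

Lemma continuous_on_minus (D : R * R -> Prop) (f g : R * R -> R) :
  continuous_on D f -> continuous_on D g -> continuous_on D (fun z => f z - g z).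
Proof.
  intros Hf Hg. apply continuous_on_intro. intros p hp e he.
  destruct (continuous_on_elim _ _ Hf p hp (e / 2)) as [r1 [hr1 H1]]; [lra|].
  destruct (continuous_on_elim _ _ Hg p hp (e / 2)) as [r2 [hr2 H2]]; [lra|].
  exists (Rmin r1 r2). split; [now apply Rmin_glb_lt|]. intros q hq [n1 n2].
  pose proof (Rmin_l r1 r2). pose proof (Rmin_r r1 r2).
  specialize (H1 q hq ltac:(split; lra)). specialize (H2 q hq ltac:(split; lra)).
  apply Rabs_le_between in H1. apply Rabs_le_between in H2. apply Rabs_le. lra.
Qed.

Lemma continuous_on_inv (D : R * R -> Prop) (f : R * R -> R) :
  continuous_on D f -> (forall z, D z -> f z <> 0) -> continuous_on D (fun z => / f z).
Proof.
  intros Hf h0 p hp. apply (filterlim_comp _ _ _ f Rinv _ (locally (f p))); auto.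
  apply (continuous_Rinv (f p)). now apply h0.
Qed.

Lemma trapezoid_convex a1 K eps : 0 < a1 -> 0 < K -> 0 < eps ->
  convex_body (trapezoid a1 K eps).
Proof.
  intros ha hK he. split.
  - intros [px py] [qx qy] t [h1 h2] [h3 h4] ht. unfold trapezoid, segment_pt in *; simpl in *.
    split; [|nra].
    assert (Rabs (px + t * (qx - px)) <= (1 - t) * Rabs px + t * Rabs qx).
    { replace (px + t * (qx - px)) with ((1 - t) * px + t * qx) by ring.
      eapply Rle_trans; [apply Rabs_triang|].
      rewrite !Rabs_mult, (Rabs_pos_eq t), (Rabs_pos_eq (1 - t)); lra. }
    nra.
  - set (h := Rmin eps (a1 / (1 + K))).
    assert (hh : 0 < h) by (apply Rmin_glb_lt; auto; apply Rdiv_lt_0_compat; lra).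
    exists 0, 0, h. split; auto. intros s t hs ht. unfold trapezoid; simpl.
    rewrite !Rplus_0_l, Rabs_pos_eq by lra.
    assert (h <= eps) by apply Rmin_l. split; [|lra].
    assert (h * (1 + K) <= a1).
    { apply Rle_trans with (a1 / (1 + K) * (1 + K)); [|right; field; lra].
      apply Rmult_le_compat_r; [lra|apply Rmin_r]. }
    nra.
Qed.

Lemma plane_lin (L : (bool -> R) -> R) k : lin L ->
  L k = L (fun b => if b then 1 else 0) * k true + L (fun b => if b then 0 else 1) * k false.
Proof.
  intros [la lm].
  replace k with (fun b : bool => k true * (if b then 1 else 0) + k false * (if b then 0 else 1)) at 1.
  - rewrite la, !lm. ring.
  - apply functional_extensionality. intros []; ring.
Qed.

Section inversion.
Variables (a1 a2 rho K0 c0 : R) (l m : (ix -> R) -> R).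
Variables (d kap : R) (U Wu Wv : ix -> R -> R -> R).
Hypotheses (ha1 : 0 < a1) (ha2 : 0 < a2) (hc0 : 0 < c0) (hd : 0 < d) (hkap : 0 < kap).
Hypothesis l_range : forall X, jet_box a1 a2 rho X -> c0 <= l X <= K0.
Hypothesis m_range : forall X, jet_box a1 a2 rho X -> - K0 <= m X <= - c0.
Hypothesis l_C1 : C1on (jet_box a1 a2 rho) l.
Hypothesis m_C1 : C1on (jet_box a1 a2 rho) m.
Hypothesis l_jet : forall X, l X = l (jet (X Ix) (X Iy) (X Ip) (X Iq)).
Hypothesis m_jet : forall X, m X = m (jet (X Ix) (X Iy) (X Ip) (X Iq)).
Let X u v : ix -> R := fun i => U i u v.
Let gap w := l (X w w) - m (X w w).
Hypothesis diag_x : forall w, Rabs w <= a1 -> U Ix w w = w.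
Hypothesis diag_y : forall w, Rabs w <= a1 -> U Iy w w = 0.
Hypothesis diag_A : forall w, Rabs w <= a1 -> U IA w w = / gap w.
Hypothesis diag_B : forall w, Rabs w <= a1 -> U IB w w = - / gap w.
Hypothesis U_C1 : forall i, UC1 (plane a1 d) (fun Y => U i (Y true) (Y false))
  (fun Y h => Wu i (Y true) (Y false) * h true + Wv i (Y true) (Y false) * h false).
Hypothesis Hsys : forall u v, tri a1 d u v ->
  jet_box a1 a2 rho (X u v) /\ kap <= U IA u v /\ U IB u v <= - kap
  /\ Wu Ix u v = l (X u v) * U IA u v /\ Wv Ix u v = m (X u v) * U IB u v
  /\ Wu Iy u v = U IA u v /\ Wv Iy u v = U IB u v.

Lemma diag_tri w : Rabs w <= a1 -> tri a1 d w w.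
Proof. intros h. unfold tri. repeat split; auto; lra. Qed.

Lemma gap_bounds w : Rabs w <= a1 -> 2 * c0 <= gap w.
Proof.
  intros hw. destruct (Hsys w w (diag_tri w hw)) as [hj _].
  pose proof (l_range _ hj). pose proof (m_range _ hj). unfold gap. lra.
Qed.

(* Near the diagonal point (w, w) the combinations x - mu y and x - lambda y, with the
   speeds frozen at that point, are almost the coordinates u and v. *)
Lemma almost_coordinates eta : 0 < eta -> exists r, 0 < r /\
  forall w u v u' v' b, Rabs w <= a1 -> tri a1 d u v -> tri a1 d u' v' ->
  Rabs (u - w) <= r -> Rabs (v - w) <= r -> Rabs (u' - w) <= r -> Rabs (v' - w) <= r ->
  Rabs (u' - u) <= b -> Rabs (v' - v) <= b -> b <= 2 * r ->
  Rabs (U Ix u' v' - U Ix u v - m (X w w) * (U Iy u' v' - U Iy u v) - (u' - u)) <= eta * b /\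
  Rabs (U Ix u' v' - U Ix u v - l (X w w) * (U Iy u' v' - U Iy u v) - (v' - v)) <= eta * b.
Proof.
  intros heta.
  assert (hK0 : 0 < K0).
  { destruct (Hsys 0 0) as [hj _]; [apply diag_tri; rewrite Rabs_R0; lra|].
    pose proof (l_range _ hj). lra. }
  set (e := eta / (2 * (1 + K0))).
  assert (he : 0 < e) by (apply Rdiv_lt_0_compat; lra).
  destruct (UC1_modulus _ _ _ (U_C1 Ix) e he) as [r1 [hr1 H1]].
  destruct (UC1_modulus _ _ _ (U_C1 Iy) e he) as [r2 [hr2 H2]].
  set (r := Rmin r1 r2 / 2).
  assert (hr : 0 < r) by (unfold r; assert (0 < Rmin r1 r2) by (now apply Rmin_glb_lt); lra).
  exists r. split; auto.
  intros w u v u' v' b hw ht ht' hu hv hu' hv' hdu hdv hb.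
  assert (hr12 : 2 * r <= r1 /\ 2 * r <= r2).
  { pose proof (Rmin_l r1 r2). pose proof (Rmin_r r1 r2). unfold r. lra. }
  assert (b0 : 0 <= b) by (eapply Rle_trans; [apply Rabs_pos|exact hdu]).
  set (Y := fun c : bool => if c then u else v). set (Y' := fun c : bool => if c then u' else v').
  set (Yw := fun c : bool => w).
  assert (n1 : nb (dlt Y Y') b) by (split; auto; intros []; auto).
  assert (n2 : nb (dlt Yw Y) r) by (split; [lra|]; intros []; auto).
  pose proof (diag_tri w hw) as htw.
  destruct (Hsys w w htw) as [hj [_ [_ [ex [ex' [ey ey']]]]]].
  rewrite diag_A in ex, ey by auto. rewrite diag_B in ex', ey' by auto.
  assert (hg := gap_bounds w hw).
  destruct (H1 Y Y' ht ht' b ltac:(lra) n1) as [k1 _].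
  destruct (H2 Y Y' ht ht' b ltac:(lra) n1) as [k2 _].
  destruct (H1 Yw Y htw ht r ltac:(lra) n2) as [_ j1]. specialize (j1 _ _ n1).
  destruct (H2 Yw Y htw ht r ltac:(lra) n2) as [_ j2]. specialize (j2 _ _ n1).
  unfold Y, Y', Yw, dlt in *; simpl in *.
  rewrite ex, ex' in j1. rewrite ey, ey' in j2.
  pose proof (l_range _ hj) as lr. pose proof (m_range _ hj) as mr.
  assert (hee : 2 * e * (1 + K0) * b = eta * b) by (unfold e; field; lra).
  assert (gen : forall c, Rabs c <= K0 -> forall z,
     z = (l (X w w) * / gap w * (u' - u) + m (X w w) * - / gap w * (v' - v))
         - c * (/ gap w * (u' - u) + - / gap w * (v' - v)) ->
     Rabs (U Ix u' v' - U Ix u v - c * (U Iy u' v' - U Iy u v) - z) <= eta * b).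
  { intros c hc z ->.
    match type of k1 with Rabs ?a1' <= _ => match type of k2 with Rabs ?a2' <= _ =>
    match type of j1 with Rabs ?a3' <= _ => match type of j2 with Rabs ?a4' <= _ =>
      match goal with |- Rabs ?t <= _ =>
        replace t with ((a1' + a3') - c * (a2' + a4')) by ring end;
      set (A1 := a1') in *; set (A2 := a2') in *; set (A3 := a3') in *; set (A4 := a4') in *
    end end end end.
    unfold Rminus. eapply Rle_trans; [apply Rabs_triang|]. rewrite Rabs_Ropp, Rabs_mult.
    pose proof (Rabs_triang A1 A3). pose proof (Rabs_triang A2 A4).
    assert (Rabs c * Rabs (A2 + A4) <= K0 * (2 * (e * b))).
    { apply Rmult_le_compat; auto using Rabs_pos. lra. }
    rewrite <- hee. nra. }
  split; apply gen.
  - apply Rabs_le. lra.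
  - unfold gap in *. field. lra.
  - apply Rabs_le. lra.
  - unfold gap in *. field. lra.
Qed.

(** The coordinates of the point over (x, y) are approximately x - m y and x - l y, within K0 y of
    x. The factor 2 leaves room for the error of this approximation. *)
Let K := 2 * K0.

(** The point is sought in a square next to the diagonal point (x, x), where the derivative of the
    coordinate map is nearly constant. For y = 0 the square shrinks to (x, x). *)
Definition preimage (z w : R * R) : Prop :=
  fst z <= fst w <= fst z + K * snd z /\ fst z - K * snd z <= snd w <= fst z
  /\ U Ix (fst w) (snd w) = fst z /\ U Iy (fst w) (snd w) = snd z.

(** The slope [K] of the lateral sides of the trapezoid is exactly what keeps the square over z
    within |u|, |v| <= a1. *)
Lemma square_tri eps z u v : 2 * K * eps <= d -> trapezoid a1 K eps z -> 0 < K ->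
  fst z <= u <= fst z + K * snd z -> fst z - K * snd z <= v <= fst z -> tri a1 d u v.
Proof.
  intros he [h1 h2] hK hu hv.
  pose proof (Rle_abs (fst z)). pose proof (Rle_abs (- fst z)). rewrite Rabs_Ropp in *.
  assert (0 <= K * snd z <= K * eps) by nra.
  unfold tri. repeat split; try apply Rabs_le; lra.
Qed.

(** A simplified Newton iteration: the derivative is frozen at the diagonal point (x, x), where its
    inverse is explicit, and the iteration starts there. No point outside the closed triangle is
    ever used. *)
Lemma preimage_exists : exists eps0, 0 < eps0 /\ forall eps, 0 < eps <= eps0 ->
  forall z, trapezoid a1 K eps z -> exists w, preimage z w.
Proof.
  assert (hK0 : c0 <= K0).
  { destruct (Hsys 0 0) as [hj _]; [apply diag_tri; rewrite Rabs_R0; lra|].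
    pose proof (l_range _ hj). lra. }
  assert (hK : 0 < K) by (unfold K; lra).
  (* On a square of side K y the iteration deviates by at most eta K y = c0 y, which is no more than
     - mu y and la y; so the iterates do not cross the diagonal. Also eta <= 1 / 2, as c0 <= K0. *)
  set (eta := c0 / K). assert (heta : 0 < eta) by (apply Rdiv_lt_0_compat; lra).
  assert (hetaK : eta * K = c0) by (unfold eta; field; lra).
  assert (heta2 : eta <= 1 / 2).
  { apply Rmult_le_reg_r with K; auto. rewrite hetaK. unfold K. lra. }
  destruct (almost_coordinates eta heta) as [r [hr Hr]].
  set (eps0 := Rmin (d / (2 * K)) (r / K)).
  assert (heps0 : 0 < eps0) by (apply Rmin_glb_lt; apply Rdiv_lt_0_compat; lra).
  exists eps0. split; auto. intros eps heps z hz.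
  assert (he1 : 2 * K * eps <= d).
  { apply Rle_trans with (2 * K * (d / (2 * K))); [|right; field; lra].
    apply Rmult_le_compat_l; [lra|]. eapply Rle_trans; [apply heps|apply Rmin_l]. }
  assert (he2 : K * eps <= r).
  { apply Rle_trans with (K * (r / K)); [|right; field; lra].
    apply Rmult_le_compat_l; [lra|]. eapply Rle_trans; [apply heps|apply Rmin_r]. }
  pose proof hz as [hz1 hz2]. set (xs := fst z) in *. set (ys := snd z) in *.
  assert (hky : 0 <= K * ys <= K * eps) by (split; nra).
  assert (hxs : Rabs xs <= a1) by lra.
  set (mu := m (X xs xs)). set (la := l (X xs xs)).
  destruct (Hsys xs xs (diag_tri xs hxs)) as [hj _].
  pose proof (l_range _ hj) as lr. pose proof (m_range _ hj) as mr. fold la in lr. fold mu in mr.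
  set (C := fun Z : bool -> R => xs <= Z true <= xs + K * ys /\ xs - K * ys <= Z false <= xs).
  (* The rows of the inverse derivative at (x, x) are dx - mu dy and dx - la dy. At a fixed point
     both vanish, and la > mu gives dx = dy = 0. *)
  set (Phi := fun (Z : bool -> R) (c : bool) =>
     let dx := U Ix (Z true) (Z false) - xs in let dy := U Iy (Z true) (Z false) - ys in
     if c then Z true - (dx - mu * dy) else Z false - (dx - la * dy)).
  assert (Ctri : forall Z, C Z -> tri a1 d (Z true) (Z false)).
  { intros Z [z1 z2]. now apply (square_tri eps z). }
  assert (Cnear : forall Z, C Z -> Rabs (Z true - xs) <= r /\ Rabs (Z false - xs) <= r).
  { intros Z [z1 z2]. split; apply Rabs_le; lra. }
  assert (Hlip : forall Z Z' b, C Z -> C Z' -> b <= 2 * r -> nb (dlt Z Z') b ->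
     nb (dlt (Phi Z) (Phi Z')) (eta * b)).
  { intros Z Z' b hZ hZ' hb [b0 hn].
    destruct (Cnear Z hZ). destruct (Cnear Z' hZ').
    destruct (Hr xs (Z true) (Z false) (Z' true) (Z' false) b) as [k1 k2]; auto.
    { apply (hn true). } { apply (hn false). }
    split; [nra|]. intros [].
    - rewrite <- Rabs_Ropp. unfold dlt, Phi.
      match goal with |- Rabs ?t <= _ => match type of k1 with Rabs ?t' <= _ =>
        replace t with t' by (unfold mu; ring) end end. exact k1.
    - rewrite <- Rabs_Ropp. unfold dlt, Phi.
      match goal with |- Rabs ?t <= _ => match type of k2 with Rabs ?t' <= _ =>
        replace t with t' by (unfold la; ring) end end. exact k2. }
  set (Z0 := fun _ : bool => xs).
  assert (CZ0 : C Z0) by (unfold C, Z0; lra).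
  assert (P1 : Phi Z0 true = xs - mu * ys).
  { unfold Phi, Z0. rewrite diag_x, diag_y by auto. ring. }
  assert (P2 : Phi Z0 false = xs - la * ys).
  { unfold Phi, Z0. rewrite diag_x, diag_y by auto. ring. }
  destruct (banach_fixed_point bool C Phi Z0 (K0 * ys)) as [Z [CZ HZ]]; auto.
  - intros Z hZ.
    assert (hn : nb (dlt Z0 Z) (K * ys)).
    { split; [lra|]. destruct hZ. intros []; unfold dlt, Z0; apply Rabs_le; lra. }
    destruct (Hlip Z0 Z (K * ys) CZ0 hZ ltac:(lra) hn) as [_ k].
    pose proof (k true) as k1. pose proof (k false) as k2. unfold dlt in k1, k2.
    rewrite P1 in k1. rewrite P2 in k2.
    apply Rabs_le_between in k1. apply Rabs_le_between in k2.
    assert (eta * (K * ys) = c0 * ys) by (rewrite <- hetaK; ring).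
    assert (c0 * ys <= - mu * ys <= K0 * ys) by (split; apply Rmult_le_compat_r; lra).
    assert (c0 * ys <= la * ys <= K0 * ys) by (split; apply Rmult_le_compat_r; lra).
    assert (c0 * ys <= K0 * ys) by (apply Rmult_le_compat_r; lra).
    unfold C, K. unfold K in *. split; lra.
  - intros Zn Z hC hlim.
    assert (hh : forall e, 0 < e -> xs - e <= Z true <= xs + K * ys + e
                    /\ xs - K * ys - e <= Z false <= xs + e).
    { intros e he. destruct (hlim e he) as [n hn].
      pose proof (hn true) as k1. pose proof (hn false) as k2. destruct (hC n) as [c1 c2].
      apply Rabs_le_between in k1. apply Rabs_le_between in k2. lra. }
    unfold C. repeat split; apply le_of_le_eps; intros e he; specialize (hh e he); lra.
  - intros Z Z' b hZ hZ' [b0 hn].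
    (* The estimate requires b <= 2 r; two points of [C] are never further apart, so the smaller
       bound is as good. *)
    set (b' := Rmin b (2 * r)).
    assert (hb' : nb (dlt Z Z') b').
    { split; [apply Rmin_glb; lra|]. intros c. apply Rmin_glb; auto. unfold dlt.
      destruct (Cnear Z hZ) as [q1 q2]. destruct (Cnear Z' hZ') as [q3 q4].
      apply Rabs_le_between in q1. apply Rabs_le_between in q2.
      apply Rabs_le_between in q3. apply Rabs_le_between in q4.
      apply Rabs_le. destruct c; lra. }
    destruct (Hlip Z Z' b' hZ hZ' (Rmin_r _ _) hb') as [_ k].
    split; [lra|]. intros c. eapply Rle_trans; [apply k|].
    assert (b' <= b) by apply Rmin_l. destruct hb' as [b0' _]. nra.
  - assert (0 <= ys) by lra.
    split; [apply Rmult_le_pos; lra|]. intros c. unfold dlt. destruct c; [rewrite P1|rewrite P2];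
    unfold Z0; apply Rabs_le; nra.
  - exists (Z true, Z false). pose proof (HZ true) as e1. pose proof (HZ false) as e2.
    unfold Phi in e1, e2. destruct CZ as [z1 z2].
    set (dx := U Ix (Z true) (Z false) - xs) in *. set (dy := U Iy (Z true) (Z false) - ys) in *.
    assert (hp : (la - mu) * dy = 0) by lra.
    apply Rmult_integral in hp. destruct hp as [hp|hp]; [lra|].
    assert (hx : dx = 0) by (rewrite hp in e1; lra).
    unfold preimage; simpl. fold xs ys. unfold dx, dy in *. repeat split; lra.
Qed.

(** The increments of u and v are (1 + K0) b up to half of the larger one, which is absorbed. For b
    = 0 this says that the point of the square is unique. *)
Lemma preimage_lipschitz : exists r0, 0 < r0 /\ forall z z' w w' b,
  Rabs (fst z) <= a1 -> 0 <= K * snd z <= r0 -> 0 <= K * snd z' <= r0 ->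
  tri a1 d (fst w) (snd w) -> tri a1 d (fst w') (snd w') ->
  preimage z w -> preimage z' w' -> b <= r0 -> near b z z' -> near (2 * (1 + K0) * b) w w'.
Proof.
  assert (h0 : Rabs 0 <= a1) by (rewrite Rabs_R0; lra).
  destruct (almost_coordinates (1 / 2)) as [r [hr Hr]]; [lra|].
  exists (r / 2). split; [lra|].
  intros z z' w w' b hz hk hk' ht ht' [p1 [p2 [p3 p4]]] [p1' [p2' [p3' p4']]] hb [n1 n2].
  set (B := Rmax (Rabs (fst w' - fst w)) (Rabs (snd w' - snd w))).
  assert (nn1 := proj1 (Rabs_le_between _ _) n1).
  assert (hB : B <= 2 * r).
  { apply Rmax_lub; apply Rabs_le; lra. }
  destruct (Hr (fst z) (fst w) (snd w) (fst w') (snd w') B) as [k1 k2]; auto;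
    try (apply Rabs_le; lra); try apply Rmax_l; try apply Rmax_r.
  rewrite p3, p4, p3', p4' in k1, k2.
  destruct (Hsys (fst z) (fst z) (diag_tri _ hz)) as [hj _].
  pose proof (l_range _ hj) as lr. pose proof (m_range _ hj) as mr.
  assert (hb0 : 0 <= b) by (eapply Rle_trans; [apply Rabs_pos|exact n1]).
  assert (q1 : Rabs (m (X (fst z) (fst z)) * (snd z' - snd z)) <= K0 * b).
  { rewrite Rabs_mult. apply Rmult_le_compat; auto using Rabs_pos. apply Rabs_le; lra. }
  assert (q2 : Rabs (l (X (fst z) (fst z)) * (snd z' - snd z)) <= K0 * b).
  { rewrite Rabs_mult. apply Rmult_le_compat; auto using Rabs_pos. apply Rabs_le; lra. }
  assert (g1 : Rabs (fst w' - fst w) <= (1 + K0) * b + B / 2).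
  { apply Rabs_le_between in k1. apply Rabs_le_between in q1. apply Rabs_le. lra. }
  assert (g2 : Rabs (snd w' - snd w) <= (1 + K0) * b + B / 2).
  { apply Rabs_le_between in k2. apply Rabs_le_between in q2. apply Rabs_le. lra. }
  assert (gB : B <= (1 + K0) * b + B / 2) by (apply Rmax_lub; auto).
  split; lra.
Qed.

Definition inverse (z : R * R) : R * R := epsilon (inhabits (0, 0)) (preimage z).

(** The chain rule through the inverse map, valid up to the boundary: a pair (a, b) that solves the
    two linear equations for the gradient is verified directly to be one, without an inverse
    function theorem. *)
Lemma transfer : exists eps, 0 < eps <= a2 /\ 2 * K * eps <= d /\
  (forall z, trapezoid a1 K eps z -> preimage z (inverse z)
      /\ tri a1 d (fst (inverse z)) (snd (inverse z))) /\
  forall H GH, UC1 (plane a1 d) H GH -> forall z, trapezoid a1 K eps z -> forall a b,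
    let w := inverse z in let Y := fun c : bool => if c then fst w else snd w in
    GH Y (fun c => if c then 1 else 0)
      = a * Wu Ix (fst w) (snd w) + b * Wu Iy (fst w) (snd w) ->
    GH Y (fun c => if c then 0 else 1)
      = a * Wv Ix (fst w) (snd w) + b * Wv Iy (fst w) (snd w) ->
    is_grad (trapezoid a1 K eps)
      (fun z => H (fun c => if c then fst (inverse z) else snd (inverse z))) z (a, b).
Proof.
  assert (hK0 : c0 <= K0).
  { destruct (Hsys 0 0) as [hj _]; [apply diag_tri; rewrite Rabs_R0; lra|].
    pose proof (l_range _ hj). lra. }
  assert (hK : 0 < K) by (unfold K; lra).
  destruct preimage_exists as [e0 [he0 He0]].
  destruct preimage_lipschitz as [r0 [hr0 Hr0]].
  set (eps := Rmin (Rmin a2 e0) (Rmin (d / (2 * K)) (r0 / K))).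
  assert (heps : 0 < eps) by (repeat apply Rmin_glb_lt; auto; apply Rdiv_lt_0_compat; lra).
  assert (h1 : eps <= a2) by (eapply Rle_trans; [apply Rmin_l|apply Rmin_l]).
  assert (h2 : eps <= e0) by (eapply Rle_trans; [apply Rmin_l|apply Rmin_r]).
  assert (h3 : 2 * K * eps <= d).
  { apply Rle_trans with (2 * K * (d / (2 * K))); [|right; field; lra].
    apply Rmult_le_compat_l; [lra|]. eapply Rle_trans; [apply Rmin_r|apply Rmin_l]. }
  assert (h4 : K * eps <= r0).
  { apply Rle_trans with (K * (r0 / K)); [|right; field; lra].
    apply Rmult_le_compat_l; [lra|]. eapply Rle_trans; [apply Rmin_r|apply Rmin_r]. }
  clearbody eps. exists eps. split; auto. split; auto.
  assert (Hinv : forall z, trapezoid a1 K eps z -> preimage z (inverse z)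
      /\ tri a1 d (fst (inverse z)) (snd (inverse z))).
  { intros z hz. assert (hp : preimage z (inverse z)).
    { exact (epsilon_spec (inhabits (0, 0)) (preimage z) (He0 eps (conj heps h2) z hz)). }
    split; auto. destruct hp as [p1 [p2 _]]. now apply (square_tri eps z). }
  split; auto.
  intros H GH HH z hz a b w Y Ha Hb.
  apply is_grad_intro; auto. intros e he.
  set (L := 2 * (1 + K0)). assert (hL : 0 < L) by (unfold L; lra).
  set (c := (1 + Rabs a + Rabs b) * L).
  assert (hc : 0 < c) by (unfold c; pose proof (Rabs_pos a); pose proof (Rabs_pos b); nra).
  set (e1 := e / c). assert (he1 : 0 < e1) by now apply Rdiv_lt_0_compat.
  destruct (UC1_modulus _ _ _ HH e1 he1) as [r1 [hr1 H1]].
  destruct (UC1_modulus _ _ _ (U_C1 Ix) e1 he1) as [r2 [hr2 H2]].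
  destruct (UC1_modulus _ _ _ (U_C1 Iy) e1 he1) as [r3 [hr3 H3]].
  set (r4 := Rmin (Rmin r1 r2) r3).
  assert (hr4 : 0 < r4) by (repeat apply Rmin_glb_lt; auto).
  exists (Rmin r0 (r4 / L)). split; [apply Rmin_glb_lt; auto; now apply Rdiv_lt_0_compat|].
  intros z' bb hz' hbb hn.
  pose proof (Rmin_l r0 (r4 / L)). pose proof (Rmin_r r0 (r4 / L)).
  assert (hLb : L * bb <= r4).
  { apply Rle_trans with (L * (r4 / L)); [apply Rmult_le_compat_l; lra|right; field; lra]. }
  assert (hr4' : r4 <= r1 /\ r4 <= r2 /\ r4 <= r3).
  { pose proof (Rmin_l (Rmin r1 r2) r3). pose proof (Rmin_r (Rmin r1 r2) r3).
    pose proof (Rmin_l r1 r2). pose proof (Rmin_r r1 r2). unfold r4. lra. }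
  destruct (Hinv z hz) as [hp ht]. destruct (Hinv z' hz') as [hp' ht'].
  set (w' := inverse z') in *. fold w in hp, ht.
  set (Y' := fun c : bool => if c then fst w' else snd w').
  assert (hnw : near (L * bb) w w').
  { destruct hz as [a01 a02]. destruct hz' as [a03 a04].
    pose proof (Rabs_pos (fst z)). pose proof (Rabs_pos (fst z')).
    apply (Hr0 z z'); auto; try lra; try (split; nra). nra. }
  assert (b0 : 0 <= bb) by (eapply Rle_trans; [apply Rabs_pos|apply hn]).
  assert (hdY : nb (dlt Y Y') (L * bb)).
  { split; [nra|]. destruct hnw. intros []; auto. }
  assert (hY : plane a1 d Y) by exact ht. assert (hY' : plane a1 d Y') by exact ht'.
  destruct (H1 Y Y' hY hY' (L * bb) ltac:(lra) hdY) as [k1 _].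
  destruct (H2 Y Y' hY hY' (L * bb) ltac:(lra) hdY) as [k2 _].
  destruct (H3 Y Y' hY hY' (L * bb) ltac:(lra) hdY) as [k3 _].
  destruct (UC1_bound _ _ _ HH) as [MH [_ HMH]].
  destruct (HMH Y hY) as [hlin _].
  rewrite (plane_lin _ (dlt Y Y') hlin), Ha, Hb in k1.
  destruct hp as [_ [_ [hp1 hp2]]]. destruct hp' as [_ [_ [hp1' hp2']]].
  unfold Y, Y', dlt in k2, k3. cbn beta iota in k2, k3.
  rewrite hp1, hp1' in k2. rewrite hp2, hp2' in k3.
  change (dlt Y Y' true) with (fst w' - fst w) in k1.
  change (dlt Y Y' false) with (snd w' - snd w) in k1.
  change (Rabs (H Y' - H Y - ((fst z' - fst z) * a + (snd z' - snd z) * b)) <= e * bb).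
  (* The increments of x and y between the two preimages are exactly those of z, so the remainder of
     H is a combination of the three remainders in (u, v), with coefficients 1, - a and - b. *)
  match type of k2 with Rabs ?A2 <= _ => match type of k3 with Rabs ?A3 <= _ =>
  match type of k1 with Rabs ?A1 <= _ =>
    replace (H Y' - H Y - ((fst z' - fst z) * a + (snd z' - snd z) * b))
      with (A1 - a * A2 - b * A3) by ring;
    set (B1 := A1) in *; set (B2 := A2) in *; set (B3 := A3) in * end end end.
  unfold Rminus. eapply Rle_trans; [apply Rabs_triang|].
  eapply Rle_trans; [apply Rplus_le_compat_r, Rabs_triang|].
  rewrite !Rabs_Ropp.  rewrite !Rabs_mult.
  pose proof (Rmult_le_compat_l _ _ _ (Rabs_pos a) k2).
  pose proof (Rmult_le_compat_l _ _ _ (Rabs_pos b) k3).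
  replace (e * bb) with (e1 * ((1 + Rabs a + Rabs b) * (L * bb)))
    by (unfold e1, c; field; pose proof (Rabs_pos a); pose proof (Rabs_pos b); split; nra).
  nra.
Qed.

End inversion.

(** * The Cauchy problem *)

Section existence.
Variables (a1 a2 rho K0 c0 : R) (l lx ly lp lq m mx my mp mq : (ix -> R) -> R).
Variables (p0 q0 z0 r0 s0 rp sp : R -> R).
Hypotheses (ha1 : 0 < a1) (ha2 : 0 < a2) (hrho : 0 < rho) (hc0 : 0 < c0).
Hypothesis Hl : jet_function a1 a2 rho l lx ly lp lq.
Hypothesis Hm : jet_function a1 a2 rho m mx my mp mq.
Hypothesis l_range : forall X, jet_box a1 a2 rho X -> c0 <= l X <= K0.
Hypothesis m_range : forall X, jet_box a1 a2 rho X -> - K0 <= m X <= - c0.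
Hypothesis Dp0 : D1 (fun w => Rabs w <= a1) p0 r0.
Hypothesis Dq0 : D1 (fun w => Rabs w <= a1) q0 s0.
Hypothesis Dz0 : D1 (fun w => Rabs w <= a1) z0 p0.
Hypothesis Dr0 : D1 (fun w => Rabs w <= a1) r0 rp.
Hypothesis Ds0 : D1 (fun w => Rabs w <= a1) s0 sp.
Hypothesis p0_small : forall w, Rabs w <= a1 -> Rabs (p0 w) <= rho / 2.
Hypothesis q0_small : forall w, Rabs w <= a1 -> Rabs (q0 w) <= rho / 2.
Hypothesis z0_small : forall w, Rabs w <= a1 -> Rabs (z0 w) <= rho / 2.

Theorem cauchy_existence : exists eps, 0 < eps <= a2 /\
  exists f p q r s t : R * R -> R, let D := trapezoid a1 (2 * K0) eps in
  (forall z, D z -> is_grad D f z (p z, q z)) /\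
  (forall z, D z -> is_grad D p z (r z, s z)) /\
  (forall z, D z -> is_grad D q z (s z, t z)) /\
  class_C 1 D r /\ class_C 1 D s /\ class_C 1 D t /\
  (forall z, D z -> Rabs (f z) <= rho /\ Rabs (p z) <= rho /\ Rabs (q z) <= rho /\
     let J := jet (fst z) (snd z) (p z) (q z) in
     l J * m J * r z + (l J + m J) * s z + t z = 0) /\
  forall x, Rabs x <= a1 -> f (x, 0) = z0 x /\ p (x, 0) = p0 x /\ q (x, 0) = q0 x
     /\ r (x, 0) = r0 x /\ s (x, 0) = s0 x.
Proof.
  destruct (hodograph_solution a1 a2 rho K0 c0 l lx ly lp lq m mx my mp mq p0 q0 z0 r0 s0 rp sp
     ha1 ha2 hrho hc0 Hl Hm l_range m_range Dp0 Dq0 Dz0 Dr0 Ds0 p0_small q0_small z0_small)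
    as [d [kap [U [Wu [Wv [hd [hkap [_ [_ [_ [Udiag [UC Hsys]]]]]]]]]]]].
  set (X := fun u v => fun i => U i u v).
  assert (Xdiag : forall w, Rabs w <= a1 -> X w w = fun i =>
      gdata l m p0 q0 z0 r0 s0 i w).
  { intros w hw. apply functional_extensionality. intros i. now apply Udiag. }
  assert (ldiag : forall w, Rabs w <= a1 -> l (X w w) = l (jet w 0 (p0 w) (q0 w))).
  { intros w hw. rewrite (jf_jet _ _ _ _ _ _ _ _ Hl), Xdiag; auto. }
  assert (mdiag : forall w, Rabs w <= a1 -> m (X w w) = m (jet w 0 (p0 w) (q0 w))).
  { intros w hw. rewrite (jf_jet _ _ _ _ _ _ _ _ Hm), Xdiag; auto. }
  destruct (transfer a1 a2 rho K0 c0 l m d kap U Wu Wv ha1 ha2 hc0 hd l_range m_range)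
    as [eps [heps [hKeps [Hinv Htr]]]].
  { intros w hw. now rewrite Udiag. }
  { intros w hw. now rewrite Udiag. }
  { intros w hw. rewrite Udiag; auto. fold (X w w). rewrite ldiag, mdiag; auto. }
  { intros w hw. rewrite Udiag; auto. fold (X w w). rewrite ldiag, mdiag; auto. }
  { exact UC. }
  { intros u v ht. destruct (Hsys u v ht) as [h1 [_ [h3 [h4 [h5 [h6 [h7 [h8 _]]]]]]]].
    repeat split; auto; apply h1. }
  assert (hK0 : 0 < K0).
  { assert (h0 : Rabs 0 <= a1) by (rewrite Rabs_R0; lra).
    assert (ht : tri a1 d 0 0) by (unfold tri; repeat split; auto; lra).
    destruct (Hsys 0 0 ht) as [hj _]. pose proof (l_range _ hj). lra. }
  set (K := 2 * K0) in *. set (D := trapezoid a1 K eps) in *.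
  set (inv := inverse K0 U) in *.
  assert (HD : convex_body D) by (apply trapezoid_convex; auto; unfold K; lra).
  set (P := plane a1 d).
  set (at_ := fun (H : (bool -> R) -> R) (z : R * R) =>
     H (fun c : bool => if c then fst (inv z) else snd (inv z))).
  assert (hP : forall z, D z -> P (fun c : bool => if c then fst (inv z) else snd (inv z))).
  { intros z hz. apply (Hinv z hz). }
  set (Ub := fun i (Y : bool -> R) => U i (Y true) (Y false)).
  set (Xb := fun (Y : bool -> R) i => U i (Y true) (Y false)).
  assert (CU : forall i, C1on P (Ub i)) by (intros i; eexists; apply UC).
  assert (hbox : forall Y, P Y -> jet_box a1 a2 rho (Xb Y)) by (intros Y hY; now apply Hsys).
  assert (Cl : C1on P (fun Y => l (Xb Y))).
  { apply (C1on_comp ixs (jet_box a1 a2 rho) P l Ub); auto using in_ixs.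
    eexists; apply Hl. }
  assert (Cm : C1on P (fun Y => m (Xb Y))).
  { apply (C1on_comp ixs (jet_box a1 a2 rho) P m Ub); auto using in_ixs.
    eexists; apply Hm. }
  assert (hA : forall Y, P Y -> kap <= Ub IA Y) by (intros Y hY; now apply Hsys).
  assert (hB : forall Y, P Y -> Ub IB Y <= - kap) by (intros Y hY; now apply Hsys).
  assert (hgap : forall Y, P Y -> 2 * c0 <= l (Xb Y) - m (Xb Y)).
  { intros Y hY. pose proof (l_range _ (hbox Y hY)). pose proof (m_range _ (hbox Y hY)). lra. }
  (* p_u / y_u = l f_xx + f_xy and p_v / y_v = m f_xx + f_xy, because x_u = l y_u and x_v = m y_v.
     Solving for f_xx and f_xy and taking f_yy from the equation expresses them by unknowns of the
     system, which are C^1 in (u, v). *)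
  set (mm := fun Y => Ub IC Y / Ub IA Y). set (nn := fun Y => Ub ID Y / Ub IB Y).
  set (gg := fun Y => l (Xb Y) - m (Xb Y)).
  set (rb := fun Y => (mm Y - nn Y) / gg Y).
  set (sb := fun Y => (l (Xb Y) * nn Y - m (Xb Y) * mm Y) / gg Y).
  set (tb := fun Y => - (l (Xb Y) * m (Xb Y) * rb Y + (l (Xb Y) + m (Xb Y)) * sb Y)).
  assert (Cmm : C1on P mm).
  { apply C1_div with kap; auto. intros Y hY. specialize (hA Y hY). rewrite Rabs_pos_eq; lra. }
  assert (Cnn : C1on P nn).
  { apply C1_div with kap; auto. intros Y hY. specialize (hB Y hY). rewrite Rabs_left1; lra. }
  assert (Cgg : C1on P gg) by now apply C1_minus.
  assert (hgg : forall Y, P Y -> 2 * c0 <= Rabs (gg Y)).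
  { intros Y hY. specialize (hgap Y hY). unfold gg. rewrite Rabs_pos_eq; lra. }
  assert (h2c : 0 < 2 * c0) by lra.
  assert (Cr : C1on P rb) by (apply C1_div with (2 * c0); auto; now apply C1_minus).
  assert (Cs : C1on P sb).
  { apply C1_div with (2 * c0); auto. apply C1_minus; now apply C1_mult. }
  assert (Ct : C1on P tb).
  { apply C1_opp. apply C1_plus; apply C1_mult; auto; [now apply C1_mult|now apply C1_plus]. }
  (* The chain rule through the characteristic coordinates: the gradient (a, b) solves
     a x_u + b y_u = H_u and a x_v + b y_v = H_v. *)
  assert (Hgrad : forall H GH, UC1 P H GH -> forall z, D z ->
    let Y := fun c : bool => if c then fst (inv z) else snd (inv z) in
    let a := (GH Y (fun c => if c then 1 else 0) / Ub IA Y
              - GH Y (fun c => if c then 0 else 1) / Ub IB Y) / gg Y in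
    is_grad D (at_ H) z (a, GH Y (fun c => if c then 1 else 0) / Ub IA Y - l (Xb Y) * a)).
  { intros H GH HH z hz Y a.
    assert (hY : P Y) by now apply hP.
    destruct (Hsys _ _ hY) as [_ [_ [_ [_ [e1 [e2 [e3 [e4 _]]]]]]]].
    pose proof (hA Y hY). pose proof (hB Y hY). pose proof (hgap Y hY).
    apply (Htr H GH HH z hz); fold inv; fold Y.
    - assert (e1' : Wu Ix (fst (inv z)) (snd (inv z)) = l (Xb Y) * Ub IA Y) by exact e1.
      assert (e3' : Wu Iy (fst (inv z)) (snd (inv z)) = Ub IA Y) by exact e3.
      rewrite e1', e3'. unfold a, gg. field. lra.
    - assert (e2' : Wv Ix (fst (inv z)) (snd (inv z)) = m (Xb Y) * Ub IB Y) by exact e2.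
      assert (e4' : Wv Iy (fst (inv z)) (snd (inv z)) = Ub IB Y) by exact e4.
      rewrite e2', e4'. unfold a, gg. field. lra. }
  assert (Hcont : forall H, C1on P H -> continuous_on D (at_ H)).
  { intros H [GH HH]. apply continuous_on_intro. intros z hz.
    exact (is_grad_near_continuous _ _ _ _ (Hgrad H GH HH z hz)). }
  assert (Hcoord : forall c, C1on P (fun Y => Y c)).
  { intros c. apply (C1_coord P c a1). intros Y [h1 [h2 _]]. destruct c; auto. }
  assert (HcontG : forall H GH k, UC1 P H GH -> (exists b, nb k b) ->
     continuous_on D (at_ (fun Y => GH Y k))).
  { intros H GH k HH [b hb]. apply continuous_on_intro. intros z hz e he.
    assert (hb1 : 0 < b + 1) by (destruct hb; lra).
    destruct (UC1_modulus _ _ _ HH (e / (b + 1))) as [r1 [hr1 H1]].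
    { now apply Rdiv_lt_0_compat. }
    destruct (continuous_on_elim _ _ (Hcont _ (Hcoord true)) z hz r1 hr1) as [r2 [hr2 H2]].
    destruct (continuous_on_elim _ _ (Hcont _ (Hcoord false)) z hz r1 hr1) as [r3 [hr3 H3]].
    exists (Rmin r2 r3). split; [now apply Rmin_glb_lt|]. intros z' hz' [n1 n2].
    pose proof (Rmin_l r2 r3). pose proof (Rmin_r r2 r3).
    specialize (H2 z' hz' ltac:(split; lra)). specialize (H3 z' hz' ltac:(split; lra)).
    destruct (H1 _ _ (hP z hz) (hP z' hz') r1 (Rle_refl _)) as [_ k1].
    { split; [lra|]. intros []; [exact H2|exact H3]. }
    specialize (k1 k b hb). unfold at_. eapply Rle_trans; [exact k1|].
    destruct hb as [hb _]. apply Rle_trans with (e / (b + 1) * (b + 1)); [|right; field; lra].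
    apply Rmult_le_compat_l; [left; now apply Rdiv_lt_0_compat|lra]. }
  assert (HC1 : forall H, C1on P H -> class_C 1 D (at_ H)).
  { intros H [GH HH].
    set (G1 := fun Y => GH Y (fun c : bool => if c then 1 else 0)).
    set (G2 := fun Y => GH Y (fun c : bool => if c then 0 else 1)).
    assert (c1 : continuous_on D (at_ G1)).
    { apply (HcontG H GH _ HH). exists 1. split; [lra|].
      intros []; rewrite ?Rabs_R1, ?Rabs_R0; lra. }
    assert (c2 : continuous_on D (at_ G2)).
    { apply (HcontG H GH _ HH). exists 1. split; [lra|].
      intros []; rewrite ?Rabs_R1, ?Rabs_R0; lra. }
    assert (iA : continuous_on D (fun z => / at_ (Ub IA) z)).
    { apply continuous_on_inv; auto. intros z hz. pose proof (hA _ (hP z hz)). unfold at_. lra. }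
    assert (iB : continuous_on D (fun z => / at_ (Ub IB) z)).
    { apply continuous_on_inv; auto. intros z hz. pose proof (hB _ (hP z hz)). unfold at_. lra. }
    assert (ig : continuous_on D (fun z => / at_ gg z)).
    { apply continuous_on_inv; auto. intros z hz. pose proof (hgap _ (hP z hz)).
      unfold at_, gg. lra. }
    assert (ca : continuous_on D (fun z => (at_ G1 z * / at_ (Ub IA) z
                  - at_ G2 z * / at_ (Ub IB) z) * / at_ gg z)).
    { apply continuous_on_mult; auto. apply continuous_on_minus; now apply continuous_on_mult. }
    apply (class_C_S_intro D HD 0 (at_ H) _ _ (fun z hz => Hgrad H GH HH z hz)).
    - exact ca.
    - apply continuous_on_minus; [now apply (continuous_on_mult D (at_ G1))|].
      apply (continuous_on_mult D (at_ (fun Y => l (Xb Y)))); auto. }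
  assert (Hcomp : forall i H1 H2,
    (forall u v, tri a1 d u v ->
       let Y := fun c : bool => if c then u else v in
       Wu i u v = H1 Y * Wu Ix u v + H2 Y * Wu Iy u v
       /\ Wv i u v = H1 Y * Wv Ix u v + H2 Y * Wv Iy u v) ->
    forall z, D z -> is_grad D (at_ (Ub i)) z (at_ H1 z, at_ H2 z)).
  { intros i H1 H2 H z hz.
    destruct (Hinv z hz) as [_ ht]. fold inv in ht. destruct (H _ _ ht) as [k1 k2].
    apply (Htr (Ub i) _ (UC i) z hz); fold inv; simpl; rewrite ?Rmult_1_r, ?Rmult_0_r,
      ?Rplus_0_r, ?Rplus_0_l; auto. }
  exists eps. split; auto.
  exists (at_ (Ub Iz)), (at_ (Ub Ip)), (at_ (Ub Iq)), (at_ rb), (at_ sb), (at_ tb).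
  fold K. cbv zeta. fold D.
  assert (hrs : forall u v, tri a1 d u v -> let Y := fun c : bool => if c then u else v in
     l (Xb Y) * rb Y + sb Y = mm Y /\ m (Xb Y) * rb Y + sb Y = nn Y
     /\ mm Y * Ub IA Y = Ub IC Y /\ nn Y * Ub IB Y = Ub ID Y).
  { intros u v ht Y. assert (hY : P Y) by exact ht.
    pose proof (hA Y hY). pose proof (hB Y hY). pose proof (hgap Y hY).
    unfold rb, sb, gg. repeat split; try (field; lra); unfold mm, nn; field; lra. }
  split; [|split; [|split; [|split; [|split; [|split; [|split]]]]]]; auto.
  - apply (Hcomp Iz (Ub Ip) (Ub Iq)). intros u v ht Y.
    destruct (Hsys u v ht) as [_ [_ [_ [_ [e1 [e2 [e3 [e4 [_ [_ [_ [_ [e5 e6]]]]]]]]]]]]].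
    rewrite e1, e2, e3, e4, e5, e6. unfold Ub, Y. cbn beta iota. split; ring.
  - apply (Hcomp Ip rb sb). intros u v ht Y.
    destruct (Hsys u v ht) as [_ [_ [_ [_ [e1 [e2 [e3 [e4 [e5 [e6 _]]]]]]]]]].
    destruct (hrs u v ht) as [k1 [k2 [k3 k4]]]. fold Y in k1, k2, k3, k4.
    assert (e1' : Wu Ix u v = l (Xb Y) * Ub IA Y) by exact e1.
    assert (e2' : Wv Ix u v = m (Xb Y) * Ub IB Y) by exact e2.
    assert (e3' : Wu Iy u v = Ub IA Y) by exact e3.
    assert (e4' : Wv Iy u v = Ub IB Y) by exact e4.
    assert (e5' : Wu Ip u v = Ub IC Y) by exact e5.
    assert (e6' : Wv Ip u v = Ub ID Y) by exact e6.
    rewrite e1', e2', e3', e4', e5', e6', <- k3, <- k4, <- k1, <- k2. split; ring.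
  (* By the definition of [tb], l s + t = - m (l r + s) and m s + t = - l (m r + s); multiplied by
     y_u and y_v these are the equations for q_u and q_v. *)
  - apply (Hcomp Iq sb tb). intros u v ht Y.
    destruct (Hsys u v ht) as [_ [_ [_ [_ [e1 [e2 [e3 [e4 [_ [_ [e5 [e6 _]]]]]]]]]]]].
    destruct (hrs u v ht) as [k1 [k2 [k3 k4]]]. fold Y in k1, k2, k3, k4.
    assert (e1' : Wu Ix u v = l (Xb Y) * Ub IA Y) by exact e1.
    assert (e2' : Wv Ix u v = m (Xb Y) * Ub IB Y) by exact e2.
    assert (e3' : Wu Iy u v = Ub IA Y) by exact e3.
    assert (e4' : Wv Iy u v = Ub IB Y) by exact e4.
    assert (e5' : Wu Iq u v = - (m (Xb Y) * Ub IC Y)) by exact e5.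
    assert (e6' : Wv Iq u v = - (l (Xb Y) * Ub ID Y)) by exact e6.
    rewrite e1', e2', e3', e4', e5', e6', <- k3, <- k4, <- k1, <- k2.
    unfold tb. split; ring.
  - intros z hz. assert (hY := hP z hz).
    destruct (Hsys _ _ hY) as [hj [hz1 _]]. destruct hj as [_ [_ [hj3 hj4]]].
    split; [exact hz1|]. split; [exact hj3|]. split; [exact hj4|].
    destruct (Hinv z hz) as [[_ [_ [ex ey]]] _]. fold inv in ex, ey.
    assert (EJ : forall g : (ix -> R) -> R, (forall X : ix -> R, g X = g (jet (X Ix) (X Iy) (X Ip) (X Iq))) ->
       g (jet (fst z) (snd z) (at_ (Ub Ip) z) (at_ (Ub Iq) z))
       = g (Xb (fun c : bool => if c then fst (inv z) else snd (inv z)))).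
    { intros g hg. rewrite (hg (Xb _)). unfold Xb, at_, Ub. now rewrite ex, ey. }
    rewrite (EJ l), (EJ m); [|apply Hm|apply Hl]. unfold at_, tb. ring.
  - intros x hx.
    assert (hz : D (x, 0)) by (unfold D, trapezoid; simpl; lra).
    destruct (Hinv _ hz) as [[h1 [h2 _]] _]. fold inv in h1, h2.
    cbn [fst snd] in h1, h2. rewrite Rmult_0_r in h1, h2.
    (* Over the initial line the square of admissible preimages is the single point (x, x). *)
    assert (E1 : fst (inv (x, 0)) = x) by lra. assert (E2 : snd (inv (x, 0)) = x) by lra.
    unfold at_. rewrite E1, E2.
    set (Y := fun c : bool => if c then x else x).
    assert (ht : tri a1 d x x) by (unfold tri; repeat split; auto; lra).
    assert (hg := hgap Y ht).
    assert (EU : forall i, Ub i Y = gdata l m p0 q0 z0 r0 s0 i x) by (intros; now apply Udiag).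
    assert (El : l (Xb Y) = l (jet x 0 (p0 x) (q0 x))) by now apply ldiag.
    assert (Em : m (Xb Y) = m (jet x 0 (p0 x) (q0 x))) by now apply mdiag.
    rewrite El, Em in hg.
    rewrite !EU. repeat split; auto; unfold rb, sb, gg, mm, nn; rewrite !EU, El, Em; simpl;
    field; repeat split; try lra; apply Rgt_not_eq || apply Rlt_not_eq; nra.
Qed.

End existence.

(** * Maximum principle along backward characteristics *)

(* Composing with the retraction turns a continuous function on D into one on the
   plane, so that one-dimensional compactness theorems apply. *)
Definition lipschitz_retract (D : R * R -> Prop) : Prop :=
  exists (ret : R * R -> R * R) (L B : R), 0 < L /\ 0 < B
  /\ (forall z, D (ret z)) /\ (forall z, D z -> ret z = z)
  /\ (forall z w b, near b z w -> near (L * b) (ret z) (ret w))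
  /\ forall z, D z -> Rabs (fst z) <= B /\ Rabs (snd z) <= B.

Lemma rect_retract a1 a2 : 0 < a1 -> 0 < a2 -> lipschitz_retract (rect a1 a2).
Proof.
  intros h1 h2.
  exists (fun z => (clamp (- a1) a1 (fst z), clamp (- a2) a2 (snd z))), 1, (a1 + a2).
  repeat split; try lra.
  - simpl. apply Rabs_le. apply clamp_range. lra.
  - simpl. apply Rabs_le. apply clamp_range. lra.
  - intros [x y] [k1 k2]; simpl in *. apply Rabs_le_between in k1. apply Rabs_le_between in k2.
    f_equal; apply clamp_id; lra.
  - simpl. eapply Rle_trans; [apply clamp_lip|]. rewrite Rmult_1_l. apply H.
  - simpl. eapply Rle_trans; [apply clamp_lip|]. rewrite Rmult_1_l. apply H.
  - destruct H. lra.
  - destruct H. lra.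
Qed.

Lemma trapezoid_retract a1 K eps : 0 < a1 -> 0 < K -> 0 < eps ->
  lipschitz_retract (trapezoid a1 K eps).
Proof.
  intros h1 h2 h3.
  (* Above the height a1 / K the trapezoid is empty; clamping y at the attained height keeps the
     width a1 - K y nonnegative. *)
  set (e := Rmin eps (a1 / K)).
  assert (he : 0 < e) by (apply Rmin_glb_lt; auto; now apply Rdiv_lt_0_compat).
  assert (he1 : e <= eps) by apply Rmin_l.
  assert (he2 : K * e <= a1).
  { apply Rle_trans with (K * (a1 / K)); [|right; field; lra].
    apply Rmult_le_compat_l; [lra|apply Rmin_r]. }
  set (ry := fun z : R * R => clamp 0 e (snd z)).
  assert (hry : forall z, 0 <= ry z <= e) by (intros; apply clamp_range; lra).
  assert (hc : forall z, 0 <= a1 - K * ry z) by (intros z; specialize (hry z); nra).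
  set (rx := fun z : R * R => clamp (- (a1 - K * ry z)) (a1 - K * ry z) (fst z)).
  exists (fun z => (rx z, ry z)), (1 + K), (a1 + eps).
  split; [lra|]. split; [lra|]. split; [|split; [|split]].
  - intros z. specialize (hry z). specialize (hc z).
    pose proof (clamp_range (- (a1 - K * ry z)) (a1 - K * ry z) (fst z) ltac:(lra)) as k.
    fold (rx z) in k. unfold trapezoid; simpl. split; [|lra].
    assert (Rabs (rx z) <= a1 - K * ry z) by (apply Rabs_le; lra). lra.
  - intros [x y] [k1 k2]; simpl in *. pose proof (Rabs_pos x).
    assert (hy : y <= e).
    { apply Rmin_glb; [lra|]. apply Rmult_le_reg_l with K; auto.
      replace (K * (a1 / K)) with a1 by (field; lra). lra. }
    assert (E : ry (x, y) = y) by (apply clamp_id; simpl; lra).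
    unfold rx. rewrite E. f_equal. apply clamp_id. simpl.
    assert (k3 : Rabs x <= a1 - K * y) by lra. apply Rabs_le_between in k3. lra.
  - intros z w b [n1 n2].
    assert (b0 : 0 <= b) by (eapply Rle_trans; [apply Rabs_pos|exact n1]).
    assert (hy : Rabs (ry w - ry z) <= b) by (eapply Rle_trans; [apply clamp_lip|auto]).
    assert (hKy : Rabs (K * (ry w - ry z)) <= K * b).
    { rewrite Rabs_mult, (Rabs_pos_eq K) by lra. apply Rmult_le_compat_l; lra. }
    split; simpl; [|nra].
    apply clamp_close; [| |nra].
    + replace (- (a1 - K * ry w) - - (a1 - K * ry z)) with (K * (ry w - ry z)) by ring. nra.
    + replace (a1 - K * ry w - (a1 - K * ry z)) with (- (K * (ry w - ry z))) by ring.
      rewrite Rabs_Ropp. nra.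
  - intros z [k1 k2]. pose proof (Rabs_pos (fst z)). split; [nra|].
    rewrite Rabs_pos_eq; lra.
Qed.

(** * Compactness and uniform estimates on a Lipschitz retract *)

Section compact.
Variable D : R * R -> Prop.
Hypothesis HD : lipschitz_retract D.

Lemma uniformly_continuous f : continuous_on D f -> forall e, 0 < e ->
  exists r, 0 < r /\ forall z w, D z -> D w -> near r z w -> Rabs (f w - f z) <= e.
Proof.
  destruct HD as [ret [L [B [hL [hB [hin [hid [hlip hbd]]]]]]]].
  intros Hf e he. set (h := fun x y => f (ret (x, y))).
  assert (hc : forall x y, continuity_2d_pt h x y).
  { intros x y [d hd]. destruct (continuous_on_elim D f Hf (ret (x, y)) (hin _) (d / 2))
      as [r [hr Hr]]; [simpl; lra|].
    assert (hrL : 0 < r / L) by now apply Rdiv_lt_0_compat.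
    exists (mkposreal _ hrL). intros u v hu hv. simpl in *.
    apply Rle_lt_trans with (d / 2); [|lra]. apply Hr; auto.
    replace r with (L * (r / L)) by (field; lra). apply hlip. split; simpl; lra. }
  destruct (uniform_continuity_2d h (- B) B (- B) B (fun x y _ _ => hc x y) (mkposreal e he))
    as [[r hr] Hr]. simpl in Hr.
  exists (r / 2). split; [lra|]. intros z w hz hw [n1 n2].
  destruct (hbd z hz) as [z1 z2]. destruct (hbd w hw) as [w1 w2].
  apply Rabs_le_between in z1. apply Rabs_le_between in z2.
  apply Rabs_le_between in w1. apply Rabs_le_between in w2.
  left. specialize (Hr (fst z) (snd z) (fst w) (snd w) z1 z2 w1 w2 ltac:(lra) ltac:(lra)).
  unfold h in Hr. rewrite <- !surjective_pairing, !hid in Hr; auto.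
Qed.

Lemma attains_max f : continuous_on D f ->
  exists z, D z /\ forall w, D w -> f w <= f z.
Proof.
  intros Hf. pose proof (uniformly_continuous f Hf) as Hu.
  destruct HD as [ret [L [B [hL [hB [hin [hid [hlip hbd]]]]]]]].
  set (h := fun x y => f (ret (x, y))).
  assert (hh : forall e, 0 < e -> exists r, 0 < r /\ forall x y u v,
     Rabs (u - x) <= r -> Rabs (v - y) <= r -> Rabs (h u v - h x y) <= e).
  { intros e he. destruct (Hu e he) as [r [hr Hr]].
    exists (r / L). split; [now apply Rdiv_lt_0_compat|]. intros x y u v hu hv.
    apply Hr; auto. replace r with (L * (r / L)) by (field; lra). apply hlip. now split. }
  assert (cty : forall g : R -> R, (forall e, 0 < e -> exists r, 0 < r /\ forall x u,
     Rabs (u - x) <= r -> Rabs (g u - g x) <= e) -> forall c, continuity_pt g c).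
  { intros g hg c. apply continuity_pt_filterlim. now apply continuous_of_modulus. }
  assert (hsel : forall x, exists y, (- B <= y <= B) /\ forall v, - B <= v <= B -> h x v <= h x y).
  { intros x. destruct (continuity_ab_maj (h x) (- B) B) as [y [hy1 hy2]]; [lra| |].
    - intros c _. apply cty. intros e he. destruct (hh e he) as [r [hr Hr]].
      exists r. split; auto. intros y u hu. apply Hr; auto. rewrite Rminus_diag, Rabs_R0. lra.
    - exists y. auto. }
  set (sel := fun x => epsilon (inhabits 0) (fun y => (- B <= y <= B) /\
      forall v, - B <= v <= B -> h x v <= h x y)).
  assert (Hsel : forall x, (- B <= sel x <= B) /\
      forall v, - B <= v <= B -> h x v <= h x (sel x)).
  { intros x. unfold sel. apply epsilon_spec. apply hsel. }
  (* The maximum is taken first in y and then in x. A chosen maximizer [sel x] need not depend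
     continuously on x, but the maximal value does, with the modulus of [h]. *)
  set (g := fun x => h x (sel x)).
  destruct (continuity_ab_maj g (- B) B) as [x [hx1 hx2]]; [lra| |].
  - intros c _. apply cty. intros e he. destruct (hh e he) as [r [hr Hr]].
    exists r. split; auto. intros y u hu.
    destruct (Hsel y) as [s1 s2]. destruct (Hsel u) as [s3 s4].
    specialize (s2 _ s3). specialize (s4 _ s1). unfold g.
    assert (k1 := Hr y (sel u) u (sel u) hu ltac:(rewrite Rminus_diag, Rabs_R0; lra)).
    assert (k2 := Hr y (sel y) u (sel y) hu ltac:(rewrite Rminus_diag, Rabs_R0; lra)).
    apply Rabs_le_between in k1. apply Rabs_le_between in k2. apply Rabs_le. lra.
  - exists (ret (x, sel x)). split; auto. intros w hw.
    destruct (hbd w hw) as [w1 w2]. apply Rabs_le_between in w1. apply Rabs_le_between in w2.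
    specialize (hx1 (fst w) w1). destruct (Hsel (fst w)) as [_ k]. specialize (k _ w2).
    unfold g, h in *. rewrite <- surjective_pairing, hid in k; auto. lra.
Qed.

Lemma bounded_on f : continuous_on D f -> exists M, 0 < M /\ forall z, D z -> Rabs (f z) <= M.
Proof.
  intros Hf. assert (Ha : continuous_on D (fun z => Rabs (f z))).
  { apply continuous_on_intro. intros p hp e he.
    destruct (continuous_on_elim _ _ Hf p hp e he) as [r [hr Hr]].
    exists r. split; auto. intros q hq hn. eapply Rle_trans; [apply Rabs_triang_inv2|auto]. }
  destruct (attains_max _ Ha) as [z [hz Hz]]. exists (Rabs (f z) + 1).
  pose proof (Rabs_pos (f z)). split; [lra|]. intros w hw. specialize (Hz w hw). lra.
Qed.

(** Passage from the pointwise class C^1 to the uniform calculus: compactness makes the moduli of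
    the partials uniform, and convexity yields the first order remainder by the mean value
    inequality. The arguments of f are the entries i and j of X. *)
Lemma class_C1_UC1 {I : Type} (i j : I) (f : R * R -> R) : convex_body D -> class_C 1 D f ->
  UC1 (fun X : I -> R => D (X i, X j)) (fun X => f (X i, X j))
    (fun X h => Dx D f (X i, X j) * h i + Dy D f (X i, X j) * h j).
Proof.
  intros Hcv Hf. destruct (class_C_S_elim D Hcv 0 f Hf) as [Hg [Hx Hy]].
  pose proof (class_C_continuous D 1 f Hf) as H0. simpl in Hx, Hy.
  destruct (bounded_on f H0) as [M0 [hM0 HM0]].
  destruct (bounded_on _ Hx) as [M1 [hM1 HM1]].
  destruct (bounded_on _ Hy) as [M2 [hM2 HM2]].
  apply (UC1_intro _ _ _ (M0 + M1 + M2)).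
  - intros X hX. split; intros; ring.
  - intros X hX. specialize (HM0 _ hX). lra.
  - intros X hX h b [hb1 hb2]. eapply Rle_trans; [apply Rabs_triang|]. rewrite !Rabs_mult.
    assert (Rabs (Dx D f (X i, X j)) * Rabs (h i) <= M1 * b)
      by (apply Rmult_le_compat; auto using Rabs_pos).
    assert (Rabs (Dy D f (X i, X j)) * Rabs (h j) <= M2 * b)
      by (apply Rmult_le_compat; auto using Rabs_pos).
    nra.
  - intros e he.
    destruct (uniformly_continuous _ Hx (e / 2)) as [r1 [hr1 H1]]; [lra|].
    destruct (uniformly_continuous _ Hy (e / 2)) as [r2 [hr2 H2]]; [lra|].
    exists (Rmin r1 r2). split; [now apply Rmin_glb_lt|].
    pose proof (Rmin_l r1 r2). pose proof (Rmin_r r1 r2).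
    intros X Y hX hY b hb [b0 hn].
    assert (n1 : near b (X i, X j) (Y i, Y j)) by (split; apply hn). split.
    + pose proof (is_grad_increment D Hcv f (Dx D f) (Dy D f) (X i, X j) (Y i, Y j)
        (Dx D f (X i, X j), Dy D f (X i, X j)) (e / 2) hX hY Hg) as k.
      assert (hseg : forall t, 0 <= t <= 1 ->
         Rabs (Dx D f (segment_pt (X i, X j) (Y i, Y j) t) - Dx D f (X i, X j)) <= e / 2 /\
         Rabs (Dy D f (segment_pt (X i, X j) (Y i, Y j) t) - Dy D f (X i, X j)) <= e / 2).
      { intros t ht.
        assert (hs : D (segment_pt (X i, X j) (Y i, Y j) t)) by (apply Hcv; auto).
        assert (n2 : near b (X i, X j) (segment_pt (X i, X j) (Y i, Y j) t)).
        { destruct n1 as [n1 n2]. unfold near, segment_pt in *; simpl in *.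
          rewrite !Rplus_minus_l, !Rabs_mult, (Rabs_pos_eq t) by lra.
          pose proof (Rabs_pos (Y i - X i)). pose proof (Rabs_pos (Y j - X j)).
          split; nra. }
        destruct n2 as [n2 n3]. split; [apply H1|apply H2]; auto; split; lra. }
      specialize (k hseg b n1). unfold pair_dot in k; simpl in k. unfold dlt.
      match goal with |- Rabs ?a <= _ => match type of k with Rabs ?a' <= _ =>
        replace a with a' by ring end end. lra.
    + intros h c [c0 hc].
      assert (k1 : Rabs (Dx D f (Y i, Y j) - Dx D f (X i, X j)) <= e / 2).
      { apply H1; auto. destruct n1. split; lra. }
      assert (k2 : Rabs (Dy D f (Y i, Y j) - Dy D f (X i, X j)) <= e / 2).
      { apply H2; auto. destruct n1. split; lra. }
      match goal with |- Rabs ?a <= _ => replace a with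
        ((Dx D f (Y i, Y j) - Dx D f (X i, X j)) * h i
         + (Dy D f (Y i, Y j) - Dy D f (X i, X j)) * h j) by ring end.
      eapply Rle_trans; [apply Rabs_triang|]. rewrite !Rabs_mult.
      replace (e * c) with (e / 2 * c + e / 2 * c) by field.
      apply Rplus_le_compat; apply Rmult_le_compat; auto using Rabs_pos.
Qed.

End compact.

Lemma max_over_list (I : Type) (l : list I) (i0 : I) (f : I -> R) :
  In i0 l -> exists i, In i l /\ forall j, In j l -> f j <= f i.
Proof.
  revert i0. induction l as [|a l IH]; intros i0 [].
  - destruct l as [|b l].
    + exists a. split; [now left|]. intros j [<-|[]]. lra.
    + destruct (IH b) as [i [hi Hi]]; [now left|].
      destruct (Rle_dec (f i) (f a)).
      * exists a. split; [now left|]. intros j [<-|hj]; [lra|]. specialize (Hi j hj). lra.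
      * exists i. split; [now right|]. intros j [<-|hj]; [lra|auto].
  - destruct (IH i0 H) as [i [hi Hi]].
    destruct (Rle_dec (f i) (f a)).
    + exists a. split; [now left|]. intros j [<-|hj]; [lra|]. specialize (Hi j hj). lra.
    + exists i. split; [now right|]. intros j [<-|hj]; [lra|auto].
Qed.

(* At a maximum of |delta_i| exp (- c y) over all components and points, the derivative
   along the backward characteristic, which stays in the trapezoid, contradicts the
   growth bound as soon as c > C. *)
Lemma transport_zero (I : Type) (ind : list I) (a1 K eps C : R)
    (delta gx gy speed : I -> R * R -> R) :
  (forall i, In i ind) -> 0 < a1 -> 0 < K -> 0 < eps -> 0 <= C ->
  let D := trapezoid a1 K eps in
  (forall i z, D z -> is_grad D (delta i) z (gx i z, gy i z)) ->
  (forall i z, D z -> Rabs (speed i z) <= K) ->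
  (forall i z b, D z -> 0 <= b -> (forall j, Rabs (delta j z) <= b) ->
     Rabs (speed i z * gx i z + gy i z) <= C * b) ->
  (forall i x, Rabs x <= a1 -> delta i (x, 0) = 0) ->
  forall i z, D z -> delta i z = 0.
Proof.
  intros Hind ha hK he hC D Hg Hs Hb H0 i1 z1 hz1.
  pose proof (trapezoid_retract a1 K eps ha hK he) as HD. fold D in HD.
  (* The excess of c over C contributes tau d in the final expansion, while the first order
     remainder and the terms quadratic in tau take at most tau d / 4 each. *)
  set (c := C + 1).
  set (wt := fun z : R * R => exp (- (c * snd z))).
  set (F := fun i z => Rabs (delta i z) * wt z).
  assert (Fc : forall i, continuous_on D (F i)).
  { intros i. apply continuous_on_mult.
    - apply continuous_on_intro. intros p hp e hpe.
      destruct (is_grad_near_continuous _ _ _ _ (Hg i p hp) e hpe) as [r [hr Hr]].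
      exists r. split; auto. intros q hq hn. eapply Rle_trans; [apply Rabs_triang_inv2|auto].
    - apply continuous_on_intro. intros p hp e hpe.
      destruct (continuous_elim (fun y => exp (- (c * y))) (snd p)) with (e := e)
        as [r [hr Hr]]; auto.
      + apply (ex_derive_continuous (fun y => exp (- (c * y)))). auto_derive. auto.
      + exists r. split; auto. intros q _ [_ hn]. now apply Hr. }
  set (best := fun i => epsilon (inhabits z1) (fun z => D z /\ forall w, D w -> F i w <= F i z)).
  assert (Hbest : forall i, D (best i) /\ forall w, D w -> F i w <= F i (best i)).
  { intros i. unfold best. apply epsilon_spec. apply (attains_max D HD); auto. }
  destruct (max_over_list I ind i1 (fun i => F i (best i)) (Hind i1)) as [i [_ Hi]].
  set (z := best i). destruct (Hbest i) as [hz Hz]. fold z in hz, Hz, Hi.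
  assert (Hmax : forall j w, D w -> F j w <= F i z).
  { intros j w hw. eapply Rle_trans; [apply (Hbest j); auto|]. apply (Hi j); auto. }
  set (d := Rabs (delta i z)).
  assert (hwt : forall w, 0 < wt w) by (intros; apply exp_pos).
  destruct (Req_dec d 0) as [hd0|hd0].
  { apply Rabs_eq_0. specialize (Hmax i1 z1 hz1). unfold F in Hmax. fold d in Hmax.
    rewrite hd0, Rmult_0_l in Hmax. pose proof (Rabs_pos (delta i1 z1)).
    specialize (hwt z1). nra. }
  exfalso.
  assert (hd : 0 < d) by (pose proof (Rabs_pos (delta i z)); unfold d in *; lra).
  assert (Hj : forall j, Rabs (delta j z) <= d).
  { intros j. specialize (Hmax j z hz). unfold F in Hmax. fold d in Hmax.
    apply Rmult_le_reg_r with (wt z); auto. }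
  set (g := speed i z * gx i z + gy i z).
  assert (hg : Rabs g <= C * d) by (apply (Hb i z d); auto; lra).
  assert (hzy : 0 < snd z).
  { destruct hz as [k1 k2]. destruct (Rle_lt_or_eq_dec 0 (snd z)) as [|E]; [lra|auto|].
    exfalso. apply hd0. unfold d. rewrite (surjective_pairing z), <- E.
    rewrite H0; [apply Rabs_R0|]. rewrite <- E in k1. lra. }
  set (e := d / (4 * (1 + K))). assert (hee : 0 < e) by (apply Rdiv_lt_0_compat; lra).
  destruct (is_grad_elim _ _ _ _ (Hg i z hz) e hee) as [r [hr Hr]].
  set (k := c * (C * d + d)).
  assert (hk : 0 < k) by (unfold k, c; nra).
  (* The step back stays above y = 0, within the range of the expansion at z, and keeps the
     quadratic terms below tau d / 4. *)
  set (tau := Rmin (Rmin (snd z) (r / (1 + K))) (d / (4 * k))).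
  assert (htau : 0 < tau).
  { repeat apply Rmin_glb_lt; auto; apply Rdiv_lt_0_compat; lra. }
  assert (t1 : tau <= snd z) by (eapply Rle_trans; [apply Rmin_l|apply Rmin_l]).
  assert (t2 : (1 + K) * tau <= r).
  { apply Rle_trans with ((1 + K) * (r / (1 + K))); [|right; field; lra].
    apply Rmult_le_compat_l; [lra|]. eapply Rle_trans; [apply Rmin_l|apply Rmin_r]. }
  assert (t3 : k * tau <= d / 4).
  { apply Rle_trans with (k * (d / (4 * k))); [|right; field; lra].
    apply Rmult_le_compat_l; [lra|]. apply Rmin_r. }
  set (w := (fst z - tau * speed i z, snd z - tau)).
  pose proof (Hs i z hz) as hs. pose proof (Rabs_pos (speed i z)).
  assert (hts : Rabs (tau * speed i z) <= K * tau).
  { rewrite Rabs_mult, (Rabs_pos_eq tau) by lra. nra. }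
  assert (hw : D w).
  { destruct hz as [k1 k2]. unfold D, trapezoid, w; simpl. split; [|lra].
    pose proof (Rabs_triang (fst z) (- (tau * speed i z))) as k3. rewrite Rabs_Ropp in k3.
    unfold Rminus at 1. lra. }
  assert (hn : near ((1 + K) * tau) z w).
  { unfold near, w; simpl. split.
    - replace (fst z - tau * speed i z - fst z) with (- (tau * speed i z)) by ring.
      rewrite Rabs_Ropp. lra.
    - replace (snd z - tau - snd z) with (- tau) by ring.
      rewrite Rabs_Ropp, Rabs_pos_eq by lra. nra. }
  specialize (Hr w _ hw t2 hn).
  assert (E : pair_dot (fst w - fst z, snd w - snd z) (gx i z, gy i z) = - (tau * g)).
  { unfold pair_dot, w, g; simpl. ring. }
  rewrite E in Hr.
  assert (hee2 : e * ((1 + K) * tau) = d / 4 * tau) by (unfold e; field; lra).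
  rewrite hee2 in Hr.
  assert (hFw := Hmax i w hw). unfold F in hFw. fold d in hFw.
  assert (hwz : wt w = wt z * exp (c * tau)).
  { unfold wt, w; simpl. rewrite <- exp_plus. f_equal. ring. }
  rewrite hwz in hFw.
  assert (hc1 : 1 + c * tau <= exp (c * tau)).
  { destruct (Req_dec (c * tau) 0) as [->|hne]; [rewrite exp_0; lra|].
    left. now apply exp_ineq1. }
  assert (hfin : Rabs (delta i w) * (1 + c * tau) <= d).
  { apply Rmult_le_reg_r with (wt z); auto. eapply Rle_trans; [|exact hFw].
    pose proof (Rabs_pos (delta i w)). specialize (hwt z).
    assert (Rabs (delta i w) * (1 + c * tau) <= Rabs (delta i w) * exp (c * tau))
      by (apply Rmult_le_compat_l; auto). nra. }
  assert (hlow : d - tau * (C * d) - d / 4 * tau <= Rabs (delta i w)).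
  { assert (hh : Rabs (delta i z - delta i w) <= tau * Rabs g + d / 4 * tau).
    { replace (delta i z - delta i w) with
        (- (delta i w - delta i z - - (tau * g)) + tau * g) by ring.
      eapply Rle_trans; [apply Rabs_triang|].
      rewrite Rabs_Ropp, Rabs_mult, (Rabs_pos_eq tau) by lra. lra. }
    pose proof (Rabs_triang_inv (delta i z) (delta i w)). fold d in H1. nra. }
  assert (hct : 0 < 1 + c * tau) by (unfold c; nra).
  assert (hcomb : (d - tau * (C * d) - d / 4 * tau) * (1 + c * tau) <= d) by nra.
  assert (hexp : (d - tau * (C * d) - d / 4 * tau) * (1 + c * tau)
     = d + tau * (d - d / 4 - c * tau * (C * d + d / 4))) by (unfold c; ring).
  rewrite hexp in hcomb.
  assert (hk2 : c * tau * (C * d + d / 4) <= k * tau).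
  { unfold k. assert (0 < c * tau) by (unfold c; nra). nra. }
  nra.
Qed.

(** * Uniqueness for the Cauchy problem *)

Section grad_rules.
Variable D : R * R -> Prop.

Lemma is_grad_const c p : D p -> is_grad D (fun _ => c) p (0, 0).
Proof.
  intros hp. apply is_grad_intro; auto. intros e he. exists 1. split; [lra|].
  intros q b hq hb [n1 n2]. unfold pair_dot; simpl.
  rewrite !Rmult_0_r, Rplus_0_r, Rminus_0_r, Rminus_diag, Rabs_R0.
  pose proof (Rabs_pos (fst q - fst p)). nra.
Qed.

Lemma is_grad_fst p : D p -> is_grad D fst p (1, 0).
Proof.
  intros hp. apply is_grad_intro; auto. intros e he. exists 1. split; [lra|].
  intros q b hq hb [n1 n2]. unfold pair_dot; simpl.
  rewrite Rmult_0_r, Rplus_0_r, Rmult_1_r, Rminus_diag, Rabs_R0.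
  pose proof (Rabs_pos (fst q - fst p)). nra.
Qed.

Lemma is_grad_snd p : D p -> is_grad D snd p (0, 1).
Proof.
  intros hp. apply is_grad_intro; auto. intros e he. exists 1. split; [lra|].
  intros q b hq hb [n1 n2]. unfold pair_dot; simpl.
  rewrite Rmult_0_r, Rplus_0_l, Rmult_1_r, Rminus_diag, Rabs_R0.
  pose proof (Rabs_pos (fst q - fst p)). nra.
Qed.

Lemma is_grad_plus f g p v w : D p -> is_grad D f p v -> is_grad D g p w ->
  is_grad D (fun z => f z + g z) p (fst v + fst w, snd v + snd w).
Proof.
  intros hp Hf Hg. apply is_grad_intro; auto. intros e he.
  destruct (is_grad_elim _ _ _ _ Hf (e / 2)) as [r1 [hr1 H1]]; [lra|].
  destruct (is_grad_elim _ _ _ _ Hg (e / 2)) as [r2 [hr2 H2]]; [lra|].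
  exists (Rmin r1 r2). split; [now apply Rmin_glb_lt|]. intros q b hq hb hn.
  pose proof (Rmin_l r1 r2). pose proof (Rmin_r r1 r2).
  specialize (H1 q b hq ltac:(lra) hn). specialize (H2 q b hq ltac:(lra) hn).
  unfold pair_dot in *; simpl in *.
  match goal with |- Rabs ?t <= _ => match type of H1 with Rabs ?t1 <= _ =>
    match type of H2 with Rabs ?t2 <= _ => replace t with (t1 + t2) by ring end end end.
  eapply Rle_trans; [apply Rabs_triang|]. lra.
Qed.

Lemma is_grad_mult f g p v w : D p -> is_grad D f p v -> is_grad D g p w ->
  is_grad D (fun z => f z * g z) p
    (f p * fst w + g p * fst v, f p * snd w + g p * snd v).
Proof.
  intros hp Hf Hg. apply is_grad_intro; auto. intros e he.
  set (c := Rabs (f p) + Rabs (g p) + 2 * (Rabs (fst v) + Rabs (snd v)) + 2).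
  pose proof (Rabs_pos (f p)). pose proof (Rabs_pos (g p)).
  pose proof (Rabs_pos (fst v)). pose proof (Rabs_pos (snd v)).
  assert (hc : 0 < c) by (unfold c; lra).
  set (e1 := e / c). assert (he1 : 0 < e1) by now apply Rdiv_lt_0_compat.
  set (e2 := Rmin e1 1). assert (he2 : 0 < e2) by (apply Rmin_glb_lt; lra).
  destruct (is_grad_elim _ _ _ _ Hf e1 he1) as [r1 [hr1 H1']].
  destruct (is_grad_elim _ _ _ _ Hg e1 he1) as [r2 [hr2 H2']].
  destruct (is_grad_near_continuous _ _ _ _ Hg e2 he2) as [r3 [hr3 H3']].
  exists (Rmin (Rmin r1 r2) r3). split; [repeat apply Rmin_glb_lt; auto|].
  intros q b hq hb hn.
  pose proof (Rmin_l (Rmin r1 r2) r3). pose proof (Rmin_r (Rmin r1 r2) r3).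
  pose proof (Rmin_l r1 r2). pose proof (Rmin_r r1 r2).
  specialize (H1' q b hq ltac:(lra) hn). specialize (H2' q b hq ltac:(lra) hn).
  assert (hn3 : near r3 p q) by (destruct hn; split; lra).
  specialize (H3' q hq hn3).
  assert (h31 : Rabs (g q - g p) <= e1) by (eapply Rle_trans; [exact H3'|apply Rmin_l]).
  assert (h32 : Rabs (g q - g p) <= 1) by (eapply Rle_trans; [exact H3'|apply Rmin_r]).
  assert (b0 : 0 <= b) by (eapply Rle_trans; [apply Rabs_pos|apply hn]).
  set (dq := (fst q - fst p, snd q - snd p)) in *.
  assert (hdv : Rabs (pair_dot dq v) <= 2 * ((Rabs (fst v) + Rabs (snd v)) * b)).
  { destruct hn. apply pair_dot_bound; simpl; auto; lra. }
  match goal with |- Rabs ?t <= _ => replace t with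
    (f p * (g q - g p - pair_dot dq w) + (g q - g p) * pair_dot dq v
     + g q * (f q - f p - pair_dot dq v)) by (unfold pair_dot; simpl; ring) end.
  eapply Rle_trans; [apply Rabs_triang|].
  eapply Rle_trans; [apply Rplus_le_compat_r, Rabs_triang|]. rewrite !Rabs_mult.
  assert (hgq : Rabs (g q) <= Rabs (g p) + 1).
  { replace (g q) with ((g q - g p) + g p) by ring.
    eapply Rle_trans; [apply Rabs_triang|]. lra. }
  assert (k1 : Rabs (f p) * Rabs (g q - g p - pair_dot dq w) <= Rabs (f p) * (e1 * b))
    by (apply Rmult_le_compat_l; auto).
  assert (k2 : Rabs (g q - g p) * Rabs (pair_dot dq v)
     <= e1 * (2 * ((Rabs (fst v) + Rabs (snd v)) * b)))
    by (apply Rmult_le_compat; auto using Rabs_pos).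
  assert (k3 : Rabs (g q) * Rabs (f q - f p - pair_dot dq v) <= (Rabs (g p) + 1) * (e1 * b))
    by (apply Rmult_le_compat; auto using Rabs_pos).
  replace (e * b) with (c * (e1 * b)) by (unfold e1; field; lra). unfold c.
  assert (0 <= e1 * b) by nra. nra.
Qed.

Lemma is_grad_opp f p v : D p -> is_grad D f p v ->
  is_grad D (fun z => - f z) p (- fst v, - snd v).
Proof.
  intros hp Hf. apply is_grad_intro; auto. intros e he.
  destruct (is_grad_elim _ _ _ _ Hf e he) as [r1 [hr1 H1]].
  exists r1. split; auto. intros q b hq hb hn. specialize (H1 q b hq hb hn).
  rewrite <- Rabs_Ropp. unfold pair_dot in *; simpl in *.
  match goal with |- Rabs ?t <= _ => match type of H1 with Rabs ?t1 <= _ =>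
    replace t with t1 by ring end end. exact H1.
Qed.

End grad_rules.

Section transport_system.
Variables (a1 a2 rho K eps c0 : R) (l lx ly lp lq m mx my mp mq : (ix -> R) -> R).
Hypotheses (ha1 : 0 < a1) (hK : 0 < K) (heps : 0 < eps <= a2) (hc0 : 0 < c0).
Hypothesis Hl : jet_function a1 a2 rho l lx ly lp lq.
Hypothesis Hm : jet_function a1 a2 rho m mx my mp mq.
Hypothesis l_bound : forall X, jet_box a1 a2 rho X -> Rabs (l X) <= K.
Hypothesis m_bound : forall X, jet_box a1 a2 rho X -> Rabs (m X) <= K.
Hypothesis lm_gap : forall X, jet_box a1 a2 rho X -> c0 <= Rabs (l X - m X).
Let D := trapezoid a1 K eps.

(* In the vectors below IC and ID hold l f_xx + f_xy and m f_xx + f_xy, from which the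
   three second derivatives are recovered. *)
Definition fxx_of (X : ix -> R) : R := (X IC - X ID) / (l X - m X).
Definition fxy_of (X : ix -> R) : R := (l X * X ID - m X * X IC) / (l X - m X).
Definition fyy_of (X : ix -> R) : R :=
  - (l X * m X * fxx_of X + (l X + m X) * fxy_of X).

(** The derivative in x of a jet function along the graph, by p_x = f_xx and q_x = f_xy; [total_y]
    is its counterpart in y. *)
Definition total_x (gx gp gq : (ix -> R) -> R) (X : ix -> R) : R :=
  gx X + gp X * fxx_of X + gq X * fxy_of X.
Definition total_y (gy gp gq : (ix -> R) -> R) (X : ix -> R) : R :=
  gy X + gp X * fxy_of X + gq X * fyy_of X.

(** What remains of the x-derivative of l m f_xx + (l + m) f_xy + f_yy = 0 once the third
    derivatives are removed. *)
Definition common_rate (X : ix -> R) : R :=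
  (total_x lx lp lq X * m X + l X * total_x mx mp mq X) * fxx_of X
  + (total_x lx lp lq X + total_x mx mp mq X) * fxy_of X.

(** The derivative of entry i in the direction ([velocity], 1). The quantity l f_xx + f_xy is
    carried with speed m and m f_xx + f_xy with speed l: then the third derivatives combine into
    those of the differentiated equation. For p and q speed l gives IC and - m IC. *)
Definition rate (i : ix) (X : ix -> R) : R :=
  match i with
  | Ip => X IC
  | Iq => - (m X * X IC)
  | IC => (m X * total_x lx lp lq X + total_y ly lp lq X) * fxx_of X - common_rate X
  | ID => (l X * total_x mx mp mq X + total_y my mp mq X) * fxx_of X - common_rate X
  | _ => 0
  end.

Definition velocity (i : ix) (X : ix -> R) : R :=
  match i with Ip | Iq | ID => l X | IC => m X | _ => 0 end.

Definition rate_box (B : R) (X : ix -> R) : Prop :=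
  jet_box a1 a2 rho X /\ Rabs (X IC) <= B /\ Rabs (X ID) <= B.

Lemma rate_C1 B i : C1on (rate_box B) (rate i) /\ C1on (rate_box B) (velocity i).
Proof.
  set (O := rate_box B).
  assert (sub : forall X, O X -> jet_box a1 a2 rho X) by (intros X hX; apply hX).
  assert (Cl : C1on O l) by (eapply C1_subset; [exact sub|eexists; apply Hl]).
  assert (Cm : C1on O m) by (eapply C1_subset; [exact sub|eexists; apply Hm]).
  assert (Clx : C1on O lx) by (eapply C1_subset; [exact sub|apply Hl]).
  assert (Cly : C1on O ly) by (eapply C1_subset; [exact sub|apply Hl]).
  assert (Clp : C1on O lp) by (eapply C1_subset; [exact sub|apply Hl]).
  assert (Clq : C1on O lq) by (eapply C1_subset; [exact sub|apply Hl]).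
  assert (Cmx : C1on O mx) by (eapply C1_subset; [exact sub|apply Hm]).
  assert (Cmy : C1on O my) by (eapply C1_subset; [exact sub|apply Hm]).
  assert (Cmp : C1on O mp) by (eapply C1_subset; [exact sub|apply Hm]).
  assert (Cmq : C1on O mq) by (eapply C1_subset; [exact sub|apply Hm]).
  assert (CC : C1on O (fun X => X IC)) by (apply (C1_coord O IC B); intros X hX; apply hX).
  assert (CD : C1on O (fun X => X ID)) by (apply (C1_coord O ID B); intros X hX; apply hX).
  assert (hgap : forall X, O X -> c0 <= Rabs (l X - m X)) by auto.
  assert (Cr : C1on O fxx_of) by (apply C1_div with c0; auto; now apply C1_minus).
  assert (Cs : C1on O fxy_of).
  { apply C1_div with c0; auto; [|now apply C1_minus].
    apply C1_minus; now apply C1_mult. }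
  assert (Ct : C1on O fyy_of).
  { apply C1_opp, C1_plus; apply C1_mult; auto; [now apply C1_mult|now apply C1_plus]. }
  assert (tx : forall gx gp gq, C1on O gx -> C1on O gp -> C1on O gq -> C1on O (total_x gx gp gq)).
  { intros. apply C1_plus; [apply C1_plus; auto|]; now apply C1_mult. }
  assert (ty : forall gx gp gq, C1on O gx -> C1on O gp -> C1on O gq -> C1on O (total_y gx gp gq)).
  { intros. apply C1_plus; [apply C1_plus; auto|]; now apply C1_mult. }
  assert (Cc : C1on O common_rate).
  { apply C1_plus; apply C1_mult; auto; apply C1_plus; auto; apply C1_mult; auto. }
  unfold rate, velocity. split; destruct i; cbv beta iota; auto using C1_const.
  - apply C1_opp. now apply C1_mult.
  - apply C1_minus; auto. apply C1_mult; auto. apply C1_plus; auto. apply C1_mult; auto.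
  - apply C1_minus; auto. apply C1_mult; auto. apply C1_plus; auto. apply C1_mult; auto.
Qed.

(** f itself is absent: uniqueness is proved for the gradient first, and f follows from f(0, 0) =
    0. *)
Record hessian_solution (p q r s t : R * R -> R) : Prop := {
  hs_p : forall z, D z -> is_grad D p z (r z, s z);
  hs_q : forall z, D z -> is_grad D q z (s z, t z);
  hs_r : class_C 1 D r;
  hs_s : class_C 1 D s;
  hs_t : class_C 1 D t;
  hs_small : forall z, D z -> Rabs (p z) <= rho /\ Rabs (q z) <= rho;
  hs_pde : forall z, D z -> let J := jet (fst z) (snd z) (p z) (q z) in
     l J * m J * r z + (l J + m J) * s z + t z = 0 }.

Definition state (p q r s : R * R -> R) (z : R * R) (i : ix) : R :=
  let J := jet (fst z) (snd z) (p z) (q z) in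
  match i with
  | IC => l J * r z + s z
  | ID => m J * r z + s z
  | _ => J i
  end.

Lemma trapezoid_jet_box p q z : D z -> Rabs (p z) <= rho -> Rabs (q z) <= rho ->
  jet_box a1 a2 rho (jet (fst z) (snd z) (p z) (q z)).
Proof.
  intros [h1 h2] hp hq. unfold jet_box; simpl. repeat split; auto; nra.
Qed.

Lemma jet_function_grad g gx gy gp gq (Hg : jet_function a1 a2 rho g gx gy gp gq)
    p q r s t z (Y : ix -> R) :
  hessian_solution p q r s t -> D z ->
  (forall i, match i with Ix | Iy | Ip | Iq => Y i = jet (fst z) (snd z) (p z) (q z) i
             | _ => True end) ->
  is_grad D (fun w => g (jet (fst w) (snd w) (p w) (q w))) z
    (gx Y + gp Y * r z + gq Y * s z, gy Y + gp Y * s z + gq Y * t z).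
Proof.
  intros S hz HY.
  set (c := fun (i : ix) (w : R * R) => match i with Ix | Iy | Ip | Iq =>
     jet (fst w) (snd w) (p w) (q w) i | _ => Y i end).
  assert (Hb : forall w, D w -> jet_box a1 a2 rho (fun i => c i w)).
  { intros w hw. destruct (hs_small _ _ _ _ _ S w hw).
    exact (trapezoid_jet_box p q w hw H H0). }
  pose proof (is_grad_comp ixs (jet_box a1 a2 rho) g (directional gx gy gp gq) D c z
    (fun i => match i with Ix => (1, 0) | Iy => (0, 1) | Ip => (r z, s z) | Iq => (s z, t z)
              | _ => (0, 0) end)
    in_ixs (jf_diff _ _ _ _ _ _ _ _ Hg) hz Hb) as H.
  assert (Hc : forall i, is_grad D (c i) z (match i with Ix => (1, 0) | Iy => (0, 1)
     | Ip => (r z, s z) | Iq => (s z, t z) | _ => (0, 0) end)).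
  { intros [| | | | | | | |]; unfold c; simpl; auto using is_grad_const.
    - now apply is_grad_fst.
    - now apply is_grad_snd.
    - now apply (hs_p _ _ _ _ _ S).
    - now apply (hs_q _ _ _ _ _ S). }
  specialize (H Hc).
  assert (EY : (fun i => c i z) = Y).
  { apply functional_extensionality. intros i. specialize (HY i). destruct i; simpl in *; auto. }
  rewrite EY in H. unfold directional in H; simpl in H.
  replace (gx Y + gp Y * r z + gq Y * s z)
    with (gx Y * 1 + gy Y * 0 + gp Y * r z + gq Y * s z) by ring.
  replace (gy Y + gp Y * s z + gq Y * t z)
    with (gx Y * 0 + gy Y * 1 + gp Y * s z + gq Y * t z) by ring.
  apply (is_grad_ext D (fun q => g (fun i => c i q))); auto.
  intros w hw. rewrite (jf_jet _ _ _ _ _ _ _ _ Hg (fun i => c i w)). reflexivity.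
Qed.

(** Equality of mixed derivatives gives r_y = s_x and s_y = t_x, so the third derivatives in the
    transport of IC and ID are l m r_x + (l + m) s_x + t_x, which the equation differentiated in x
    replaces by lower order terms. Continuity of [gx] is recorded because the x-derivatives of one
    solution have to be bounded. *)
Lemma state_transport p q r s t : hessian_solution p q r s t ->
  exists gx gy : ix -> R * R -> R,
  (forall i z, D z -> match i with Ip | Iq | IC | ID =>
     is_grad D (fun w => state p q r s w i) z (gx i z, gy i z) | _ => True end)
  /\ (forall i, match i with Ip | Iq | IC | ID => continuous_on D (gx i) | _ => True end)
  /\ forall i z, D z -> match i with Ip | Iq | IC | ID =>
     velocity i (state p q r s z) * gx i z + gy i z = rate i (state p q r s z) | _ => True end.
Proof.
  intros S. pose proof (trapezoid_convex a1 K eps ha1 hK (proj1 heps)) as HD. fold D in HD.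
  destruct (class_C_S_elim D HD 0 r (hs_r _ _ _ _ _ S)) as [Gr [Crx Cry]].
  destruct (class_C_S_elim D HD 0 s (hs_s _ _ _ _ _ S)) as [Gs [Csx Csy]].
  destruct (class_C_S_elim D HD 0 t (hs_t _ _ _ _ _ S)) as [Gt [Ctx Cty]].
  simpl in Crx, Cry, Csx, Csy, Ctx, Cty.
  set (rx := Dx D r) in *. set (ry := Dy D r) in *. set (sx := Dx D s) in *.
  set (sy := Dy D s) in *. set (tx := Dx D t) in *. set (ty := Dy D t) in *.
  assert (E1 : forall z, D z -> ry z = sx z).
  { apply (mixed_derivatives D HD p r s rx ry sx sy); auto. apply S. }
  assert (E2 : forall z, D z -> sy z = tx z).
  { apply (mixed_derivatives D HD q s t sx sy tx ty); auto. apply S. }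
  set (J := fun z => jet (fst z) (snd z) (p z) (q z)).
  set (X := state p q r s).
  assert (hJ : forall z, D z -> jet_box a1 a2 rho (J z)).
  { intros z hz. destruct (hs_small _ _ _ _ _ S z hz). now apply trapezoid_jet_box. }
  assert (hXj : forall z, D z -> l (X z) = l (J z) /\ m (X z) = m (J z)).
  { intros z hz. split; [apply Hl|apply Hm]. }
  assert (hnz : forall z, D z -> l (J z) - m (J z) <> 0).
  { intros z hz h0. pose proof (lm_gap _ (hJ z hz)) as k. rewrite h0, Rabs_R0 in k. lra. }
  assert (Er : forall z, D z -> fxx_of (X z) = r z).
  { intros z hz. destruct (hXj z hz) as [h1 h2]. unfold fxx_of. rewrite h1, h2.
    unfold X, state. fold (J z). field. auto. }
  assert (Es : forall z, D z -> fxy_of (X z) = s z).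
  { intros z hz. destruct (hXj z hz) as [h1 h2]. unfold fxy_of. rewrite h1, h2.
    unfold X, state. fold (J z). field. auto. }
  assert (Et : forall z, D z -> fyy_of (X z) = t z).
  { intros z hz. destruct (hXj z hz) as [h1 h2]. unfold fyy_of.
    rewrite h1, h2, Er, Es by auto. pose proof (hs_pde _ _ _ _ _ S z hz) as k.
    cbv zeta in k. fold (J z) in k. lra. }
  set (lX := fun z => total_x lx lp lq (X z)). set (lY := fun z => total_y ly lp lq (X z)).
  set (mX := fun z => total_x mx mp mq (X z)). set (mY := fun z => total_y my mp mq (X z)).
  assert (Gl : forall z, D z -> is_grad D (fun w => l (J w)) z (lX z, lY z)).
  { intros z hz. unfold lX, lY, total_x, total_y. rewrite Er, Es, Et by auto.
    apply (jet_function_grad l lx ly lp lq Hl p q r s t z (X z)); auto.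
    intros [| | | | | | | |]; simpl; auto. }
  assert (Gm : forall z, D z -> is_grad D (fun w => m (J w)) z (mX z, mY z)).
  { intros z hz. unfold mX, mY, total_x, total_y. rewrite Er, Es, Et by auto.
    apply (jet_function_grad m mx my mp mq Hm p q r s t z (X z)); auto.
    intros [| | | | | | | |]; simpl; auto. }
  (* The gradient of the left-hand side of the equation, computed by the product rule, must be that
     of the constant 0. *)
  assert (Epde : forall z, D z ->
     (lX z * m (J z) + l (J z) * mX z) * r z + l (J z) * m (J z) * rx z
     + ((lX z + mX z) * s z + (l (J z) + m (J z)) * sx z) + tx z = 0).
  { intros z hz.
    pose proof (is_grad_plus D _ _ z _ _ hz
      (is_grad_plus D _ _ z _ _ hz
        (is_grad_mult D _ _ z _ _ hz (is_grad_mult D _ _ z _ _ hz (Gl z hz) (Gm z hz)) (Gr z hz))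
        (is_grad_mult D _ _ z _ _ hz (is_grad_plus D _ _ z _ _ hz (Gl z hz) (Gm z hz)) (Gs z hz)))
      (Gt z hz)) as H.
    assert (H0 : is_grad D (fun _ => 0) z (0, 0)) by now apply is_grad_const.
    pose proof (grad_unique D HD _ z _ _ hz
      (is_grad_ext D _ (fun _ => 0) z _ hz (fun w hw => eq_sym (hs_pde _ _ _ _ _ S w hw)) H) H0)
      as E.
    apply (f_equal fst) in E. cbn [fst snd] in E. lra. }
  set (gx := fun (i : ix) (z : R * R) => match i with Ip => r z | Iq => s z
     | IC => l (J z) * rx z + r z * lX z + sx z | ID => m (J z) * rx z + r z * mX z + sx z
     | _ => 0 end).
  set (gy := fun (i : ix) (z : R * R) => match i with Ip => s z | Iq => t z
     | IC => l (J z) * ry z + r z * lY z + sy z | ID => m (J z) * ry z + r z * mY z + sy z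
     | _ => 0 end).
  exists gx, gy. split; [|split].
  - intros [| | | | | | | |] z hz; auto.
    + now apply (hs_p _ _ _ _ _ S).
    + now apply (hs_q _ _ _ _ _ S).
    + exact (is_grad_plus D _ _ z _ _ hz (is_grad_mult D _ _ z _ _ hz (Gl z hz) (Gr z hz)) (Gs z hz)).
    + exact (is_grad_plus D _ _ z _ _ hz (is_grad_mult D _ _ z _ _ hz (Gm z hz) (Gr z hz)) (Gs z hz)).
  - assert (cg : forall f vx vy, (forall z, D z -> is_grad D f z (vx z, vy z)) -> continuous_on D f).
    { intros f vx vy H. apply continuous_on_intro. intros z hz.
      exact (is_grad_near_continuous _ _ _ _ (H z hz)). }
    assert (cr := cg _ _ _ Gr). assert (cs := cg _ _ _ Gs).
    assert (cl := cg _ _ _ Gl). assert (cm := cg _ _ _ Gm).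
    assert (cjet : forall g, C1on (jet_box a1 a2 rho) g -> continuous_on D (fun z => g (X z))).
    { intros g [G HG].
      assert (Hc : forall z, D z -> forall i, exists v, is_grad D (fun w => X w i) z v).
      { intros z hz i. destruct i; eexists.
        - exact (is_grad_fst D z hz).
        - exact (is_grad_snd D z hz).
        - exact (hs_p _ _ _ _ _ S z hz).
        - exact (hs_q _ _ _ _ _ S z hz).
        - exact (is_grad_const D 0 z hz).
        - exact (is_grad_const D 0 z hz).
        - exact (is_grad_const D 0 z hz).
        - exact (is_grad_plus D _ _ z _ _ hz (is_grad_mult D _ _ z _ _ hz (Gl z hz) (Gr z hz)) (Gs z hz)).
        - exact (is_grad_plus D _ _ z _ _ hz (is_grad_mult D _ _ z _ _ hz (Gm z hz) (Gr z hz)) (Gs z hz)). }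
      apply continuous_on_intro. intros z hz.
      set (v := fun i => epsilon (inhabits (0, 0)) (is_grad D (fun w => X w i) z)).
      assert (Hv : forall i, is_grad D (fun w => X w i) z (v i)).
      { intros i. unfold v. apply epsilon_spec. now apply Hc. }
      pose proof (is_grad_comp ixs (jet_box a1 a2 rho) g G D (fun i w => X w i) z v in_ixs HG hz)
        as H.
      exact (is_grad_near_continuous _ _ _ _ (H (fun w hw => hJ w hw) Hv)). }
    assert (cX : forall hx hp hq, C1on (jet_box a1 a2 rho) hx -> C1on (jet_box a1 a2 rho) hp ->
       C1on (jet_box a1 a2 rho) hq -> continuous_on D (fun z => total_x hx hp hq (X z))).
    { intros hx hp hq k1 k2 k3. apply continuous_on_intro. intros z hz.
      assert (cc : continuous_on D (fun z => hx (X z) + hp (X z) * r z + hq (X z) * s z)).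
      { apply continuous_on_plus; [apply continuous_on_plus|]; auto; now apply continuous_on_mult; auto. }
      intros e he. destruct (continuous_on_elim _ _ cc z hz e he) as [b [hb Hb]].
      exists b. split; auto. intros w hw hn. specialize (Hb w hw hn).
      unfold total_x. rewrite !Er, !Es by auto. exact Hb. }
    assert (clX : continuous_on D lX) by (apply cX; apply Hl).
    assert (cmX : continuous_on D mX) by (apply cX; apply Hm).
    intros [| | | | | | | |]; auto; unfold gx;
    repeat apply continuous_on_plus; auto; now apply continuous_on_mult.
  - intros i z hz. destruct (hXj z hz) as [h1 h2]. pose proof (Epde z hz) as k.
    rewrite <- E2 in k by auto.
    pose proof (hs_pde _ _ _ _ _ S z hz) as k0. cbv zeta in k0. fold (J z) in k0.
    destruct i; auto; unfold gx, gy, velocity, rate, common_rate; fold X;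
      fold (lX z) (lY z) (mX z) (mY z); rewrite ?h1, ?h2, ?Er, ?Es by auto;
      rewrite ?(E1 z hz); unfold X, state; fold (J z); nra.
Qed.

(** The differences are transported with the speeds of the first solution. The speeds of the second
    differ by at most L b, which multiplies its bounded x-derivatives. *)
Theorem hessian_solution_unique p1 q1 r1 s1 t1 p2 q2 r2 s2 t2 :
  hessian_solution p1 q1 r1 s1 t1 -> hessian_solution p2 q2 r2 s2 t2 ->
  (forall x, Rabs x <= a1 -> p1 (x, 0) = p2 (x, 0) /\ q1 (x, 0) = q2 (x, 0)
     /\ r1 (x, 0) = r2 (x, 0) /\ s1 (x, 0) = s2 (x, 0)) ->
  forall z, D z -> p1 z = p2 z /\ q1 z = q2 z.
Proof.
  intros S1 S2 H0.
  destruct (state_transport _ _ _ _ _ S1) as [gx1 [gy1 [A1 [B1 C1']]]].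
  destruct (state_transport _ _ _ _ _ S2) as [gx2 [gy2 [A2 [B2 C2']]]].
  set (X1 := state p1 q1 r1 s1) in *. set (X2 := state p2 q2 r2 s2) in *.
  pose proof (trapezoid_retract a1 K eps ha1 hK (proj1 heps)) as HR. fold D in HR.
  assert (cst : forall p q r s t, hessian_solution p q r s t ->
    forall i, match i with IC | ID => exists B, 0 < B /\ forall z, D z -> Rabs (state p q r s z i) <= B
       | _ => True end).
  { intros p q r s t S. destruct (state_transport _ _ _ _ _ S) as [gx [gy [A _]]].
    intros i. destruct i; auto;
    apply (bounded_on D HR (fun w => state p q r s w _)); apply continuous_on_intro; intros z hz.
    - exact (is_grad_near_continuous _ _ _ _ (A IC z hz)).
    - exact (is_grad_near_continuous _ _ _ _ (A ID z hz)). }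
  destruct (cst _ _ _ _ _ S1 IC) as [b1 [hb1 Hb1]]. destruct (cst _ _ _ _ _ S1 ID) as [b2 [hb2 Hb2]].
  destruct (cst _ _ _ _ _ S2 IC) as [b3 [hb3 Hb3]]. destruct (cst _ _ _ _ _ S2 ID) as [b4 [hb4 Hb4]].
  set (B := b1 + b2 + b3 + b4).
  assert (O1 : forall z, D z -> rate_box B (X1 z)).
  { intros z hz. destruct (hs_small _ _ _ _ _ S1 z hz).
    specialize (Hb1 z hz). specialize (Hb2 z hz). fold X1 in Hb1, Hb2.
    split; [now apply (trapezoid_jet_box p1 q1)|]. unfold B. lra. }
  assert (O2 : forall z, D z -> rate_box B (X2 z)).
  { intros z hz. destruct (hs_small _ _ _ _ _ S2 z hz).
    specialize (Hb3 z hz). specialize (Hb4 z hz). fold X2 in Hb3, Hb4.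
    split; [now apply (trapezoid_jet_box p2 q2)|]. unfold B. lra. }
  destruct (finite_upper ix ixs (fun i L => forall X Y, rate_box B X -> rate_box B Y ->
     forall b, nb (dlt X Y) b -> Rabs (rate i Y - rate i X) <= L * b
        /\ Rabs (velocity i Y - velocity i X) <= L * b)) as [L [hL HL]].
  { apply in_ixs. }
  { intros i M M' hM H X Y hX hY b hb. destruct (H X Y hX hY b hb). destruct hb as [hb _].
    split; nra. }
  { intros i. destruct (rate_C1 B i) as [c1 c2].
    destruct (C1_lipschitz _ _ c1) as [L1 [hL1 HL1]].
    destruct (C1_lipschitz _ _ c2) as [L2 [hL2 HL2]].
    exists (L1 + L2). split; [lra|]. intros X Y hX hY b hb.
    specialize (HL1 X Y hX hY b hb). specialize (HL2 X Y hX hY b hb). destruct hb as [hb _].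
    split; nra. }
  destruct (finite_upper ix ixs (fun i G => match i with Ip | Iq | IC | ID =>
     forall z, D z -> Rabs (gx2 i z) <= G | _ => True end)) as [G [hG HG]].
  { apply in_ixs. }
  { intros i M M' hM H. destruct i; auto; intros z hz; specialize (H z hz); lra. }
  { intros i. pose proof (B2 i) as k. destruct i; try (exists 1; split; [lra|exact I]);
    destruct (bounded_on D HR _ k) as [M [hM HM]]; exists M; auto. }
  set (delta := fun (i : ix) (z : R * R) => match i with Ip | Iq | IC | ID => X1 z i - X2 z i | _ => 0 end).
  set (gx := fun (i : ix) (z : R * R) => match i with Ip | Iq | IC | ID => gx1 i z - gx2 i z | _ => 0 end).
  set (gy := fun (i : ix) (z : R * R) => match i with Ip | Iq | IC | ID => gy1 i z - gy2 i z | _ => 0 end).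
  assert (Hz : forall i z, D z -> delta i z = 0).
  (* L is the Lipschitz constant of the rates, and L G accounts for the difference of the speeds
     times the x-derivative of the second solution. *)
  { apply (transport_zero ix ixs a1 K eps (L + L * G) delta gx gy (fun i z => velocity i (X1 z))
       in_ixs ha1 hK (proj1 heps)).
    - nra.
    - intros i z hz. pose proof (A1 i z hz) as k1. pose proof (A2 i z hz) as k2.
      destruct i;
      match type of k1 with
      | True => exact (is_grad_const D 0 z hz)
      | _ => exact (is_grad_plus D _ _ z _ _ hz k1 (is_grad_opp D _ z _ hz k2))
      end.
    - intros i z hz. destruct (O1 z hz) as [hj _].
      destruct i; simpl; auto; rewrite Rabs_R0; lra.
    - intros i z b hz hb Hd.
      assert (hn : nb (dlt (X2 z) (X1 z)) b).
      { split; auto. intros j. specialize (Hd j). unfold dlt.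
        destruct j; try exact Hd; unfold X1, X2, state; simpl; rewrite Rminus_diag, Rabs_R0; auto. }
      destruct (HL i _ _ (O2 z hz) (O1 z hz) b hn) as [k1 k2].
      pose proof (C1' i z hz) as e1. pose proof (C2' i z hz) as e2. specialize (HG i).
      assert (0 <= (L + L * G) * b) by (apply Rmult_le_pos; [apply Rplus_le_le_0_compat; [lra|apply Rmult_le_pos; lra]|exact hb]).
      destruct i; unfold gx, gy; try (rewrite Rmult_0_r, Rplus_0_l, Rabs_R0; assumption);
      specialize (HG z hz);
      match goal with |- Rabs (velocity ?i _ * _ + _) <= _ =>
        replace (velocity i (X1 z) * (gx1 i z - gx2 i z) + (gy1 i z - gy2 i z)) with
         ((rate i (X1 z) - rate i (X2 z)) - (velocity i (X1 z) - velocity i (X2 z)) * gx2 i z)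
         by (rewrite <- e1, <- e2; ring) end;
      unfold Rminus at 1; (eapply Rle_trans; [apply Rabs_triang|]);
      rewrite Rabs_Ropp, Rabs_mult;
      match goal with |- _ + Rabs ?u * Rabs ?v <= _ =>
        assert (Rabs u * Rabs v <= L * b * G)
          by (apply Rmult_le_compat; auto using Rabs_pos) end; lra.
    - intros i x hx. destruct (H0 x hx) as [e1 [e2 [e3 e4]]].
      destruct i; unfold delta; auto; unfold X1, X2, state; simpl;
      rewrite ?e1, ?e2, ?e3, ?e4; ring. }
  intros z hz. pose proof (Hz Ip z hz) as k1. pose proof (Hz Iq z hz) as k2.
  unfold delta, X1, X2, state in k1, k2; simpl in k1, k2. lra.
Qed.

End transport_system.

(** * The shape operator of a graph *)

Lemma max_norm_le (v : list R) r : 0 <= r -> (max_norm v <= r <-> forall x, In x v -> Rabs x <= r).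
Proof.
  intros hr. unfold max_norm. induction v as [|a v IH]; simpl.
  - split; [intros _ x []|auto].
  - split.
    + intros H x [<-|hx].
      * eapply Rle_trans; [apply Rmax_l|exact H].
      * apply IH; auto. eapply Rle_trans; [apply Rmax_r|exact H].
    + intros H. apply Rmax_lub; [apply H; auto|]. apply IH. auto.
Qed.

Lemma sup_norm_le {T : Type} (D : T -> Prop) (u : T -> list R) r : 0 <= r ->
  (Rbar_le (sup_norm D u) (Finite r) <-> forall z, D z -> forall x, In x (u z) -> Rabs x <= r).
Proof.
  intros hr. unfold sup_norm. set (E := fun s => exists x, D x /\ s = max_norm (u x)).
  destruct (Lub_Rbar_correct E) as [Hub Hlub]. split.
  - intros H z hz. apply (proj1 (max_norm_le (u z) r hr)).
    assert (k : Rbar_le (max_norm (u z)) (Lub_Rbar E)) by (apply Hub; now exists z).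
    exact (Rbar_le_trans _ _ _ k H).
  - intros H. apply Hlub. intros s [z [hz ->]]. apply (proj2 (max_norm_le (u z) r hr)). exact (H z hz).
Qed.

Lemma sup_norm_single_lt {T : Type} (D : T -> Prop) (k : T -> R) r : 0 <= r ->
  Rbar_lt (sup_norm D (fun x => [k x])) (Finite r) -> forall x, D x -> Rabs (k x) <= r.
Proof.
  intros hr H x hx. apply Rbar_lt_le in H.
  apply (proj1 (sup_norm_le D _ r hr) H x hx). now left.
Qed.

Lemma increment_bound_sym (f : R -> R) (a b B : R) :
  (forall t, Rmin a b <= t <= Rmax a b -> forall e, 0 < e -> exists r, 0 < r /\
     forall s, Rmin a b <= s <= Rmax a b -> Rabs (s - t) <= r ->
       Rabs (f s - f t) <= (B + e) * Rabs (s - t)) ->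
  Rabs (f b - f a) <= B * Rabs (b - a).
Proof.
  intros H. destruct (Rle_dec a b) as [h|h].
  - rewrite Rmin_left, Rmax_right in H by lra. rewrite (Rabs_pos_eq (b - a)) by lra.
    now apply increment_bound.
  - rewrite Rmin_right, Rmax_left in H by lra. rewrite (Rabs_left1 (b - a)) by lra.
    rewrite Rabs_minus_sym. replace (- (b - a)) with (a - b) by ring.
    apply increment_bound; auto. lra.
Qed.

Lemma D1_of_class_C1_1d a k : 0 < a -> class_C1_1d (segment a) k ->
  exists k', D1 (fun x => Rabs x <= a) k k'.
Proof.
  intros ha [k' [Hk Hc]]. exists k'.
  assert (Hexp : forall x, Rabs x <= a -> forall e, 0 < e -> exists r, 0 < r /\
    forall y, Rabs y <= a -> Rabs (y - x) <= r ->
      Rabs (k y - k x - (y - x) * k' x) <= e * Rabs (y - x)).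
  { intros x hx e he. destruct (Hk x hx) as [_ H].
    assert (hl : is_filter_lim (within (segment a) (locally x)) x).
    { intros P hP. unfold within. eapply filter_imp; [|exact hP]. auto. }
    destruct (H x hl (mkposreal e he)) as [[r hr] Hr].
    exists (r / 2). split; [lra|]. intros y hy hyx.
    apply (Hr y); auto. unfold ball; simpl. unfold AbsRing_ball, abs, minus, plus, opp; simpl.
    unfold Rminus in hyx. lra. }
  assert (Hc' : forall x, Rabs x <= a -> forall e, 0 < e -> exists r, 0 < r /\
    forall y, Rabs y <= a -> Rabs (y - x) <= r -> Rabs (k' y - k' x) <= e).
  { intros x hx e he.
    destruct (Hc x hx (ball (k' x) (mkposreal e he)) (locally_ball _ _)) as [[r hr] Hr].
    exists (r / 2). split; [lra|]. intros y hy hyx. left.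
    apply (Hr y); auto. unfold ball; simpl. unfold AbsRing_ball, abs, minus, plus, opp; simpl.
    unfold Rminus in hyx. lra. }
  (* Uniform continuity of k' is read off from the compactness of a rectangle. *)
  set (D := rect a 1). set (h := fun z : R * R => k' (fst z)).
  assert (HD : lipschitz_retract D) by (apply rect_retract; lra).
  assert (hcont : continuous_on D h).
  { apply continuous_on_intro. intros p [hp _] e he.
    destruct (Hc' (fst p) hp e he) as [r [hr Hr]]. exists r. split; auto.
    intros q [hq _] [hn _]. now apply Hr. }
  assert (hz : forall x, Rabs x <= a -> D (x, 0)).
  { intros x hx. split; simpl; auto. rewrite Rabs_R0. lra. }
  destruct (bounded_on D HD h hcont) as [M' [hM' HM']].
  pose proof (uniformly_continuous D HD h hcont) as Hu.
  assert (Hinc : forall x y B c, Rabs x <= a -> Rabs y <= a ->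
    (forall t, Rmin x y <= t <= Rmax x y -> Rabs (k' t - c) <= B) ->
    Rabs (k y - k x - (y - x) * c) <= B * Rabs (y - x)).
  { intros x y B c hx hy HB.
    replace (k y - k x - (y - x) * c)
      with ((fun t => k t - t * c) y - (fun t => k t - t * c) x) by ring.
    apply (increment_bound_sym (fun t => k t - t * c)).
    assert (hin : forall t, Rmin x y <= t <= Rmax x y -> Rabs t <= a).
    { intros t. apply Rabs_le_between in hx. apply Rabs_le_between in hy.
      unfold Rmin, Rmax. destruct (Rle_dec x y); intros; apply Rabs_le; lra. }
    intros t ht e he. destruct (Hexp t (hin t ht) e he) as [r [hr Hr]].
    exists r. split; auto. intros s hs hst.
    specialize (Hr s (hin s hs) hst). specialize (HB t ht).
    replace (k s - s * c - (k t - t * c))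
      with ((k s - k t - (s - t) * k' t) + (s - t) * (k' t - c)) by ring.
    eapply Rle_trans; [apply Rabs_triang|]. rewrite Rabs_mult.
    pose proof (Rabs_pos (s - t)). nra. }
  assert (hbt : forall x y t r, Rabs (y - x) <= r -> Rmin x y <= t <= Rmax x y ->
     Rabs (t - x) <= r).
  { intros x y t r hr. apply Rabs_le_between in hr. unfold Rmin, Rmax.
    destruct (Rle_dec x y); intros; apply Rabs_le; lra. }
  assert (hin : forall x y t, Rabs x <= a -> Rabs y <= a -> Rmin x y <= t <= Rmax x y ->
     Rabs t <= a).
  { intros x y t hx hy. apply Rabs_le_between in hx. apply Rabs_le_between in hy.
    unfold Rmin, Rmax. destruct (Rle_dec x y); intros; apply Rabs_le; lra. }
  assert (h0 : Rabs 0 <= a) by (rewrite Rabs_R0; lra).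
  apply (D1_intro _ _ _ (Rabs (k 0) + M' * a + M')).
  - intros x hx. assert (hk' := HM' _ (hz x hx)). unfold h in hk'; simpl in hk'.
    pose proof (Rabs_pos (k 0)). split; [|nra].
    assert (q := Hinc 0 x M' 0 h0 hx).
    replace (k x) with (k 0 + (k x - k 0 - (x - 0) * 0)) by ring.
    eapply Rle_trans; [apply Rabs_triang|].
    assert (Rabs (k x - k 0 - (x - 0) * 0) <= M' * Rabs (x - 0)).
    { apply q. intros t ht. rewrite Rminus_0_r.
      exact (HM' _ (hz t (hin 0 x t h0 hx ht))). }
    rewrite Rminus_0_r in *. nra.
  - intros e he. destruct (Hu e he) as [r [hr Hr]]. exists r. split; auto.
    assert (Hr' : forall x y, Rabs x <= a -> Rabs y <= a -> Rabs (y - x) <= r ->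
      Rabs (k' y - k' x) <= e).
    { intros x y hx hy hxy. apply (Hr (x, 0) (y, 0)); auto. split; simpl; auto.
      rewrite Rminus_diag, Rabs_R0; lra. }
    intros x y hx hy hxy. split; [|now apply Hr'].
    rewrite (Rmult_comm (k' x)). apply Hinc; auto.
    intros t ht. apply Hr'; auto. now apply (hin x y). now apply (hbt x y).
Qed.

Lemma D1_primitive a (h : R -> R) : 0 < a ->
  (exists M, 0 < M /\ forall x, Rabs (h x) <= M) ->
  (forall e, 0 < e -> exists r, 0 < r /\ forall x y, Rabs (y - x) <= r ->
     Rabs (h y - h x) <= e) ->
  D1 (fun x => Rabs x <= a) (fun x => RI h 0 x) h.
Proof.
  intros ha [M [hM HM]] Hu. pose proof (continuous_of_modulus h Hu) as hc.
  apply (D1_intro _ _ _ (M * a + M)).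
  - intros x hx. split; [|specialize (HM x); nra].
    assert (k : Rabs (RI h 0 x) <= M * Rabs (x - 0)) by (apply RI_bound; auto).
    rewrite Rminus_0_r in k. nra.
  - intros e he. destruct (Hu e he) as [r [hr Hr]]. exists r. split; auto.
    intros x y _ _ hxy. split; [|now apply Hr].
    rewrite <- (RI_chasles h hc 0 x y).
    replace (RI h 0 x + RI h x y - RI h 0 x - h x * (y - x))
      with (RI h x y - (y - x) * h x) by ring.
    apply RI_lin_bound; auto. intros t ht. apply Hr.
    apply Rabs_le_between in hxy. revert ht. unfold Rmin, Rmax.
    destruct (Rle_dec x y); intros; apply Rabs_le; lra.
Qed.

(** Decides which of the two characteristic speeds is the positive one: the intermediate value
    theorem along a segment, whose parameter is clamped to obtain a continuous function on the
    line. *)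
Lemma constant_sign (D : R * R -> Prop) f : lipschitz_retract D -> convex_body D ->
  continuous_on D f -> (forall z, D z -> f z <> 0) ->
  (forall z, D z -> 0 < f z) \/ (forall z, D z -> f z < 0).
Proof.
  intros HD Hcv Hf H0.
  destruct (classic (exists z, D z /\ 0 < f z)) as [[z [hz fz]]|hno].
  - left. intros w hw. destruct (Rlt_le_dec 0 (f w)) as [h|h]; auto. exfalso.
    assert (fw : f w < 0) by (specialize (H0 w hw); lra).
    set (g := fun t => f (segment_pt w z (clamp 0 1 t))).
    assert (hin : forall t, D (segment_pt w z (clamp 0 1 t))).
    { intros t. apply Hcv; auto. apply clamp_range. lra. }
    set (B := Rabs (fst z - fst w) + Rabs (snd z - snd w) + 1).
    pose proof (Rabs_pos (fst z - fst w)). pose proof (Rabs_pos (snd z - snd w)).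
    assert (hB : 0 < B) by (unfold B; lra).
    assert (gc : continuity g).
    { intros t. apply continuity_pt_filterlim. apply continuous_of_modulus. intros e he.
      destruct (uniformly_continuous D HD f Hf e he) as [r [hr Hr]].
      exists (r / B). split; [now apply Rdiv_lt_0_compat|]. intros x y hxy. apply Hr; auto.
      assert (hcl : Rabs (clamp 0 1 y - clamp 0 1 x) <= r / B)
        by (eapply Rle_trans; [apply clamp_lip|auto]).
      assert (hrB : r / B * B = r) by (field; lra).
      pose proof (Rabs_pos (clamp 0 1 y - clamp 0 1 x)).
      unfold near, segment_pt; simpl. split.
      - match goal with |- Rabs ?u <= _ =>
          replace u with ((clamp 0 1 y - clamp 0 1 x) * (fst z - fst w)) by ring end.
        rewrite Rabs_mult. rewrite <- hrB. apply Rmult_le_compat; auto. unfold B; lra.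
      - match goal with |- Rabs ?u <= _ =>
          replace u with ((clamp 0 1 y - clamp 0 1 x) * (snd z - snd w)) by ring end.
        rewrite Rabs_mult. rewrite <- hrB. apply Rmult_le_compat; auto. unfold B; lra. }
    destruct (IVT g 0 1 gc) as [t [_ ht]]; [lra| | |].
    + unfold g. rewrite clamp_id by lra. unfold segment_pt.
      rewrite !Rmult_0_l, !Rplus_0_r, <- surjective_pairing. exact fw.
    + unfold g. rewrite clamp_id by lra. unfold segment_pt.
      rewrite !Rmult_1_l. replace (fst w + (fst z - fst w)) with (fst z) by ring.
      replace (snd w + (snd z - snd w)) with (snd z) by ring.
      rewrite <- surjective_pairing. exact fz.
    + exact (H0 _ (hin t) ht).
  - right. intros w hw. specialize (H0 w hw).
    destruct (Rlt_le_dec (f w) 0); auto. exfalso. apply hno. exists w. split; auto. lra.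
Qed.

Section geometry.
(* P al and P be are the first components of the first fundamental form applied to the
   directions (al, 1) and (be, 1), which it makes orthogonal. *)
Variables (al p q r s t : R).
Let W := sqrt (1 + p ^ 2 + q ^ 2).
Let P (c : R) := (1 + p ^ 2) * c + p * q.
Let Q := p * q * al + 1 + q ^ 2.
Let be := - (Q / P al).
Hypothesis hP : P al <> 0.

Lemma W_sq : W * W = 1 + p ^ 2 + q ^ 2 /\ 0 < W.
Proof.
  assert (h : 0 < 1 + p ^ 2 + q ^ 2) by nra.
  split; [apply sqrt_sqrt; lra|now apply sqrt_lt_R0].
Qed.

(** The identity behind both directions of the equivalence: it shows that P be does not vanish, and
    it cancels the determinant of the first form in the trace and the determinant of the shape
    operator. *)
Lemma P_product : P al * P be = - (1 + p ^ 2 + q ^ 2).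
Proof. unfold be, P, Q in *. field. exact hP. Qed.

Lemma P_be_nz : P be <> 0.
Proof.
  intros h. pose proof P_product as k. rewrite h, Rmult_0_r in k.
  assert (0 < 1 + p ^ 2 + q ^ 2) by nra. lra.
Qed.

(** The shape operator with the derivatives of f replaced by free numbers, which separates the
    algebra from the differentiation. *)
Definition weingarten (u : R * R) : R * R :=
  let L := (r * fst u + s * snd u) / W in
  let N := (s * fst u + t * snd u) / W in
  let d := (1 + p ^ 2) * (1 + q ^ 2) - (p * q) ^ 2 in
  (((1 + q ^ 2) * L - p * q * N) / d, ((1 + p ^ 2) * N - p * q * L) / d).

Lemma det_eq : (1 + p ^ 2) * (1 + q ^ 2) - (p * q) ^ 2 = 1 + p ^ 2 + q ^ 2.
Proof. ring. Qed.

(** For an eigenvector the second form with (al, 1) equals k1 times the first form with (al, 1). Its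
    first component is the equation for k1; evaluation on the orthogonal direction (be, 1) gives 0,
    which is the partial differential equation. *)
Lemma eigen_equations k1 k2 :
  eigenvalues2 weingarten k1 k2 -> eigenvector2 weingarten k1 (al, 1) ->
  al * be * r + (al + be) * s + t = 0 /\ al * r + s = W * k1 * P al
  /\ be * r + s = W * k2 * P be.
Proof.
  intros Hv [_ Hw]. destruct W_sq as [hW hW0].
  set (d := 1 + p ^ 2 + q ^ 2) in *. assert (hd : 0 < d) by (unfold d; nra).
  unfold weingarten in Hw. cbv zeta in Hw. rewrite det_eq in Hw. fold d in Hw. cbn [fst snd] in Hw.
  injection Hw as e1 e2.
  set (mm := r * al + s * 1) in *. set (tt := s * al + t * 1) in *.
  assert (f1 : (1 + q ^ 2) * mm - p * q * tt = k1 * al * d * W).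
  { rewrite <- e1. field. lra. }
  assert (f2 : (1 + p ^ 2) * tt - p * q * mm = k1 * d * W).
  { replace (k1 * d * W) with (k1 * 1 * d * W) by ring. rewrite <- e2. field. lra. }
  assert (g1 : d * mm = d * (W * k1 * P al)).
  { replace (d * mm) with ((1 + p ^ 2) * ((1 + q ^ 2) * mm - p * q * tt)
      + p * q * ((1 + p ^ 2) * tt - p * q * mm)) by (unfold d; ring).
    rewrite f1, f2. unfold P. ring. }
  assert (g2 : d * tt = d * (W * k1 * Q)).
  { replace (d * tt) with (p * q * ((1 + q ^ 2) * mm - p * q * tt)
      + (1 + q ^ 2) * ((1 + p ^ 2) * tt - p * q * mm)) by (unfold d; ring).
    rewrite f1, f2. unfold Q. ring. }
  apply Rmult_eq_reg_l in g1; [|lra]. apply Rmult_eq_reg_l in g2; [|lra].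
  assert (pde : al * be * r + (al + be) * s + t = 0).
  { replace (al * be * r + (al + be) * s + t) with (be * mm + tt) by (unfold mm, tt; ring).
    rewrite g1, g2. unfold be. field. exact hP. }
  split; [exact pde|]. split; [unfold mm in g1; lra|].
  (* k2 is known only through the characteristic polynomial; comparing its values at 0 and 1 yields
     the trace. *)
  assert (tr : k1 + k2 = ((1 + q ^ 2) * r - 2 * (p * q) * s + (1 + p ^ 2) * t) / (W * d)).
  { pose proof (Hv 0) as v0. pose proof (Hv 1) as v1.
    unfold char_poly2, weingarten in v0, v1. cbv zeta in v0, v1.
    rewrite det_eq in v0, v1. fold d in v0, v1. cbn [fst snd] in v0, v1.
    match type of v0 with (0 - ?a) * (0 - ?b) - ?c * ?e = _ =>
      assert (k : k1 + k2 = a + b) by nra; rewrite k end.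
    field. lra. }
  set (n := be * r + s).
  assert (T : (1 + q ^ 2) * r - 2 * (p * q) * s + (1 + p ^ 2) * t = - (P al * n + P be * mm)).
  { assert (ht : t = - (al * be * r + (al + be) * s)) by lra.
    assert (ho : al * be * (1 + p ^ 2) + p * q * (al + be) + (1 + q ^ 2) = 0).
    { unfold be, Q. unfold P in *. field. exact hP. }
    rewrite ht. unfold n, mm, P.
    replace (1 + q ^ 2) with (- (al * be * (1 + p ^ 2) + p * q * (al + be))) by lra. ring. }
  rewrite T, g1 in tr. pose proof P_product as pp. fold d in pp.
  assert (tr2 : (k1 + k2) * (W * d) = - (P al * n + P be * (W * k1 * P al))).
  { rewrite tr. field. lra. }
  assert (k3 : P al * n = P al * (W * k2 * P be)).
  { assert (P al * (W * k2 * P be) = W * k2 * (P al * P be)) by ring.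
    assert (P be * (W * k1 * P al) = W * k1 * (P al * P be)) by ring.
    rewrite H, H0 in *. rewrite pp in *. lra. }
  apply Rmult_eq_reg_l in k3; auto.
Qed.

(** The characteristic polynomial is recovered from the trace and the determinant of the operator,
    both computed from the three equations and [P_product]. *)
Lemma equations_eigen k1 k2 :
  al * be * r + (al + be) * s + t = 0 -> al * r + s = W * k1 * P al ->
  be * r + s = W * k2 * P be ->
  eigenvalues2 weingarten k1 k2 /\ eigenvector2 weingarten k1 (al, 1).
Proof.
  intros pde h1 h2. destruct W_sq as [hW hW0]. pose proof P_product as pp. pose proof P_be_nz as hP2.
  set (d := 1 + p ^ 2 + q ^ 2) in *. assert (hd : 0 < d) by (unfold d; nra).
  assert (ht : t = - (al * be * r + (al + be) * s)) by lra.
  assert (hbP : be * P al = - Q) by (unfold be; field; exact hP).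
  assert (ho : al * be * (1 + p ^ 2) + p * q * (al + be) + (1 + q ^ 2) = 0).
  { unfold be, Q. unfold P in *. field. exact hP. }
  split.
  - intros x. unfold char_poly2, weingarten. cbv zeta. rewrite det_eq. fold d. cbn [fst snd].
    assert (T : (1 + q ^ 2) * r - 2 * (p * q) * s + (1 + p ^ 2) * t = (k1 + k2) * (W * d)).
    { replace ((1 + q ^ 2) * r - 2 * (p * q) * s + (1 + p ^ 2) * t)
        with (- (P al * (be * r + s) + P be * (al * r + s))).
      - rewrite h1, h2.
        replace (- (P al * (W * k2 * P be) + P be * (W * k1 * P al)))
          with (- (k1 + k2) * W * (P al * P be)) by ring.
        rewrite pp. ring.
      - rewrite ht. unfold P.
        replace (1 + q ^ 2) with (- (al * be * (1 + p ^ 2) + p * q * (al + be))) by lra. ring. }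
    assert (Dt : r * t - s * s = k1 * k2 * (W * W * d)).
    { replace (r * t - s * s) with (- ((al * r + s) * (be * r + s))) by (rewrite ht; ring).
      rewrite h1, h2.
      replace (- (W * k1 * P al * (W * k2 * P be))) with (- (k1 * k2) * (W * W) * (P al * P be)) by ring.
      rewrite pp. ring. }
    assert (hsum : forall A B C E : R, A + B = k1 + k2 -> A * B - C * E = k1 * k2 ->
       (x - A) * (x - B) - C * E = (x - k1) * (x - k2)).
    { intros A B C E q1 q2.
      replace ((x - A) * (x - B) - C * E) with (x * x - (A + B) * x + (A * B - C * E)) by ring.
      rewrite q1, q2. ring. }
    apply hsum.
    + apply Rmult_eq_reg_r with (W * d); [|nra]. rewrite <- T. field. lra.
    + apply Rmult_eq_reg_r with (W * W * d); [|nra]. rewrite <- Dt. unfold d. field.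
      fold d. lra.
  - split; [intros h; injection h; intros; lra|].
    unfold weingarten. cbv zeta. rewrite det_eq. fold d. cbn [fst snd].
    replace (r * al + s * 1) with (W * k1 * P al) by lra.
    replace (s * al + t * 1) with (W * k1 * Q).
    + f_equal.
      * unfold P, Q. unfold d. field. fold d. lra.
      * unfold P, Q. unfold d. field. fold d. lra.
    + replace (s * al + t * 1) with (- be * (al * r + s)) by (rewrite ht; ring).
      rewrite h1. replace (W * k1 * Q) with (- (W * k1 * - Q)) by ring. rewrite <- hbP. ring.
Qed.

End geometry.

Lemma shape_operator_weingarten D f z u p q r s t :
  Dx D f z = p -> Dy D f z = q -> Dx D (Dx D f) z = r -> Dy D (Dx D f) z = s ->
  Dy D (Dy D f) z = t -> shape_operator D f z u = weingarten p q r s t u.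
Proof.
  intros e1 e2 e3 e4 e5.
  unfold shape_operator, first_form, second_form, weingarten. cbv zeta. cbn [fst snd].
  rewrite e1, e2, e3, e4, e5.
  replace ((1 + p ^ 2) * 1 * 1 + p * q * (1 * 0 + 0 * 1) + (1 + q ^ 2) * 0 * 0)
    with (1 + p ^ 2) by ring.
  replace ((1 + p ^ 2) * 1 * 0 + p * q * (1 * 1 + 0 * 0) + (1 + q ^ 2) * 0 * 1)
    with (p * q) by ring.
  replace ((1 + p ^ 2) * 0 * 0 + p * q * (0 * 1 + 1 * 0) + (1 + q ^ 2) * 1 * 1)
    with (1 + q ^ 2) by ring.
  replace (r * 1 * fst u + s * (1 * snd u + 0 * fst u) + t * 0 * snd u)
    with (r * fst u + s * snd u) by ring.
  replace (r * 0 * fst u + s * (0 * snd u + 1 * fst u) + t * 1 * snd u)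
    with (s * fst u + t * snd u) by ring.
  reflexivity.
Qed.

(** * Characteristic directions and Cauchy data *)

Lemma D1_ext S f df f' df' : D1 S f df -> (forall x, S x -> f' x = f x) ->
  (forall x, S x -> df' x = df x) -> D1 S f' df'.
Proof.
  intros H h1 h2. apply (UC1_ext _ _ _ _ _ H).
  - intros X hX. now apply h1.
  - intros X h hX. simpl. now rewrite h2.
Qed.

Section directions.
Variables (a1 a2 A0 A1 rho : R) (alpha : R * R -> R).
Hypotheses (ha1 : 0 < a1) (ha2 : 0 < a2) (hA0 : 0 < A0) (hrho : 0 < rho <= 1).
Hypotheses (hrho0 : 2 * (rho * rho) <= A0) (hrho1 : 2 * (rho * rho) * A1 <= 1).
Hypothesis alpha_C2 : class_C 2 (rect a1 a2) alpha.
Hypothesis alpha_range : forall z, rect a1 a2 z -> A0 <= Rabs (alpha z) <= A1.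
Let O := jet_box a1 a2 rho.
Let D := rect a1 a2.

(* The directions (AL, 1) and (BE, 1) are orthogonal for the first fundamental form of
   the jet X; PA and PB are the first components of the form applied to them. *)
Definition AL (X : ix -> R) : R := alpha (X Ix, X Iy).
Definition PA (X : ix -> R) : R := (1 + X Ip ^ 2) * AL X + X Ip * X Iq.
Definition QA (X : ix -> R) : R := X Ip * X Iq * AL X + 1 + X Iq ^ 2.
Definition BE (X : ix -> R) : R := - (QA X / PA X).
Definition PB (X : ix -> R) : R := (1 + X Ip ^ 2) * BE X + X Ip * X Iq.
Definition WJ (X : ix -> R) : R := sqrt (1 + X Ip ^ 2 + X Iq ^ 2).

Definition ALx (X : ix -> R) : R := Dx D alpha (X Ix, X Iy).
Definition ALy (X : ix -> R) : R := Dy D alpha (X Ix, X Iy).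
(** The partial derivative of [BE] with respect to alpha; x and y enter [BE] through alpha alone. *)
Definition BE_al (X : ix -> R) : R :=
  - ((X Ip * X Iq * PA X - QA X * (1 + X Ip ^ 2)) / PA X ^ 2).
Definition BEx (X : ix -> R) : R := BE_al X * ALx X.
Definition BEy (X : ix -> R) : R := BE_al X * ALy X.
Definition BEp (X : ix -> R) : R :=
  - ((X Iq * AL X * PA X - QA X * (2 * X Ip * AL X + X Iq)) / PA X ^ 2).
Definition BEq (X : ix -> R) : R :=
  - (((X Ip * AL X + 2 * X Iq) * PA X - QA X * X Ip) / PA X ^ 2).

Lemma jet_box_rect X : O X -> D (X Ix, X Iy).
Proof.
  intros [h1 [h2 _]]. split; simpl; auto. rewrite Rabs_pos_eq; lra.
Qed.

Lemma jet_bounds X : O X ->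
  A0 <= Rabs (AL X) <= A1 /\ Rabs (X Ip) <= 1 /\ Rabs (X Iq) <= 1
  /\ Rabs (X Ip * X Iq) <= rho * rho /\ 0 <= X Ip ^ 2 <= 1 /\ 0 <= X Iq ^ 2 <= 1.
Proof.
  intros hX. pose proof (alpha_range _ (jet_box_rect X hX)) as ha.
  destruct hX as [_ [_ [hp hq]]].
  assert (k : Rabs (X Ip * X Iq) <= rho * rho).
  { rewrite Rabs_mult. apply Rmult_le_compat; auto using Rabs_pos. }
  assert (sq : forall x, Rabs x <= rho -> 0 <= x ^ 2 <= 1).
  { intros x hx. rewrite <- (pow2_abs x). pose proof (Rabs_pos x). nra. }
  specialize (sq (X Ip) hp) as k1. specialize (sq (X Iq) hq) as k2.
  repeat split; auto; try apply ha; try apply k1; try apply k2; lra.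
Qed.

(** The choice of rho works here and in the bounds on [PA]: |p q alpha| <= 1 / 2 keeps [QA]
    positive, and |p q| <= A0 / 2 keeps the sign of [PA] equal to that of alpha, so [BE] has the
    opposite sign. *)
Lemma QA_range X : O X -> 1 / 2 <= QA X <= 3.
Proof.
  intros hX. destruct (jet_bounds X hX) as [ha [_ [_ [hpq [_ hq]]]]]. unfold QA.
  assert (Rabs (X Ip * X Iq * AL X) <= 1 / 2).
  { rewrite Rabs_mult. apply Rle_trans with (rho * rho * A1); [|lra].
    apply Rmult_le_compat; auto using Rabs_pos. apply ha. }
  apply Rabs_le_between in H. lra.
Qed.

Lemma PA_range_pos X : O X -> 0 < AL X -> A0 / 2 <= PA X <= 2 * A1 + 1.
Proof.
  intros hX hpos. destruct (jet_bounds X hX) as [ha [_ [_ [hpq [hp _]]]]].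
  rewrite Rabs_pos_eq in ha by lra. apply Rabs_le_between in hpq.
  unfold PA. assert (rho * rho <= 1) by nra. nra.
Qed.

Lemma PA_range_neg X : O X -> AL X < 0 -> - (2 * A1 + 1) <= PA X <= - (A0 / 2).
Proof.
  intros hX hneg. destruct (jet_bounds X hX) as [ha [_ [_ [hpq [hp _]]]]].
  rewrite Rabs_left in ha by lra. apply Rabs_le_between in hpq.
  unfold PA. assert (rho * rho <= 1) by nra. nra.
Qed.

Lemma AL_sign X : O X -> 0 < AL X \/ AL X < 0.
Proof.
  intros hX. destruct (jet_bounds X hX) as [ha _].
  destruct (Rtotal_order (AL X) 0) as [h|[h|h]]; auto. rewrite h, Rabs_R0 in ha. lra.
Qed.

Lemma PA_lower X : O X -> A0 / 2 <= Rabs (PA X).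
Proof.
  intros hX. destruct (AL_sign X hX) as [h|h].
  - pose proof (PA_range_pos X hX h). rewrite Rabs_pos_eq; lra.
  - pose proof (PA_range_neg X hX h). rewrite Rabs_left1; lra.
Qed.

Lemma PA_nz X : O X -> PA X <> 0.
Proof. intros hX h. pose proof (PA_lower X hX) as k. rewrite h, Rabs_R0 in k. lra. Qed.

(** The bounds for |alpha| combined with those for |QA / PA|, which lies between (1 / 2) / (2 A1 +
    1) and 3 / (A0 / 2). *)
Definition lower_speed : R := Rmin A0 (/ (4 * A1 + 2)).
Definition upper_speed : R := Rmax A1 (6 / A0).

Lemma A1_pos : 0 < A1.
Proof.
  assert (h : D (0, 0)) by (split; simpl; rewrite Rabs_R0; lra).
  pose proof (alpha_range _ h). lra.
Qed.

Lemma speeds_pos : 0 < lower_speed /\ 0 < upper_speed.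
Proof.
  pose proof A1_pos. split.
  - apply Rmin_glb_lt; auto. apply Rinv_0_lt_compat. lra.
  - eapply Rlt_le_trans; [|apply Rmax_l]. auto.
Qed.

Lemma quotient_range Q P : 1 / 2 <= Q <= 3 -> A0 / 2 <= P <= 2 * A1 + 1 ->
  lower_speed <= Q / P <= upper_speed.
Proof.
  intros hQ hP. pose proof A1_pos. split.
  - eapply Rle_trans; [apply Rmin_r|].
    apply Rmult_le_reg_r with P; [lra|]. replace (Q / P * P) with Q by (field; lra).
    apply Rle_trans with (/ (4 * A1 + 2) * (2 * A1 + 1)).
    + apply Rmult_le_compat_l; [left; apply Rinv_0_lt_compat; lra|lra].
    + apply Rle_trans with (1 / 2); [right; field; lra|lra].
  - eapply Rle_trans; [|apply Rmax_r].
    apply Rmult_le_reg_r with P; [lra|]. replace (Q / P * P) with Q by (field; lra).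
    apply Rle_trans with (6 / A0 * (A0 / 2)).
    + replace (6 / A0 * (A0 / 2)) with 3 by (field; lra). lra.
    + apply Rmult_le_compat_l; [|lra]. left. apply Rdiv_lt_0_compat; lra.
Qed.

Lemma speeds_of_pos X : O X -> 0 < AL X ->
  lower_speed <= AL X <= upper_speed /\ - upper_speed <= BE X <= - lower_speed.
Proof.
  intros hX h. destruct (jet_bounds X hX) as [ha _]. rewrite Rabs_pos_eq in ha by lra.
  pose proof (quotient_range _ _ (QA_range X hX) (PA_range_pos X hX h)) as k.
  assert (lower_speed <= A0) by apply Rmin_l. assert (A1 <= upper_speed) by apply Rmax_l.
  unfold BE. lra.
Qed.

Lemma speeds_of_neg X : O X -> AL X < 0 ->
  lower_speed <= BE X <= upper_speed /\ - upper_speed <= AL X <= - lower_speed.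
Proof.
  intros hX h. destruct (jet_bounds X hX) as [ha _]. rewrite Rabs_left in ha by lra.
  pose proof (PA_range_neg X hX h) as hP.
  assert (hP' : A0 / 2 <= - PA X <= 2 * A1 + 1) by lra.
  pose proof (quotient_range _ _ (QA_range X hX) hP') as k.
  assert (E : QA X / - PA X = BE X) by (unfold BE; field; lra). rewrite E in k.
  assert (lower_speed <= A0) by apply Rmin_l. assert (A1 <= upper_speed) by apply Rmax_l.
  lra.
Qed.

Lemma speeds_bound X : O X -> Rabs (AL X) <= upper_speed /\ Rabs (BE X) <= upper_speed
  /\ 2 * lower_speed <= Rabs (AL X - BE X).
Proof.
  intros hX. destruct speeds_pos. destruct (AL_sign X hX) as [h|h].
  - destruct (speeds_of_pos X hX h). repeat split; try (apply Rabs_le; lra).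
    rewrite Rabs_pos_eq; lra.
  - destruct (speeds_of_neg X hX h). repeat split; try (apply Rabs_le; lra).
    rewrite Rabs_left1; lra.
Qed.

Lemma rect_convex : convex_body D.
Proof.
  split.
  - intros [px py] [qx qy] t [h1 h2] [h3 h4] ht. unfold D, rect, segment_pt in *; simpl in *.
    apply Rabs_le_between in h1. apply Rabs_le_between in h2.
    apply Rabs_le_between in h3. apply Rabs_le_between in h4.
    split; apply Rabs_le; nra.
  - exists 0, 0, (Rmin a1 a2). split; [now apply Rmin_glb_lt|].
    pose proof (Rmin_l a1 a2). pose proof (Rmin_r a1 a2).
    intros s t hs ht. split; simpl; rewrite Rplus_0_l, Rabs_pos_eq; lra.
Qed.

Lemma class_C1_jet f : class_C 1 D f -> C1on O (fun X => f (X Ix, X Iy)).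
Proof.
  intros Hf. eexists. eapply UC1f_subset; [|apply (class_C1_UC1 D
    (rect_retract a1 a2 ha1 ha2) Ix Iy f rect_convex Hf)]. exact jet_box_rect.
Qed.

Lemma coord_C1 : C1on O (fun X => X Ip) /\ C1on O (fun X => X Iq).
Proof. split; eapply C1_coord; intros X hX; apply hX. Qed.

Lemma alpha_C1 : class_C 1 D alpha /\ class_C 1 D (Dx D alpha) /\ class_C 1 D (Dy D alpha).
Proof. split; [now apply class_C_pred|]. apply alpha_C2. Qed.

Lemma AL_jet : jet_function a1 a2 rho AL ALx ALy (fun _ => 0) (fun _ => 0).
Proof.
  destruct alpha_C1 as [h1 [h2 h3]]. constructor; try apply C1_const.
  - apply (UC1_ext O AL (fun X h => ALx X * h Ix + ALy X * h Iy)).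
    + eapply UC1f_subset; [|apply (class_C1_UC1 D (rect_retract a1 a2 ha1 ha2) Ix Iy alpha
        rect_convex h1)]. exact jet_box_rect.
    + auto.
    + intros X h _. unfold directional. ring.
  - now apply (class_C1_jet (Dx D alpha)).
  - now apply (class_C1_jet (Dy D alpha)).
  - intros X. reflexivity.
Qed.

Lemma AL_C1 : C1on O AL.
Proof. eexists. apply AL_jet. Qed.

Lemma PA_C1 : C1on O PA.
Proof.
  destruct coord_C1. apply C1_plus; apply C1_mult; auto using AL_C1.
  apply C1_plus; auto using C1_const, C1_pow.
Qed.

Lemma QA_C1 : C1on O QA.
Proof.
  destruct coord_C1. repeat apply C1_plus; auto using C1_const, C1_pow.
  apply C1_mult; auto using AL_C1. now apply C1_mult.
Qed.

Lemma PA_sq_lower X : O X -> A0 / 2 * (A0 / 2) <= Rabs (PA X ^ 2).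
Proof.
  intros hX. pose proof (PA_lower X hX). rewrite <- RPow_abs. simpl. rewrite Rmult_1_r.
  apply Rmult_le_compat; lra.
Qed.

Lemma BE_jet : jet_function a1 a2 rho BE BEx BEy BEp BEq.
Proof.
  destruct coord_C1 as [Cp Cq].
  assert (CAL := AL_C1). assert (CPA := PA_C1). assert (CQA := QA_C1).
  assert (hA2 : 0 < A0 / 2) by lra. assert (hA4 : 0 < A0 / 2 * (A0 / 2)) by nra.
  assert (CPA2 : C1on O (fun X => PA X ^ 2)) by now apply C1_pow.
  assert (Cdiv : forall F, C1on O F -> C1on O (fun X => - (F X / PA X ^ 2))).
  { intros F HF. apply C1_opp. apply C1_div with (A0 / 2 * (A0 / 2)); auto using PA_sq_lower. }
  assert (Cbe : C1on O BE_al).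
  { apply Cdiv. apply C1_minus; apply C1_mult; auto; [now apply C1_mult|].
    apply C1_plus; auto using C1_const, C1_pow. }
  pose proof AL_jet as JA. constructor.
  - assert (Up : UC1 O (fun X => X Ip) (fun _ h => h Ip)).
    { apply (UC1_coord O Ip rho). intros X hX. apply hX. }
    assert (Uq : UC1 O (fun X => X Iq) (fun _ h => h Iq)).
    { apply (UC1_coord O Iq rho). intros X hX. apply hX. }
    pose proof (jf_diff _ _ _ _ _ _ _ _ JA) as UA. fold O in UA.
    assert (UP : UC1 O PA (fun X h => (1 + X Ip ^ 2) * directional ALx ALy (fun _ => 0) (fun _ => 0) X h
         + (2 * X Ip * AL X + X Iq) * h Ip + X Ip * h Iq)).
    { apply (UC1_ext O _ _ _ _ (UC1_plus O _ _ _ _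
        (UC1_mult O _ _ _ _ (UC1_plus O _ _ _ _ (UC1_const O 1) (UC1_mult O _ _ _ _ Up Up)) UA)
        (UC1_mult O _ _ _ _ Up Uq))); intros; unfold PA; ring. }
    assert (UQ : UC1 O QA (fun X h => X Ip * X Iq * directional ALx ALy (fun _ => 0) (fun _ => 0) X h
         + X Iq * AL X * h Ip + (X Ip * AL X + 2 * X Iq) * h Iq)).
    { apply (UC1_ext O _ _ _ _ (UC1_plus O _ _ _ _
        (UC1_mult O _ _ _ _ (UC1_mult O _ _ _ _ Up Uq) UA)
        (UC1_plus O _ _ _ _ (UC1_const O 1) (UC1_mult O _ _ _ _ Uq Uq))));
      intros; unfold QA; ring. }
    apply (UC1_ext O _ _ _ _ (UC1_mult O _ _ _ _ (UC1_const O (-1))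
      (UC1_mult O _ _ _ _ UQ (UC1_inv O _ _ (A0 / 2) hA2 PA_lower UP)))).
    + intros X hX. unfold BE. field. now apply PA_nz.
    + intros X h hX. unfold directional, BEx, BEy, BEp, BEq, BE_al. field. now apply PA_nz.
  - apply C1_mult; auto. apply JA.
  - apply C1_mult; auto. apply JA.
  - apply Cdiv. apply C1_minus; repeat apply C1_mult; auto.
    apply C1_plus; auto. repeat apply C1_mult; auto using C1_const.
  - apply Cdiv. apply C1_minus; apply C1_mult; auto.
    apply C1_plus; apply C1_mult; auto using C1_const.
  - intros X. reflexivity.
Qed.

(** Cramer's rule for al r + s = W k1 PA and be r + s = W k2 PB: the solution is linear in k1 and
    k2, with coefficients [coef1] and [coef2]. The index [true] stands for r = f_xx and [false] for
    s = f_xy. *)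
Definition coef1 (i : bool) (X : ix -> R) : R :=
  (if i then WJ X * PA X else - (BE X * (WJ X * PA X))) / (AL X - BE X).
Definition coef2 (i : bool) (X : ix -> R) : R :=
  (if i then - (WJ X * PB X) else AL X * (WJ X * PB X)) / (AL X - BE X).

Lemma coef_C1 i : C1on O (coef1 i) /\ C1on O (coef2 i).
Proof.
  destruct coord_C1 as [Cp Cq].
  assert (CAL := AL_C1). assert (CPA := PA_C1).
  assert (CBE : C1on O BE) by (eexists; apply BE_jet).
  assert (CPB : C1on O PB).
  { apply C1_plus; apply C1_mult; auto. apply C1_plus; auto using C1_const, C1_pow. }
  assert (CW : C1on O WJ).
  { apply C1_sqrt.
    - intros X hX. pose proof (pow2_ge_0 (X Ip)). pose proof (pow2_ge_0 (X Iq)). lra.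
    - repeat apply C1_plus; auto using C1_const, C1_pow. }
  assert (Cg : C1on O (fun X => AL X - BE X)) by now apply C1_minus.
  destruct speeds_pos as [hl _].
  assert (hg : forall X, O X -> 2 * lower_speed <= Rabs (AL X - BE X))
    by (intros X hX; apply speeds_bound; auto).
  assert (h2 : 0 < 2 * lower_speed) by lra.
  split; destruct i; apply C1_div with (2 * lower_speed); auto;
  auto using C1_mult, C1_opp.
Qed.

(** One constant for all four coefficients, determined by alpha and the rectangle alone, so that
    [Delta] can be chosen before the curvatures are given. *)
Lemma coef_bounds : exists Mf, 0 < Mf /\ forall i X Y, O X -> O Y ->
  Rabs (coef1 i X) <= Mf /\ Rabs (coef2 i X) <= Mf /\ forall b, nb (dlt X Y) b ->
  Rabs (coef1 i Y - coef1 i X) <= Mf * b /\ Rabs (coef2 i Y - coef2 i X) <= Mf * b.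
Proof.
  destruct (finite_upper bool [true; false] (fun i M => forall X Y, O X -> O Y ->
    Rabs (coef1 i X) <= M /\ Rabs (coef2 i X) <= M /\ forall b, nb (dlt X Y) b ->
    Rabs (coef1 i Y - coef1 i X) <= M * b /\ Rabs (coef2 i Y - coef2 i X) <= M * b))
    as [M [hM HM]].
  - intros []; simpl; auto.
  - intros i M M' hM H X Y hX hY. destruct (H X Y hX hY) as [h1 [h2 h3]].
    split; [lra|]. split; [lra|]. intros b hb. destruct (h3 b hb). destruct hb as [hb _].
    split; nra.
  - intros i. destruct (coef_C1 i) as [k1 k2].
    destruct (C1_bounded _ _ k1) as [M1 [hM1 HM1]]. destruct (C1_bounded _ _ k2) as [M2 [hM2 HM2]].
    destruct (C1_lipschitz _ _ k1) as [L1 [hL1 HL1]]. destruct (C1_lipschitz _ _ k2) as [L2 [hL2 HL2]].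
    exists (M1 + M2 + L1 + L2). split; [lra|]. intros X Y hX hY.
    specialize (HM1 X hX). specialize (HM2 X hX). split; [lra|]. split; [lra|].
    intros b hb. specialize (HL1 X Y hX hY b hb). specialize (HL2 X Y hX hY b hb).
    destruct hb as [hb _]. split; nra.
  - exists M. split; auto.
Qed.

(** * Cauchy data on the initial segment *)

Section initial_curve.
Variables (kb1 kb2 kp1 kp2 : R -> R) (Mf Delta : R).
Hypothesis hMf : 0 < Mf.
Hypothesis Hcoef : forall i X Y, O X -> O Y ->
  Rabs (coef1 i X) <= Mf /\ Rabs (coef2 i X) <= Mf /\ forall b, nb (dlt X Y) b ->
  Rabs (coef1 i Y - coef1 i X) <= Mf * b /\ Rabs (coef2 i Y - coef2 i X) <= Mf * b.
Hypothesis hDelta : 0 < Delta.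
Hypothesis hDelta1 : 8 * a1 * Mf * Delta <= 1.
Hypothesis hDelta2 : 4 * a1 * (1 + a1) * Mf * Delta <= rho.
Hypothesis Dk1 : D1 (fun x => Rabs x <= a1) kb1 kp1.
Hypothesis Dk2 : D1 (fun x => Rabs x <= a1) kb2 kp2.
Hypothesis k1_small : forall x, Rabs x <= a1 -> Rabs (kb1 x) <= Delta.
Hypothesis k2_small : forall x, Rabs x <= a1 -> Rabs (kb2 x) <= Delta.

Definition hess (i : bool) (x p q : R) : R :=
  kb1 x * coef1 i (jet x 0 p q) + kb2 x * coef2 i (jet x 0 p q).

Lemma jet0_box x p q : Rabs x <= a1 -> Rabs p <= rho -> Rabs q <= rho -> O (jet x 0 p q).
Proof. intros. unfold O, jet_box; simpl. repeat split; auto; lra. Qed.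

Lemma hess_lip i x p q p' q' b : Rabs x <= a1 -> Rabs p <= rho -> Rabs q <= rho ->
  Rabs p' <= rho -> Rabs q' <= rho -> Rabs (p' - p) <= b -> Rabs (q' - q) <= b ->
  Rabs (hess i x p' q' - hess i x p q) <= 2 * Delta * Mf * b.
Proof.
  intros hx hp hq hp' hq' h1 h2.
  assert (b0 : 0 <= b) by (eapply Rle_trans; [apply Rabs_pos|exact h1]).
  assert (hn : nb (dlt (jet x 0 p q) (jet x 0 p' q')) b).
  { split; auto. intros []; unfold dlt; simpl; auto; rewrite Rminus_diag, Rabs_R0; auto. }
  destruct (Hcoef i _ _ (jet0_box x p q hx hp hq) (jet0_box x p' q' hx hp' hq')) as [_ [_ H]].
  destruct (H b hn) as [k1 k2]. unfold hess.
  match goal with |- Rabs ?t <= _ => replace t with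
    (kb1 x * (coef1 i (jet x 0 p' q') - coef1 i (jet x 0 p q))
     + kb2 x * (coef2 i (jet x 0 p' q') - coef2 i (jet x 0 p q))) by ring end.
  eapply Rle_trans; [apply Rabs_triang|]. rewrite !Rabs_mult.
  replace (2 * Delta * Mf * b) with (Delta * (Mf * b) + Delta * (Mf * b)) by ring.
  apply Rplus_le_compat; apply Rmult_le_compat; auto using Rabs_pos.
Qed.

Lemma hess_bound i x p q : Rabs x <= a1 -> Rabs p <= rho -> Rabs q <= rho ->
  Rabs (hess i x p q) <= 2 * Delta * Mf.
Proof.
  intros hx hp hq. pose proof (jet0_box x p q hx hp hq) as hO.
  destruct (Hcoef i _ _ hO hO) as [h1 [h2 _]]. unfold hess.
  eapply Rle_trans; [apply Rabs_triang|]. rewrite !Rabs_mult.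
  replace (2 * Delta * Mf) with (Delta * Mf + Delta * Mf) by ring.
  apply Rplus_le_compat; apply Rmult_le_compat; auto using Rabs_pos.
Qed.

(** The ordinary differential equation p' = f_xx, q' = f_xy along y = 0 with zero initial values at
    the origin. Its right-hand side has size and Lipschitz constant 2 Delta Mf, so smallness of
    [Delta] makes one contraction work on the whole segment. *)
Theorem initial_curve : exists p0 q0 z0 rp sp : R -> R,
  let r0 := fun x => hess true x (p0 x) (q0 x) in
  let s0 := fun x => hess false x (p0 x) (q0 x) in
  let S := fun x => Rabs x <= a1 in
  D1 S p0 r0 /\ D1 S q0 s0 /\ D1 S z0 p0 /\ D1 S r0 rp /\ D1 S s0 sp
  /\ (forall x, S x -> Rabs (p0 x) <= rho / 2 /\ Rabs (q0 x) <= rho / 2 /\ Rabs (z0 x) <= rho / 2)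
  /\ p0 0 = 0 /\ q0 0 = 0 /\ z0 0 = 0.
Proof.
  (* p and q are clamped so that the coefficients are evaluated inside the jet box; the bound on the
     solution shows afterwards that the clamp was inactive. *)
  set (cl := clamp (- rho) rho).
  assert (hcl : forall x, Rabs (cl x) <= rho) by (intros; apply Rabs_le; apply clamp_range; lra).
  set (F := fun (i : bool) (u v : R) (X : bool -> R) =>
     hess i (ret1 a1 u) (cl (X true)) (cl (X false))).
  assert (hr1 : forall u, Rabs (ret1 a1 u) <= a1).
  { intros u. apply Rabs_le. apply clamp_range. lra. }
  set (L := 2 * Delta * Mf). assert (hL : 0 < L) by (unfold L; nra).
  assert (hd : 0 < 2 * a1) by lra.
  assert (hdL : 2 * a1 * L <= 1 / 2) by (unfold L; lra).
  assert (F_lip : forall i u v X Y b, nb (dlt X Y) b -> Rabs (F i u v Y - F i u v X) <= L * b).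
  { intros i u v X Y b [b0 hn]. apply hess_lip; auto;
    (eapply Rle_trans; [apply clamp_lip|apply hn]). }
  assert (F_bound : exists M, 0 < M /\ forall i u v, Rabs (F i u v (fun _ => 0)) <= M).
  { exists L. split; auto. intros. apply hess_bound; auto. }
  destruct (D1_elim _ _ _ Dk1) as [[M1 [hM1 HM1]] U1].
  destruct (D1_elim _ _ _ Dk2) as [[M2 [hM2 HM2]] U2].
  assert (k_lip : forall k kp, D1 (fun x => Rabs x <= a1) k kp -> exists Lk, 0 < Lk /\
     forall x y, Rabs x <= a1 -> Rabs y <= a1 -> Rabs (k y - k x) <= Lk * Rabs (y - x)).
  { intros k kp Dk. destruct (UC1_lipschitz _ _ _ Dk) as [Lk [hLk HLk]]. exists Lk. split; auto.
    intros x y hx hy. apply (HLk (fun _ => x) (fun _ => y) hx hy).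
    split; [apply Rabs_pos|]. intros j. unfold dlt. lra. }
  destruct (k_lip _ _ Dk1) as [L1 [hL1 HL1]]. destruct (k_lip _ _ Dk2) as [L2 [hL2 HL2]].
  assert (F_uc : forall K e, 0 < e -> exists r, 0 < r /\
    forall i u v u' v' X, nb X K -> Rabs (u' - u) <= r -> Rabs (v' - v) <= r ->
    Rabs (F i u' v' X - F i u v X) <= e).
  { intros K e he. set (c := (L1 + L2) * Mf + L).
    assert (hc : 0 < c) by (unfold c; nra).
    exists (e / c). split; [now apply Rdiv_lt_0_compat|].
    intros i u v u' v' X _ hu _. unfold F.
    set (x := ret1 a1 u). set (x' := ret1 a1 u').
    assert (hx : Rabs x <= a1) by apply hr1. assert (hx' : Rabs x' <= a1) by apply hr1.
    assert (hxx : Rabs (x' - x) <= e / c) by (eapply Rle_trans; [apply clamp_lip|auto]).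
    set (P := cl (X true)). set (Q := cl (X false)).
    assert (hP : Rabs P <= rho) by apply hcl. assert (hQ : Rabs Q <= rho) by apply hcl.
    pose proof (jet0_box x P Q hx hP hQ) as o1. pose proof (jet0_box x' P Q hx' hP hQ) as o2.
    destruct (Hcoef i _ _ o2 o1) as [b1 [b2 _]]. destruct (Hcoef i _ _ o1 o2) as [_ [_ H]].
    assert (hn : nb (dlt (jet x 0 P Q) (jet x' 0 P Q)) (e / c)).
    { split; [left; now apply Rdiv_lt_0_compat|].
      intros []; unfold dlt; simpl; auto; rewrite Rminus_diag, Rabs_R0;
      left; now apply Rdiv_lt_0_compat. }
    destruct (H _ hn) as [k1 k2]. unfold hess.
    match goal with |- Rabs ?t <= _ => replace t with
      ((kb1 x' - kb1 x) * coef1 i (jet x' 0 P Q)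
       + kb1 x * (coef1 i (jet x' 0 P Q) - coef1 i (jet x 0 P Q))
       + ((kb2 x' - kb2 x) * coef2 i (jet x' 0 P Q)
       + kb2 x * (coef2 i (jet x' 0 P Q) - coef2 i (jet x 0 P Q)))) by ring end.
    eapply Rle_trans; [apply Rabs_triang|].
    eapply Rle_trans; [apply Rplus_le_compat; apply Rabs_triang|]. rewrite !Rabs_mult.
    pose proof (HL1 x x' hx hx') as l1. pose proof (HL2 x x' hx hx') as l2.
    assert (l1' : Rabs (kb1 x' - kb1 x) <= L1 * (e / c)).
    { eapply Rle_trans; [exact l1|]. apply Rmult_le_compat_l; lra. }
    assert (l2' : Rabs (kb2 x' - kb2 x) <= L2 * (e / c)).
    { eapply Rle_trans; [exact l2|]. apply Rmult_le_compat_l; lra. }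
    assert (q1 := Rmult_le_compat _ _ _ _ (Rabs_pos _) (Rabs_pos _) l1' b1).
    assert (q2 := Rmult_le_compat _ _ _ _ (Rabs_pos _) (Rabs_pos _) l2' b2).
    assert (q3 := Rmult_le_compat _ _ _ _ (Rabs_pos _) (Rabs_pos _) (k1_small x hx) k1).
    assert (q4 := Rmult_le_compat _ _ _ _ (Rabs_pos _) (Rabs_pos _) (k2_small x hx) k2).
    apply Rle_trans with (c * (e / c)); [|right; field; lra].
    unfold c at 1. unfold L. lra. }
  (* An ordinary differential equation is the case in which every component is integrated along u,
     read on the line v = 0. The width 2 a1 makes the strip the full square. *)
  destruct (picard (fun _ : bool => true) F (fun _ _ => 0) a1 (2 * a1) L ha1 hd
     (Rlt_le _ _ hL) hdL F_lip F_bound F_uc) as [U [HU Heq]].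
  { exists 1. split; [lra|]. intros. rewrite Rabs_R0. lra. }
  { intros e he. exists 1. split; [lra|]. intros. rewrite Rminus_diag, Rabs_R0. lra. }
  pose proof (nemytskii_BUC F L (Rlt_le _ _ hL) F_lip F_bound F_uc U HU) as HN.
  set (h := fun i s => nemytskii F U i s 0).
  assert (hM : forall i s, Rabs (h i s) <= L) by (intros; apply hess_bound; auto).
  assert (hU : forall i, forall e, 0 < e -> exists r, 0 < r /\ forall x y, Rabs (y - x) <= r ->
     Rabs (h i y - h i x) <= e).
  { intros i e he. destruct HN as [_ H]. destruct (H e he) as [r [hr Hr]].
    exists r. split; auto. intros x y hxy. apply Hr; auto. rewrite Rminus_diag, Rabs_R0; lra. }
  pose proof (fun i => continuous_of_modulus (h i) (hU i)) as hcont.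
  assert (hUeq : forall i w, Rabs w <= a1 -> U i w 0 = RI (h i) 0 w).
  { intros i w hw. rewrite Heq; [apply Rplus_0_l|].
    unfold strip. rewrite Rabs_R0, Rminus_0_r. repeat split; lra. }
  assert (hsmall0 : forall i w, Rabs w <= a1 -> Rabs (U i w 0) <= L * a1).
  { intros i w hw. rewrite hUeq by auto.
    apply Rle_trans with (L * Rabs (w - 0)); [apply RI_bound; auto|].
    rewrite Rminus_0_r. apply Rmult_le_compat_l; lra. }
  (* The factor 1 + a1 covers p0 and q0, bounded by L a1, as well as the primitive z0, bounded by L
     a1 times a1. *)
  assert (hLa : L * a1 * (1 + a1) <= rho / 2) by (unfold L; lra).
  assert (hLa0 : 0 < L * a1) by nra.
  assert (hsmall : forall i w, Rabs w <= a1 -> Rabs (U i w 0) <= rho / 2).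
  { intros i w hw. specialize (hsmall0 i w hw). nra. }
  assert (hclU : forall i w, Rabs w <= a1 -> cl (U i w 0) = U i w 0).
  { intros i w hw. specialize (hsmall i w hw). apply clamp_id.
    apply Rabs_le_between in hsmall. lra. }
  set (p0 := fun w => U true w 0). set (q0 := fun w => U false w 0).
  assert (hh : forall i w, Rabs w <= a1 -> h i w = hess i w (p0 w) (q0 w)).
  { intros i w hw. unfold h, nemytskii, F. rewrite !hclU by auto.
    assert (E : ret1 a1 w = w) by (apply clamp_id; apply Rabs_le_between in hw; lra).
    now rewrite E. }
  set (z0 := fun w => RI p0 0 w).
  assert (hp0 : forall e, 0 < e -> exists r, 0 < r /\ forall x y, Rabs (y - x) <= r ->
     Rabs (p0 y - p0 x) <= e).
  { intros e he. destruct HU as [_ H]. destruct (H e he) as [r [hr Hr]].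
    exists r. split; auto. intros x y hxy. apply Hr; auto. rewrite Rminus_diag, Rabs_R0; lra. }
  assert (Dp0 : D1 (fun x => Rabs x <= a1) p0 (fun x => hess true x (p0 x) (q0 x))).
  { apply (D1_ext _ _ _ _ _ (D1_primitive a1 (h true) ha1 (ex_intro _ L (conj hL (hM true))) (hU true))).
    - intros x hx. now apply hUeq.
    - intros x hx. symmetry. now apply hh. }
  assert (Dq0 : D1 (fun x => Rabs x <= a1) q0 (fun x => hess false x (p0 x) (q0 x))).
  { apply (D1_ext _ _ _ _ _ (D1_primitive a1 (h false) ha1 (ex_intro _ L (conj hL (hM false))) (hU false))).
    - intros x hx. now apply hUeq.
    - intros x hx. symmetry. now apply hh. }
  assert (Dh : forall i, exists dh, D1 (fun x => Rabs x <= a1) (fun x => hess i x (p0 x) (q0 x)) dh).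
  { intros i. apply C1on_D1.
    set (OS := fun X : unit -> R => Rabs (X tt) <= a1).
    assert (Cj : forall f, C1on O f -> C1on OS (fun X => f (jet (X tt) 0 (p0 (X tt)) (q0 (X tt))))).
    { intros f Hf. apply (C1on_comp ixs O OS f (fun i X => jet (X tt) 0 (p0 (X tt)) (q0 (X tt)) i));
        auto using in_ixs.
      - intros [| | | | | | | |]; unfold jet; try apply C1_const.
        + apply (C1_coord OS tt a1). auto.
        + eexists; apply Dp0.
        + eexists; apply Dq0.
      - intros X hX. pose proof (hsmall true _ hX). pose proof (hsmall false _ hX).
        apply jet0_box; auto; unfold p0, q0; lra. }
    assert (K1 : C1on OS (fun X => kb1 (X tt))) by (eexists; apply Dk1).
    assert (K2 : C1on OS (fun X => kb2 (X tt))) by (eexists; apply Dk2).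
    destruct (coef_C1 i) as [C1' C2'].
    apply C1_plus; apply C1_mult; auto. }
  destruct (Dh true) as [rp Hrp]. destruct (Dh false) as [sp Hsp].
  assert (h0 : Rabs 0 <= a1) by (rewrite Rabs_R0; lra).
  exists p0, q0, z0, rp, sp. cbv zeta.
  split; [exact Dp0|]. split; [exact Dq0|]. split; [|split; [exact Hrp|split; [exact Hsp|split]]].
  - apply D1_primitive; auto. destruct HU as [[M [hM' HM]] _]. exists M. split; auto.
    intros; apply HM.
  - intros x hx. split; [now apply hsmall|]. split; [now apply hsmall|].
    apply Rle_trans with (L * a1 * Rabs (x - 0)).
    + apply RI_bound; [now apply continuous_of_modulus|]. intros t ht. apply hsmall0.
      apply Rabs_le_between in hx. revert ht. unfold Rmin, Rmax.
      destruct (Rle_dec 0 x); intros; apply Rabs_le; lra.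
    + rewrite Rminus_0_r. pose proof (Rabs_pos x). nra.
  - unfold p0, q0, z0. rewrite !hUeq by auto. unfold RI. rewrite !RInt_point.
    unfold zero; simpl. auto.
Qed.

(** Only the first components of the gradients matter, since the points move along y = 0.
    Integrating from the origin multiplies a bound on the differences by 2 Delta Mf a1 <= 1 / 4. *)
Lemma initial_curve_unique (D' : R * R -> Prop) p1 q1 t1 p2 q2 t2 :
  (forall x, Rabs x <= a1 -> D' (x, 0)) ->
  (forall x, Rabs x <= a1 -> Rabs (p1 (x, 0)) <= rho /\ Rabs (q1 (x, 0)) <= rho
     /\ Rabs (p2 (x, 0)) <= rho /\ Rabs (q2 (x, 0)) <= rho) ->
  (forall x, Rabs x <= a1 ->
     let r1 := hess true x (p1 (x, 0)) (q1 (x, 0)) in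
     let s1 := hess false x (p1 (x, 0)) (q1 (x, 0)) in
     let r2 := hess true x (p2 (x, 0)) (q2 (x, 0)) in
     let s2 := hess false x (p2 (x, 0)) (q2 (x, 0)) in
     is_grad D' p1 (x, 0) (r1, s1) /\ is_grad D' q1 (x, 0) (s1, t1 x)
     /\ is_grad D' p2 (x, 0) (r2, s2) /\ is_grad D' q2 (x, 0) (s2, t2 x)) ->
  p1 (0, 0) = p2 (0, 0) -> q1 (0, 0) = q2 (0, 0) ->
  forall x, Rabs x <= a1 -> p1 (x, 0) = p2 (x, 0) /\ q1 (x, 0) = q2 (x, 0).
Proof.
  intros hD hsm Hg e1 e2.
  set (f := fun t : bool * R => let (i, x) := t in
     if i then p1 (x, 0) - p2 (x, 0) else q1 (x, 0) - q2 (x, 0)).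
  set (P := fun t : bool * R => Rabs (snd t) <= a1).
  assert (Hz : forall t, P t -> f t = 0).
  { apply (zero_of_halving _ P f (2 * rho)).
    - intros [[] x] hx; unfold f, P in *; simpl in hx; destruct (hsm x hx) as [h1 [h2 [h3 h4]]];
      unfold Rminus; (eapply Rle_trans; [apply Rabs_triang|]); rewrite Rabs_Ropp; lra.
    - intros b hb Hb [i x] hx. unfold P in hx; simpl in hx.
      assert (h0 : f (i, 0) = 0) by (unfold f; destruct i; lra).
      replace (f (i, x)) with (f (i, x) - f (i, 0)) by lra.
      set (B := 2 * Delta * Mf * b).
      assert (hB : B * a1 <= b / 2).
      { unfold B. assert (0 <= b) by auto. nra. }
      assert (hB0 : 0 <= B) by (unfold B; repeat apply Rmult_le_pos; lra).
      apply Rle_trans with (B * Rabs (x - 0)).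
      2:{ rewrite Rminus_0_r. apply Rle_trans with (B * a1); auto. apply Rmult_le_compat_l; auto. }
      apply (increment_bound_sym (fun t => f (i, t))).
      assert (hin : forall t, Rmin 0 x <= t <= Rmax 0 x -> Rabs t <= a1).
      { intros t. apply Rabs_le_between in hx. unfold Rmin, Rmax.
        destruct (Rle_dec 0 x); intros; apply Rabs_le; lra. }
      intros t ht e he. pose proof (hin t ht) as hta.
      destruct (Hg t hta) as [g1 [g2 [g3 g4]]].
      destruct (hsm t hta) as [s1 [s2 [s3 s4]]].
      assert (hlip := hess_lip i t (p2 (t, 0)) (q2 (t, 0)) (p1 (t, 0)) (q1 (t, 0)) b hta s3 s4 s1 s2
        (Hb (true, t) hta) (Hb (false, t) hta)). fold B in hlip.
      assert (gen : forall u v c1 c2 d1 d2, is_grad D' u (t, 0) (c1, d1) ->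
        is_grad D' v (t, 0) (c2, d2) -> Rabs (c1 - c2) <= B ->
        exists r, 0 < r /\ forall s, Rmin 0 x <= s <= Rmax 0 x -> Rabs (s - t) <= r ->
         Rabs (u (s, 0) - v (s, 0) - (u (t, 0) - v (t, 0))) <= (B + e) * Rabs (s - t)).
      { intros u v c1 c2 d1 d2 gu gv hc.
        destruct (is_grad_elim _ _ _ _ gu (e / 2)) as [r1 [hr1 H1]]; [lra|].
        destruct (is_grad_elim _ _ _ _ gv (e / 2)) as [r2 [hr2 H2]]; [lra|].
        exists (Rmin r1 r2). split; [now apply Rmin_glb_lt|]. intros s hs hst.
        pose proof (Rmin_l r1 r2). pose proof (Rmin_r r1 r2).
        assert (hn : near (Rabs (s - t)) (t, 0) (s, 0)).
        { split; simpl; [lra|]. rewrite Rminus_diag, Rabs_R0. apply Rabs_pos. }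
        specialize (H1 (s, 0) (Rabs (s - t)) (hD s (hin s hs)) ltac:(lra) hn).
        specialize (H2 (s, 0) (Rabs (s - t)) (hD s (hin s hs)) ltac:(lra) hn).
        unfold pair_dot in H1, H2; cbn [fst snd] in H1, H2.
        match type of H1 with Rabs ?a <= _ => match type of H2 with Rabs ?c <= _ =>
          replace (u (s, 0) - v (s, 0) - (u (t, 0) - v (t, 0))) with
           (a - c + (s - t) * (c1 - c2)) by ring end end.
        eapply Rle_trans; [apply Rabs_triang|]. rewrite Rabs_mult. unfold Rminus at 1.
        eapply Rle_trans; [apply Rplus_le_compat_r, Rabs_triang|]. rewrite Rabs_Ropp.
        pose proof (Rabs_pos (s - t)).
        assert (Rabs (s - t) * Rabs (c1 - c2) <= Rabs (s - t) * B) by (apply Rmult_le_compat_l; auto).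
        lra. }
      destruct i.
      + exact (gen p1 p2 _ _ _ _ g1 g3 hlip).
      + exact (gen q1 q2 _ _ _ _ g2 g4 hlip). }
  intros x hx. pose proof (Hz (true, x) hx) as k1. pose proof (Hz (false, x) hx) as k2.
  unfold f in k1, k2. lra.
Qed.

End initial_curve.

End directions.

(** * Graphs with prescribed curvature lines *)

Section graphs.
Variables (a1 a2 A0 A1 rho eps : R) (alpha : R * R -> R) (kb1 kb2 : R -> R).
Hypotheses (ha1 : 0 < a1) (ha2 : 0 < a2) (hA0 : 0 < A0) (hrho : 0 < rho <= 1).
Hypotheses (hrho0 : 2 * (rho * rho) <= A0) (hrho1 : 2 * (rho * rho) * A1 <= 1).
Hypothesis alpha_C2 : class_C 2 (rect a1 a2) alpha.
Hypothesis alpha_range : forall z, rect a1 a2 z -> A0 <= Rabs (alpha z) <= A1.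
Hypothesis heps : 0 < eps <= a2.
Let K := 2 * upper_speed A0 A1.
Let D := trapezoid a1 K eps.

Lemma K_pos : 0 < K.
Proof.
  destruct (speeds_pos a1 a2 A0 A1 alpha ha1 ha2 hA0 alpha_range). unfold K. lra.
Qed.

Lemma D_convex : convex_body D.
Proof. apply trapezoid_convex; [exact ha1|exact K_pos|apply heps]. Qed.

Lemma D_jet z p q : D z -> Rabs p <= rho -> Rabs q <= rho ->
  jet_box a1 a2 rho (jet (fst z) (snd z) p q).
Proof.
  intros [h1 h2] hp hq. pose proof K_pos. unfold jet_box; simpl. repeat split; auto; nra.
Qed.

(** Brings an arbitrary C^3 solution with small gradient into the setting of the uniqueness theorem.
    Its second derivatives on the initial line are forced by its first ones and the prescribed
    curvatures. *)
Lemma solution_hessian g : class_C 3 D g ->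
  (forall z, D z -> Rabs (Dx D g z) <= rho /\ Rabs (Dy D g z) <= rho) ->
  is_solution a1 alpha kb1 kb2 D g ->
  hessian_solution a1 rho K eps (AL alpha) (BE alpha) (Dx D g) (Dy D g)
     (Dx D (Dx D g)) (Dy D (Dx D g)) (Dy D (Dy D g))
  /\ forall x, Rabs x <= a1 ->
     Dx D (Dx D g) (x, 0) = hess alpha kb1 kb2 true x (Dx D g (x, 0)) (Dy D g (x, 0))
     /\ Dy D (Dx D g) (x, 0) = hess alpha kb1 kb2 false x (Dx D g (x, 0)) (Dy D g (x, 0)).
Proof.
  intros Hg Hsm [[k1 [k2 [Hev [Hbd Hvec]]]] _].
  pose proof D_convex as HD.
  destruct (class_C_S_elim D HD 2 g Hg) as [Gg [Cp Cq]].
  destruct (class_C_S_elim D HD 1 _ Cp) as [Gp [Cr Cs]].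
  destruct (class_C_S_elim D HD 1 _ Cq) as [Gq [Cs' Ct]].
  set (p := Dx D g) in *. set (q := Dy D g) in *.
  assert (Emix : forall z, D z -> Dy D p z = Dx D q z).
  { apply (mixed_derivatives D HD g p q (Dx D p) (Dy D p) (Dx D q) (Dy D q)); auto;
    now apply (class_C_continuous D 1). }
  assert (Heq : forall z, D z -> let J := jet (fst z) (snd z) (p z) (q z) in
    AL alpha J * BE alpha J * Dx D p z + (AL alpha J + BE alpha J) * Dy D p z + Dy D q z = 0
    /\ AL alpha J * Dx D p z + Dy D p z = WJ J * k1 z * PA alpha J
    /\ BE alpha J * Dx D p z + Dy D p z = WJ J * k2 z * PB alpha J).
  { intros z hz J. destruct (Hsm z hz) as [hp hq].
    assert (hJ : jet_box a1 a2 rho J) by now apply D_jet.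
    assert (Esh : shape_operator D g z = weingarten (p z) (q z) (Dx D p z) (Dy D p z) (Dy D q z)).
    { apply functional_extensionality. intros u. now apply shape_operator_weingarten. }
    specialize (Hev z hz). specialize (Hvec z hz). rewrite Esh in Hev, Hvec.
    apply (eigen_equations (alpha (fst z, snd z)) (p z) (q z) (Dx D p z) (Dy D p z) (Dy D q z)
       (PA_nz a1 a2 A0 A1 rho alpha hA0 hrho hrho0 hrho1 alpha_range J hJ) (k1 z) (k2 z)); auto.
    now rewrite <- surjective_pairing. }
  split.
  - constructor; auto.
    + intros z hz. change (is_grad D q z (Dy D p z, Dy D q z)). rewrite Emix by auto. auto.
    + intros z hz. now apply (Heq z hz).
  - intros x hx.
    assert (hz : D (x, 0)).
    { unfold D, trapezoid; simpl. lra. }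
    destruct (Hbd x hx) as [b1 b2]. destruct (Heq _ hz) as [_ [e1 e2]]. rewrite b1 in e1.
    rewrite b2 in e2. cbn [fst snd] in e1, e2.
    destruct (Hsm _ hz) as [hp hq].
    assert (hJ : jet_box a1 a2 rho (jet x 0 (p (x, 0)) (q (x, 0)))) by exact (D_jet (x, 0) _ _ hz hp hq).
    set (J := jet x 0 (p (x, 0)) (q (x, 0))) in *.
    destruct (speeds_pos a1 a2 A0 A1 alpha ha1 ha2 hA0 alpha_range) as [hl _].
    destruct (speeds_bound a1 a2 A0 A1 rho alpha ha1 ha2 hA0 hrho hrho0 hrho1 alpha_range J hJ)
      as [_ [_ hg]].
    assert (hgap : AL alpha J - BE alpha J <> 0).
    { intros h. rewrite h, Rabs_R0 in hg. lra. }
    unfold hess. fold J. unfold coef1, coef2.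
    set (A := AL alpha J) in *. set (B := BE alpha J) in *.
    set (r := Dx D p (x, 0)) in *. set (s := Dy D p (x, 0)) in *.
    split.
    + transitivity (((A * r + s) - (B * r + s)) / (A - B)); [field; exact hgap|].
      rewrite e1, e2. field. exact hgap.
    + transitivity ((A * (B * r + s) - B * (A * r + s)) / (A - B)); [field; exact hgap|].
      rewrite e1, e2. field. exact hgap.
Qed.

Lemma graph_solution f p q r s t :
  (forall z, D z -> is_grad D f z (p z, q z)) ->
  (forall z, D z -> is_grad D p z (r z, s z)) ->
  (forall z, D z -> is_grad D q z (s z, t z)) ->
  class_C 1 D r -> class_C 1 D s -> class_C 1 D t ->
  (forall z, D z -> Rabs (p z) <= rho /\ Rabs (q z) <= rho) ->
  (forall z, D z -> let J := jet (fst z) (snd z) (p z) (q z) in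
     AL alpha J * BE alpha J * r z + (AL alpha J + BE alpha J) * s z + t z = 0) ->
  (forall x, Rabs x <= a1 -> r (x, 0) = hess alpha kb1 kb2 true x (p (x, 0)) (q (x, 0))
     /\ s (x, 0) = hess alpha kb1 kb2 false x (p (x, 0)) (q (x, 0))) ->
  f (0, 0) = 0 -> p (0, 0) = 0 -> q (0, 0) = 0 ->
  class_C 3 D f /\ is_solution a1 alpha kb1 kb2 D f.
Proof.
  intros Gf Gp Gq Cr Cs Ct Hsm Hpde Hbd f0 p0 q0.
  pose proof D_convex as HD.
  assert (Cp : class_C 2 D p) by (apply (class_C_S_intro D HD 1 p r s); auto).
  assert (Cq : class_C 2 D q) by (apply (class_C_S_intro D HD 1 q s t); auto).
  assert (Cf : class_C 3 D f) by (apply (class_C_S_intro D HD 2 f p q); auto).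
  split; auto.
  assert (Ep : forall z, D z -> Dx D f z = p z) by (intros z hz; now rewrite (Dx_eq D HD f z _ hz (Gf z hz))).
  assert (Eq : forall z, D z -> Dy D f z = q z) by (intros z hz; now rewrite (Dy_eq D HD f z _ hz (Gf z hz))).
  assert (Gfx : forall z, D z -> is_grad D (Dx D f) z (r z, s z)).
  { intros z hz. apply (is_grad_ext D p); auto. }
  assert (Gfy : forall z, D z -> is_grad D (Dy D f) z (s z, t z)).
  { intros z hz. apply (is_grad_ext D q); auto. }
  set (Jt := fun z => jet (fst z) (snd z) (p z) (q z)).
  assert (hJ : forall z, D z -> jet_box a1 a2 rho (Jt z)).
  { intros z hz. destruct (Hsm z hz). now apply D_jet. }
  assert (hnz : forall z, D z -> PA alpha (Jt z) <> 0).
  { intros z hz. exact (PA_nz a1 a2 A0 A1 rho alpha hA0 hrho hrho0 hrho1 alpha_range _ (hJ z hz)). }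
  assert (hPB : forall z, D z -> PB alpha (Jt z) <> 0).
  { intros z hz. exact (P_be_nz (alpha (fst z, snd z)) (p z) (q z) (hnz z hz)). }
  assert (hW : forall z, 0 < WJ (Jt z)) by (intros z; apply W_sq).
  (* The principal curvatures are read off from the two curvature equations, whose denominators do
     not vanish for small gradients. *)
  set (k1 := fun z => (AL alpha (Jt z) * r z + s z) / (WJ (Jt z) * PA alpha (Jt z))).
  set (k2 := fun z => (BE alpha (Jt z) * r z + s z) / (WJ (Jt z) * PB alpha (Jt z))).
  assert (Hall : forall z, D z -> eigenvalues2 (shape_operator D f z) (k1 z) (k2 z)
     /\ eigenvector2 (shape_operator D f z) (k1 z) (alpha z, 1)).
  { intros z hz.
    assert (Esh : shape_operator D f z = weingarten (p z) (q z) (r z) (s z) (t z)).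
    { apply functional_extensionality. intros u. apply shape_operator_weingarten; auto.
      - now rewrite (Dx_eq D HD _ z _ hz (Gfx z hz)).
      - now rewrite (Dy_eq D HD _ z _ hz (Gfx z hz)).
      - now rewrite (Dy_eq D HD _ z _ hz (Gfy z hz)). }
    rewrite Esh. replace (alpha z) with (alpha (fst z, snd z)) by now rewrite <- surjective_pairing.
    pose proof (hW z). pose proof (hnz z hz) as n1. pose proof (hPB z hz) as n2.
    apply (equations_eigen (alpha (fst z, snd z)) (p z) (q z) (r z) (s z) (t z) n1).
    - exact (Hpde z hz).
    - change (AL alpha (Jt z) * r z + s z = WJ (Jt z) * k1 z * PA alpha (Jt z)).
      unfold k1. field. split; auto. lra.
    - change (BE alpha (Jt z) * r z + s z = WJ (Jt z) * k2 z * PB alpha (Jt z)).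
      unfold k2. field. split; auto. lra. }
  split.
  - exists k1, k2. split; [intros z hz; now apply Hall|]. split; [|intros z hz; now apply Hall].
    intros x hx.
    assert (hz : D (x, 0)) by (unfold D, trapezoid; simpl; unfold segment in hx; lra).
    destruct (Hbd x hx) as [er es]. pose proof (hW (x, 0)) as w0.
    pose proof (hnz _ hz) as n1. pose proof (hPB _ hz) as n2.
    destruct (speeds_pos a1 a2 A0 A1 alpha ha1 ha2 hA0 alpha_range) as [hl _].
    destruct (speeds_bound a1 a2 A0 A1 rho alpha ha1 ha2 hA0 hrho hrho0 hrho1 alpha_range _ (hJ _ hz))
      as [_ [_ hg]].
    assert (hgap : AL alpha (Jt (x, 0)) - BE alpha (Jt (x, 0)) <> 0).
    { intros h. rewrite h, Rabs_R0 in hg. lra. }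
    unfold k1, k2. rewrite er, es. unfold hess.
    change (jet x 0 (p (x, 0)) (q (x, 0))) with (Jt (x, 0)).
    unfold coef1, coef2. set (J := Jt (x, 0)) in *.
    split; field; repeat split; auto; lra.
  - split; auto. apply (grad_eq D HD).
    + unfold D, trapezoid; simpl. rewrite Rabs_R0. lra.
    + pose proof (Gf (0, 0)) as G0. rewrite p0, q0 in G0. apply G0.
      unfold D, trapezoid; simpl. rewrite Rabs_R0. lra.
Qed.

End graphs.

(** * Choice of the constants and conclusion *)

Theorem corollary1 :
  forall (a1 a2 : R) (alpha : R * R -> R),
    0 < a1 -> 0 < a2 ->
    class_C 2 (rect a1 a2) alpha ->
    (forall p, rect a1 a2 p -> alpha p <> 0) ->
    exists Delta K : R, 0 < Delta /\ 0 < K /\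
      forall kb1 kb2 : R -> R,
        class_C1_1d (segment a1) kb1 ->
        class_C1_1d (segment a1) kb2 ->
        Rbar_lt (sup_norm (segment a1) (fun x => [kb1 x])) (Finite Delta) ->
        Rbar_lt (sup_norm (segment a1) (fun x => [kb2 x])) (Finite Delta) ->
        exists eps : R, 0 < eps <= a2 /\
          exists f : R * R -> R,
            class_C 3 (trapezoid a1 K eps) f /\
            is_solution a1 alpha kb1 kb2 (trapezoid a1 K eps) f /\
            exists r : R, 0 < r /\
              Rbar_le (sup_norm (trapezoid a1 K eps)
                         (jet1 (trapezoid a1 K eps) f)) (Finite r) /\
              forall g : R * R -> R,
                class_C 3 (trapezoid a1 K eps) g ->
                Rbar_le (sup_norm (trapezoid a1 K eps)
                           (jet1 (trapezoid a1 K eps) g)) (Finite r) ->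
                is_solution a1 alpha kb1 kb2 (trapezoid a1 K eps) g ->
                forall p, trapezoid a1 K eps p -> g p = f p.
Proof.
  intros a1 a2 alpha ha1 ha2 HC2 Hnz.
  pose proof (rect_retract a1 a2 ha1 ha2) as HR.
  assert (Hac : continuous_on (rect a1 a2) alpha) by now apply (class_C_continuous _ 2).
  destruct (bounded_on _ HR alpha Hac) as [A1 [hA1 HA1]].
  assert (Hlow : exists A0, 0 < A0 /\ forall z, rect a1 a2 z -> A0 <= Rabs (alpha z)).
  { assert (Hn : continuous_on (rect a1 a2) (fun z => - Rabs (alpha z))).
    { apply continuous_on_intro. intros z hz e he.
      destruct (continuous_on_elim _ _ Hac z hz e he) as [r [hr Hr]].
      exists r. split; auto. intros w hw hn.
      replace (- Rabs (alpha w) - - Rabs (alpha z)) with (- (Rabs (alpha w) - Rabs (alpha z))) by ring.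
      rewrite Rabs_Ropp. eapply Rle_trans; [apply Rabs_triang_inv2|auto]. }
    destruct (attains_max _ HR _ Hn) as [z [hz Hz]]. exists (Rabs (alpha z)).
    split; [apply Rabs_pos_lt; auto|]. intros w hw. specialize (Hz w hw). lra. }
  destruct Hlow as [A0 [hA0 HA0]].
  assert (Hrange : forall z, rect a1 a2 z -> A0 <= Rabs (alpha z) <= A1) by auto.
  (* The bound rho <= 1 / 2 turns the linear conditions rho <= A0 / 2 and rho <= 1 / (2 A1) into the
     quadratic ones required. *)
  set (rho := Rmin 1 (Rmin A0 (/ A1)) / 2).
  assert (hiA : 0 < / A1) by now apply Rinv_0_lt_compat.
  assert (hrho_all : 0 < rho /\ rho <= 1 / 2 /\ rho <= A0 / 2 /\ rho <= / A1 / 2).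
  { pose proof (Rmin_l 1 (Rmin A0 (/ A1))). pose proof (Rmin_r 1 (Rmin A0 (/ A1))).
    pose proof (Rmin_l A0 (/ A1)). pose proof (Rmin_r A0 (/ A1)).
    assert (0 < Rmin 1 (Rmin A0 (/ A1))) by (repeat apply Rmin_glb_lt; lra).
    unfold rho. lra. }
  clearbody rho. destruct hrho_all as [hr0 [hr1 [hr2 hr3]]].
  assert (hrho : 0 < rho <= 1) by lra.
  assert (hrho0 : 2 * (rho * rho) <= A0) by nra.
  assert (hrho1 : 2 * (rho * rho) * A1 <= 1).
  { assert (rho * A1 <= 1 / 2).
    { apply Rle_trans with (/ A1 / 2 * A1); [apply Rmult_le_compat_r; lra|]. right. field. lra. }
    nra. }
  destruct (coef_bounds a1 a2 A0 A1 rho alpha ha1 ha2 hA0 hrho hrho0 hrho1 HC2 Hrange)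
    as [Mf [hMf HMf]].
  destruct (speeds_pos a1 a2 A0 A1 alpha ha1 ha2 hA0 Hrange) as [hlow hup].
  (* The first term solves the ordinary differential equation on the whole segment, the second keeps
     its solution within rho / 2. Neither involves the prescribed curvatures. *)
  set (Delta := Rmin (/ (8 * a1 * Mf)) (rho / (4 * a1 * (1 + a1) * Mf))).
  assert (q1 : 0 < 8 * a1 * Mf) by (repeat apply Rmult_lt_0_compat; lra).
  assert (q2 : 0 < 4 * a1 * (1 + a1) * Mf) by (repeat apply Rmult_lt_0_compat; lra).
  assert (hDelta : 0 < Delta).
  { apply Rmin_glb_lt; [now apply Rinv_0_lt_compat|now apply Rdiv_lt_0_compat]. }
  assert (hDelta1 : 8 * a1 * Mf * Delta <= 1).
  { apply Rle_trans with (8 * a1 * Mf * / (8 * a1 * Mf)); [|right; apply Rinv_r; lra].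
    apply Rmult_le_compat_l; [lra|apply Rmin_l]. }
  assert (hDelta2 : 4 * a1 * (1 + a1) * Mf * Delta <= rho).
  { apply Rle_trans with (4 * a1 * (1 + a1) * Mf * (rho / (4 * a1 * (1 + a1) * Mf)));
      [|right; field; lra].
    apply Rmult_le_compat_l; [lra|apply Rmin_r]. }
  clearbody Delta.
  exists Delta, (2 * upper_speed A0 A1). split; [exact hDelta|]. split; [lra|].
  intros kb1 kb2 Ck1 Ck2 Sk1 Sk2.
  destruct (D1_of_class_C1_1d a1 kb1 ha1 Ck1) as [kp1 Dk1].
  destruct (D1_of_class_C1_1d a1 kb2 ha1 Ck2) as [kp2 Dk2].
  assert (k1_small : forall x, Rabs x <= a1 -> Rabs (kb1 x) <= Delta)
    by exact (sup_norm_single_lt _ _ _ (Rlt_le _ _ hDelta) Sk1).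
  assert (k2_small : forall x, Rabs x <= a1 -> Rabs (kb2 x) <= Delta)
    by exact (sup_norm_single_lt _ _ _ (Rlt_le _ _ hDelta) Sk2).
  destruct (initial_curve a1 a2 A0 A1 rho alpha ha1 ha2 hA0 hrho hrho0 hrho1 HC2 Hrange
    kb1 kb2 kp1 kp2 Mf Delta hMf HMf hDelta hDelta1 hDelta2 Dk1 Dk2 k1_small k2_small)
    as [p0 [q0 [z0 [rp [sp [Dp0 [Dq0 [Dz0 [Dr0 [Ds0 [Hsm0 [ep0 [eq0 ez0]]]]]]]]]]]]].
  set (r0 := fun x => hess alpha kb1 kb2 true x (p0 x) (q0 x)) in *.
  set (s0 := fun x => hess alpha kb1 kb2 false x (p0 x) (q0 x)) in *.
  pose proof (AL_jet a1 a2 rho alpha ha1 ha2 HC2) as JA.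
  pose proof (BE_jet a1 a2 A0 A1 rho alpha ha1 ha2 hA0 hrho hrho0 hrho1 HC2 Hrange) as JB.
  assert (Hex : exists eps, 0 < eps <= a2 /\
    exists f p q r s t : R * R -> R, let D := trapezoid a1 (2 * upper_speed A0 A1) eps in
    (forall z, D z -> is_grad D f z (p z, q z)) /\
    (forall z, D z -> is_grad D p z (r z, s z)) /\
    (forall z, D z -> is_grad D q z (s z, t z)) /\
    class_C 1 D r /\ class_C 1 D s /\ class_C 1 D t /\
    (forall z, D z -> Rabs (f z) <= rho /\ Rabs (p z) <= rho /\ Rabs (q z) <= rho /\
       let J := jet (fst z) (snd z) (p z) (q z) in
       AL alpha J * BE alpha J * r z + (AL alpha J + BE alpha J) * s z + t z = 0) /\
    forall x, Rabs x <= a1 -> f (x, 0) = z0 x /\ p (x, 0) = p0 x /\ q (x, 0) = q0 x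
       /\ r (x, 0) = r0 x /\ s (x, 0) = s0 x).
  { assert (sm : forall (h : R -> R), (forall x, Rabs x <= a1 -> Rabs (h x) <= rho / 2) ->
       forall w, Rabs w <= a1 -> Rabs (h w) <= rho / 2) by auto.
    (* The positive speed l is [AL] or [BE] according to the sign of alpha; the equation is
       symmetric in the two. *)
    destruct (constant_sign _ alpha HR (rect_convex a1 a2 ha1 ha2) Hac Hnz) as [Hs|Hs].
    - apply (cauchy_existence a1 a2 rho (upper_speed A0 A1) (lower_speed A0 A1)
        (AL alpha) (ALx a1 a2 alpha) (ALy a1 a2 alpha) (fun _ => 0) (fun _ => 0)
        (BE alpha) (BEx a1 a2 alpha) (BEy a1 a2 alpha) (BEp alpha) (BEq alpha)
        p0 q0 z0 r0 s0 rp sp); auto; try (intros; now apply Hsm0).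
      + intros X hX. apply (speeds_of_pos a1 a2 A0 A1 rho alpha); auto.
        apply Hs. now apply (jet_box_rect a1 a2 rho).
      + intros X hX. apply (speeds_of_pos a1 a2 A0 A1 rho alpha); auto.
        apply Hs. now apply (jet_box_rect a1 a2 rho).
    - destruct (cauchy_existence a1 a2 rho (upper_speed A0 A1) (lower_speed A0 A1)
        (BE alpha) (BEx a1 a2 alpha) (BEy a1 a2 alpha) (BEp alpha) (BEq alpha)
        (AL alpha) (ALx a1 a2 alpha) (ALy a1 a2 alpha) (fun _ => 0) (fun _ => 0)
        p0 q0 z0 r0 s0 rp sp) as [eps [he [f [p [q [r [s [t H]]]]]]]];
        auto; try (intros; now apply Hsm0).
      + intros X hX. apply (speeds_of_neg a1 a2 A0 A1 rho alpha); auto.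
        apply Hs. now apply (jet_box_rect a1 a2 rho).
      + intros X hX. apply (speeds_of_neg a1 a2 A0 A1 rho alpha); auto.
        apply Hs. now apply (jet_box_rect a1 a2 rho).
      + exists eps. split; auto. exists f, p, q, r, s, t. cbv zeta in *.
        destruct H as [h1 [h2 [h3 [h4 [h5 [h6 [h7 h8]]]]]]].
        repeat (split; [assumption|]). split; [|assumption].
        intros z hz. destruct (h7 z hz) as [j1 [j2 [j3 j4]]].
        repeat (split; [assumption|]). rewrite <- j4. ring. }
  destruct Hex as [eps [heps [f [p [q [r [s [t H]]]]]]]]. cbv zeta in H.
  set (K := 2 * upper_speed A0 A1) in *. set (D := trapezoid a1 K eps) in *.
  destruct H as [Gf [Gp [Gq [Cr [Cs [Ct [Hall Hini]]]]]]].
  assert (hK : 0 < K) by (unfold K; lra).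
  assert (HD : convex_body D) by (apply trapezoid_convex; auto; lra).
  assert (h00 : Rabs 0 <= a1) by (rewrite Rabs_R0; lra).
  assert (hline : forall x, Rabs x <= a1 -> D (x, 0)) by (intros x hx; unfold D, trapezoid; simpl; lra).
  destruct (Hini 0 h00) as [i1 [i2 [i3 _]]].
  destruct (graph_solution a1 a2 A0 A1 rho eps alpha kb1 kb2 ha1 ha2 hA0 hrho hrho0 hrho1 Hrange
     heps f p q r s t Gf Gp Gq Cr Cs Ct) as [Cf Sf].
  { intros z hz. destruct (Hall z hz) as [_ [j1 [j2 _]]]. auto. }
  { intros z hz. now apply (Hall z hz). }
  { intros x hx. destruct (Hini x hx) as [_ [j2 [j3 [j4 j5]]]]. rewrite j2, j3, j4, j5. auto. }
  { now rewrite i1. } { now rewrite i2. } { now rewrite i3. }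
  fold K in Cf, Sf. fold D in Cf, Sf.
  exists eps. split; [exact heps|]. exists f. split; [exact Cf|]. split; [exact Sf|].
  (* The radius of uniqueness is the size of the jet box: within it every solution satisfies the
     hyperbolic equation with controlled speeds. *)
  exists rho. split; [exact hr0|].
  assert (Hjet : forall g, Rbar_le (sup_norm D (jet1 D g)) rho <->
     forall z, D z -> Rabs (g z) <= rho /\ Rabs (Dx D g z) <= rho /\ Rabs (Dy D g z) <= rho).
  { intros g. split.
    - intros Hs z hz. pose proof (proj1 (sup_norm_le D (jet1 D g) rho (Rlt_le _ _ hr0)) Hs z hz) as k.
      repeat split; apply k; simpl; auto.
    - intros Hs. apply (proj2 (sup_norm_le D (jet1 D g) rho (Rlt_le _ _ hr0))).
      intros z hz x hx. destruct (Hs z hz) as [j1 [j2 j3]].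
      destruct hx as [<-|[<-|[<-|[]]]]; auto. }
  assert (Hf : Rbar_le (sup_norm D (jet1 D f)) rho).
  { apply Hjet. intros z hz. destruct (Hall z hz) as [j1 [j2 [j3 _]]].
    rewrite (Dx_eq D HD f z _ hz (Gf z hz)), (Dy_eq D HD f z _ hz (Gf z hz)). auto. }
  split; [exact Hf|].
  intros g Cg Hg Sg.
  pose proof (proj1 (Hjet f) Hf) as Jf. pose proof (proj1 (Hjet g) Hg) as Jg.
  destruct (solution_hessian a1 a2 A0 A1 rho eps alpha kb1 kb2 ha1 ha2 hA0 hrho hrho0 hrho1 Hrange
    heps f Cf (fun z hz => proj2 (Jf z hz)) Sf) as [Hsf Hbf].
  destruct (solution_hessian a1 a2 A0 A1 rho eps alpha kb1 kb2 ha1 ha2 hA0 hrho hrho0 hrho1 Hrange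
    heps g Cg (fun z hz => proj2 (Jg z hz)) Sg) as [Hsg Hbg].
  fold K in Hsf, Hbf, Hsg, Hbg. fold D in Hsf, Hbf, Hsg, Hbg.
  assert (D00 : D (0, 0)) by now apply hline.
  assert (g0 : forall h, is_solution a1 alpha kb1 kb2 D h ->
     h (0, 0) = 0 /\ Dx D h (0, 0) = 0 /\ Dy D h (0, 0) = 0).
  { intros h [_ [j1 j2]]. unfold Dx, Dy. rewrite j2. auto. }
  destruct (g0 f Sf) as [f1 [f2 f3]]. destruct (g0 g Sg) as [g1 [g2 g3]].
  assert (Hcurve : forall x, Rabs x <= a1 ->
     Dx D f (x, 0) = Dx D g (x, 0) /\ Dy D f (x, 0) = Dy D g (x, 0)).
  { apply (initial_curve_unique a1 a2 rho alpha ha1 ha2 kb1 kb2 Mf Delta hMf HMf hDelta hDelta1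
      k1_small k2_small D (Dx D f) (Dy D f) (fun x => Dy D (Dy D f) (x, 0))
      (Dx D g) (Dy D g) (fun x => Dy D (Dy D g) (x, 0)) hline).
    - intros x hx. destruct (Jf _ (hline x hx)) as [_ [j1 j2]].
      destruct (Jg _ (hline x hx)) as [_ [j3 j4]]. auto.
    - intros x hx. cbv zeta. destruct (Hbf x hx) as [j1 j2]. destruct (Hbg x hx) as [j3 j4].
      rewrite <- j1, <- j2, <- j3, <- j4.
      pose proof (hline x hx) as hz.
      exact (conj (hs_p _ _ _ _ _ _ _ _ _ _ _ Hsf _ hz) (conj (hs_q _ _ _ _ _ _ _ _ _ _ _ Hsf _ hz)
        (conj (hs_p _ _ _ _ _ _ _ _ _ _ _ Hsg _ hz) (hs_q _ _ _ _ _ _ _ _ _ _ _ Hsg _ hz)))).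
    - lra.
    - lra. }
  assert (Hpq : forall z, D z -> Dx D f z = Dx D g z /\ Dy D f z = Dy D g z).
  { apply (hessian_solution_unique a1 a2 rho K eps (2 * lower_speed A0 A1)
      (AL alpha) (ALx a1 a2 alpha) (ALy a1 a2 alpha) (fun _ => 0) (fun _ => 0)
      (BE alpha) (BEx a1 a2 alpha) (BEy a1 a2 alpha) (BEp alpha) (BEq alpha)
      ha1 hK heps ltac:(lra) JA JB) with
      (r1 := Dx D (Dx D f)) (s1 := Dy D (Dx D f)) (t1 := Dy D (Dy D f))
      (r2 := Dx D (Dx D g)) (s2 := Dy D (Dx D g)) (t2 := Dy D (Dy D g)); auto.
    - intros X hX. destruct (speeds_bound a1 a2 A0 A1 rho alpha ha1 ha2 hA0 hrho hrho0 hrho1 Hrange X hX)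
        as [j1 _]. unfold K. lra.
    - intros X hX. destruct (speeds_bound a1 a2 A0 A1 rho alpha ha1 ha2 hA0 hrho hrho0 hrho1 Hrange X hX)
        as [_ [j1 _]]. unfold K. lra.
    - intros X hX. now apply (speeds_bound a1 a2 A0 A1 rho alpha ha1 ha2 hA0 hrho hrho0 hrho1 Hrange X hX).
    - intros x hx. destruct (Hcurve x hx) as [e1 e2].
      destruct (Hbf x hx) as [j1 j2]. destruct (Hbg x hx) as [j3 j4].
      rewrite j1, j2, j3, j4, e1, e2. auto. }
  intros z hz.
  destruct (class_C_S_elim D HD 2 f Cf) as [Gf' _]. destruct (class_C_S_elim D HD 2 g Cg) as [Gg' _].
  (* The gradient of the difference vanishes on the trapezoid, so the increment estimate with
     constant 0 from the origin gives g = f. *)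
  set (h := fun w => g w + - f w).
  assert (Gh : forall w, D w -> is_grad D h w (0, 0)).
  { intros w hw.
    pose proof (is_grad_plus D _ _ w _ _ hw (Gg' w hw) (is_grad_opp D _ w _ hw (Gf' w hw))) as k.
    cbn [fst snd] in k. destruct (Hpq w hw) as [e1 e2].
    rewrite e1, e2, !Rplus_opp_r in k. exact k. }
  assert (k : Rabs (h z - h (0, 0) - pair_dot (fst z - fst (0, 0), snd z - snd (0, 0)) (0, 0))
     <= 2 * (0 * (Rabs (fst z) + Rabs (snd z)))).
  { apply (is_grad_increment D HD h (fun _ => 0) (fun _ => 0)); auto.
    - intros u _. simpl. rewrite Rminus_diag, Rabs_R0. lra.
    - unfold near; simpl. rewrite !Rminus_0_r.
      pose proof (Rabs_pos (fst z)). pose proof (Rabs_pos (snd z)). lra. }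
  unfold pair_dot, h in k. cbn [fst snd] in k. rewrite f1, g1 in k.
  apply Rminus_diag_uniq. apply Rabs_eq_0_of_eps. intros e he.
  match type of k with Rabs ?a <= _ => replace (g z - f z) with a by ring end. lra.
Qed.
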